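(* Let $\Omega=(0,1)^2$. There are a functional $f\in H^{-1}(\Omega)$, a sequence $(L_n)_n$ of real numbers and a constant $C$ such that $L_n\le C\log n$, $L_n\to\infty$ as $n\to\infty$, $$\min_{\#\mathcal M\le n}\|\nabla(u_f-U_{f;\mathcal M})\|\le C\,n^{-1/2},$$ and $$\min_{\#\mathcal M\le n}\ \min_{g\in\mathbb P_0(\mathcal M)}\Big(\sum_{z\in\mathcal V(\mathcal M)}\|f-g\|_{H^{-1}(\omega_z)}^2\Big)^{1/2}\ge L_n\,n^{-1/2},$$ for all $n$ for which the minima are over nonempty sets, where $\mathcal M$ varies in all meshes created by recursive or iterative newest vertex bisection of some conforming initial mesh $\mathcal M_0$ of $\Omega$.
   Context: $\|\cdot\|$ is the $L^2(\Omega)$-norm. For open $\omega\subset\Omega$, $H^1_0(\omega)$ carries the norm $\|\nabla\cdot\|_{L^2(\omega)}$ and $H^{-1}(\omega)$ is its dual with dual norm; functions in $H^1_0(\omega)$ are extended by zero, and for $\ell\in H^{-1}(\Omega)$, $\|\ell\|_{H^{-1}(\omega)}$ is the norm of its restriction to $H^1_0(\omega)$. $L^2(\Omega)$ functions are identified with functionals by integration. All meshes $\mathcal M$ are conforming (face-to-face) triangulations of $\Omega$; $\#\mathcal M$ is the number of triangles, $\mathcal V(\mathcal M)$ the set of all vertices, $\omega_z=\bigcup\{K\in\mathcal M:K\ni z\}$ ($H^{-1}(\omega_z)$ refers to its interior), $\mathbb P_0(\mathcal M)$ the space of $\mathcal M$-piecewise constant functions, $\mathbb V_0(\mathcal M)$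 the space of continuous $\mathcal M$-piecewise affine functions vanishing on $\partial\Omega$. $u_f\in H^1_0(\Omega)$ satisfies $\int_\Omega\nabla u_f\cdot\nabla v=\langle f,v\rangle$ for all $v\in H^1_0(\Omega)$, and $U_{f;\mathcal M}\in\mathbb V_0(\mathcal M)$ satisfies the same identity for all $v\in\mathbb V_0(\mathcal M)$. The constant $C$ is independent of $n$. *)

(* Defs.v *)
From HB Require Import structures.
From mathcomp Require Import all_boot all_order all_algebra.
From mathcomp Require Import all_classical all_reals all_analysis.
Set Implicit Arguments.
Unset Strict Implicit.
Unset Printing Implicit Defensive.
Import Order.TTheory GRing.Theory Num.Theory.
Import numFieldNormedType.Exports.
Local Open Scope classical_set_scope.
Local Open Scope ring_scope.

(* Functions on a subdomain are represented by their extension by zero to the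
   plane, and Lebesgue classes are represented by actual functions. *)

Definition is_min {R : realType} (A : set R) (m : R) : Prop :=
  A m /\ lbound A m.

Definition plane_measure (R : realType) :=
  (@lebesgue_measure R \x @lebesgue_measure R)%E.
Arguments plane_measure {R}.

Definition unit_square (R : realType) : set (R * R) :=
  `]0, 1[%classic `*` `]0, 1[%classic.
Arguments unit_square {R}.

Section Sobolev.
Context {R : realType}.
Implicit Types (omega D : set (R * R)) (v w : R * R -> R).

(* The Boolean index [false]/[true] stands for the first/second coordinate. *)
Definition axis (i : bool) : R * R := if i then (0, 1) else (1, 0).

Definition partial (i : bool) v : R * R -> R := fun p => 'D_(axis i) v p.

Definition smooth v : Prop := forall s : seq bool,
  let w := foldr partial v s in
  continuous w /\ forall i p, derivable w p (axis i).

Definition test_function omega v : Prop :=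
  smooth v /\
  exists K : set (R * R),
    [/\ compact K, K `<=` omega & forall p, ~ K p -> v p = 0].

Definition L2 v : Prop := v \in Lfun (@plane_measure R) 2%:E.

Definition L2norm v : \bar R := 'N[@plane_measure R]_2%:E[EFin \o v]%E.

Definition is_weak_partial (i : bool) v w : Prop :=
  L2 w /\
  forall phi, test_function setT phi ->
    \int[plane_measure]_p (v p * partial i phi p) =
    - \int[plane_measure]_p (w p * phi p).

(* A representative of the (a.e. unique) weak derivative, 0 if there is none. *)
Definition weak_partial (i : bool) v : R * R -> R :=
  xget (fun=> 0) [set w | is_weak_partial i v w].

(* Closure of the test functions on [omega] in the H^1-norm.  Since elements
   are extended by zero, the ambient space may be taken to be H^1 of the plane:
   zero extension of test functions is isometric from H^1(omega). *)
Definition H10 omega v : Prop :=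
  [/\ L2 v,
      forall i, exists w, is_weak_partial i v w &
      exists phi : nat -> R * R -> R,
        [/\ forall k, test_function omega (phi k),
            L2norm (phi k \- v) @[k --> \oo] --> 0%E &
            forall i,
              L2norm (partial i (phi k) \- weak_partial i v) @[k --> \oo]
                --> 0%E]].

Definition grad_dot D v w : R :=
  \int[plane_measure]_(p in D)
    \sum_(i : bool) weak_partial i v p * weak_partial i w p.

Definition grad_norm D v : R := Num.sqrt (grad_dot D v v).

(* Elements of the dual of H^1_0(omega); the values of [l] at functions outside
   H^1_0(omega) are irrelevant.  Linearity and the bound force [l] to agree on
   functions that are equal almost everywhere. *)
Definition Hm1 omega (l : (R * R -> R) -> R) : Prop :=
  (forall a v w, H10 omega v -> H10 omega w ->
     l (fun p => a * v p + w p) = a * l v + l w) /\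
  exists c : R, forall v, H10 omega v -> `|l v| <= c * grad_norm omega v.

Definition Hm1norm omega (l : (R * R -> R) -> R) : R :=
  sup [set `|l v| | v in [set v | H10 omega v /\ grad_norm omega v <= 1]].

End Sobolev.

Section Triangulations.
Context {R : realType}.

(* The triangle [(z, a, b)] has newest vertex [z] and refinement edge [ab]. *)
Definition triangle : Type := (R * R) * (R * R) * (R * R).

Implicit Types (K : triangle) (M : seq triangle) (z y : R * R).

Definition newest K : R * R := K.1.1.
Definition edge1 K : R * R := K.1.2.
Definition edge2 K : R * R := K.2.
Definition vertices K : seq (R * R) := [:: newest K; edge1 K; edge2 K].

Definition hull K : set (R * R) :=
  [set p | exists r s t : R,
     [/\ 0 <= r, 0 <= s, 0 <= t & r + s + t = 1] /\
     p = r *: newest K + s *: edge1 K + t *: edge2 K].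

Definition segm y z : set (R * R) :=
  [set p | exists2 t : R, 0 <= t <= 1 & p = (1 - t) *: y + t *: z].

Definition nondegenerate K : Prop :=
  let d1 := edge1 K - newest K in
  let d2 := edge2 K - newest K in
  d1.1 * d2.2 - d1.2 * d2.1 != 0.

Definition face_to_face K K' : Prop :=
  let common z := z \in vertices K /\ z \in vertices K' in
  [\/ hull K `&` hull K' = set0,
      exists2 z, common z & hull K `&` hull K' = [set z] |
      exists y z, [/\ common y, common z, y != z &
                      hull K `&` hull K' = segm y z]].

(* A mesh is a duplicate-free list.  Two differently labelled copies of one
   triangle cannot both occur, as they are not [face_to_face]. *)
Definition triangulation (Omega : set (R * R)) M : Prop :=
  [/\ uniq M,
      forall K, K \in M -> nondegenerate K,
      closure Omega = [set p | exists2 K, K \in M & hull K p] &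
      forall K K', K \in M -> K' \in M -> K != K' -> face_to_face K K'].

Definition mesh_vertices M : seq (R * R) :=
  undup (flatten [seq vertices K | K <- M]).

Definition vertex_patch M z : set (R * R) :=
  interior [set p | exists2 K, K \in M & hull K z /\ hull K p].

(* Values on the skeleton of the mesh are irrelevant, up to measurability. *)
Definition P0 (Omega : set (R * R)) M (g : R * R -> R) : Prop :=
  measurable_fun (Omega : set (measurableTypeR R * measurableTypeR R)) g /\
  forall K, K \in M ->
    exists c : R, forall p, interior (hull K) p -> g p = c.

Definition V0 (Omega : set (R * R)) M (v : R * R -> R) : Prop :=
  [/\ continuous v,
      forall p, ~ Omega p -> v p = 0 &
      forall K, K \in M ->
        exists a b c : R, forall p, hull K p -> v p = a * p.1 + b * p.2 + c].

Definition midpoint y z : R * R := 2^-1 *: (y + z).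

(* The midpoint of the refinement edge is the newest vertex of both children. *)
Definition children K : seq triangle :=
  let m := midpoint (edge1 K) (edge2 K) in
  [:: (m, newest K, edge1 K); (m, newest K, edge2 K)].

Definition bisect (S M : seq triangle) : seq triangle :=
  flatten [seq if K \in S then children K else [:: K] | K <- M].

(* The triangles containing a hanging node. *)
Definition irregular M : seq triangle :=
  [seq K <- M | has (fun z => `[< hull K z >] && (z \notin vertices K))
                    (mesh_vertices M)].

(* Completion in iterative newest vertex bisection. *)
Inductive completion : seq triangle -> seq triangle -> Prop :=
| Completion_done M : irregular M = [::] -> completion M M
| Completion_step M M' : irregular M <> [::] ->
    completion (bisect (irregular M) M) M' -> completion M M'.

Definition neighbour M K K' : Prop :=
  [/\ K' \in M, K' != K, edge1 K \in vertices K' & edge2 K \in vertices K'].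

Definition compatible K K' : Prop :=
  perm_eq [:: edge1 K; edge2 K] [:: edge1 K'; edge2 K'].

(* Recursive refinement of a triangle: the neighbour across its refinement edge
   is recursively refined until it shares that refinement edge. *)
Inductive recursive_refinement :
    seq triangle -> triangle -> seq triangle -> Prop :=
| Recursive_boundary M K : K \in M ->
    (forall K', ~ neighbour M K K') ->
    recursive_refinement M K (bisect [:: K] M)
| Recursive_pair M K K' : K \in M -> neighbour M K K' -> compatible K K' ->
    recursive_refinement M K (bisect [:: K; K'] M)
| Recursive_call M K K' M1 M2 : K \in M ->
    neighbour M K K' -> ~ compatible K K' ->
    recursive_refinement M K' M1 -> recursive_refinement M1 K M2 ->
    recursive_refinement M K M2.

Inductive nvb (M0 : seq triangle) : seq triangle -> Prop :=
| Nvb_initial : nvb M0 M0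
| Nvb_iterative M S M' : nvb M0 M -> {subset S <= M} ->
    completion (bisect S M) M' -> nvb M0 M'
| Nvb_recursive M K M' : nvb M0 M ->
    recursive_refinement M K M' -> nvb M0 M'.

Definition nvb_meshes (M0 : seq triangle) (n : nat) : set (seq triangle) :=
  [set M | nvb M0 M /\ (size M <= n)%N].

End Triangulations.
Arguments triangle R : clear implicits.

Section Problem.
Context {R : realType}.
Variable Omega : set (R * R).
Implicit Types (f : (R * R -> R) -> R) (M : seq (triangle R)).

Definition poisson_solution f (u : R * R -> R) : Prop :=
  H10 Omega u /\ forall v, H10 Omega v -> grad_dot Omega u v = f v.

Definition galerkin_solution f M (U : R * R -> R) : Prop :=
  V0 Omega M U /\ forall v, V0 Omega M v -> grad_dot Omega U v = f v.

Definition oscillation f M (g : R * R -> R) : R :=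
  Num.sqrt (\sum_(z <- mesh_vertices M)
    Hm1norm (vertex_patch M z)
      (fun v => f v - \int[plane_measure]_(p in Omega) (g p * v p)) ^+ 2).

End Problem.

(* Main.v *)
(* On a triangle T0 inside the square let u be the sum over j of 4^(-kj) times the sum of
   the hat functions of the midpoints of the medians of all descendants of T0 of
   generation 2kj, and f = - Delta u.  The J-th partial sum is affine on the descendants
   of generation 2kJ and each summand of the tail lives on one of these, whence it is
   orthogonal to the discrete functions: the partial sum is the Galerkin solution on the
   uniform refinement, with error of order 2^(-kJ), that is, n^(-1/2).
   On the other hand f has a line density of order 2^(-kj) on the medians of generation
   2kj, which is invisible to piecewise constants.  Testing with a wave whose mean vanishes
   on either side of the median bounds the local dual norm at a mesh vertex on the median
   from below by 2^(-kj) times the distance to the next mesh vertex on that median.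
   Unless the mesh has a triangle that contains a descendant of generation 2kJ - in which
   case this one triangle suffices - these gaps add up to a fixed portion of the median,
   whose length is of order 2^(-kj), so each of the J levels contributes a constant to the
   sum of the local dual norms over the vertices, and Cauchy-Schwarz bounds the
   oscillation from below by J n^(-1/2), where J may be of order log n. *)

From HB Require Import structures.
Require Import Defs.
From mathcomp Require Import all_boot all_order all_algebra.
From mathcomp Require Import all_classical all_reals all_analysis.
From mathcomp Require Import measurable_realfun ring lra.
Import Order.TTheory GRing.Theory Num.Theory.
Import numFieldNormedType.Exports.
Local Open Scope classical_set_scope.
Local Open Scope ring_scope.
Set Implicit Arguments.
Unset Strict Implicit.
Unset Printing Implicit Defensive.

(** * Integration in the plane *)

Section Plane.
Context {R : realType}.
Local Notation P := (measurableTypeR R * measurableTypeR R)%type.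
Local Notation mu := (@plane_measure R).

(** The initial mesh has arbitrary shapes and arbitrary refinement edges. Barycentric coordinates
    absorb both: in them all descendants of a triangle are right isosceles, and the coordinates of a
    descendant arise from those of [T0] by iterating one folding map, which makes u self-similar.
    The passage back to the plane costs only powers of [shape], a quantity that bisection preserves.
    The spacing k of the levels serves two purposes. With k > 1 each tent is affine on the triangles
    of the next level. Moreover, the levels after j must not cancel the kink of level j in the
    pairing with a wave; their gradients are smaller by 2^(-k), so k is taken large in terms of the
    shape. The line density enters as a jump of the gradient, and the integrals of the wave are
    treated by one principle: integrals of derivatives of compactly supported Lipschitz functions
    vanish. Derivatives almost everywhere are given explicitly, off the countable union of the
    boundaries of all descendants. The minima exist because finitely many meshes have at most n
    triangles and because the sum of local dual norms is continuous and coercive on piecewise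
    constants. *)

Lemma nbhs_box (p : R * R) (U : set (R * R)) : nbhs p U ->
  exists2 e : R, 0 < e &
    forall q : R * R, `|q.1 - p.1| < e -> `|q.2 - p.2| < e -> U q.
Proof.
move=> /nbhs_ballP [e /= e0 eU]; exists e => // q q1 q2; apply: eU.
by split; rewrite /= /ball /= distrC.
Qed.

Lemma box_nbhs (p : R * R) (U : set (R * R)) (e : R) : 0 < e ->
  (forall q : R * R, `|q.1 - p.1| < e -> `|q.2 - p.2| < e -> U q) -> nbhs p U.
Proof.
move=> e0 eU; apply/nbhs_ballP; exists e => //= q [].
by rewrite /ball /= => q1 q2; apply: eU; rewrite distrC.
Qed.

(** The product sigma-algebra comes from rectangles, so an open set is exhausted by the countably
    many rational boxes that it contains. *)
Lemma open_measurable2 (U : set (R * R)) : open U -> measurable (U : set P).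
Proof.
move=> oU.
pose box (q : rat * rat * nat) : set P :=
  (ball (ratr q.1.1 : R) (q.2.+1%:R^-1)) `*` (ball (ratr q.1.2 : R) (q.2.+1%:R^-1)).
have -> : U = \bigcup_(q in [set q | box q `<=` U]) box q.
  apply/seteqP; split=> [p Up|p [q /=]]; last by exact.
  have [e e0 eU] := nbhs_box (open_nbhs_nbhs (conj oU Up)).
  (* The box has a centre within its radius of [p]; with a radius below [e / 2] it stays within [e]
     of [p]. *)
  have [k ke] : exists k : nat, k.+1%:R^-1 < e / 2 :> R.
    have [N _ /(_ N (leqnn N)) h] := near_infty_natSinv_lt (PosNum (divr_gt0 e0 (ltr0n _ 2))).
    by exists N.
  have ratc (x : R) : exists q : rat, `|x - ratr q| < k.+1%:R^-1.
    have /(_ (ball x (k.+1%:R^-1))) := @dense_rat R.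
    case=> [||y [yb [q _ qy]]].
    - by exists x; apply: ballxx.
    - exact: ball_open.
    by exists q; rewrite qy.
  have [q1 h1] := ratc p.1; have [q2 h2] := ratc p.2.
  exists ((q1, q2), k); last by split; rewrite /ball /= distrC.
  move=> y [/= y1 y2]; apply: eU.
    apply: (le_lt_trans (ler_distD (ratr q1) _ _)).
    rewrite (splitr e) ltrD //; last by rewrite distrC; apply: lt_trans ke.
    by apply: lt_trans ke; move: y1; rewrite /ball /= distrC.
  apply: (le_lt_trans (ler_distD (ratr q2) _ _)).
  rewrite (splitr e) ltrD //; last by rewrite distrC; apply: lt_trans ke.
  by apply: lt_trans ke; move: y2; rewrite /ball /= distrC.
rewrite bigcup_mkcond.
apply: (@countable_bigcupT_measurable _ _ _ (fun q => if q \in _ then box q else set0)) => [|q].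
  exact: countableP.
case: ifPn => // _.
by apply: measurableX; apply: open_measurable; exact: ball_open.
Qed.

Lemma continuous_measurable2 (f : R * R -> R) : continuous f ->
  measurable_fun setT (f : P -> measurableTypeR R).
Proof.
move=> cf; apply: (measurability (@RGenOpens.G R)).
  exact: RGenOpens.measurableE.
move=> _ [_ [a [b ->] <-]]; rewrite setTI.
apply: open_measurable2; move/continuousP: cf; apply.
exact: interval_open.
Qed.

Lemma lebesgue_measure_shift (a : R) (A : set R) : measurable A ->
  lebesgue_measure ((fun x : R => x + a) @^-1` A) = lebesgue_measure A.
Proof.
move=> mA.
have mf : measurable_fun setT ((fun x : R => x + a) : measurableTypeR R -> measurableTypeR R).
  by apply: measurable_funD.
rewrite -[LHS]/(pushforward (@lebesgue_measure R) ((fun x : R => x + a) : measurableTypeR R -> measurableTypeR R) A).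
apply/esym/lebesgue_measure_unique => //= _ [[x y]] _ <-.
rewrite /pushforward /=.
have -> : (fun x0 : R => x0 + a) @^-1` `]x, y] = `]x - a, y - a]%classic.
  apply/seteqP; split => z /=; rewrite !in_itv /=; lra.
rewrite !lebesgue_measure_itv /= !lte_fin ltrD2r.
by case: ifP => // _; congr (_%:E); ring.
Qed.

Lemma measurable_shift (a : R * R) :
  measurable_fun setT ((fun p : R * R => p + a) : P -> P).
Proof.
by apply: measurable_fun_pair; apply: measurable_funD.
Qed.

(** A product measure is determined by its values on rectangles, where the claim reduces to the
    line. *)
Lemma plane_measure_shift (a : R * R) (A : set P) : measurable A ->
  mu ((fun p : R * R => p + a) @^-1` A) = mu A.
Proof.
move=> mA; pose s : P -> P := fun p : R * R => p + a.
have ms : measurable_fun setT s := @measurable_shift a.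
rewrite [RHS](@product_measure_unique _ _ _ _ _ _ _ (pushforward mu s)) // => B C mB mC.
rewrite /= /pushforward.
have -> : s @^-1` (B `*` C) =
    ((fun x : R => x + a.1) @^-1` B) `*` ((fun x : R => x + a.2) @^-1` C).
  by [].
have m1 (b : R) (D : set R) : measurable D -> measurable ((fun x : R => x + b) @^-1` D).
  move=> mD; rewrite -[X in measurable X]setTI.
  have m1f : measurable_fun setT ((fun x : R => x + b) : measurableTypeR R -> measurableTypeR R).
    by apply: measurable_funD.
  exact: m1f.
rewrite product_measure1E; [|exact: m1|exact: m1].
by congr (_ * _)%E; apply: lebesgue_measure_shift.
Qed.

Definition itg (f : R * R -> R) := mu.-integrable setT (EFin \o f).

Lemma itg_measurable f : itg f -> measurable_fun setT (f : P -> measurableTypeR R).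
Proof. by move=> /measurable_int/measurable_EFinP. Qed.

(** Translations are the only changes of variables in the proof. This invariance is the reason why
    integrals of derivatives vanish. *)
Lemma Rint_shift (a : R * R) (f : R * R -> R) : itg f ->
  itg (fun p => f (p + a)) /\
  \int[mu]_p f (p + a) = \int[mu]_p f p.
Proof.
move=> itf; have mf := itg_measurable itf.
pose s : P -> P := fun p : R * R => p + a.
have ms : measurable_fun setT s := @measurable_shift a.
have mfs : measurable_fun setT ((fun p => f (p + a)) : P -> measurableTypeR R).
  exact: (measurableT_comp mf ms).
have eqm g : measurable_fun setT g ->
    (\int[pushforward mu s]_p g p = \int[mu]_p g p)%E.
  by move=> mg; apply: eq_measure_integral => A mA _; apply: plane_measure_shift.
have itfs : itg (fun p => f (p + a)).
  apply/integrableP; split; first exact/measurable_EFinP.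
  have /integrableP[_] := itf.
  rewrite -[X in (X < _)%E -> _]eqm; last first.
    by apply: measurableT_comp => //; apply/measurable_EFinP.
  rewrite ge0_integral_pushforward //.
  by apply: measurableT_comp => //; apply/measurable_EFinP.
split=> //; rewrite /Rintegral; congr fine.
rewrite -[RHS]eqm; last exact/measurable_EFinP.
by rewrite integral_pushforward //; apply/measurable_EFinP.
Qed.

End Plane.

(** * Integrals of bounded functions with bounded support *)

Section Integrals.
Context {R : realType}.
Local Notation P := (measurableTypeR R * measurableTypeR R)%type.
Local Notation mu := (@plane_measure R).
Implicit Types (f g h : R * R -> R).

Definition mfun2 f := measurable_fun setT (f : P -> measurableTypeR R).

Definition in_box (b : R) : set (R * R) := [set p | `|p.1| <= b /\ `|p.2| <= b].

Lemma plane_measure_rect (a b c d : R) : a <= b -> c <= d ->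
  mu (`[a, b]%classic `*` `[c, d]%classic) = ((b - a) * (d - c))%:E.
Proof.
move=> ab cd.
have aux (x y : R) : x <= y -> lebesgue_measure `[x, y]%classic = (y - x)%:E.
  rewrite lebesgue_measure_itv /= lte_fin.
  by rewrite le_eqVlt => /orP[/eqP ->|->]; rewrite ?ltxx ?subrr.
transitivity (lebesgue_measure `[a, b]%classic * lebesgue_measure `[c, d]%classic)%E.
  exact: product_measure1E.
by rewrite !aux.
Qed.

Lemma in_boxE b : in_box b = `[- b, b]%classic `*` `[- b, b]%classic.
Proof. by apply/seteqP; split => p /=; rewrite !in_itv /= -!ler_norml. Qed.

Lemma plane_measure_box b : 0 <= b -> mu (in_box b) = ((2 * b) ^+ 2)%:E.
Proof.
by move=> b0; rewrite in_boxE plane_measure_rect; [congr (_%:E); ring|lra|lra].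
Qed.

Lemma measurable_in_box b : measurable (in_box b : set P).
Proof. by rewrite in_boxE; apply: measurableX. Qed.

Lemma itgD f g : itg f -> itg g -> itg (fun p => f p + g p).
Proof. by move=> hf hg; apply: (integrableD measurableT hf hg). Qed.

Lemma itgZ (k : R) f : itg f -> itg (fun p => k * f p).
Proof. by move=> hf; apply: (integrableZl measurableT k hf). Qed.

Lemma itgB f g : itg f -> itg g -> itg (fun p => f p - g p).
Proof. by move=> hf hg; apply: (integrableB measurableT hf hg). Qed.

Lemma itg_le f g : mfun2 f -> itg g -> (forall p, `|f p| <= `|g p|) -> itg f.
Proof.
move=> mf ig fg; apply: (le_integrable measurableT _ _ ig).
  exact/measurable_EFinP.
by move=> p _ /=; rewrite lee_fin.
Qed.

Lemma itg_norm f : itg f -> itg (fun p => `|f p|).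
Proof.
move=> hf; apply: (@itg_le _ f) => //.
  by apply: measurableT_comp => //; apply: itg_measurable.
by move=> p; rewrite normr_id.
Qed.

(** One predicate that yields integrability over the plane as well as an explicit bound of the
    integral. *)
Definition bdd (b c : R) f :=
  [/\ mfun2 f, forall p, `|f p| <= c & forall p, ~ in_box b p -> f p = 0].

Lemma itg_box b : itg (\1_(in_box b)).
Proof.
rewrite /itg; apply/integrableP; split.
  by apply/measurable_EFinP; apply: measurable_indic; exact: measurable_in_box.
have [b0|b0] := leP 0 b.
  under eq_integral do rewrite /= ger0_norm //.
  rewrite integral_indic //; last exact: measurable_in_box.
  rewrite setIT; apply: (@le_lt_trans _ _ (mu (in_box b))) => //.
  by rewrite plane_measure_box // ltry.
rewrite (_ : in_box b = set0).
  by under eq_integral do rewrite /= indic0 /= normr0; rewrite integral0.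
by apply/seteqP; split=> p //= [h _]; have := le_trans (normr_ge0 _) h; lra.
Qed.

Lemma bdd_itg b c f : bdd b c f -> itg f.
Proof.
move=> [mf fc f0]; apply: (@itg_le _ (fun p => c * \1_(in_box b) p)) => //.
  by apply: itgZ; exact: itg_box.
move=> p; have [hp|hp] := pselect (in_box b p).
  rewrite indicE mem_set // mulr1; exact: le_trans (ler_norm _).
by rewrite f0 // normr0.
Qed.

Lemma bdd_le b b' c c' f : b <= b' -> c <= c' -> bdd b c f -> bdd b' c' f.
Proof.
move=> bb cc [mf fc f0]; split=> // p; first exact: le_trans cc.
by move=> h; apply: f0 => -[h1 h2]; apply: h; split; apply: le_trans bb.
Qed.

Lemma bddM b c c' f g : mfun2 g -> (forall p, `|g p| <= c') -> bdd b c f ->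
  bdd b (c * c') (fun p => f p * g p).
Proof.
move=> mg gc [mf fc f0]; split.
- exact: measurable_funM.
- by move=> p; rewrite normrM ler_pM.
- by move=> p hp; rewrite f0 // mul0r.
Qed.

Lemma RintD f g : itg f -> itg g ->
  \int[mu]_p (f p + g p) = \int[mu]_p f p + \int[mu]_p g p.
Proof. by move=> hf hg; rewrite RintegralD. Qed.

Lemma RintB f g : itg f -> itg g ->
  \int[mu]_p (f p - g p) = \int[mu]_p f p - \int[mu]_p g p.
Proof. by move=> hf hg; rewrite RintegralB. Qed.

Lemma RintZ (k : R) f : itg f -> \int[mu]_p (k * f p) = k * \int[mu]_p f p.
Proof. by move=> hf; rewrite RintegralZl. Qed.

Lemma eq_Rint f g : f =1 g -> \int[mu]_p f p = \int[mu]_p g p.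
Proof. by move=> fg; apply: eq_Rintegral => p _. Qed.

Lemma Rint0 : \int[mu]_p (0 : R) = 0.
Proof. by rewrite Rintegral_cst // mul0r. Qed.

Lemma le_Rint f g : itg f -> itg g -> (forall p, f p <= g p) ->
  \int[mu]_p f p <= \int[mu]_p g p.
Proof. by move=> hf hg fg; apply: le_Rintegral. Qed.

Lemma normr_Rint f : itg f -> `|\int[mu]_p f p| <= \int[mu]_p `|f p|.
Proof. by move=> hf; apply: le_normr_Rintegral. Qed.

Lemma Rint_itv_box b : 0 <= b -> \int[mu]_p (\1_(in_box b) p) = (2 * b) ^+ 2 :> R.
Proof.
move=> b0; rewrite /Rintegral integral_indic //; last exact: measurable_in_box.
rewrite setIT; transitivity (fine (mu (in_box b))) => //.
by rewrite plane_measure_box.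
Qed.

Lemma normr_Rint_bdd b c f : 0 <= b -> bdd b c f ->
  `|\int[mu]_p f p| <= c * (2 * b) ^+ 2.
Proof.
move=> b0 hf; have [mf fc f0] := hf; apply: (le_trans (normr_Rint (bdd_itg hf))).
rewrite -Rint_itv_box // -RintZ; last exact: itg_box.
apply: le_Rint => [| |p].
- by apply: itg_norm; apply: bdd_itg hf.
- by apply: itgZ; exact: itg_box.
have [hp|hp] := pselect (in_box b p).
  by rewrite indicE mem_set // mulr1.
by rewrite f0 // normr0 indicE memNset // mulr0.
Qed.

Lemma Rint_ae (N : set P) f g : mu.-negligible N -> mfun2 f -> mfun2 g ->
  (forall p, ~ N p -> f p = g p) -> \int[mu]_p f p = \int[mu]_p g p.
Proof.
move=> N0 mf mg fg; rewrite /Rintegral; congr fine.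
apply: ae_eq_integral => //; try exact/measurable_EFinP.
apply: (negligibleS _ N0) => p /= h; apply: contrapT => hN.
by apply: h => _; rewrite fg.
Qed.

Lemma itg_ae (N : set P) f g : mu.-negligible N -> itg f -> mfun2 g ->
  (forall p, ~ N p -> f p = g p) -> itg g.
Proof.
move=> N0 itf mg fg; apply/integrableP; split; first exact/measurable_EFinP.
have /integrableP[mf] := itf; congr (_ < _)%E.
apply: ae_eq_integral => //.
- by apply: measurableT_comp.
- by apply: measurableT_comp => //; exact/measurable_EFinP.
apply: (negligibleS _ N0) => p /= h; apply: contrapT => hN.
by apply: h => _; rewrite fg.
Qed.

(** Domination is asked for at every point, convergence only almost everywhere: difference quotients
    of Lipschitz functions and mollifications are bounded without exceptional set. *)
Lemma dct (f_ : nat -> R * R -> R) f g (N : set P) :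
  (forall n, mfun2 (f_ n)) -> mfun2 f -> mu.-negligible N ->
  (forall p, ~ N p -> f_ n p @[n --> \oo] --> f p) -> itg g ->
  (forall n p, `|f_ n p| <= g p) ->
  itg f /\ (\int[mu]_p f_ n p) @[n --> \oo] --> \int[mu]_p f p.
Proof.
move=> mf_ mf N0 cvg ig le.
have [] := @dominated_convergence _ _ _ mu setT measurableT
  (fun n => EFin \o f_ n) (EFin \o f) (EFin \o g).
- by move=> n; apply/measurable_EFinP; exact: mf_.
- exact/measurable_EFinP.
- apply: (negligibleS _ N0) => p /= h; apply: contrapT => hN; apply: h => _.
  by apply: cvg_EFin; [near=> n | exact: cvg].
- exact: ig.
- by apply: aeW => p n _ /=; rewrite lee_fin.
move=> itf _ c; split=> //.
have itf_ n : itg (f_ n).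
  apply: (@itg_le _ g) => // p; exact: le_trans (le n p) (ler_norm _).
have fin (h : R * R -> R) : itg h -> (\int[mu]_p (h p)%:E)%E \is a fin_num.
  by move=> ih; apply: integrable_fin_num.
apply: fine_cvg; rewrite fineK; last exact: fin.
exact: c.
Unshelve. all: end_near. Qed.

End Integrals.

(** * Real-valued product and norm of square integrable functions *)

HB.lock Definition ip {R : realType} (f g : R * R -> R) : R :=
  \int[@plane_measure R]_p (f p * g p).
HB.lock Definition n2 {R : realType} (f : R * R -> R) : R := Num.sqrt (ip f f).

Section SquareIntegrable.
Context {R : realType}.
Local Notation P := (measurableTypeR R * measurableTypeR R)%type.
Local Notation mu := (@plane_measure R).
Implicit Types (f g h : R * R -> R).

Lemma L2P f : L2 f <-> mfun2 f /\ itg (fun p => f p ^+ 2).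
Proof.
split=> [hf|[mf hf]].
  split; last exact: Lfun2_integrable_sqr.
  by move: hf; rewrite /L2 inE => /andP[/[!inE]/= mf _].
rewrite /L2 inE; apply/andP; split; rewrite inE //=.
rewrite /finite_norm unlock /Lnorm /= poweR_lty //.
have /integrableP[_] := hf.
congr (_ < _)%E; apply: eq_integral => p _ /=.
by rewrite normrX powR_mulrn.
Qed.

Lemma L2_mfun f : L2 f -> mfun2 f. Proof. by move=> /L2P[]. Qed.

Lemma L2M f g : L2 f -> L2 g -> itg (fun p => f p * g p).
Proof.
move=> /L2P[mf hf] /L2P[mg hg].
apply: (@itg_le _ _ (fun p => f p ^+ 2 + g p ^+ 2)).
- exact: measurable_funM.
- exact: itgD.
move=> p; rewrite (ger0_norm (addr_ge0 (sqr_ge0 _) (sqr_ge0 _))) normrM.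
rewrite -(real_normK (num_real (f p))) -(real_normK (num_real (g p))).
have := sqr_ge0 (`|f p| - `|g p|); have := sqr_ge0 (`|f p| + `|g p|); nra.
Qed.

Lemma L2D f g : L2 f -> L2 g -> L2 (fun p => f p + g p).
Proof.
move=> hf hg; have [[mf sf] [mg sg]] := (iffLR (L2P _) hf, iffLR (L2P _) hg).
apply/L2P; split; first exact: measurable_funD.
have := itgD (itgD sf sg) (itgZ 2 (L2M hf hg)).
by congr itg; apply/funext => p; ring.
Qed.

Lemma L2Z (k : R) f : L2 f -> L2 (fun p => k * f p).
Proof.
move=> /L2P[mf sf]; apply/L2P; split; first exact: measurable_funM.
by have := itgZ (k ^+ 2) sf; congr itg; apply/funext => p; ring.
Qed.

Lemma L2N f : L2 f -> L2 (fun p => - f p).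
Proof. by move=> /(L2Z (-1)); congr L2; apply/funext => p; ring. Qed.

Lemma L2B f g : L2 f -> L2 g -> L2 (fun p => f p - g p).
Proof. by move=> hf /L2N; exact: L2D. Qed.

Lemma bdd_L2 b c f : bdd b c f -> L2 f.
Proof.
move=> hf; have [mf fc _] := hf; apply/L2P; split => //.
by have := bdd_itg (bddM mf fc hf); congr itg; apply/funext => p; ring.
Qed.

Lemma L2_le f g : mfun2 f -> L2 g -> (forall p, `|f p| <= `|g p|) -> L2 f.
Proof.
move=> mf /L2P[mg sg] fg; apply/L2P; split => //.
apply: (itg_le _ sg); first exact: measurable_funX.
by move=> p; rewrite !normrX lerXn2r // nnegrE.
Qed.

Lemma ipE f g : ip f g = \int[mu]_p (f p * g p).
Proof. by rewrite ip.unlock. Qed.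

Lemma n2E f : n2 f = Num.sqrt (ip f f).
Proof. by rewrite n2.unlock. Qed.

Lemma ipC f g : ip f g = ip g f.
Proof. by rewrite !ipE; apply: eq_Rint => p; rewrite mulrC. Qed.

Lemma ip_ge0 f : 0 <= ip f f.
Proof. by rewrite ipE; apply: Rintegral_ge0 => p _; rewrite -expr2 sqr_ge0. Qed.

Lemma ipDl f g h : L2 f -> L2 g -> L2 h ->
  ip (fun p => f p + g p) h = ip f h + ip g h.
Proof.
move=> hf hg hh; rewrite !ipE -RintD; [|exact: L2M|exact: L2M].
by apply: eq_Rint => p; rewrite mulrDl.
Qed.

Lemma ipZl (k : R) f h : L2 f -> L2 h -> ip (fun p => k * f p) h = k * ip f h.
Proof.
move=> hf hh; rewrite !ipE -RintZ; last exact: L2M.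
by apply: eq_Rint => p; rewrite mulrA.
Qed.

Lemma n2_ge0 f : 0 <= n2 f. Proof. by rewrite n2E sqrtr_ge0. Qed.

Lemma n2_sqr f : n2 f ^+ 2 = ip f f.
Proof. by rewrite n2E sqr_sqrtr // ip_ge0. Qed.

Lemma ip_expand f g (t : R) : L2 f -> L2 g ->
  ip (fun p => f p + t * g p) (fun p => f p + t * g p) =
  ip f f + 2 * t * ip f g + t ^+ 2 * ip g g.
Proof.
move=> hf hg; have hs := L2D hf (L2Z t hg).
rewrite ipDl //; last exact: L2Z.
rewrite ipZl // ![ip _ (fun p => _ + _)]ipC !ipDl ?ipZl //; try exact: L2Z.
by rewrite [ip g f]ipC; ring.
Qed.

Lemma cauchy_schwarz f g : L2 f -> L2 g -> `|ip f g| <= n2 f * n2 g.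
Proof.
move=> hf hg.
have key (t : R) : 0 <= ip f f + 2 * t * ip f g + t ^+ 2 * ip g g.
  by rewrite -ip_expand // ip_ge0.
rewrite -(ler_pXn2r (_ : 0 < 2)%N) ?nnegrE ?mulr_ge0 ?n2_ge0 //.
rewrite exprMn !n2_sqr real_normK ?num_real //.
have [g0|g0] := eqVneq (ip g g) 0.
  have [fg0|fg0] := eqVneq (ip f g) 0; first by rewrite fg0 g0 expr0n mulr0.
  (* When [g] has norm zero, the quadratic is affine in [t], and this [t] gives it the value -1. *)
  have := key (- (ip f f + 1) / (2 * ip f g)).
  rewrite g0 mulr0 addr0.
  have -> : 2 * (- (ip f f + 1) / (2 * ip f g)) * ip f g = - (ip f f + 1).
    by field.
  lra.
have gp : 0 < ip g g by rewrite lt_def g0 ip_ge0.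
have := key (- ip f g / ip g g).
have -> : ip f f + 2 * (- ip f g / ip g g) * ip f g +
   (- ip f g / ip g g) ^+ 2 * ip g g = (ip f f * ip g g - ip f g ^+ 2) / ip g g.
  by field.
by rewrite pmulr_lge0 ?invr_gt0 // subr_ge0.
Qed.

Lemma n2D f g : L2 f -> L2 g -> n2 (fun p => f p + g p) <= n2 f + n2 g.
Proof.
move=> hf hg; rewrite -(ler_pXn2r (_ : 0 < 2)%N) ?nnegrE ?addr_ge0 ?n2_ge0 //.
have := ip_expand 1 hf hg.
have -> : (fun p => f p + 1 * g p) = (fun p => f p + g p).
  by apply/funext => p; rewrite mul1r.
rewrite n2_sqr => ->; rewrite sqrrD !n2_sqr.
have := ler_norm (ip f g); have := cauchy_schwarz hf hg.
by rewrite mulr2n; lra.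
Qed.

Lemma n2Z (k : R) f : L2 f -> n2 (fun p => k * f p) = `|k| * n2 f.
Proof.
move=> hf; rewrite !n2E ipZl ?(ipC f) ?ipZl //; last exact: L2Z.
by rewrite mulrA -expr2 sqrtrM ?sqr_ge0 // sqrtr_sqr.
Qed.

Lemma n2B f g : L2 f -> L2 g -> n2 (fun p => f p - g p) <= n2 f + n2 g.
Proof.
move=> hf hg; apply: le_trans (n2D hf (L2N hg)) _.
have -> : (fun p => - g p) = (fun p => -1 * g p).
  by apply/funext => p; rewrite mulN1r.
by rewrite n2Z // normrN1 mul1r.
Qed.

Lemma L2normE f : L2 f -> L2norm f = (n2 f)%:E.
Proof.
move=> hf; rewrite /L2norm unlock /Lnorm /=.
have -> : (\int[mu]_x (`|(f x)%:E| `^ 2%R))%E = (ip f f)%:E.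
  rewrite ipE /Rintegral fineK; last first.
    by apply: integrable_fin_num => //; exact: L2M.
  apply: eq_integral => p _ /=.
  by rewrite powR_mulrn // real_normK ?num_real // expr2.
rewrite poweR_EFin n2E -powR12_sqrt ?ip_ge0 //.
Qed.

Lemma n2_ae0 f : L2 f -> n2 f = 0 -> mu.-negligible [set p : P | f p != 0].
Proof.
move=> hf /eqP; rewrite n2E sqrtr_eq0 => f0.
have {}f0 : ip f f = 0 by apply/eqP; rewrite eq_le f0 ip_ge0.
have /L2P[mf sf] := hf.
have := @ae_eq_integral_abs _ _ _ mu setT measurableT (EFin \o (fun p => f p ^+ 2)).
case=> [|+ _]; first by apply/measurable_EFinP; exact: measurable_funX.
case.
  have : (ip f f)%:E = 0%:E by rewrite f0.
  rewrite ipE /Rintegral fineK; last first.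
    by apply: integrable_fin_num => //; exact: L2M.
  move=> e; rewrite -[RHS]/(0%:E) -e; apply: eq_integral => p _ /=.
  by rewrite ger0_norm ?sqr_ge0 // expr2.
move=> N [mN N0 sN]; exists N; split=> // p /= fp; apply: sN => /= h.
by move: (h I) => [] /eqP; rewrite sqrf_eq0 (negbTE fp).
Qed.

End SquareIntegrable.

(** * Mollification *)

Section SmoothOneVariable.
Context {R : realType}.
Implicit Types (f g : R -> R).

(** A remainder of second order is the form of differentiability that can be integrated: it serves
    for convolutions as well as for [flat] at the origin. *)
Lemma is_derive_quadratic (V : normedModType R) (f : V -> R) (p v : V) (l C : R) :
  (forall h : R, `|f (h *: v + p) - f p - h * l| <= C * h ^+ 2) ->
  is_derive p v f l.
Proof.
move=> hC.
have C0 : 0 <= C by have := hC 1; rewrite expr1n mulr1; exact: le_trans.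
have cv : h^-1 *: (f (h *: v + p) - f p) @[h --> 0^'] --> l.
  apply/cvgrPdist_le => e e0; near=> h.
  have h0 : h != 0 by near: h; exact: nbhs_dnbhs_neq.
  have hs : `|h| <= e / (C + 1).
    near: h; apply: dnbhs0_le; rewrite divr_gt0 //; lra.
  have -> : l - h^-1 *: (f (h *: v + p) - f p) =
      - (h^-1 * (f (h *: v + p) - f p - h * l)).
    by rewrite /GRing.scale /=; field.
  rewrite normrN normrM normfV ler_pdivrMl ?normr_gt0 //.
  apply: (le_trans (hC h)).
  rewrite -(real_normK (num_real h)) expr2 mulrCA ler_wpM2l //.
  have C1 : 0 < C + 1 by lra.
  move: hs; rewrite ler_pdivlMr // => hs; have := normr_ge0 h; nra.
split; last exact: cvg_lim.
by apply/cvg_ex; exists l.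
Unshelve. all: end_near. Qed.

Fixpoint times_derivable (n : nat) f : Prop :=
  if n is n'.+1 then
    (forall x : R, derivable f x 1) /\ times_derivable n' (fun x => 'D_1 f x)
  else True.

Definition smooth1 f := forall n, times_derivable n f.

Lemma times_derivableW n f : times_derivable n.+1 f -> times_derivable n f.
Proof.
elim: n f => [//|n IH] f [df hf]; split=> //; exact: IH.
Qed.

Lemma times_derivable_lin n (a b : R) f g :
  times_derivable n f -> times_derivable n g ->
  times_derivable n (fun x => a * f x + b * g x).
Proof.
elim: n f g => [//|n IH] f g [df hf] [dg hg].
have h (x : R) : is_derive x 1 (fun x => a * f x + b * g x) (a * 'D_1 f x + b * 'D_1 g x).
  have hf' : is_derive x 1 f ('D_1 f x) by split.
  have hg' : is_derive x 1 g ('D_1 g x) by split.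
  exact: (@is_deriveD _ _ _ (a *: f) (b *: g) x 1 _ _ _ _).
split=> [x|]; first by have [] := h x.
rewrite (_ : (fun x => _) = fun x => a * 'D_1 f x + b * 'D_1 g x); first exact: IH.
by apply/funext => x; have [_ ->] := h x.
Qed.

Lemma times_derivable_mul n f g :
  times_derivable n f -> times_derivable n g ->
  times_derivable n (fun x => f x * g x).
Proof.
elim: n f g => [//|n IH] f g hf hg.
have hf' := times_derivableW hf; have hg' := times_derivableW hg.
move: hf hg => [df hf] [dg hg].
have h (x : R) : is_derive x 1 (fun x => f x * g x) (1 * (f x * 'D_1 g x) + 1 * (g x * 'D_1 f x)).
  have hf2 : is_derive x 1 f ('D_1 f x) by split.
  have hg2 : is_derive x 1 g ('D_1 g x) by split.
  by rewrite !mul1r; exact: (@is_deriveM _ _ f g x 1 _ _ _ _).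
split=> [x|]; first by have [] := h x.
rewrite (_ : (fun x => _) = fun x => 1 * (f x * 'D_1 g x) + 1 * (g x * 'D_1 f x)).
  by apply: times_derivable_lin; apply: IH.
by apply/funext => x; have [_ ->] := h x.
Qed.

Lemma times_derivable_affine n (a b : R) f :
  times_derivable n f -> times_derivable n (fun x => f (a * x + b)).
Proof.
elim: n f => [//|n IH] f [df hf].
have h (x : R) : is_derive x 1 (fun x => f (a * x + b)) (a * 'D_1 f (a * x + b) + 0 * 0).
  rewrite mul0r addr0 mulrC.
  have h1 : is_derive x 1 (fun x => a * x + b) a.
    by apply: is_derive_eq; rewrite /GRing.scale /= mulr1 addr0.
  have h2 : is_derive (a * x + b) 1 f ('D_1 f (a * x + b)) by split.
  have := @is_derive1_comp _ f (fun x => a * x + b) x _ _ h2 h1.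
  by [].
split=> [x|]; first by have [] := h x.
rewrite (_ : (fun x => _) = fun x => a * 'D_1 f (a * x + b) + 0 * 0).
  apply: (@times_derivable_lin n a 0 (fun x => 'D_1 f (a * x + b)) (fun=> 0)).
    exact: (IH (fun x => 'D_1 f x)).
  elim: (n) => [//|m hm] /=; split => //.
  by rewrite (_ : (fun x => _) = fun=> 0) //; apply/funext => x; rewrite derive_cst.
by apply/funext => x; have [_ ->] := h x.
Qed.

(** The functions t^(-k) exp(-1/t), extended by zero. The family is closed under differentiation up
    to linear combinations, so smoothness becomes an induction over all [k] at once. *)
Definition flat (k : nat) (t : R) : R :=
  if 0 < t then t ^- k * expR (- t^-1) else 0.

Lemma flat_ge0 k t : 0 <= flat k t.
Proof.
by rewrite /flat; case: ifP => // t0; rewrite mulr_ge0 ?expR_ge0 // invr_ge0 exprn_ge0 // ltW.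
Qed.

Lemma flat_gt0 k t : 0 < t -> 0 < flat k t.
Proof.
by move=> t0; rewrite /flat t0 mulr_gt0 ?expR_gt0 // invr_gt0 exprn_gt0.
Qed.

Lemma flat_le0 k t : t <= 0 -> flat k t = 0.
Proof. by rewrite /flat leNgt => /negbTE ->. Qed.

(** The exponential of 1/t dominates the term of degree [k + 2] of its series. The quadratic decay
    at the origin is what [is_derive_quadratic] asks for. *)
Lemma flat_bound k t : flat k t <= (k.+2)`!%:R * t ^+ 2.
Proof.
rewrite /flat; case: ifP => [t0|_]; last by rewrite mulr_ge0 // sqr_ge0.
have t1 : 0 <= t^-1 by rewrite invr_ge0 ltW.
have := @expR_ge1Dxn R t^-1 k.+1 t1.
rewrite expRN => h.
have e0 : 0 < expR t^-1 by exact: expR_gt0.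
rewrite ler_pdivrMr //.
have fp : 0 < (k.+2)`!%:R :> R by rewrite ltr0n fact_gt0.
have h2 : t^-1 ^+ k.+2 <= (k.+2)`!%:R * expR t^-1.
  by rewrite mulrC -ler_pdivrMr //; apply: le_trans h; rewrite lerDr.
rewrite -exprVn (_ : t^-1 ^+ k = t^-1 ^+ k.+2 * t ^+ 2).
  by rewrite [leRHS]mulrAC ler_pM2r // exprn_gt0.
by rewrite !exprS expr0 mulr1; field; rewrite gt_eqF.
Qed.

(** The factor 1 is kept so that the derivative is literally an instance of
    [times_derivable_lin]. *)
Lemma is_derive_flat k (x : R) :
  is_derive x 1 (flat k) (- k%:R * flat k.+1 x + 1 * flat k.+2 x).
Proof.
have [x0|x0|->] := ltgtP x 0.
- rewrite !flat_le0 ?(ltW x0) // !mulr0 addr0.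
  apply: (@near_eq_is_derive _ _ _ (fun=> 0)).
    by near=> y; rewrite flat_le0 //; apply: ltW; near: y; exact: lt_nbhsl.
- apply: (@near_eq_is_derive _ _ _ (fun t : R => t^-1 ^+ k * expR (- t^-1))).
    near=> y; rewrite /flat exprVn ifT //; near: y; exact: lt_nbhsr.
  have xn0 : x != 0 by rewrite gt_eqF.
  have h1 : is_derive x 1 (fun t : R => t^-1) (- x^-2).
    apply: is_derive_eq; first by apply: is_deriveV.
    by rewrite /GRing.scale /= mulr1.
  have h2 : is_derive x 1 (fun t : R => expR (- t^-1)) (expR (- x^-1) * x^-2).
    have h3 : is_derive x 1 (fun t : R => - t^-1) (x^-2).
      by apply: is_derive_eq; rewrite opprK.
    exact: (@is_derive1_comp _ (@expR R) (fun t : R => - t^-1) x _ _ _ h3).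
  have h4 : is_derive x 1 (fun t : R => t^-1 ^+ k) (k%:R * x^-1 ^+ k.-1 * - x^-2).
    by have := @is_deriveX _ _ (fun t : R => t^-1) k x 1 _ h1; rewrite exprfctE.
  have := @is_deriveM _ _ (fun t : R => t^-1 ^+ k) (fun t : R => expR (- t^-1)) x 1 _ _ h4 h2.
  congr (is_derive _ _ _ _); rewrite /flat x0 /GRing.scale /=.
  case: (k) => [|k'] /=; rewrite -!exprVn !exprS ?expr0; first by ring.
  by ring.
rewrite !flat_le0 // !mulr0 addr0.
apply: (@is_derive_quadratic _ _ _ _ _ (k.+2)`!%:R) => h.
rewrite mulr0 subr0 addr0 [flat k 0]flat_le0 // subr0.
rewrite ger0_norm ?flat_ge0 // /GRing.scale /= mulr1; exact: flat_bound.
Unshelve. all: end_near. Qed.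

Lemma flat_smooth k : smooth1 (flat k).
Proof.
move=> n; elim: n k => [//|n IH] k; split.
  by move=> x; have [] := is_derive_flat k x.
rewrite (_ : (fun x => _) = fun x => - k%:R * flat k.+1 x + 1 * flat k.+2 x).
  exact: times_derivable_lin.
by apply/funext => x; have [_ ->] := is_derive_flat k x.
Qed.

Definition test1 (b : R) f := smooth1 f /\ forall x, b < `|x| -> f x = 0.

Lemma test1_derive b f : test1 b f -> test1 b (fun x => 'D_1 f x).
Proof.
move=> [sf f0]; split=> [n|x bx]; first by have [_] := sf n.+1.
have -> : 'D_1 f x = 'D_1 (fun=> 0) x.
  apply: near_eq_derive; near=> y; apply: f0.
  near: y; apply: (cvgr_gt `|x|) => //.
  exact: norm_continuous.
by rewrite derive_cst.
Unshelve. all: end_near. Qed.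

Lemma test1_is_derive b f (x : R) : test1 b f -> is_derive x 1 f ('D_1 f x).
Proof. by move=> [sf _]; have [df _] := sf 1%N; split. Qed.

Lemma test1_continuous b f : test1 b f -> continuous f.
Proof.
move=> hf x; apply/differentiable_continuous/derivable1_diffP.
by have [] := test1_is_derive x hf.
Qed.

Lemma test1_bounded b f : test1 b f -> exists2 M, 0 <= M & forall x, `|f x| <= M.
Proof.
move=> hf; have cf := test1_continuous hf; have [_ f0] := hf.
have [b0|b0] := leP 0 b; last first.
  by exists 0 => // x; rewrite f0 ?normr0 // (lt_le_trans b0).
have := @EVT_max R (fun x => `|f x|) (- b) b.
case=> [||c _ hc]; first lra.
  apply: continuous_subspaceT => x; apply: cvg_norm; exact: cf.
exists `|f c| => // x; have [xb|xb] := leP `|x| b; last by rewrite f0 // normr0.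
by apply: hc; rewrite in_itv /= -ler_norml.
Qed.

Lemma test1_lipschitz b f : test1 b f ->
  exists2 M, 0 <= M & forall x y, `|f x - f y| <= M * `|x - y|.
Proof.
move=> hf; have [M M0 hM] := test1_bounded (test1_derive hf).
exists M => // x y; wlog yx : x y / y <= x.
  move=> W; have [/W//|/ltW/W h] := leP y x.
  by rewrite distrC [`|x - y|]distrC.
have := @MVT_segment R f (fun x => 'D_1 f x) y x yx.
case=> [z _||c _ ->]; first exact: test1_is_derive hf.
  by apply: continuous_subspaceT => z; exact: (test1_continuous hf).
by rewrite normrM ler_wpM2r.
Qed.

(** The mean value theorem for [f] and the Lipschitz bound of its derivative give a remainder that
    is uniform in [x] and therefore survives integration. *)
Lemma test1_taylor b f : test1 b f ->
  exists2 M, 0 <= M & forall x h, `|f (x + h) - f x - h * 'D_1 f x| <= M * h ^+ 2.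
Proof.
move=> hf; have [M M0 hM] := test1_lipschitz (test1_derive hf).
exists M => // x h.
have cf : {within `[Num.min x (x + h), Num.max x (x + h)], continuous f}.
  by apply: continuous_subspaceT => z; exact: (test1_continuous hf).
have := @MVT_segment R f (fun x => 'D_1 f x) _ _ _ _ cf.
case=> [|z _|c]; first by rewrite ge_min le_max lexx.
  exact: test1_is_derive hf.
rewrite in_itv /= => /andP[c1 c2] e.
have {}e : f (x + h) - f x = 'D_1 f c * h.
  have [h0|h0] := leP 0 h.
    by move: e; rewrite min_l ?max_r ?lerDl // => ->; congr (_ * _); ring.
  move: e; rewrite min_r ?max_l ?gerDl ?(ltW h0) // => e.
  by apply: oppr_inj; rewrite opprB e; ring.
have cx : `|c - x| <= `|h|.
  have [h0|h0] := leP 0 h.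
    move: c1 c2; rewrite min_l ?max_r ?lerDl // => c1 c2.
    rewrite !ger0_norm; lra.
  move: c1 c2; rewrite min_r ?max_l ?gerDl ?(ltW h0) // => c1 c2.
  rewrite !ler0_norm; lra.
rewrite e mulrC -mulrBr normrM.
have := hM c x => h1.
rewrite -(real_normK (num_real h)) expr2 mulrCA ler_wpM2l //.
by apply: le_trans h1 _; rewrite ler_wpM2l.
Qed.

Definition bump (n : nat) (x : R) : R :=
  flat 0 (n.+1%:R * x + 1) * flat 0 (- n.+1%:R * x + 1).

Lemma bump_test n : test1 n.+1%:R^-1 (bump n).
Proof.
split=> [m|x nx].
  by apply: times_derivable_mul; apply: times_derivable_affine; exact: flat_smooth.
have n0 : 0 < n.+1%:R :> R by rewrite ltr0n.
have : 1 < n.+1%:R * `|x| by rewrite -ltr_pdivrMl ?mulr1.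
rewrite /bump; have [x0|x0] := leP 0 x.
  rewrite ger0_norm // => h; rewrite [X in _ * X]flat_le0 ?mulr0 //; lra.
rewrite ltr0_norm // => h; rewrite [X in X * _]flat_le0 ?mul0r //; lra.
Qed.

Lemma bump_ge0 n x : 0 <= bump n x.
Proof. by rewrite mulr_ge0 ?flat_ge0. Qed.

Lemma bump_gt0 n x : `|x| < n.+1%:R^-1 -> 0 < bump n x.
Proof.
have n0 : 0 < n.+1%:R :> R by rewrite ltr0n.
rewrite -(ltr_pM2l n0) divff ?gt_eqF // -{1}[n.+1%:R]gtr0_norm // -normrM ltr_norml => /andP[h1 h2].
by rewrite mulr_gt0 // flat_gt0 //; lra.
Qed.

End SmoothOneVariable.

Section Mollification.
Context {R : realType}.
Local Notation P := (measurableTypeR R * measurableTypeR R)%type.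
Local Notation mu := (@plane_measure R).
Implicit Types (v w : R * R -> R) (f g : R -> R) (p q : R * R).

Definition kernel2 f g p q : R := f (q.1 - p.1) * g (q.2 - p.2).

Definition convol v f g p : R := \int[mu]_q (v q * kernel2 f g p q).

(** The kernel depends on [q - p], so differentiation in [p] changes the sign. *)
Definition opp_deriv f : R -> R := fun x => - 'D_1 f x.

Lemma test1_opp_deriv b f : test1 b f -> test1 b (opp_deriv f).
Proof.
move=> /test1_derive [sf f0]; split=> [n|x bx]; last by rewrite /opp_deriv f0 ?oppr0.
have := times_derivable_lin (-1) 0 (sf n) (sf n).
by congr times_derivable; apply/funext => x; rewrite /opp_deriv; ring.
Qed.

Lemma test1_scale b (k : R) f : test1 b f -> test1 b (fun x => k * f x).
Proof.
move=> [sf f0]; split=> [n|x bx]; last by rewrite f0 ?mulr0.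
have := times_derivable_lin k 0 (sf n) (sf n).
by congr times_derivable; apply/funext => x; ring.
Qed.

Lemma test1_mfun b f : test1 b f -> measurable_fun setT (f : measurableTypeR R -> measurableTypeR R).
Proof. by move=> h; apply: continuous_measurable_fun; exact: test1_continuous h. Qed.

Lemma mfun2_coord1 f (a : R) : measurable_fun setT (f : measurableTypeR R -> measurableTypeR R) ->
  mfun2 (fun q => f (q.1 + a)).
Proof.
move=> me; apply: (measurableT_comp me).
by apply: measurable_funD => //; exact: measurable_fst.
Qed.

Lemma mfun2_coord2 f (a : R) : measurable_fun setT (f : measurableTypeR R -> measurableTypeR R) ->
  mfun2 (fun q => f (q.2 + a)).
Proof.
move=> me; apply: (measurableT_comp me).
by apply: measurable_funD => //; exact: measurable_snd.
Qed.

Lemma kernel2_mfun b b' f g p : test1 b f -> test1 b' g -> mfun2 (kernel2 f g p).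
Proof.
move=> /test1_mfun h1 /test1_mfun h2.
by apply: measurable_funM; [exact: mfun2_coord1|exact: mfun2_coord2].
Qed.

Lemma convol_bdd b c b1 b2 v f g p : bdd b c v -> test1 b1 f -> test1 b2 g ->
  exists c', bdd b c' (fun q => v q * kernel2 f g p q).
Proof.
move=> hv h1 h2.
have [M1 M10 hM1] := test1_bounded h1; have [M2 M20 hM2] := test1_bounded h2.
exists (c * (M1 * M2)); apply: bddM hv; first exact: kernel2_mfun h1 h2.
by move=> q; rewrite normrM ler_pM.
Qed.

Lemma convol_itg b c b1 b2 v f g p : bdd b c v -> test1 b1 f -> test1 b2 g ->
  itg (fun q => v q * kernel2 f g p q).
Proof.
by move=> hv h1 h2; have [c' h] := convol_bdd p hv h1 h2; exact: bdd_itg h.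
Qed.

Lemma bdd_c_ge0 b c v : bdd b c v -> 0 <= c.
Proof. by move=> [_ vc _]; exact: le_trans (vc 0). Qed.

(** The uniform Taylor remainder of the kernel is integrated over the support of [v]; the result is
    again of second order in the step. *)
Lemma convol_is_derive (i : bool) b c b1 b2 v f g p : 0 <= b ->
  bdd b c v -> test1 b1 f -> test1 b2 g ->
  is_derive p (axis i) (convol v f g)
    (convol v (if i then f else opp_deriv f) (if i then opp_deriv g else g) p).
Proof.
move=> b0 hv h1 h2; have c0 := bdd_c_ge0 hv.
have [M1 M10 hM1] := test1_bounded h1; have [M2 M20 hM2] := test1_bounded h2.
have [N1 N10 hN1] := test1_taylor h1; have [N2 N20 hN2] := test1_taylor h2.
apply: (@is_derive_quadratic _ _ _ _ _ _ (c * (M1 * N2 + N1 * M2) * (2 * b) ^+ 2)) => h.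
set f' := if i then f else _; set g' := if i then _ else g.
have t1 : test1 b1 f' by rewrite /f'; case: (i) => //; exact: test1_opp_deriv.
have t2 : test1 b2 g' by rewrite /g'; case: (i) => //; exact: test1_opp_deriv.
have i1 := convol_itg (h *: axis i + p) hv h1 h2.
have i2 := convol_itg p hv h1 h2; have i3 := convol_itg p hv t1 t2.
rewrite /convol -RintZ // -RintB // -RintB //; [|exact: itgB|exact: itgZ].
pose F q := kernel2 f g (h *: axis i + p) q - kernel2 f g p q - h * kernel2 f' g' p q.
rewrite (@eq_Rint _ _ (fun q => v q * F q)); last by move=> q; rewrite /F; ring.
have mF : mfun2 F.
  apply: measurable_funB; first apply: measurable_funB.
  - exact: kernel2_mfun h1 h2.
  - exact: kernel2_mfun h1 h2.
  by apply: measurable_funM => //; exact: kernel2_mfun t1 t2.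
have FM q : `|F q| <= (M1 * N2 + N1 * M2) * h ^+ 2.
  rewrite /F /kernel2 /f' /g' /axis /opp_deriv; case: (i) => /=.
    rewrite /GRing.scale /= mulr0 mulr1 add0r.
    have := hN2 (q.2 - p.2) (- h); rewrite sqrrN.
    have -> : q.2 - (h + p.2) = q.2 - p.2 - h by ring.
    set A := g (_ - h); set B := g (q.2 - p.2); set D := 'D_1 g (q.2 - p.2); set E := f _ => le1.
    have -> : E * A - E * B - h * (E * - D) = E * (A - B - - h * D) by ring.
    rewrite normrM mulrDl; have h20 := sqr_ge0 h.
    apply: (@le_trans _ _ (M1 * (N2 * h ^+ 2))); first by apply: ler_pM => //; exact: hM1.
    by rewrite mulrA lerDl; apply: mulr_ge0 => //; exact: mulr_ge0.
  rewrite /GRing.scale /= mulr0 mulr1 add0r.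
  have := hN1 (q.1 - p.1) (- h); rewrite sqrrN.
  have -> : q.1 - (h + p.1) = q.1 - p.1 - h by ring.
  set A := f (_ - h); set B := f (q.1 - p.1); set D := 'D_1 f (q.1 - p.1); set E := g _ => le1.
  have -> : A * E - B * E - h * (- D * E) = (A - B - - h * D) * E by ring.
  rewrite normrM mulrDl; have h20 := sqr_ge0 h.
  apply: (@le_trans _ _ (N1 * h ^+ 2 * M2)); first by apply: ler_pM => //; exact: hM2.
  by rewrite mulrAC lerDr; apply: mulr_ge0 => //; exact: mulr_ge0.
have -> : c * (M1 * N2 + N1 * M2) * (2 * b) ^+ 2 * h ^+ 2 =
  c * ((M1 * N2 + N1 * M2) * h ^+ 2) * (2 * b) ^+ 2 by ring.
by apply: normr_Rint_bdd => //; apply: bddM.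
Qed.

Lemma lip_continuous v (L : R) :
  (forall p q, `|v p - v q| <= L * (`|p.1 - q.1| + `|p.2 - q.2|)) -> continuous v.
Proof.
move=> hv p; apply/cvgrPdist_le => e e0.
have L0 : 0 <= L.
  have := hv (1, 0) 0; rewrite /= subr0 normr1 subrr normr0 addr0 mulr1.
  exact: le_trans.
have d0 : 0 < e / (2 * (L + 1)) by rewrite divr_gt0 //; lra.
apply: (box_nbhs d0) => q q1 q2 /=.
apply: (le_trans (hv p q)).
rewrite distrC [`|p.2 - q.2|]distrC.
have L1 : 0 < 2 * (L + 1) by lra.
rewrite !ltr_pdivlMr // in q1 q2.
have := normr_ge0 (q.1 - p.1); have := normr_ge0 (q.2 - p.2); nra.
Qed.

Lemma convol_continuous b c b1 b2 v f g : 0 <= b ->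
  bdd b c v -> test1 b1 f -> test1 b2 g -> continuous (convol v f g).
Proof.
move=> b0 hv h1 h2; have c0 := bdd_c_ge0 hv.
have [M1 M10 hM1] := test1_bounded h1; have [M2 M20 hM2] := test1_bounded h2.
have [N1 N10 hN1] := test1_lipschitz h1; have [N2 N20 hN2] := test1_lipschitz h2.
apply: (@lip_continuous _ (c * (M1 * N2 + N1 * M2) * (2 * b) ^+ 2)) => p p'.
rewrite /convol -RintB //; [|exact: (convol_itg _ hv h1 h2)|exact: (convol_itg _ hv h1 h2)].
pose F q := kernel2 f g p q - kernel2 f g p' q.
rewrite (@eq_Rint _ _ (fun q => v q * F q)); last by move=> q; rewrite /F; ring.
rewrite mulrAC -[c * _ * _]mulrA.
apply: normr_Rint_bdd => //; apply: bddM => //.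
  by apply: measurable_funB; exact: kernel2_mfun h1 h2.
move=> q; rewrite /F /kernel2.
set x := q.1 - p.1; set y := q.2 - p.2; set x' := q.1 - p'.1; set y' := q.2 - p'.2.
have -> : f x * g y - f x' * g y' = f x * (g y - g y') + (f x - f x') * g y'.
  by ring.
have k1 : `|f x * (g y - g y')| <= M1 * (N2 * `|p.2 - p'.2|).
  rewrite normrM ler_pM //; apply: le_trans (hN2 _ _) _.
  by rewrite ler_wpM2l // distrC /y /y' (_ : q.2 - p'.2 - (q.2 - p.2) = p.2 - p'.2) //; ring.
have k2 : `|(f x - f x') * g y'| <= N1 * `|p.1 - p'.1| * M2.
  rewrite normrM ler_pM //; apply: le_trans (hN1 _ _) _.
  by rewrite ler_wpM2l // distrC /x /x' (_ : q.1 - p'.1 - (q.1 - p.1) = p.1 - p'.1) //; ring.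
apply: le_trans (ler_normD _ _) _; apply: le_trans (lerD k1 k2) _.
have := normr_ge0 (p.1 - p'.1); have := normr_ge0 (p.2 - p'.2).
have := mulr_ge0 M10 N20; have := mulr_ge0 N10 M20; nra.
Qed.

(** A partial derivative falls on one factor of the kernel, so convolutions with test kernels are
    stable under differentiation. This settles all sequences of partial derivatives by induction. *)
Lemma convol_partials b c b1 b2 v f g (s : seq bool) : 0 <= b ->
  bdd b c v -> test1 b1 f -> test1 b2 g ->
  exists f' g', [/\ test1 b1 f', test1 b2 g' &
    foldr partial (convol v f g) s = convol v f' g'].
Proof.
move=> b0 hv h1 h2; elim: s => [|i s [f1 [f2 [t1 t2 /= ->]]]]; first by exists f, g.
exists (if i then f1 else opp_deriv f1), (if i then opp_deriv f2 else f2); split.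
- by case: (i) => //; exact: test1_opp_deriv.
- by case: (i) => //; exact: test1_opp_deriv.
by apply/funext => p; have [_ <-] := convol_is_derive i p b0 hv t1 t2.
Qed.

Lemma convol_smooth b c b1 b2 v f g : 0 <= b ->
  bdd b c v -> test1 b1 f -> test1 b2 g -> smooth (convol v f g).
Proof.
move=> b0 hv h1 h2 s /=.
have [f1 [f2 [t1 t2 ->]]] := convol_partials s b0 hv h1 h2.
split; first exact: (convol_continuous b0 hv t1 t2).
by move=> i p; have [] := convol_is_derive i p b0 hv t1 t2.
Qed.

Lemma convol_shift b c b1 b2 v f g p : bdd b c v -> test1 b1 f -> test1 b2 g ->
  itg (fun q => v (q + p) * (f q.1 * g q.2)) /\
  convol v f g p = \int[mu]_q (v (q + p) * (f q.1 * g q.2)).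
Proof.
move=> hv h1 h2; have [i1 i2] := Rint_shift p (convol_itg p hv h1 h2).
have e : (fun q => v (q + p) * kernel2 f g p (q + p)) =
    (fun q => v (q + p) * (f q.1 * g q.2)).
  by apply/funext => q; rewrite /kernel2 /= !addrK.
split; first by rewrite -e.
by rewrite /convol -i2 e.
Qed.

Definition bump_mass (n : nat) : R := \int[mu]_q (bump n q.1 * bump n q.2).

Lemma bump2_bdd n : exists c, bdd n.+1%:R^-1 c (fun q : R * R => bump n q.1 * bump n q.2).
Proof.
have hb := @bump_test R n; have [M M0 hM] := test1_bounded hb.
exists (M * M); split.
- have := kernel2_mfun 0 hb hb; congr mfun2; apply/funext => q.
  by rewrite /kernel2 /= !subr0.
- by move=> q; rewrite normrM ler_pM.
move=> q hq; have [_ b0] := hb.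
have [h|h] := leP `|q.1| n.+1%:R^-1; last by rewrite b0 // mul0r.
have [h'|h'] := leP `|q.2| n.+1%:R^-1; last by rewrite [X in _ * X]b0 // mulr0.
by case: hq.
Qed.

Lemma bump_mass_gt0 n : 0 < bump_mass n.
Proof.
have [c hb] := bump2_bdd n.
have n0 : 0 < n.+1%:R^-1 :> R by rewrite invr_gt0 ltr0n.
rewrite lt_def Rintegral_ge0 ?andbT => [|q _]; last by rewrite mulr_ge0 ?bump_ge0.
apply/negP => /eqP m0.
(* The square root turns a vanishing integral into a vanishing norm, to which [n2_ae0] applies. *)
pose g (q : R * R) := Num.sqrt (bump n q.1 * bump n q.2).
have [mb _ _] := hb.
have gg q : g q ^+ 2 = bump n q.1 * bump n q.2.
  by rewrite sqr_sqrtr // mulr_ge0 ?bump_ge0.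
have mg : mfun2 g.
  by apply: measurableT_comp mb; apply: continuous_measurable_fun; exact: sqrt_continuous.
have Lg : L2 g.
  apply/L2P; split=> //; have := bdd_itg hb; congr itg; apply/funext => q.
  by rewrite gg.
have g0 : n2 g = 0.
  rewrite n2E (_ : ip g g = 0) ?sqrtr0 // -m0 ipE; apply: eq_Rint => q.
  by rewrite -expr2 gg.
have := n2_ae0 Lg g0.
move=> [N [mN N0 sN]].
have : (mu (in_box (n.+1%:R^-1 / 2)) <= mu N)%E.
  apply: le_measure; rewrite ?inE //; first exact: measurable_in_box.
  move=> q [q1 q2]; apply: sN => /=; rewrite sqrtr_eq0 -ltNge mulr_gt0 // bump_gt0 //.
    by apply: (le_lt_trans q1); rewrite ltr_pdivrMr // mulr_natr mulr2n ltrDl.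
  by apply: (le_lt_trans q2); rewrite ltr_pdivrMr // mulr_natr mulr2n ltrDl.
have -> : mu N = 0 by exact: N0.
rewrite plane_measure_box; last by rewrite divr_ge0 // ltW.
rewrite lee_fin leNgt exprn_gt0 // mulr_gt0 // divr_gt0 //.
Qed.

Definition bumpZ n (x : R) : R := (bump_mass n)^-1 * bump n x.

Definition mollify n v : R * R -> R := convol v (bumpZ n) (bump n).

Lemma bumpZ_test n : test1 n.+1%:R^-1 (bumpZ n).
Proof. by apply: test1_scale; exact: bump_test. Qed.

(** The reference value [l] is arbitrary: [l = 0] gives bounds and supports, the value at the centre
    gives convergence, and a slope gives convergence of gradients. *)
Lemma average_dist n (F : R * R -> R) (l e : R) :
  itg (fun q => F q * (bumpZ n q.1 * bump n q.2)) ->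
  (forall q, in_box n.+1%:R^-1 q -> `|F q - l| <= e) ->
  `|\int[mu]_q (F q * (bumpZ n q.1 * bump n q.2)) - l| <= e.
Proof.
move=> iF hF; have [c hb] := bump2_bdd n; have m0 := bump_mass_gt0 n.
have ib := bdd_itg hb.
have ib' : itg (fun q => bumpZ n q.1 * bump n q.2).
  have := itgZ (bump_mass n)^-1 ib; congr itg; apply/funext => q.
  by rewrite /bumpZ mulrA.
have b1 : \int[mu]_q (bumpZ n q.1 * bump n q.2) = 1.
  rewrite (@eq_Rint _ _ (fun q => (bump_mass n)^-1 * (bump n q.1 * bump n q.2))).
    by rewrite RintZ // mulVf // gt_eqF.
  by move=> q /=; rewrite /bumpZ -mulrA.
rewrite -[X in _ - X]mulr1 -[X in _ - _ * X]b1 -RintZ // -RintB //; last exact: itgZ.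
apply: le_trans (normr_Rint _) _; first by apply: itgB => //; exact: itgZ.
rewrite -[e]mulr1 -b1 -RintZ //.
apply: le_Rint => [||q].
- by apply: itg_norm; apply: itgB => //; exact: itgZ.
- exact: itgZ.
have bz : 0 <= bumpZ n q.1 * bump n q.2.
  rewrite /bumpZ mulr_ge0 ?bump_ge0 // mulr_ge0 ?bump_ge0 //.
  by rewrite invr_ge0 ltW.
have [hq|hq] := pselect (in_box n.+1%:R^-1 q).
  by rewrite -mulrBl normrM (ger0_norm bz) ler_wpM2r // hF.
have [_ _ b0] := hb.
have z0 : bumpZ n q.1 * bump n q.2 = 0 by rewrite /bumpZ -mulrA b0 // mulr0.
by rewrite z0 !mulr0 subrr normr0.
Qed.

Lemma mollify_dist n b c v p (l e : R) : bdd b c v ->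
  (forall q, `|q.1 - p.1| <= n.+1%:R^-1 -> `|q.2 - p.2| <= n.+1%:R^-1 ->
     `|v q - l| <= e) ->
  `|mollify n v p - l| <= e.
Proof.
move=> hv h; rewrite /mollify; have [i ->] := convol_shift p hv (bumpZ_test n) (@bump_test R n).
apply: average_dist => // q [q1 q2].
by apply: h; rewrite /= addrK.
Qed.

Lemma mollify_le n b c v p : bdd b c v -> `|mollify n v p| <= c.
Proof.
move=> hv; rewrite -[mollify n v p]subr0; apply: (mollify_dist hv) => q _ _.
by rewrite subr0; have [] := hv.
Qed.

Lemma mollify_smooth n b c v : 0 <= b -> bdd b c v -> smooth (mollify n v).
Proof.
by move=> b0 hv; apply: convol_smooth hv (bumpZ_test n) (@bump_test R n).
Qed.

Lemma mollify_outside n b c v p : bdd b c v -> ~ in_box (b + 1) p -> mollify n v p = 0.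
Proof.
move=> hv hp; apply/eqP; rewrite -normr_le0 -[mollify n v p]subr0.
apply: (mollify_dist hv) => q q1 q2; rewrite subr0.
have [_ _ ->] := hv; first by rewrite normr0.
have n1 : n.+1%:R^-1 <= 1 :> R by rewrite invf_le1 ?ltr0n // ler1n.
move=> [h1 h2]; apply: hp; split.
  rewrite -(subKr q.1 p.1); apply: (le_trans (ler_normB _ _)).
  by apply: lerD => //; apply: le_trans q1 n1.
rewrite -(subKr q.2 p.2); apply: (le_trans (ler_normB _ _)).
  by apply: lerD => //; apply: le_trans q2 n1.
Qed.

Lemma in_box_compact (b : R) : compact (in_box b).
Proof. by rewrite in_boxE; apply: compact_setX; exact: segment_compact. Qed.

Lemma mollify_test n b c v : 0 <= b -> bdd b c v -> test_function setT (mollify n v).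
Proof.
move=> b0 hv; split; first exact: mollify_smooth hv.
exists (in_box (b + 1)); split => //; first exact: in_box_compact.
by move=> p; apply: mollify_outside hv.
Qed.

End Mollification.

(** * Weak derivatives *)

Section WeakDerivatives.
Context {R : realType}.
Local Notation P := (measurableTypeR R * measurableTypeR R)%type.
Local Notation mu := (@plane_measure R).
Implicit Types (v w phi : R * R -> R) (omega : set (R * R)) (p q : R * R).

Lemma negligible_line (a b c : R) : (a, b) != 0 ->
  mu.-negligible [set p : P | a * p.1 + b * p.2 = c].
Proof.
move=> ab.
have cf : continuous (fun p : R * R => a * p.1 + b * p.2).
  apply: (@lip_continuous _ _ (`|a| + `|b|)) => p q.
  have -> : a * p.1 + b * p.2 - (a * q.1 + b * q.2) = a * (p.1 - q.1) + b * (p.2 - q.2) by ring.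
  apply: le_trans (ler_normD _ _) _; rewrite !normrM.
  have := normr_ge0 a; have := normr_ge0 b.
  have := normr_ge0 (p.1 - q.1); have := normr_ge0 (p.2 - q.2); nra.
have mE : measurable ([set p : P | a * p.1 + b * p.2 = c] : set P).
  have := @continuous_measurable2 R _ cf measurableT [set c] (measurable_set1 c).
  by rewrite setTI.
apply/negligibleP => //.
have [b0|b0] := eqVneq b 0.
  have a0 : a != 0 by apply: contra ab => /eqP ->; rewrite b0.
  have -> : [set p : P | a * p.1 + b * p.2 = c] = [set c / a] `*` setT.
    apply/seteqP; split=> p /=; rewrite b0 mul0r addr0.
      by move=> <-; split => //; rewrite mulrAC divff // mul1r.
    by case=> -> _; rewrite mulrC divfK.
  transitivity (lebesgue_measure ([set (c / a)%R] : set R) * lebesgue_measure [set: R])%E.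
    exact: product_measure1E.
  by rewrite lebesgue_measure_set1 mul0e.
pose S : set P := [set p | a * p.1 + b * p.2 = c].
transitivity (\int[lebesgue_measure]_x lebesgue_measure (xsection S x))%E => //.
rewrite integral0_eq // => x _ /=.
have -> : xsection S x = [set (c - a * x) / b].
  apply/seteqP; split=> y /=; rewrite /xsection /= inE /=.
    by move=> <-; rewrite addrAC subrr add0r mulrAC divff // mul1r.
  by move=> ->; rewrite /S /= mulrCA divff // mulr1 addrCA subrr addr0.
exact: lebesgue_measure_set1.
Qed.

Definition rect (r : R * R * (R * R)) : set P :=
  `]r.1.1, r.1.2]%classic `*` `]r.2.1, r.2.2]%classic.

Lemma measurable_rect r : measurable (rect r).
Proof. exact: measurableX. Qed.

Lemma rect_bdd r : exists2 b, 0 <= b & bdd b 1 (\1_(rect r) : R * R -> R).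
Proof.
pose b := `|r.1.1| + `|r.1.2| + (`|r.2.1| + `|r.2.2|).
have p1 := normr_ge0 r.1.1; have p2 := normr_ge0 r.1.2.
have p3 := normr_ge0 r.2.1; have p4 := normr_ge0 r.2.2.
exists b; first by rewrite /b; lra.
split.
- by apply: measurable_indic; exact: measurable_rect.
- by move=> p; rewrite indicE; case: (_ \in _); rewrite /= ?normr1 ?normr0.
move=> p hp; rewrite indicE memNset // => -[/=]; rewrite !in_itv /= => /andP[h1 h2] /andP[h3 h4].
apply: hp; split; rewrite ler_norml /b.
  have := ler_norm r.1.2; have := ler_norm (- r.1.1); rewrite normrN => *.
  by apply/andP; split; lra.
have := ler_norm r.2.2; have := ler_norm (- r.2.1); rewrite normrN => *.
by apply/andP; split; lra.
Qed.

Lemma L2_itg_bdd w b c v : L2 w -> bdd b c v -> itg (fun p => w p * v p).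
Proof. by move=> hw hv; apply: L2M => //; exact: bdd_L2 hv. Qed.

Lemma same_side (x y a e : R) : `|y - x| <= e -> e < `|x - a| ->
  ((a < y) = (a < x)) * ((y <= a) = (x <= a)).
Proof.
rewrite ler_norml => /andP[h1 h2].
have [xa|xa] := leP a x.
  rewrite ger0_norm ?subr_ge0 // => h; split; first by do 2 case: ltP; lra.
  by do 2 case: leP; lra.
rewrite ltr0_norm ?subr_lt0 // => h; split; first by do 2 case: ltP; lra.
by do 2 case: leP; lra.
Qed.

Lemma rect_same_side r p q e : `|q.1 - p.1| <= e -> `|q.2 - p.2| <= e ->
  e < `|p.1 - r.1.1| -> e < `|p.1 - r.1.2| -> e < `|p.2 - r.2.1| -> e < `|p.2 - r.2.2| ->
  rect r q = rect r p.
Proof.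
move=> h1 h2 k1 k2 k3 k4; rewrite /rect /= !in_itv /=.
by rewrite (same_side h1 k1) (same_side h1 k2) (same_side h2 k3) (same_side h2 k4).
Qed.

Definition rect_sides r : set P :=
  [set p | 1 * p.1 + 0 * p.2 = r.1.1] `|` [set p | 1 * p.1 + 0 * p.2 = r.1.2]
   `|` [set p | 0 * p.1 + 1 * p.2 = r.2.1] `|` [set p | 0 * p.1 + 1 * p.2 = r.2.2].

Lemma negligible_rect_sides r : mu.-negligible (rect_sides r).
Proof.
have n10 : (1, 0) != 0 :> R * R by rewrite xpair_eqE oner_eq0.
have n01 : (0, 1) != 0 :> R * R by rewrite xpair_eqE oner_eq0 andbF.
by do 3 ?apply: negligibleU; apply: negligible_line.
Qed.

(** Off the sides the indicator is constant near [p], so [mollify_dist] with [e = 0] makes the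
    sequence eventually constant. *)
Lemma mollify_rect_near r p b : bdd b 1 (\1_(rect r) : R * R -> R) -> ~ rect_sides r p ->
  mollify n (\1_(rect r)) p @[n --> \oo] --> (\1_(rect r) p : R).
Proof.
move=> hb hp; apply: cvg_near_cst.
pose d := Num.min (Num.min `|p.1 - r.1.1| `|p.1 - r.1.2|)
                  (Num.min `|p.2 - r.2.1| `|p.2 - r.2.2|).
have d0 : 0 < d.
  rewrite /d !lt_min !normr_gt0 !subr_eq0.
  rewrite -!andbA; apply/and4P; split; apply/eqP => e; apply: hp;
    rewrite /rect_sides /= !mul1r !mul0r !addr0 !add0r; tauto.
near=> n.
have nd : n.+1%:R^-1 < d by near: n; exact: (near_infty_natSinv_lt (PosNum d0)).
apply/eqP; rewrite -subr_eq0 -normr_le0; apply: (mollify_dist hb) => q q1 q2.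
move: nd; rewrite /d !lt_min => /andP[/andP[k1 k2] /andP[k3 k4]].
rewrite !indicE (_ : (q \in rect r) = (p \in rect r)) ?subrr ?normr0 //.
by apply/idP/idP; rewrite !inE (rect_same_side q1 q2).
Unshelve. all: end_near. Qed.

Lemma test_orthogonal_rect w r : L2 w ->
  (forall phi, test_function setT phi -> \int[mu]_p (w p * phi p) = 0) ->
  \int[mu]_p (w p * \1_(rect r) p) = 0.
Proof.
move=> hw h; have [b b0 hb] := rect_bdd r.
have mw := L2_mfun hw.
have [||||||_ cv] := @dct R (fun n p => w p * mollify n (\1_(rect r)) p)
  (fun p => w p * \1_(rect r) p) (fun p => `|w p * \1_(in_box (b + 1)) p|) (rect_sides r).
- move=> n; apply: measurable_funM => //.
  by apply: continuous_measurable2; have [+ _] := mollify_smooth n b0 hb [::].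
- by apply: measurable_funM => //; have [] := hb.
- exact: negligible_rect_sides.
- move=> p hp; apply: cvgM; first exact: cvg_cst.
  exact: (mollify_rect_near hb hp).
- apply: itg_norm; apply: L2M => //; apply: (@bdd_L2 _ (b + 1) 1); split.
  + by apply: measurable_indic; exact: measurable_in_box.
  + by move=> p; rewrite indicE; case: (_ \in _); rewrite /= ?normr1 ?normr0.
  + by move=> p hp; rewrite indicE memNset.
- move=> n p; rewrite !normrM; apply: ler_wpM2l => //.
  have [hp|hp] := pselect (in_box (b + 1) p).
    by rewrite indicE mem_set // normr1; apply: mollify_le hb.
  by rewrite (mollify_outside _ hb hp) normr0.
apply: (cvg_unique _ cv) => //.
rewrite (_ : (fun n => _) = cst 0); first exact: cvg_cst.
by apply/funext => n; apply: h; exact: mollify_test hb.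
Qed.

Definition rects : set (set P) := range rect.

Lemma rects_generate : @measurable _ P = <<s rects >>.
Proof.
pose GT := g_sigma_algebraType rects.
have box_sub (n : nat) (x : R) : `|x| <= n%:R -> - n.+1%:R < x <= n.+1%:R.
  rewrite ler_norml => /andP[h1 h2]; rewrite -natr1; apply/andP; split; lra.
have ex_nat (x : R) : exists n : nat, `|x| <= n%:R.
  by exists (Num.truncn `|x|).+1; apply: ltW; exact: truncnS_gt.
have m1 : measurable_fun setT (fst : GT -> measurableTypeR R).
  apply: (@measurability _ _ _ (measurableTypeR R) setT _ (@ocitv R)) => // _ [_ [[a b] _ <-] <-].
  rewrite setTI (_ : fst @^-1` _ =
    \bigcup_n rect ((a, b), (- n.+1%:R, n.+1%:R))); last first.
    apply/seteqP; split=> p /=.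
      move=> h; have [n hn] := ex_nat p.2; exists n => //; split => //=.
      by rewrite in_itv /= box_sub.
    by case=> n _ [].
  by apply: bigcupT_measurable => n; apply: sub_sigma_algebra; eexists.
have m2 : measurable_fun setT (snd : GT -> measurableTypeR R).
  apply: (@measurability _ _ _ (measurableTypeR R) setT _ (@ocitv R)) => // _ [_ [[a b] _ <-] <-].
  rewrite setTI (_ : snd @^-1` _ =
    \bigcup_n rect ((- n.+1%:R, n.+1%:R), (a, b))); last first.
    apply/seteqP; split=> p /=.
      move=> h; have [n hn] := ex_nat p.1; exists n => //; split => //=.
      by rewrite in_itv /= box_sub.
    by case=> n _ [].
  by apply: bigcupT_measurable => n; apply: sub_sigma_algebra; eexists.
apply/seteqP; split; last first.
  apply: smallest_sub; first exact: sigma_algebra_measurable.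
  by move=> _ [r _ <-]; exact: measurable_rect.
rewrite measurable_prod_measurableType.
apply: smallest_sub; first exact: smallest_sigma_algebra.
move=> _ [A mA [B mB <-]].
rewrite (_ : A `*` B = (fst @^-1` A) `&` (snd @^-1` B)) //.
have : measurable ((fst @^-1` A : set GT) `&` (snd @^-1` B : set GT)).
  by apply: measurableI; [rewrite -[X in measurable X]setTI; exact: m1|
                          rewrite -[X in measurable X]setTI; exact: m2].
by [].
Qed.

Lemma rectI (r s : R * R * (R * R)) :
  rect r `&` rect s = rect ((Num.max r.1.1 s.1.1, Num.min r.1.2 s.1.2),
                            (Num.max r.2.1 s.2.1, Num.min r.2.2 s.2.2)).
Proof.
apply/seteqP; split=> p /=; rewrite /rect /= !in_itv /= !gt_max !le_min.
  by move=> [[/andP[-> ->] /andP[-> ->]] [/andP[-> ->] /andP[-> ->]]].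
by move=> [/andP[/andP[-> ->] /andP[-> ->]] /andP[/andP[-> ->] /andP[-> ->]]].
Qed.

Lemma rects_setI : setI_closed rects.
Proof. by move=> _ _ [r _ <-] [s _ <-]; rewrite rectI; eexists. Qed.

(** The fundamental lemma of the calculus of variations: mollified indicators give vanishing
    integrals over rectangles, and Dynkin's theorem extends this to all measurable sets. *)
Lemma test_orthogonal w : L2 w ->
  (forall phi, test_function setT phi -> \int[mu]_p (w p * phi p) = 0) ->
  mu.-negligible [set p : P | w p != 0].
Proof.
move=> hw h.
(* Truncation to growing squares, since a square integrable function on the plane need not be
   integrable. *)
pose sq n : R * R * (R * R) := ((- n.+1%:R, n.+1%:R), (- n.+1%:R, n.+1%:R)).
pose wn n p := w p * \1_(rect (sq n)) p.
have mw := L2_mfun hw.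
have iwn n : itg (wn n).
  by have [b b0 hb] := rect_bdd (sq n); exact: L2_itg_bdd hw hb.
have wnr n r : (\int[mu]_(p in rect r) (wn n p)%:E = 0)%E.
  have : \int[mu]_(p in rect r) (wn n p) = 0 :> R.
    rewrite Rintegral_mkcond -(test_orthogonal_rect
      ((Num.max r.1.1 (sq n).1.1, Num.min r.1.2 (sq n).1.2),
       (Num.max r.2.1 (sq n).2.1, Num.min r.2.2 (sq n).2.2)) hw h).
    apply: eq_Rint => p; rewrite -rectI patchE /wn !indicE in_setI.
    by case: (p \in rect r) => //=; rewrite mulr0.
  move=> e; rewrite -[LHS]fineK; first by rewrite -[fine _]/(\int[mu]_(p in rect r) wn n p) e.
  apply: integrable_fin_num; first exact: measurable_rect.
  by apply: integrableS (iwn n) => //; exact: measurable_rect.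
have wnE n (E : set P) : measurable E -> (\int[mu]_(p in E) (wn n p)%:E = 0)%E.
  move=> mE; have gE : <<s rects >> E by rewrite -rects_generate.
  move: E gE {mE}; apply: (@dynkin_induction _ P rects) => //.
  - exact: rects_generate.
  - exact: rects_setI.
  - rewrite -[RHS](wnr n (sq n)) [RHS]integral_mkcond; apply: eq_integral => p _.
    by rewrite patchE /wn indicE; case: (p \in _) => //=; rewrite mulr0.
  - by move=> _ [r _ <-]; exact: wnr.
  - move=> S mS ES; have iT : (\int[mu]_(p in setT) (wn n p)%:E = 0)%E.
      rewrite -[RHS](wnr n (sq n)) [RHS]integral_mkcond; apply: eq_integral => p _.
      by rewrite patchE /wn indicE; case: (p \in _) => //=; rewrite mulr0.
    have := iT; rewrite -(setUv S) integral_setU //.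
    + by rewrite ES add0e.
    + exact: measurableC.
    + by apply: measurable_funTS; apply/measurable_EFinP; exact: itg_measurable.
    + by apply/disj_setPS => x [].
  - move=> F mF tF HF; rewrite integral_bigcup //.
      by apply: eseries0 => i _ _; exact: HF.
    by apply: integrableS (iwn n) => //; exact: bigcupT_measurable.
have wn0 n : mu.-negligible [set p : P | wn n p != 0].
  have := @integral_ae_eq _ P R mu setT measurableT (cst 0%E) (EFin \o wn n) (iwn n).
  case=> [||N [mN N0 sN]]; first exact: measurable_cst.
    by move=> E _ mE; rewrite integral_cst // mul0e; exact: wnE.
  exists N; split=> // p /= hp; apply: sN => /= hh.
  by move: (hh I) => [] /eqP; rewrite (negbTE hp).
apply: (negligibleS _ (negligible_bigcup wn0)) => p /= wp.
pose n := (Num.truncn (`|p.1| + `|p.2|)).+1.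
have hn : `|p.1| + `|p.2| < n%:R by rewrite truncnS_gt.
exists n => //=; rewrite /wn indicE mem_set ?mulr1 //.
have := normr_ge0 p.1; have := normr_ge0 p.2 => h2 h1.
have h1' : `|p.1| < n%:R by lra.
have h2' : `|p.2| < n%:R by lra.
move: h1' h2'; rewrite !ltr_norml => /andP[k1 k2] /andP[k3 k4].
by rewrite /rect /= !in_itv /= -natr1; split; apply/andP; split; lra.
Qed.

Lemma compact_in_box (K : set (R * R)) : compact K ->
  exists2 b, 0 <= b & K `<=` in_box b.
Proof.
move=> /compact_bounded [b [_ bK]].
have hb : b < `|b| + 1 by have := ler_norm b; lra.
exists (`|b| + 1); first by have := normr_ge0 b; lra.
move=> p /(bK _ hb) /= hp.
by split; apply: le_trans hp; rewrite /Num.norm /= le_max lexx ?orbT.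
Qed.

Lemma continuous_bdd (f : R * R -> R) b : 0 <= b -> continuous f ->
  (forall p, ~ in_box b p -> f p = 0) -> exists c, bdd b c f.
Proof.
move=> b0 cf f0.
have [||c _ hc] := @compact_EVT_max _ _ (fun p => `|f p|) (in_box b) _ (@in_box_compact R b).
- by exists 0; split; rewrite /= normr0.
- by apply: continuous_subspaceT => x; apply: cvg_norm; exact: cf.
exists `|f c|; split => // [|p]; first exact: continuous_measurable2.
have [hp|hp] := pselect (in_box b p); last by rewrite f0 // normr0.
by apply: hc; rewrite inE.
Qed.

Lemma test_bdd omega phi : test_function omega phi ->
  exists b c, [/\ 0 <= b, bdd b c phi & forall i, bdd b c (partial i phi)].
Proof.
move=> [sphi [K [cK _ K0]]].
have [b b0 Kb] := compact_in_box cK.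
have z p : ~ in_box b p -> phi p = 0 by move=> hp; apply: K0 => /Kb.
have dz i p : ~ in_box b p -> partial i phi p = 0.
  move=> hp; rewrite /partial.
  have -> : 'D_(axis i) phi p = 'D_(axis i) (fun=> 0) p.
    apply: near_eq_derive.
    have : closed (in_box b) by apply: compact_closed; [exact: norm_hausdorff|exact: (@in_box_compact R b)].
    move=> /closed_openC oC.
    have : nbhs p (~` in_box b) by apply: open_nbhs_nbhs.
    by apply: filterS => q; exact: z.
  exact: derive_cst.
have [c0 h0] := continuous_bdd b0 (sphi [::]).1 z.
have [c1 h1] := continuous_bdd b0 (sphi [:: false]).1 (dz false).
have [c2 h2] := continuous_bdd b0 (sphi [:: true]).1 (dz true).
exists b, (Num.max c0 (Num.max c1 c2)); split; first exact: b0.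
  by apply: bdd_le h0 => //; rewrite le_max lexx.
by case; [apply: bdd_le h2|apply: bdd_le h1] => //; rewrite !le_max lexx !orbT.
Qed.

Lemma test_lip omega phi (i : bool) c : test_function omega phi ->
  (forall p, `|partial i phi p| <= c) ->
  forall p (h : R), `|phi (p + h *: axis i) - phi p| <= c * `|h|.
Proof.
move=> [sphi _] hc p h.
have dphi (t : R) : is_derive t 1 (fun t : R => phi (p + t *: axis i)) (partial i phi (p + t *: axis i)).
  have [_ /(_ i (p + t *: axis i)) d] := sphi [::].
  have d' : is_derive (p + t *: axis i) (axis i) phi (partial i phi (p + t *: axis i)).
    by split.
  have [d1 d2] := d'.
  have E : (fun k : R => k^-1 *: (((fun t : R => phi (p + t *: axis i)) \o shift t) (k *: 1) -
      phi (p + t *: axis i))) =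
    (fun k : R => k^-1 *: ((phi \o shift (p + t *: axis i)) (k *: axis i) - phi (p + t *: axis i))).
    by apply/funext => k /=; rewrite scalerDl [k *: 1]mulr1 addrCA.
  by split; [rewrite /derivable E|rewrite /derive E].
have cont : continuous (fun t : R => phi (p + t *: axis i)).
  by move=> t; apply/differentiable_continuous/derivable1_diffP; have [] := dphi t.
have [h0|h0] := leP 0 h.
  have [|t _] := MVT_segment h0 (fun t _ => dphi t).
    exact: continuous_subspaceT.
  by rewrite scale0r addr0 subr0 => ->; rewrite normrM ler_wpM2r.
have [|t _] := MVT_segment (ltW h0) (fun t _ => dphi t).
  exact: continuous_subspaceT.
by rewrite scale0r addr0 sub0r distrC => ->; rewrite normrM normrN ler_wpM2r.
Qed.

Lemma weak_partial_unique i v w w' :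
  is_weak_partial i v w -> is_weak_partial i v w' ->
  mu.-negligible [set p : P | w p != w' p].
Proof.
move=> [hw h] [hw' h'].
have := test_orthogonal (L2B hw hw').
have -> : [set p : P | w p - w' p != 0] = [set p : P | w p != w' p].
  by apply/seteqP; split => p /=; rewrite subr_eq0.
apply=> phi ht.
have [b [c [b0 hphi _]]] := test_bdd ht; have Lphi := bdd_L2 hphi.
have e : forall p, (w p - w' p) * phi p = w p * phi p - w' p * phi p.
  by move=> p; rewrite mulrBl.
rewrite (eq_Rint e) RintB; [|exact: L2M|exact: L2M].
have := h _ ht; rewrite h' // => /oppr_inj ->; by rewrite subrr.
Qed.

Lemma weak_partialP i v w : is_weak_partial i v w ->
  is_weak_partial i v (weak_partial i v) /\
  mu.-negligible [set p : P | weak_partial i v p != w p].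
Proof.
move=> h; have h' : is_weak_partial i v (weak_partial i v).
  by have := @xgetPex _ (fun=> 0) _ (ex_intro (is_weak_partial i v) w h).
by split=> //; exact: weak_partial_unique h' h.
Qed.

Definition invS (n : nat) : R := n.+1%:R^-1.

Lemma invS_gt0 n : 0 < invS n. Proof. by rewrite invr_gt0 ltr0n. Qed.

Lemma invS_le1 n : invS n <= 1.
Proof. by rewrite invf_le1 ?ltr0n // ler1n. Qed.

Lemma invS_near (e : R) : 0 < e -> \forall n \near \oo, invS n < e.
Proof. by move=> e0; exact: (near_infty_natSinv_lt (PosNum e0)). Qed.

(** The steps run through 1/(n+1), so that limits are taken along a sequence, as in [dct]. *)
Definition dquot (a : R * R) v n p : R := n.+1%:R * (v (p + invS n *: a) - v p).

Lemma bdd_shift b c v (a : R * R) (d : R) : `|a.1| <= d -> `|a.2| <= d ->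
  bdd b c v -> bdd (b + d) c (fun p => v (p + a)).
Proof.
move=> a1 a2 [mv vc v0]; split=> //.
  exact: (measurableT_comp mv (@measurable_shift _ a)).
move=> p hp; apply: v0 => -[/= h1 h2]; apply: hp; split.
  rewrite -(addrK a.1 p.1); apply: le_trans (ler_normB _ _) _; exact: lerD.
rewrite -(addrK a.2 p.2); apply: le_trans (ler_normB _ _) _; exact: lerD.
Qed.

(* Translation invariance kills the integral of every difference quotient. *)
Lemma Rint_derivative0 b c (L : R) v w (a : R * R) (N : set P) : 0 <= b ->
  bdd b c v -> mfun2 w -> mu.-negligible N ->
  (forall n p, `|dquot a v n p| <= L) ->
  (forall p, ~ N p -> dquot a v n p @[n --> \oo] --> w p) ->
  \int[mu]_p w p = 0.
Proof.
move=> b0 hv mw N0 hL hc.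
pose d := `|a.1| + `|a.2|.
have d0 : 0 <= d by rewrite addr_ge0.
have sh n : bdd (b + d) c (fun p => v (p + invS n *: a)).
  apply: bdd_shift hv; rewrite /= normrM (ger0_norm (ltW (invS_gt0 n))) /d.
    apply: le_trans (_ : 1 * `|a.1| <= _); first by rewrite ler_wpM2r ?invS_le1.
    by rewrite mul1r lerDl.
  apply: le_trans (_ : 1 * `|a.2| <= _); first by rewrite ler_wpM2r ?invS_le1.
  by rewrite mul1r lerDr.
have iv := bdd_itg hv.
have [||||||_ cv] := @dct R (dquot a v) w (fun p => L * \1_(in_box (b + d)) p) N => //.
- move=> n; apply: measurable_funM => //.
  by apply: measurable_funB; [have [] := sh n|have [] := hv].
- by apply: itgZ; exact: itg_box.
- move=> n p; have [hp|hp] := pselect (in_box (b + d) p).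
    by rewrite indicE mem_set // mulr1.
  have [_ _ z1] := sh n; have [_ _ z2] := hv.
  rewrite /dquot z1 // z2 ?subr0 ?mulr0 ?normr0 ?indicE ?memNset ?mulr0 //.
  by move=> [h1 h2]; apply: hp; split; rewrite ler_wpDr.
apply: (cvg_unique _ cv) => //.
rewrite (_ : (fun n => _) = cst 0); first exact: cvg_cst.
apply/funext => n; have [i e] := Rint_shift (invS n *: a) iv.
by rewrite /dquot RintZ ?RintB ?e ?subrr ?mulr0 //; exact: itgB.
Qed.

End WeakDerivatives.

(** * Calculus of weak derivatives *)

HB.lock Definition wp {R : realType} (i : bool) (v : R * R -> R) : R * R -> R :=
  weak_partial i v.
(** Taken over the whole plane, so that one form serves all subdomains: the gradient of an extension
    by zero vanishes almost everywhere outside, see [grad_dotE]. *)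
HB.lock Definition gip {R : realType} (v w : R * R -> R) : R :=
  ip (wp false v) (wp false w) + ip (wp true v) (wp true w).

Section SobolevCalculus.
Context {R : realType}.
Local Notation P := (measurableTypeR R * measurableTypeR R)%type.
Local Notation mu := (@plane_measure R).
Implicit Types (v w phi : R * R -> R) (p q : R * R) (omega : set (R * R)).

Lemma invS_cvg0 : (@invS R) n @[n --> \oo] --> (0 : R).
Proof.
apply/cvgrPdist_lt => e e0; near=> n.
rewrite sub0r normrN gtr0_norm ?invS_gt0 //; near: n; exact: invS_near.
Unshelve. all: end_near. Qed.

Lemma dquotE (a : R * R) v n p : dquot a v n p = (invS n)^-1 * (v (p + invS n *: a) - v p).
Proof. by rewrite /dquot /invS invrK. Qed.

Lemma dquot_derive (a : R * R) v p (l : R) : is_derive p a v l ->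
  dquot a v n p @[n --> \oo] --> l.
Proof.
move=> [d <-].
have c : (fun h : R => h^-1 *: (v (h *: a + p) - v p)) @ 0^' --> 'D_a v p by exact: d.
have i0 : (@invS R) n @[n --> \oo] --> (0 : R)^'.
  move=> A [e /= e0 hA]; have := @invS_near R e e0; apply: filterS => n hn.
  apply: hA; last by rewrite gt_eqF // invS_gt0.
  by rewrite /ball /= sub0r normrN gtr0_norm // invS_gt0.
have := cvg_comp _ _ i0 c; apply: cvg_trans; apply: near_eq_cvg; near=> n.
by rewrite dquotE /= [p + _]addrC.
Unshelve. all: end_near. Qed.

Lemma dquot_point (a : R * R) v p (L : R) : (forall n, `|dquot a v n p| <= L) ->
  v (p + invS n *: a) @[n --> \oo] --> v p.
Proof.
move=> h; apply/cvgrPdist_le => e e0.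
have L0 : 0 <= L by apply: le_trans (h 0%N).
near=> n.
have hn : invS n < e / (L + 1) by near: n; apply: invS_near; rewrite divr_gt0 //; lra.
have := h n; rewrite dquotE normrM normfV (gtr0_norm (invS_gt0 n)).
rewrite ler_pdivrMl ?invS_gt0 // distrC => h1.
apply: le_trans h1 _.
have L1 : 0 < L + 1 by lra.
move: hn; rewrite ltr_pdivlMr //; have := @invS_gt0 R n; nra.
Unshelve. all: end_near. Qed.

Lemma dquotM (a : R * R) v w n p :
  dquot a (fun q => v q * w q) n p =
  v (p + invS n *: a) * dquot a w n p + w p * dquot a v n p.
Proof. by rewrite /dquot; ring. Qed.

Lemma normr_leMDM (a b c d A B C D : R) :
  `|a| <= A -> `|b| <= B -> `|c| <= C -> `|d| <= D ->
  `|a * b + c * d| <= A * B + C * D.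
Proof.
move=> ha hb hc hd; apply: le_trans (ler_normD _ _) _.
by rewrite !normrM; apply: lerD; apply: ler_pM.
Qed.

(** The difference quotients of [v * phi] have integral zero, and their limit is the sum of the two
    integrands by the product rule. *)
Lemma integration_by_parts i b c (L : R) v w phi omega (N : set P) : 0 <= b ->
  bdd b c v -> bdd b L w -> mu.-negligible N ->
  (forall n p, `|dquot (axis i) v n p| <= L) ->
  (forall p, ~ N p -> dquot (axis i) v n p @[n --> \oo] --> w p) ->
  test_function omega phi ->
  \int[mu]_p (v p * partial i phi p) = - \int[mu]_p (w p * phi p).
Proof.
move=> b0 hv hw N0 hL hc ht.
have [b' [c' [b'0 hphi dphi]]] := test_bdd ht.
have [mv vc vz] := hv; have [mw wc wz] := hw; have [mphi phic phiz] := hphi.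
have [mdphi dphic dphiz] := dphi i.
have c0 := bdd_c_ge0 hv; have c'0 := bdd_c_ge0 hphi.
have lphi n p : `|dquot (axis i) phi n p| <= c'.
  rewrite dquotE normrM normfV (gtr0_norm (invS_gt0 n)) ler_pdivrMl ?invS_gt0 //.
  have := test_lip ht dphic p (invS n).
  by rewrite (gtr0_norm (invS_gt0 n)) mulrC.
have cphi p : dquot (axis i) phi n p @[n --> \oo] --> partial i phi p.
  apply: dquot_derive; have [sphi _] := ht.
  by have [_ /(_ i p) d] := sphi [::]; split.
have i1 : itg (fun p => v p * partial i phi p) by apply: bdd_itg (bddM mdphi dphic hv).
have i2 : itg (fun p => w p * phi p) by apply: bdd_itg (bddM mphi phic hw).
apply/eqP; rewrite -addr_eq0 -RintD //; apply/eqP.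
apply: (@Rint_derivative0 _ b (c * c') (c * c' + c' * L) (fun p => v p * phi p) _ (axis i) N) => //.
- exact: bddM.
- by apply: measurable_funD; apply: measurable_funM.
- by move=> n p; rewrite dquotM; apply: normr_leMDM.
move=> p hp.
rewrite (_ : (fun n => _) = (fun n => v (p + invS n *: axis i) * dquot (axis i) phi n p +
   phi p * dquot (axis i) v n p)); last by apply/funext => n; rewrite dquotM.
apply: cvgD.
  by apply: cvgM => //; apply: (@dquot_point _ _ _ L) => n.
rewrite [w p * phi p]mulrC; apply: cvgM; first exact: cvg_cst.
exact: hc.
Qed.

Lemma n2_le v w : mfun2 v -> L2 w -> (forall p, `|v p| <= `|w p|) -> n2 v <= n2 w.
Proof.
move=> mv hw vw; have hv := L2_le mv hw vw.
rewrite !n2E; apply: ler_wsqrtr; rewrite !ipE; apply: le_Rint => [||p]; try exact: L2M.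
rewrite -!expr2 -(real_normK (num_real (v p))) -(real_normK (num_real (w p))).
by rewrite lerXn2r // nnegrE.
Qed.

(** The first partial derivative of [p.1 * phi p * phi p] has integral zero. Hence the squared norm
    of [phi] is -2 times the product of [p.1 * phi p] with the derivative of [phi], and [p.1] is at
    most 1 on the support. *)
Lemma friedrichs_test omega phi : omega `<=` unit_square -> test_function omega phi ->
  n2 phi <= 2 * n2 (partial false phi).
Proof.
move=> om ht; have [b [c [b0 hphi dphi]]] := test_bdd ht.
have [mphi phic phiz] := hphi; have [mdphi dphic dphiz] := dphi false.
have c0 := bdd_c_ge0 hphi.
have [sphi [K [cK Kom K0]]] := ht.
have box p : phi p != 0 -> 0 < p.1 < 1.
  move=> hp; have /Kom/om : K p by apply: contrapT => /K0/eqP; rewrite (negbTE hp).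
  by move=> [/=]; rewrite !in_itv.
have Lphi := bdd_L2 hphi; have Ldphi := bdd_L2 (dphi false).
pose F p := p.1 * phi p * phi p.
have xphi p : `|p.1 * phi p| <= c.
  have [->|/box /andP[h1 h2]] := eqVneq (phi p) 0; first by rewrite mulr0 normr0.
  rewrite normrM -[c]mul1r; apply: ler_pM => //; rewrite gtr0_norm //; exact: ltW.
have mxphi : mfun2 (fun p => p.1 * phi p).
  by apply: measurable_funM => //; exact: measurable_fst.
have bxphi : bdd b c (fun p => p.1 * phi p).
  by split => // p hp; rewrite phiz // mulr0.
have bF : bdd b (c * c) F by exact: bddM.
have lphi n p : `|dquot (axis false) phi n p| <= c.
  rewrite dquotE normrM normfV (gtr0_norm (invS_gt0 n)) ler_pdivrMl ?invS_gt0 //.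
  have := test_lip ht dphic p (invS n).
  by rewrite (gtr0_norm (invS_gt0 n)) mulrC.
have cphi p : dquot (axis false) phi n p @[n --> \oo] --> partial false phi p.
  by apply: dquot_derive; have [_ /(_ false p) d] := sphi [::]; split.
have dx n p : dquot (axis false) (fun q => q.1 * phi q) n p =
    (p.1 + invS n) * dquot (axis false) phi n p + phi p.
  have hn : n.+1%:R * invS n = 1 :> R by rewrite mulfV // pnatr_eq0.
  rewrite /dquot /axis /= [invS n *: 1]mulr1.
  transitivity ((p.1 + invS n) * (n.+1%:R * (phi (p + invS n *: (1, 0)) - phi p)) +
    n.+1%:R * invS n * phi p); [ring|by rewrite hn mul1r].
have dxb n p : `|dquot (axis false) (fun q => q.1 * phi q) n p| <= 2 * c + c.
  have n0 := @invS_gt0 R n; have n1 := @invS_le1 R n.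
  rewrite dx; apply: le_trans (ler_normD _ _) _; apply: lerD => //.
  (* In the other case neither [p] nor the shifted point lies in the strip that carries [phi]. *)
  have [h|h] := boolP (0 <= p.1 + invS n <= 2).
    rewrite normrM; apply: ler_pM => //; move: h => /andP[h1 h2].
    by rewrite ger0_norm.
  have z1 : phi p = 0.
    by apply/eqP; apply: contraNT h => /box /andP[h1 h2]; apply/andP; split; lra.
  have z2 : phi (p + invS n *: axis false) = 0.
    apply/eqP; apply: contraNT h => /box /=; rewrite [invS n *: 1]mulr1 => /andP[h1 h2].
    by apply/andP; split; lra.
  by rewrite /dquot z1 z2 subrr !mulr0 normr0 mulr_ge0.
have cdx p : dquot (axis false) (fun q => q.1 * phi q) n p @[n --> \oo] -->
    (p.1 * partial false phi p + phi p).
  rewrite (_ : (fun n => _) = fun n => (p.1 + invS n) * dquot (axis false) phi n p + phi p).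
    apply: cvgD; last exact: cvg_cst.
    apply: cvgM => //; rewrite -[X in _ --> X]addr0.
    by apply: cvgD; [exact: cvg_cst|exact: invS_cvg0].
  by apply/funext => n; exact: dx.
have mw : mfun2 (fun p => p.1 * phi p * partial false phi p +
     phi p * (p.1 * partial false phi p + phi p)).
  apply: measurable_funD; apply: measurable_funM => //.
  apply: measurable_funD => //; apply: measurable_funM => //; exact: measurable_fst.
have key : \int[mu]_p (p.1 * phi p * partial false phi p +
     phi p * (p.1 * partial false phi p + phi p)) = 0.
  apply: (@Rint_derivative0 _ b (c * c) (c * c + c * (2 * c + c)) F _ (axis false) set0) => //.
  - exact: negligible_set0.
  - move=> n p; rewrite /F dquotM; apply: normr_leMDM => //; exact: xphi.
  move=> p _; rewrite /F.
  rewrite (_ : (fun n => _) = (fun n => (p + invS n *: axis false).1 *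
     phi (p + invS n *: axis false) * dquot (axis false) phi n p +
     phi p * dquot (axis false) (fun q => q.1 * phi q) n p)).
    apply: cvgD; apply: cvgM => //; last exact: cvg_cst.
    by apply: (@dquot_point (axis false) (fun q => q.1 * phi q) p (2 * c + c)) => n.
  by apply/funext => n; rewrite dquotM.
have Lx := bdd_L2 bxphi.
have i1 := L2M Lphi Lphi; have i2 := L2M Lx Ldphi.
have e p : p.1 * phi p * partial false phi p +
     phi p * (p.1 * partial false phi p + phi p) =
   phi p * phi p + 2 * (p.1 * phi p * partial false phi p) by ring.
rewrite (eq_Rint e) RintD ?RintZ // in key; last exact: itgZ.
have {}key : ip phi phi = - 2 * ip (fun p => p.1 * phi p) (partial false phi).
  by move: key; rewrite !ipE; lra.
have cs := cauchy_schwarz Lx Ldphi.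
have nx : n2 (fun p => p.1 * phi p) <= n2 phi.
  apply: n2_le => // p; have [->|/box /andP[h1 h2]] := eqVneq (phi p) 0.
    by rewrite mulr0.
  by rewrite normrM gtr0_norm // -[leRHS]mul1r ler_wpM2r // ltW.
have : n2 phi ^+ 2 <= 2 * (n2 phi * n2 (partial false phi)).
  rewrite n2_sqr key; apply: le_trans (ler_norm _) _; rewrite normrM normrN.
  rewrite (ger0_norm (ler0n _ 2)); apply: ler_wpM2l => //; apply: le_trans cs _.
  by rewrite ler_wpM2r // n2_ge0.
have := n2_ge0 phi; rewrite le_eqVlt => /predU1P[<- _|h].
  by rewrite mulr_ge0 ?n2_ge0.
by rewrite expr2 mulrCA ler_pM2l.
Qed.

Lemma H10_approx omega v : H10 omega v ->
  [/\ L2 v, forall i, is_weak_partial i v (weak_partial i v) &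
    exists phi : nat -> R * R -> R,
      [/\ forall k, test_function omega (phi k),
          n2 (fun p => phi k p - v p) @[k --> \oo] --> (0 : R) &
          forall i, n2 (fun p => partial i (phi k) p - weak_partial i v p) @[k --> \oo] --> (0 : R)]].
Proof.
move=> [hv ex [phi [tphi c1 c2]]].
have wp i : is_weak_partial i v (weak_partial i v).
  by have [w hw] := ex i; have [] := weak_partialP hw.
have L2phi k : L2 (phi k).
  by have [b [c [_ h _]]] := test_bdd (tphi k); exact: bdd_L2 h.
have L2dphi i k : L2 (partial i (phi k)).
  by have [b [c [_ _ h]]] := test_bdd (tphi k); exact: bdd_L2 (h i).
split => //; exists phi; split => // [|i].
  have e k : L2norm (phi k \- v) = (n2 (fun p => phi k p - v p))%:E.
    by rewrite L2normE //; exact: L2B.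
  by move: c1; under eq_fun do rewrite e; move/fine_cvg.
have e k : L2norm (partial i (phi k) \- weak_partial i v) =
    (n2 (fun p => partial i (phi k) p - weak_partial i v p))%:E.
  by rewrite L2normE //; apply: L2B => //; have [] := wp i.
by move: (c2 i); under eq_fun do rewrite e; move/fine_cvg.
Qed.

Lemma le_of_cvg0 (x y : R) (u : nat -> R) : u n @[n --> \oo] --> (0 : R) ->
  (forall n, x <= y + u n) -> x <= y.
Proof.
move=> cu h; apply/ler_addgt0Pr => e e0.
have /cvgr0Pnorm_lt /(_ _ e0) [n _ /(_ n (leqnn n)) hn] := cu.
by apply: le_trans (h n) _; rewrite lerD2l; apply: ltW; apply: le_lt_trans hn; exact: ler_norm.
Qed.

Lemma friedrichs omega v : omega `<=` unit_square -> H10 omega v ->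
  n2 v <= 2 * n2 (weak_partial false v).
Proof.
move=> om /H10_approx [hv wp [phi [tphi c1 c2]]].
have hw : L2 (weak_partial false v) by have [] := wp false.
apply: (@le_of_cvg0 _ _ (fun k => n2 (fun p => phi k p - v p) +
   2 * n2 (fun p => partial false (phi k) p - weak_partial false v p))).
  rewrite -[X in _ --> X]addr0 -[X in _ --> _ + X](mulr0 2).
  by apply: cvgD => //; apply: cvgM; [exact: cvg_cst|exact: c2].
move=> k; have [b [c [_ h dh]]] := test_bdd (tphi k).
have Lp := bdd_L2 h; have Ldp := bdd_L2 (dh false).
have h1 : n2 v <= n2 (phi k) + n2 (fun p => phi k p - v p).
  have := n2B Lp (L2B Lp hv); congr (n2 _ <= _); apply/funext => p; ring.
have h2 : n2 (partial false (phi k)) <= n2 (weak_partial false v) +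
     n2 (fun p => partial false (phi k) p - weak_partial false v p).
  have := n2D hw (L2B Ldp hw); congr (n2 _ <= _); apply/funext => p; ring.
have := friedrichs_test om (tphi k); lra.
Qed.

Lemma test_partial_outside i omega phi p : test_function omega phi -> ~ omega p ->
  phi p = 0 /\ partial i phi p = 0.
Proof.
move=> [_ [K [cK Kom K0]]] op.
have nK : ~ K p by move=> /Kom.
split; first exact: K0.
rewrite /partial; have -> : 'D_(axis i) phi p = 'D_(axis i) (fun=> 0) p.
  apply: near_eq_derive.
  have : closed K by apply: compact_closed => //; exact: norm_hausdorff.
  move=> /closed_openC oC.
  have : nbhs p (~` K) by apply: open_nbhs_nbhs.
  by apply: filterS => q; exact: K0.
exact: derive_cst.
Qed.

(** The gradients of the approximating test functions vanish off [omega], and so does their limit in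
    the mean. *)
Lemma H10_outside i omega v : open omega -> H10 omega v ->
  mu.-negligible [set p : P | ~ omega p /\ weak_partial i v p != 0].
Proof.
move=> oom /H10_approx [hv wp [phi [tphi c1 c2]]].
have hw : L2 (weak_partial i v) by have [] := wp i.
have mo := open_measurable2 oom.
pose g p := weak_partial i v p * \1_(~` omega) p.
have mg : mfun2 g.
  apply: measurable_funM; first exact: L2_mfun.
  by apply: measurable_indic; exact: measurableC.
have gw p : `|g p| <= `|weak_partial i v p|.
  by rewrite /g indicE; case: (_ \in _); rewrite ?mulr1 // mulr0 normr0.
have Lg := L2_le mg hw gw.
have g0 : n2 g = 0.
  apply/eqP; rewrite eq_le n2_ge0 andbT.
  apply: (@le_of_cvg0 _ _ _ (c2 i)) => k; rewrite add0r.
  have [b [c [_ h dh]]] := test_bdd (tphi k).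
  apply: n2_le => //; first exact: L2B (bdd_L2 (dh i)) hw.
  move=> p; rewrite /g indicE; have [po|po] := pselect (omega p).
    by rewrite memNset ?mulr0 ?normr0 // => /(_ po).
  have [_ ->] := test_partial_outside i (tphi k) po.
  by rewrite mem_set // mulr1 sub0r normrN.
apply: (negligibleS _ (n2_ae0 Lg g0)) => p /= [po].
by rewrite /g indicE mem_set // mulr1.
Qed.

Lemma wpE i v : wp i v = weak_partial i v.
Proof. by rewrite wp.unlock. Qed.

Lemma wpP i v w : is_weak_partial i v w ->
  is_weak_partial i v (wp i v) /\ mu.-negligible [set p : P | wp i v p != w p].
Proof. by rewrite wpE; exact: weak_partialP. Qed.

Lemma gipE v w : gip v w = ip (wp false v) (wp false w) + ip (wp true v) (wp true w).
Proof. by rewrite gip.unlock. Qed.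

Definition wdiff v := L2 v /\ forall i, is_weak_partial i v (wp i v).

Lemma H10_wdiff omega v : H10 omega v -> wdiff v.
Proof. by move=> /H10_approx [hv h _]; split => // i; rewrite wpE. Qed.

Lemma wdiff_L2 i v : wdiff v -> L2 (wp i v).
Proof. by move=> [_ /(_ i) []]. Qed.

Lemma Rint_setE (D : set P) v :
  \int[mu]_(p in D) v p = \int[mu]_p (v p * \1_D p).
Proof.
by rewrite Rintegral_mkcond patch_indic.
Qed.

Lemma grad_dotE (D : set P) v w : measurable D -> wdiff v -> wdiff w ->
  (forall i, mu.-negligible [set p : P | ~ D p /\ wp i w p != 0]) ->
  grad_dot D v w = gip v w.
Proof.
move=> mD hv hw out.
have iL i := L2M (wdiff_L2 i hv) (wdiff_L2 i hw).
pose F p := wp false v p * wp false w p +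
     wp true v p * wp true w p.
have mF : mfun2 F by apply: itg_measurable; exact: itgD.
have e p : \sum_(i : bool) wp i v p * wp i w p = F p.
  by rewrite big_bool /F addrC.
rewrite /grad_dot (_ : (fun p => _) = F); last first.
  by apply/funext => p; rewrite -e; apply: eq_bigr => i _; rewrite !wpE.
rewrite Rint_setE gipE !ipE -RintD //.
apply: (Rint_ae (negligibleU (out false) (out true))) => //.
  by apply: measurable_funM => //; exact: measurable_indic.
move=> p hp; rewrite indicE; have [Dp|Dp] := pselect (D p).
  by rewrite mem_set // mulr1.
have z i : wp i w p = 0.
  apply/eqP; apply: contrapT => /negP h; apply: hp.
  by case: i h => h; [right|left].
rewrite (memNset Dp); move: (wp false v p) (wp true v p) (z false) (z true).
by move=> A B -> ->; rewrite !mulr0 addr0.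
Qed.

Lemma weak_partial_lin i (a : R) v w v' w' : L2 v -> L2 w ->
  is_weak_partial i v v' -> is_weak_partial i w w' ->
  is_weak_partial i (fun p => a * v p + w p) (fun p => a * v' p + w' p).
Proof.
move=> hv hw [hv' h] [hw' h']; split; first by apply: L2D => //; exact: L2Z.
move=> phi ht; have [b [c [b0 hphi dphi]]] := test_bdd ht.
have Lp := bdd_L2 hphi; have Ldp := bdd_L2 (dphi i).
have e p : (a * v p + w p) * partial i phi p =
  a * (v p * partial i phi p) + w p * partial i phi p by ring.
have e' p : (a * v' p + w' p) * phi p = a * (v' p * phi p) + w' p * phi p by ring.
rewrite (eq_Rint e) (eq_Rint e') !RintD ?RintZ //; try exact: L2M; try by apply: itgZ; exact: L2M.
by rewrite h // h' //; ring.
Qed.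

Lemma wdiff_lin (a : R) v w : wdiff v -> wdiff w ->
  wdiff (fun p => a * v p + w p) /\
  forall i, mu.-negligible [set p : P |
     wp i (fun p => a * v p + w p) p !=
     a * wp i v p + wp i w p].
Proof.
move=> [hv wv] [hw ww].
have h i := wpP (weak_partial_lin a hv hw (wv i) (ww i)).
split; last by move=> i; have [] := h i.
split; first by apply: L2D => //; exact: L2Z.
by move=> i; have [] := h i.
Qed.

Lemma gip_linl (a : R) v w z : wdiff v -> wdiff w -> wdiff z ->
  gip (fun p => a * v p + w p) z = a * gip v z + gip w z.
Proof.
move=> hv hw hz; have [hs ae] := wdiff_lin a hv hw.
have k (i : bool) : ip (wp i (fun p => a * v p + w p)) (wp i z) =
    a * ip (wp i v) (wp i z) + ip (wp i w) (wp i z).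
  have L1 := wdiff_L2 i hv; have L2' := wdiff_L2 i hw; have L3 := wdiff_L2 i hz.
  rewrite -ipZl // -ipDl //; last exact: L2Z.
  rewrite !ipE; apply: (Rint_ae (ae i)).
  - by apply: itg_measurable; apply: L2M => //; exact: wdiff_L2.
  - by apply: itg_measurable; apply: L2M => //; apply: L2D => //; exact: L2Z.
  by move=> p /= /negP; rewrite negbK => /eqP ->.
by rewrite !gipE (k false) (k true) mulrDr addrACA.
Qed.

Lemma gipC v w : gip v w = gip w v.
Proof. by rewrite !gipE ipC [ip (wp true v) _]ipC. Qed.

Lemma gip_ge0 v : 0 <= gip v v.
Proof. by rewrite gipE addr_ge0 // ip_ge0. Qed.

Lemma gip_cs v w : wdiff v -> wdiff w ->
  `|gip v w| <= Num.sqrt (gip v v) * Num.sqrt (gip w w).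
Proof.
move=> hv hw.
have h1 := cauchy_schwarz (wdiff_L2 false hv) (wdiff_L2 false hw).
have h2 := cauchy_schwarz (wdiff_L2 true hv) (wdiff_L2 true hw).
rewrite gipE; apply: le_trans (ler_normD _ _) _; apply: le_trans (lerD h1 h2) _.
rewrite -sqrtrM ?gip_ge0 //.
set a := n2 _; set b := n2 _; set c := n2 _; set d := n2 _.
have -> : gip v v = a ^+ 2 + c ^+ 2 by rewrite /a /c !n2_sqr gipE.
have -> : gip w w = b ^+ 2 + d ^+ 2 by rewrite /b /d !n2_sqr gipE.
have a0 : 0 <= a by exact: n2_ge0.
have b0 : 0 <= b by exact: n2_ge0.
have c0 : 0 <= c by exact: n2_ge0.
have d0 : 0 <= d by exact: n2_ge0.
rewrite -[leLHS]ger0_norm ?addr_ge0 ?mulr_ge0 // -sqrtr_sqr ler_wsqrtr //.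
have := sqr_ge0 (a * d - c * b); nra.
Qed.

End SobolevCalculus.

(** * Lipschitz functions *)

Section LipschitzFunctions.
Context {R : realType}.
Local Notation P := (measurableTypeR R * measurableTypeR R)%type.
Local Notation mu := (@plane_measure R).
Implicit Types (v w phi : R * R -> R) (p q : R * R) (omega : set (R * R)).

Definition lip (L : R) v :=
  forall p q, `|v p - v q| <= L * (`|p.1 - q.1| + `|p.2 - q.2|).

(** Strict differentiability: both points vary near [p]. This controls the difference quotients at
    all points near [p] and hence the gradients of mollifications at [p]. *)
Definition sdiff v p (G : bool -> R) := forall e : R, 0 < e -> exists2 d : R, 0 < d &
  forall x y : R * R, `|x.1 - p.1| < d -> `|x.2 - p.2| < d ->
    `|y.1 - p.1| < d -> `|y.2 - p.2| < d ->
    `|v x - v y - (G false * (x.1 - y.1) + G true * (x.2 - y.2))| <=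
      e * (`|x.1 - y.1| + `|x.2 - y.2|).

(** A Lipschitz function with bounded support together with its strict gradient [G] off an explicit
    null set [N]. The gradient is carried as data and need not be measurable. *)
Definition lipreg (b L : R) v (N : set P) (G : R * R -> bool -> R) :=
  [/\ 0 <= b, lip L v, forall p, ~ in_box b p -> v p = 0, mu.-negligible N &
      forall p, ~ N p -> sdiff v p (G p)].

Lemma lip_ge0 L v : lip L v -> 0 <= L.
Proof.
move=> /(_ (1, 0) 0); rewrite /= subr0 normr1 subrr normr0 addr0 mulr1.
exact: le_trans.
Qed.

Lemma lip_bdd b L v : 0 <= b -> lip L v -> (forall p, ~ in_box b p -> v p = 0) ->
  bdd b (L * (3 * b + 1)) v.
Proof.
move=> b0 hv v0; have L0 := lip_ge0 hv; split => //.
  by apply: continuous_measurable2; exact: lip_continuous hv.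
move=> p; have [[p1 p2]|hp] := pselect (in_box b p); last first.
  by rewrite v0 // normr0 mulr_ge0 //; lra.
(* A point outside the support whose distance to any point of the box is at most [3 * b + 1]. *)
have z : v (b + 1, 0) = 0.
  by apply: v0 => -[/= h _]; have := ler_norm (b + 1); lra.
have := hv p (b + 1, 0); rewrite z subr0 /= subr0 => h.
apply: le_trans h _; rewrite ler_wpM2l //.
have := ler_normB p.1 (b + 1); rewrite [`|b + 1|]ger0_norm; lra.
Qed.

Lemma shift_sub (p a : R * R) (s : R) :
  ((p + s *: a).1 - p.1 = s * a.1) * ((p + s *: a).2 - p.2 = s * a.2).
Proof. by split => /=; rewrite addrAC subrr add0r. Qed.

Lemma lip_dquot (a : R * R) L v n p : lip L v ->
  `|dquot a v n p| <= L * (`|a.1| + `|a.2|).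
Proof.
move=> hv; rewrite dquotE normrM normfV (gtr0_norm (invS_gt0 n)) ler_pdivrMl ?invS_gt0 //.
apply: le_trans (hv _ _) _.
rewrite (shift_sub p a (invS n)).1 (shift_sub p a (invS n)).2 !normrM.
by rewrite (gtr0_norm (invS_gt0 n)) -mulrDr mulrCA.
Qed.

Lemma axis_norm (i : bool) : `|(axis i).1| + `|(axis i).2| = 1 :> R.
Proof. by case: i; rewrite /= normr0 normr1 ?addr0 ?add0r. Qed.

Lemma sdiff_dquot_near (a : R * R) v p (G : bool -> R) (e : R) : sdiff v p G -> 0 < e ->
  exists2 d, 0 < d & forall n q, invS n < d -> `|q.1 - p.1| < d -> `|q.2 - p.2| < d ->
    `|dquot a v n q - (G false * a.1 + G true * a.2)| <= e.
Proof.
move=> h e0; set A := `|a.1| + `|a.2|.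
have A0 : 0 <= A by rewrite addr_ge0.
have e1 : 0 < e / (A + 1) by rewrite divr_gt0 //; lra.
have [d d0 hd] := h _ e1.
exists (d / (2 * (A + 1))); first by rewrite divr_gt0 //; lra.
have dd : d / (2 * (A + 1)) <= d / 2.
  rewrite ler_wpM2l ?(ltW d0) // lef_pV2 ?posrE //; lra.
move=> n q hn q1 q2; have n0 := @invS_gt0 R n.
have s1 : invS n * `|a.1| < d / 2.
  have := hn; rewrite ltr_pdivlMr => [|]; last lra.
  rewrite /A => k; rewrite ltr_pdivlMr //; have := normr_ge0 a.1; have := normr_ge0 a.2; nra.
have s2 : invS n * `|a.2| < d / 2.
  have := hn; rewrite ltr_pdivlMr => [|]; last lra.
  rewrite /A => k; rewrite ltr_pdivlMr //; have := normr_ge0 a.1; have := normr_ge0 a.2; nra.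
have := hd (q + invS n *: a) q.
rewrite (shift_sub q a (invS n)).1 (shift_sub q a (invS n)).2.
rewrite !normrM (gtr0_norm n0).
have -> : dquot a v n q - (G false * a.1 + G true * a.2) = (invS n)^-1 *
  (v (q + invS n *: a) - v q - (G false * (invS n * a.1) + G true * (invS n * a.2))).
  rewrite dquotE; move: n0; set s := invS n => s0; field; exact: lt0r_neq0.
move=> hh; rewrite normrM normfV (gtr0_norm n0) ler_pdivrMl //.
apply: le_trans (hh _ _ _ _) _.
- rewrite -(subrK q.1 (q + _).1) (shift_sub q a (invS n)).1 -addrA.
  apply: le_lt_trans (ler_normD _ _) _; rewrite normrM (gtr0_norm n0).
  by rewrite (splitr d) ltrD // (lt_le_trans q1).
- rewrite -(subrK q.2 (q + _).2) (shift_sub q a (invS n)).2 -addrA.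
  apply: le_lt_trans (ler_normD _ _) _; rewrite normrM (gtr0_norm n0).
  by rewrite (splitr d) ltrD // (lt_le_trans q2).
- by apply: lt_le_trans q1 _; lra.
- by apply: lt_le_trans q2 _; lra.
rewrite -mulrDr mulrCA ler_wpM2l ?(ltW n0) // -/A mulrAC ler_pdivrMr; last lra.
by rewrite ler_wpM2l ?(ltW e0) //; lra.
Qed.

Lemma sdiff_dquot (a : R * R) v p (G : bool -> R) : sdiff v p G ->
  dquot a v n p @[n --> \oo] --> G false * a.1 + G true * a.2.
Proof.
move=> h; apply/cvgrPdist_le => e e0.
have [d d0 hd] := sdiff_dquot_near a h e0.
near=> n; rewrite distrC; apply: hd; rewrite ?subrr ?normr0 //.
near: n; exact: invS_near.
Unshelve. all: end_near. Qed.

Lemma axis_dot (i : bool) (G : bool -> R) : G false * (axis i).1 + G true * (axis i).2 = G i :> R.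
Proof. by case: i; rewrite /= mulr0 mulr1 ?addr0 ?add0r. Qed.

Lemma cvg_dist_le (u : nat -> R) (x l e : R) : u n @[n --> \oo] --> x ->
  (\forall n \near \oo, `|u n - l| <= e) -> `|x - l| <= e.
Proof.
move=> cu hu; apply/ler_addgt0Pr => e' e'0.
have h : \forall n \near \oo, `|x - u n| <= e' by move/cvgrPdist_le: cu => /(_ _ e'0).
have [n [h1 h2]] := filter_ex (filterI hu h).
have -> : x - l = (u n - l) + (x - u n) by ring.
by apply: le_trans (ler_normD _ _) _; exact: lerD.
Qed.

Lemma lipreg_weak b L v N (G : R * R -> bool -> R) i : lipreg b L v N G ->
  exists w, [/\ bdd (b + 1) L w, is_weak_partial i v w &
    mu.-negligible [set p : P | w p != G p i]].
Proof.
move=> [b0 hv v0 [M [mM M0 NM]] hG].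
have L0 := lip_ge0 hv.
have hb := lip_bdd b0 hv v0.
have cG p : ~ M p -> dquot (axis i) v n p @[n --> \oo] --> G p i.
  by move=> hp; rewrite -axis_dot; apply: sdiff_dquot; apply: hG => /NM.
(* [G] comes without measurability or bounds. So [w] is zero on a measurable null set that contains
   [N], and off the box of radius [b + 1], where all quotients vanish as the steps are at most 1. *)
pose w p : R := if `[< M p >] then 0 else if `[< in_box (b + 1) p >] then G p i else 0.
have wE p : ~ M p -> w p = if `[< in_box (b + 1) p >] then G p i else 0.
  by move=> hp; rewrite /w asboolF.
have dq n p : `|dquot (axis i) v n p| <= L.
  by have := lip_dquot (axis i) n p hv; rewrite axis_norm mulr1.
have dq0 n p : ~ in_box (b + 1) p -> dquot (axis i) v n p = 0.
  have n0 := @invS_gt0 R n; have n1 := @invS_le1 R n.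
  move=> hp; have z1 : v p = 0.
    by apply: v0 => -[h1 h2]; apply: hp; split; lra.
  have z2 : v (p + invS n *: axis i) = 0.
    have s1 : `|(invS n *: axis i).1| <= 1 :> R.
      by case: (i); rewrite /= /GRing.scale /= ?mulr0 ?mulr1 ?normr0 ?(gtr0_norm n0).
    have s2 : `|(invS n *: axis i).2| <= 1 :> R.
      by case: (i); rewrite /= /GRing.scale /= ?mulr0 ?mulr1 ?normr0 ?(gtr0_norm n0).
    apply: v0 => -[h1 h2]; apply: hp; split.
      by rewrite -(addrK (invS n *: axis i).1 p.1); apply: le_trans (ler_normB _ _) _; exact: lerD.
    by rewrite -(addrK (invS n *: axis i).2 p.2); apply: le_trans (ler_normB _ _) _; exact: lerD.
  by rewrite /dquot z1 z2 subrr mulr0.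
have cw p : ~ M p -> dquot (axis i) v n p @[n --> \oo] --> w p.
  move=> hp; rewrite wE //; case: asboolP => [_|hb']; first exact: cG.
  rewrite (_ : (fun n => _) = cst 0); first exact: cvg_cst.
  by apply/funext => n; rewrite dq0.
have bw : bdd (b + 1) L w.
  split.
  - apply: (@measurable_fun_cvg _ _ _ _ (fun n p => dquot (axis i) v n p * \1_(~` M) p)).
      move=> n; apply: measurable_funM; last by apply: measurable_indic; exact: measurableC.
      apply: measurable_funM => //; have [mv _ _] := hb.
      by apply: measurable_funB => //; exact: (measurableT_comp mv (@measurable_shift _ _)).
    move=> p _; have [hp|hp] := pselect (M p).
      rewrite /w asboolT //; rewrite (_ : (fun n => _) = cst 0); first exact: cvg_cst.
      by apply/funext => n; rewrite indicE memNset ?mulr0 // => /(_ hp).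
    rewrite (_ : (fun n => _) = (fun n => dquot (axis i) v n p)); first exact: cw.
    by apply/funext => n; rewrite indicE mem_set ?mulr1.
  - move=> p; have [hp|hp] := pselect (M p); first by rewrite /w asboolT // normr0.
    rewrite -[w p]subr0; apply: cvg_dist_le (cw _ hp) _.
    by near=> n; rewrite subr0.
  - move=> p hp; rewrite /w; case: asboolP => // _; by rewrite asboolF.
have NM0 : mu.-negligible M by exists M; split.
exists w; split => //.
- split; first exact: bdd_L2 bw.
  move=> phi ht.
  apply: (@integration_by_parts _ i (b + 1) _ L v w phi setT M _ _ bw NM0) => //; first lra.
  by apply: bdd_le hb => //; lra.
apply: (negligibleS _ NM0) => p /= hw; apply: contrapT => hp.
move/negP: hw; apply; rewrite wE //; case: asboolP => // hb'.
rewrite eq_sym; apply/eqP; apply: (cvg_unique _ (cG p hp)) => //.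
rewrite (_ : (fun n => _) = cst 0); first exact: cvg_cst.
by apply/funext => n; rewrite dq0.
Unshelve. all: end_near. Qed.

Lemma lipreg_wdiff b L v N (G : R * R -> bool -> R) : lipreg b L v N G -> wdiff v.
Proof.
move=> h; have [b0 hv v0 _ _] := h; split; first exact: bdd_L2 (lip_bdd b0 hv v0).
by move=> i; have [w [_ hw _]] := lipreg_weak i h; have [] := wpP hw.
Qed.

Lemma lipreg_wp b L v N (G : R * R -> bool -> R) i : lipreg b L v N G ->
  mu.-negligible [set p : P | wp i v p != G p i].
Proof.
move=> h; have [w [_ hw n1]] := lipreg_weak i h; have [_ n2] := wpP hw.
apply: negligibleS (negligibleU n1 n2) => p /= hp.
have [e|e] := eqVneq (w p) (G p i); [right|left] => //=.
by rewrite e.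
Qed.

(** Mollification commutes with translations, so its difference quotients are averages of those of
    [v]. *)
Lemma mollify_dquot n m b c (a : R * R) v p (l e : R) : bdd b c v ->
  (forall q, `|q.1 - p.1| <= invS n -> `|q.2 - p.2| <= invS n ->
     `|dquot a v m q - l| <= e) ->
  `|dquot a (mollify n v) m p - l| <= e.
Proof.
move=> hv h; rewrite {1}/dquot /mollify.
have [i1 ->] := convol_shift (p + invS m *: a) hv (bumpZ_test n) (@bump_test R n).
have [i2 ->] := convol_shift p hv (bumpZ_test n) (@bump_test R n).
rewrite -RintB // -RintZ; last exact: itgB.
have E q : m.+1%:R * (v (q + (p + invS m *: a)) * (bumpZ n q.1 * bump n q.2) -
    v (q + p) * (bumpZ n q.1 * bump n q.2)) =
    dquot a v m (q + p) * (bumpZ n q.1 * bump n q.2).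
  by rewrite /dquot addrA; ring.
rewrite (eq_Rint E); apply: average_dist.
  have := itgZ m.+1%:R (itgB i1 i2); congr itg; apply/funext => q; exact: E.
by move=> q [q1 q2]; apply: h; rewrite /= addrK.
Qed.

Lemma mollify_partial i n b c v p (l e : R) : 0 <= b -> bdd b c v ->
  (\forall m \near \oo, forall q, `|q.1 - p.1| <= invS n -> `|q.2 - p.2| <= invS n ->
     `|dquot (axis i) v m q - l| <= e) ->
  `|partial i (mollify n v) p - l| <= e.
Proof.
move=> b0 hv h.
have cv : dquot (axis i) (mollify n v) m p @[m --> \oo] --> partial i (mollify n v) p.
  apply: dquot_derive; have [_ /(_ i p) d] := mollify_smooth n b0 hv [::].
  by split.
apply: cvg_dist_le cv _; apply: filterS h => m; exact: mollify_dquot hv.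
Qed.

(** Mollification at scales below [d / 2] keeps the support in [omega]. Strict differentiability
    makes the gradients converge almost everywhere, and the Lipschitz constant dominates them. *)
Lemma lipreg_H10 b L v N (G : R * R -> bool -> R) omega (d : R) : lipreg b L v N G -> 0 < d ->
  (forall p q, v p != 0 -> `|q.1 - p.1| <= d -> `|q.2 - p.2| <= d -> omega q) ->
  H10 omega v.
Proof.
move=> h d0 margin; have [b0 hv v0 N0 hG] := h; have hb := lip_bdd b0 hv v0.
have L0 := lip_ge0 hv.
have [n0 _ hn0] := @invS_near R (d / 2) (divr_gt0 d0 (ltr0n _ 2)).
have {}hn0 n : invS (n + n0) < d / 2 :> R by apply: hn0 => /=; rewrite leq_addl.
have tphi n : test_function omega (mollify (n + n0) v).
  split; first exact: mollify_smooth hb.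
  pose S : set (R * R) := [set q | exists2 p, v p != 0 & `|q.1 - p.1| <= d / 2 /\ `|q.2 - p.2| <= d / 2].
  have SB : closure S `<=` in_box (b + d).
    have cl : closed (in_box (b + d)).
      by apply: compact_closed; [exact: norm_hausdorff|exact: (@in_box_compact R)].
    rewrite [X in _ `<=` X]((closure_id (in_box (b + d))).1 cl).
    apply: closure_subset => q [p vp [q1 q2]].
    have [p1 p2] : in_box b p by apply: contrapT => /v0/eqP; rewrite (negbTE vp).
    split; [rewrite -(subrK p.1 q.1)|rewrite -(subrK p.2 q.2)];
      apply: le_trans (ler_normD _ _) _; lra.
  exists (closure S); split.
  - apply: (subclosed_compact _ (@in_box_compact R (b + d))) => //.
    exact: closed_closure.
  - move=> q cq; have d2 : 0 < d / 2 by rewrite divr_gt0.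
    have : nbhs q [set q' | `|q'.1 - q.1| < d / 2 /\ `|q'.2 - q.2| < d / 2].
      by apply: (box_nbhs d2).
    move=> /cq [q' [[p vp [h1 h2]] [h3 h4]]]; apply: (margin p) => //.
      have -> : q.1 - p.1 = (q'.1 - p.1) - (q'.1 - q.1) by ring.
      by rewrite (splitr d); apply: le_trans (ler_normB _ _) _; apply: lerD => //; exact: ltW.
    have -> : q.2 - p.2 = (q'.2 - p.2) - (q'.2 - q.2) by ring.
    by rewrite (splitr d); apply: le_trans (ler_normB _ _) _; apply: lerD => //; exact: ltW.
  move=> p hp; apply/eqP; rewrite -normr_le0 -[mollify _ _ _]subr0.
  apply: (mollify_dist hb) => q q1 q2; rewrite subr0 normr_le0; apply: contraPT hp => vq hp.
  apply: hp; apply: subset_closure; exists q => //.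
  by rewrite distrC [`|p.2 - _|]distrC; split; apply: le_trans (ltW (hn0 n)).
have L2v := bdd_L2 hb.
have L2phi n : L2 (mollify (n + n0) v).
  by have [b' [c' [_ k _]]] := test_bdd (tphi n); exact: bdd_L2 k.
have L2dphi i n : L2 (partial i (mollify (n + n0) v)).
  by have [b' [c' [_ _ k]]] := test_bdd (tphi n); exact: bdd_L2 (k i).
have wdv := lipreg_wdiff h.
split => //.
  by move=> i; have [w [_ hw _]] := lipreg_weak i h; exists w.
have b10 : 0 <= b + 1 by lra.
have cvz (g : nat -> R * R -> R) (c : R) (M : set P) : mu.-negligible M ->
    (forall n, bdd (b + 1) c (g n)) ->
    (forall p, ~ M p -> g n p @[n --> \oo] --> (0 : R)) ->
    n2 (g n) @[n --> \oo] --> (0 : R).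
  move=> M0 bg cg.
  have [||||||_ ci] := @dct R (fun n p => g n p * g n p) (fun=> 0)
     (fun p => c * c * \1_(in_box (b + 1)) p) M.
  - by move=> n; have [mg _ _] := bg n; exact: measurable_funM.
  - exact: measurable_cst.
  - exact: M0.
  - by move=> p hp; rewrite -[X in _ --> X](mulr0 0); apply: cvgM; exact: cg.
  - by apply: itgZ; exact: itg_box.
  - move=> n p; have [_ gc gz] := bg n; have [hp|hp] := pselect (in_box (b + 1) p).
      by rewrite indicE mem_set // mulr1 normrM ler_pM.
    by rewrite gz // mul0r normr0 indicE memNset // mulr0.
  rewrite (_ : (fun n => n2 (g n)) = (fun n => Num.sqrt (\int[mu]_p (g n p * g n p)))); last first.
    by apply/funext => n; rewrite n2E ipE.
  rewrite -[X in _ --> X](@sqrtr0 R); apply: continuous_cvg; first exact: sqrt_continuous.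
  by rewrite Rint0 in ci.
have ebdd (f g : R * R -> R) (c c' : R) : bdd (b + 1) c f -> bdd (b + 1) c' g ->
    bdd (b + 1) (c + c') (fun p => f p - g p).
  move=> [mf fc fz] [mg gc gz]; split.
  - exact: measurable_funB.
  - by move=> p; apply: le_trans (ler_normB _ _) _; exact: lerD.
  - by move=> p hp; rewrite fz // gz // subrr.
have tin n : test_function (in_box (b + 1)) (mollify (n + n0) v).
  split; first exact: mollify_smooth hb.
  exists (in_box (b + 1)); split => //; first exact: (@in_box_compact R).
  by move=> p; apply: mollify_outside hb.
exists (fun n => mollify (n + n0) v); split => //.
  rewrite (_ : (fun k => _) = (fun k => (n2 (fun p => mollify (k + n0) v p - v p))%:E)); last first.
    by apply/funext => k; rewrite L2normE //; exact: L2B.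
  apply: cvg_EFin; first by near=> n.
  apply: (cvz _ (L * (3 * b + 1) + L * (3 * b + 1)) set0).
  - exact: negligible_set0.
  - move=> n; apply: ebdd; last by apply: bdd_le hb => //; lra.
    split; first exact: L2_mfun.
      by move=> p; exact: mollify_le hb.
    by move=> p; apply: mollify_outside hb.
  move=> p _; apply/cvgrPdist_le => e e0.
  have L1 : 0 < 2 * L + 1 by lra.
  near=> n; rewrite sub0r normrN.
  have hn : invS (n + n0) < e / (2 * L + 1).
    apply: (@le_lt_trans _ _ (invS n)); last by near: n; apply: invS_near; rewrite divr_gt0.
    by rewrite lef_pV2 ?posrE ?ltr0n // ler_nat ltnS leq_addr.
  apply: (mollify_dist hb) => q q1 q2; apply: le_trans (hv _ _) _.
  move: hn; rewrite ltr_pdivlMr // => hn; rewrite -/(invS _) in q1 q2.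
  have := @invS_gt0 R (n + n0); nra.
move=> i; have [w [bw hw nw]] := lipreg_weak i h.
have [_ nw'] := weak_partialP hw.
have Lw := bdd_L2 bw.
have Lwp : L2 (weak_partial i v) by have [[]] := weak_partialP hw.
rewrite (_ : (fun k => _) = (fun k => (n2 (fun p => partial i (mollify (k + n0) v) p - w p))%:E)); last first.
  apply/funext => k; rewrite L2normE; last exact: L2B.
  congr (_%:E); rewrite !n2E !ipE; congr Num.sqrt; apply: (Rint_ae nw').
  - by apply: measurable_funM; apply: L2_mfun; exact: L2B.
  - by apply: measurable_funM; apply: L2_mfun; exact: L2B.
  by move=> p /= /negP; rewrite negbK => /eqP ->.
apply: cvg_EFin; first by near=> n.
apply: (cvz _ (L + L) (N `|` [set p : P | w p != G p i])).
- exact: negligibleU.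
- move=> n; apply: ebdd => //; split; first exact: L2_mfun.
    move=> p; rewrite -[partial _ _ _]subr0; apply: mollify_partial hb _ => //.
    near=> m => q _ _; rewrite subr0.
    by have := lip_dquot (axis i) m q hv; rewrite axis_norm mulr1.
  by move=> p hp; have [] := test_partial_outside i (tin n) hp.
move=> p hp; have hN : ~ N p by move=> k; apply: hp; left.
have hw' : w p = G p i by apply/eqP; apply: contrapT => /negP k; apply: hp; right.
apply/cvgrPdist_le => e e0; rewrite hw'.
have [r r0 hr] := sdiff_dquot_near (axis i) (hG p hN) e0.
near=> n; rewrite sub0r normrN.
have hn : invS (n + n0) < r.
  apply: (@le_lt_trans _ _ (invS n)); last by near: n; exact: invS_near.
  by rewrite lef_pV2 ?posrE ?ltr0n // ler_nat ltnS leq_addr.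
apply: mollify_partial hb _ => //; near=> m => q q1 q2.
rewrite -[G p i]axis_dot; apply: hr.
- near: m; exact: invS_near.
- exact: le_lt_trans q1 hn.
- exact: le_lt_trans q2 hn.
Unshelve. all: end_near. Qed.

End LipschitzFunctions.

(** * Bisection trees in barycentric coordinates *)

Section Triangles.
Context {R : realType}.
Implicit Types (K T : triangle R) (p q : R * R) (x : R * R) (w : seq bool).

Definition tdet K : R :=
  (edge1 K - newest K).1 * (edge2 K - newest K).2 -
  (edge1 K - newest K).2 * (edge2 K - newest K).1.

(* In barycentric coordinates, [tr K] is the weight of the newest vertex and [td K]
   the difference of the weights of the endpoints of the refinement edge; [gr] and
   [gd] are their gradients. *)
Definition gr K : R * R :=
  (((edge1 K).2 - (edge2 K).2) / tdet K, ((edge2 K).1 - (edge1 K).1) / tdet K).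

Definition gd K : R * R :=
  (((edge1 K).2 + (edge2 K).2 - 2 * (newest K).2) / tdet K,
   (2 * (newest K).1 - (edge1 K).1 - (edge2 K).1) / tdet K).

Definition tr K p : R :=
  1 + (gr K).1 * (p.1 - (newest K).1) + (gr K).2 * (p.2 - (newest K).2).

Definition td K p : R :=
  (gd K).1 * (p.1 - (newest K).1) + (gd K).2 * (p.2 - (newest K).2).

Definition trd K p : R * R := (tr K p, td K p).

(** The image of every triangle under [trd]: the right isosceles triangle with apex (1, 0), the
    newest vertex, and with (0, 1) and (0, -1) as ends of the refinement edge. *)
Definition in_ref x : Prop := 0 <= x.1 /\ `|x.2| <= 1 - x.1.
Definition strict_ref x : Prop := 0 < x.1 /\ `|x.2| < 1 - x.1.

Lemma tdetE K : tdet K = ((edge1 K).1 - (newest K).1) * ((edge2 K).2 - (newest K).2) -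
  ((edge1 K).2 - (newest K).2) * ((edge2 K).1 - (newest K).1).
Proof. by []. Qed.

Lemma nondegenerateE K : Defs.nondegenerate K <-> tdet K != 0.
Proof. by []. Qed.

Lemma tri_point K p : tdet K != 0 ->
  p = tr K p *: newest K + ((1 - tr K p + td K p) / 2) *: edge1 K +
      ((1 - tr K p - td K p) / 2) *: edge2 K.
Proof.
case: K => [[[z1 z2] [a1 a2]] [b1 b2]]; case: p => p1 p2.
rewrite /tr /td /gr /gd tdetE /newest /edge1 /edge2 /= => D0.
by congr pair; rewrite /= /GRing.scale /=; field.
Qed.

Lemma trd_comb K (r s t : R) : tdet K != 0 -> r + s + t = 1 ->
  trd K (r *: newest K + s *: edge1 K + t *: edge2 K) = (r, s - t).
Proof.
case: K => [[[z1 z2] [a1 a2]] [b1 b2]].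
rewrite /trd /tr /td /gr /gd tdetE /newest /edge1 /edge2 /= => D0 rst.
have -> : r = 1 - s - t by lra.
by congr pair; rewrite /= /GRing.scale /=; field.
Qed.

Lemma hullP K p : tdet K != 0 -> hull K p <-> in_ref (trd K p).
Proof.
move=> D0; split.
  move=> [r [s [t [[r0 s0 t0 rst] ->]]]]; rewrite trd_comb //.
  by split => //=; rewrite ler_norml; apply/andP; split; lra.
move=> [/= r0]; rewrite ler_norml => /andP[h1 h2].
exists (tr K p), ((1 - tr K p + td K p) / 2), ((1 - tr K p - td K p) / 2).
split; last exact: tri_point.
by split; lra.
Qed.

Lemma trd_inj K p q : tdet K != 0 -> trd K p = trd K q -> p = q.
Proof.
by move=> D0 [h1 h2]; rewrite (tri_point p D0) (tri_point q D0) h1 h2.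
Qed.

Lemma trd_newest K : tdet K != 0 -> trd K (newest K) = (1, 0).
Proof.
move=> D0; have := @trd_comb K 1 0 0 D0; rewrite scale1r !scale0r !addr0 subr0.
exact.
Qed.

Lemma trd_edge1 K : tdet K != 0 -> trd K (edge1 K) = (0, 1).
Proof.
move=> D0; have := @trd_comb K 0 1 0 D0; rewrite scale1r !scale0r !addr0 !add0r subr0.
exact.
Qed.

Lemma trd_edge2 K : tdet K != 0 -> trd K (edge2 K) = (0, -1).
Proof.
by move=> D0; have := @trd_comb K 0 0 1 D0; rewrite scale1r !scale0r !add0r => ->.
Qed.

Lemma trd_affine K p q (s t : R) : s + t = 1 ->
  trd K (s *: p + t *: q) = s *: trd K p + t *: trd K q.
Proof.
move=> st; have -> : s = 1 - t by lra.
by rewrite /trd /tr /td; congr pair; rewrite /= /GRing.scale /=; ring.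
Qed.

Lemma tr_diff K p q : tr K p - tr K q = (gr K).1 * (p.1 - q.1) + (gr K).2 * (p.2 - q.2).
Proof. by rewrite /tr; ring. Qed.

Lemma td_diff K p q : td K p - td K q = (gd K).1 * (p.1 - q.1) + (gd K).2 * (p.2 - q.2).
Proof. by rewrite /td; ring. Qed.

Definition child K (b : bool) : triangle R :=
  (midpoint (edge1 K) (edge2 K), newest K, if b then edge2 K else edge1 K).

Lemma childrenE K : children K = [:: child K false; child K true].
Proof. by []. Qed.

Lemma tdet_child K b : tdet (child K b) = (if b then - tdet K else tdet K) / 2.
Proof.
case: K => [[[z1 z2] [a1 a2]] [b1 b2]]; case: b;
by rewrite !tdetE /newest /edge1 /edge2 /= /GRing.scale /=; field.
Qed.

Lemma tdet_child_neq0 K b : tdet K != 0 -> tdet (child K b) != 0.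
Proof. by move=> D0; rewrite tdet_child; case: b; rewrite mulf_neq0 ?oppr_eq0 ?invr_eq0. Qed.

Lemma grd_child K b : tdet K != 0 -> let s := if b then -1 else 1 in
  (gr (child K b) = - gr K - s *: gd K) * (gd (child K b) = gr K - s *: gd K).
Proof.
move=> D0 /=; rewrite /gr /gd tdet_child; move: (tdet K) D0 => D D0.
case: K => [[[z1 z2] [a1 a2]] [b1 b2]]; rewrite /newest /edge1 /edge2.
case: b; (split; congr pair; rewrite /= /GRing.scale /=; by field).
Qed.

Lemma trd_child K b p : tdet K != 0 -> let s := if b then -1 else 1 in
  trd (child K b) p = (1 - tr K p - s * td K p, tr K p - s * td K p).
Proof.
move=> D0 /=; rewrite /trd /tr /td; have [-> ->] := grd_child b D0.
rewrite /gr /gd; move: D0.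
case: K => [[[z1 z2] [a1 a2]] [b1 b2]]; case: b; rewrite !tdetE /newest /edge1 /edge2 /= /GRing.scale /= => D0;
by congr pair; rewrite /=; field.
Qed.

(** Both children are folded onto each other along the median [td = 0] and then rescaled to the
    reference triangle. Consequently the coordinates with respect to a descendant depend on its
    generation and not on the path, see [trd_node]. *)
Definition fold_ref x : R * R := (1 - x.1 - `|x.2|, x.1 - `|x.2|).

Lemma hull_child K b p : tdet K != 0 -> hull (child K b) p <->
  hull K p /\ (if b then td K p <= 0 else 0 <= td K p).
Proof.
move=> D0; rewrite !hullP ?tdet_child_neq0 // /in_ref trd_child //= !ler_norml.
case: b; split.
- by move=> [h1 /andP[h2 h3]]; split; [split; [|apply/andP; split]|]; lra.
- by move=> [[h1 /andP[h2 h3]] h4]; split; [|apply/andP; split]; lra.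
- by move=> [h1 /andP[h2 h3]]; split; [split; [|apply/andP; split]|]; lra.
- by move=> [[h1 /andP[h2 h3]] h4]; split; [|apply/andP; split]; lra.
Qed.

Lemma trd_child_fold K b p : tdet K != 0 -> (if b then td K p <= 0 else 0 <= td K p) ->
  trd (child K b) p = fold_ref (trd K p).
Proof.
move=> D0 h; rewrite trd_child // /fold_ref /=; case: b h => h.
  by rewrite ler0_norm //; congr pair; ring.
by rewrite ger0_norm //; congr pair; ring.
Qed.

Definition node K w : triangle R := foldl child K w.

Lemma node_cat K w w' : node K (w ++ w') = node (node K w) w'.
Proof. exact: foldl_cat. Qed.

Lemma tdet_node K w : tdet K != 0 -> tdet (node K w) != 0.
Proof. by elim: w K => //= b w IH K D0; apply: IH; exact: tdet_child_neq0. Qed.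

Lemma hull_node K w p : tdet K != 0 -> hull (node K w) p -> hull K p.
Proof.
elim: w K => //= b w IH K D0 /(IH _ (tdet_child_neq0 b D0)).
by rewrite hull_child // => -[].
Qed.

Lemma trd_node K w p : tdet K != 0 -> hull (node K w) p ->
  trd (node K w) p = iter (size w) fold_ref (trd K p).
Proof.
elim: w K => //= b w IH K D0 hp; have D1 := tdet_child_neq0 b D0.
rewrite (IH _ D1 hp) -iterS iterSr -(trd_child_fold (b := b)) //.
by have := hull_node D1 hp; rewrite hull_child // => -[].
Qed.

Lemma node_cover K n p : tdet K != 0 -> hull K p ->
  exists w, size w = n /\ hull (node K w) p.
Proof.
elim: n K => [|n IH] K D0 hp; first by exists [::].
have [b hb] : exists b : bool, if b then td K p <= 0 else 0 <= td K p.
  by have [h|h] := leP 0 (td K p); [exists false|exists true => /=; exact: ltW].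
have hc : hull (child K b) p by rewrite hull_child.
by have [w [<- hw]] := IH _ (tdet_child_neq0 b D0) hc; exists (b :: w).
Qed.

(** Boundary and exterior together: this set is stable under folding, so functions that vanish on it
    extend by zero at all levels without case distinctions. *)
Definition bnd_ref x : Prop := ~ strict_ref x.

Lemma fold_bnd x : bnd_ref x -> bnd_ref (fold_ref x).
Proof.
move=> h [/= h1 h2]; apply: h; move: h1 h2; rewrite /strict_ref ltr_norml => h1 /andP[h2 h3].
by split; lra.
Qed.

Lemma iter_fold_bnd n x : bnd_ref x -> bnd_ref (iter n fold_ref x).
Proof. by elim: n => //= n IH /IH; exact: fold_bnd. Qed.

Definition strict K p := strict_ref (trd K p).

Lemma strict_hull K p : tdet K != 0 -> strict K p -> hull K p.
Proof. by move=> D0 [h1 h2]; rewrite hullP //; split; exact: ltW. Qed.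

Lemma strict_node K w p : tdet K != 0 -> strict (node K w) p -> strict K p.
Proof.
move=> D0 h; apply: contrapT => hn; have hw := strict_hull (tdet_node w D0) h.
by apply: (iter_fold_bnd (n := size w) hn); rewrite -trd_node.
Qed.

(** The two paths agree up to their first difference, where the sign of [td] separates the
    children. *)
Lemma node_disjoint K w w' p : tdet K != 0 -> size w = size w' -> w != w' ->
  strict (node K w) p -> ~ hull (node K w') p.
Proof.
elim: w w' K => [|b w IH] [|b' w'] K D0 //= [sw].
rewrite eqseq_cons; have [<-|bb] /= := eqVneq b b'.
  by move=> ww; apply: IH => //; exact: tdet_child_neq0.
move=> _ hs hh; have D1 c := tdet_child_neq0 c D0.
have s1 : strict (child K b) p := strict_node (D1 b) hs.
have := hull_node (D1 b') hh; rewrite hull_child // => -[_ h2].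
move: s1 {hs hh}; rewrite /strict trd_child // /strict_ref /= ltr_norml => -[h3 /andP[h4 h5]].
by move: b b' bb h2 h3 h4 h5 => [] [] //= _; lra.
Qed.

Lemma strict_nbhs K p : strict K p -> exists2 e : R, 0 < e &
  forall q, `|q.1 - p.1| < e -> `|q.2 - p.2| < e -> strict K q.
Proof.
move=> [/= h1 h2].
pose A := `|(gr K).1| + `|(gr K).2| + `|(gd K).1| + `|(gd K).2| + 1.
have n1 := normr_ge0 (gr K).1; have n2 := normr_ge0 (gr K).2.
have n3 := normr_ge0 (gd K).1; have n4 := normr_ge0 (gd K).2.
have A0 : 0 < A by rewrite /A; lra.
pose m := Num.min (tr K p) (1 - tr K p - `|td K p|).
have m0 : 0 < m by rewrite lt_min h1 subr_gt0.
exists (m / (2 * A)); first by rewrite divr_gt0 // mulr_gt0.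
have A20 : 0 < 2 * A by rewrite mulr_gt0.
move=> q q1 q2; rewrite !ltr_pdivlMr // in q1 q2.
have k1 : `|tr K q - tr K p| <= `|(gr K).1| * `|q.1 - p.1| + `|(gr K).2| * `|q.2 - p.2|.
  by rewrite tr_diff; apply: le_trans (ler_normD _ _) _; rewrite !normrM.
have k2 : `|td K q - td K p| <= `|(gd K).1| * `|q.1 - p.1| + `|(gd K).2| * `|q.2 - p.2|.
  by rewrite td_diff; apply: le_trans (ler_normD _ _) _; rewrite !normrM.
have [mm1 mm2] : m <= tr K p /\ m <= 1 - tr K p - `|td K p|.
  by rewrite /m !ge_min !lexx orbT.
have x0 := normr_ge0 (q.1 - p.1); have y0 := normr_ge0 (q.2 - p.2).
set X := `|q.1 - p.1| in q1 k1 k2 x0 *; set Y := `|q.2 - p.2| in q2 k1 k2 y0 *.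
have s1 : `|(gr K).1| * X + `|(gr K).2| * Y + (`|(gd K).1| * X + `|(gd K).2| * Y) < m / 1.
  rewrite divr1.
  apply: (@le_lt_trans _ _ (A * (X + Y) - (X + Y))).
    rewrite /A; have := mulr_ge0 n1 y0; have := mulr_ge0 n2 x0.
    by have := mulr_ge0 n3 y0; have := mulr_ge0 n4 x0; lra.
  by lra.
rewrite divr1 in s1.
have g1 := le_trans (ler_norm _) k1.
have g2 : `|td K q| <= `|td K p| + `|td K q - td K p|.
  by have := ler_normD (td K p) (td K q - td K p); rewrite addrC subrK.
have g3 : tr K p - tr K q <= `|tr K q - tr K p| by rewrite distrC ler_norm.
have t1 : `|tr K q - tr K p| + `|td K q - td K p| < m by lra.
have n5 := normr_ge0 (tr K q - tr K p); have n6 := normr_ge0 (td K q - td K p).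
by rewrite /strict /strict_ref /=; split; lra.
Qed.

Lemma strict_interior K p : tdet K != 0 -> strict K p -> interior (hull K) p.
Proof.
move=> D0 /strict_nbhs [e e0 he]; apply: (box_nbhs e0) => q q1 q2.
by apply: strict_hull => //; exact: he.
Qed.

End Triangles.

(** * The tower of hat functions *)

Section Tower.
Context {R : realType}.
Implicit Types (x y : R * R).

(* The hat function of the midpoint of the median through the newest vertex, in the
   coordinates [trd]. *)
Definition tent x : R := Num.max 0 (1 - `|1 - 2 * x.1| - 2 * `|x.2|).

Definition dist1 x y : R := `|x.1 - y.1| + `|x.2 - y.2|.

Lemma normr_sub_le (a b : R) : `| `|a| - `|b| | <= `|a - b|.
Proof. exact: ler_dist_dist. Qed.

Lemma dist1_ge0 x y : 0 <= dist1 x y.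
Proof. by rewrite addr_ge0. Qed.

(** On either side of the median a fold is the square root of 2 times an isometry. Passing from the
    maximum norm to the sum norm here, and back in [fold_dist2], shows that two folds expand [dist1]
    at most by the exact factor 2. *)
Lemma fold_dist1 x y (m : R) : `|x.1 - y.1| <= m -> `|x.2 - y.2| <= m ->
  dist1 (fold_ref x) (fold_ref y) <= 2 * m.
Proof.
rewrite /dist1 /fold_ref /= => h1 h2.
have := le_trans (normr_sub_le x.2 y.2) h2; move: h1.
set a := `|x.2|; set b := `|y.2|; rewrite !ler_norml => /andP[h3 h4] /andP[h5 h6].
by case: (ger0P (1 - x.1 - a - (1 - y.1 - b))); case: (ger0P (x.1 - a - (y.1 - b))); lra.
Qed.

Lemma fold_dist2 x y :
  `|(fold_ref x).1 - (fold_ref y).1| <= dist1 x y /\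
  `|(fold_ref x).2 - (fold_ref y).2| <= dist1 x y.
Proof.
rewrite /dist1 /fold_ref /=.
have := normr_sub_le x.2 y.2; set m1 := `|x.1 - _|; set m2 := `|x.2 - y.2|.
have : `|x.1 - y.1| <= m1 by [].
set a := `|x.2|; set b := `|y.2|; rewrite !ler_norml => /andP[h3 h4] /andP[h5 h6].
by split; apply/andP; split; lra.
Qed.

Lemma iter_fold_dist (m : nat) x y :
  dist1 (iter m.*2 fold_ref x) (iter m.*2 fold_ref y) <= 2 ^+ m * dist1 x y.
Proof.
elim: m => [|m IH]; first by rewrite expr0 mul1r.
rewrite doubleS !iterS exprS -mulrA.
have [h1 h2] := fold_dist2 (iter m.*2 fold_ref x) (iter m.*2 fold_ref y).
by apply: le_trans (fold_dist1 h1 h2) _; rewrite ler_wpM2l.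
Qed.

Lemma tent_dist x y : `|tent x - tent y| <= 2 * dist1 x y.
Proof.
have mx (a b : R) : `|Num.max 0 a - Num.max 0 b| <= `|a - b|.
  case: (leP 0 a); case: (leP 0 b); rewrite ?subr0 ?sub0r ?subrr ?normr0 ?normrN //;
  by case: (ger0P (a - b)); case: (ger0P a); case: (ger0P b); lra.
apply: le_trans (mx _ _) _; rewrite /dist1.
have h1 := normr_sub_le (1 - 2 * x.1) (1 - 2 * y.1); have h2 := normr_sub_le x.2 y.2.
have e : `|1 - 2 * x.1 - (1 - 2 * y.1)| = 2 * `|x.1 - y.1|.
  by rewrite -[2 in RHS]ger0_norm // -normrM -normrN; congr `|_|; ring.
rewrite e in h1; move: h1 h2.
set a := `|1 - 2 * x.1|; set b := `|1 - 2 * y.1|; set c := `|x.2|; set d := `|y.2|.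
set m := `|x.1 - y.1|; set n := `|x.2 - y.2|.
by rewrite !ler_norml => /andP[h3 h4] /andP[h5 h6]; apply/andP; split; lra.
Qed.

Lemma tent_ge0 x : 0 <= tent x.
Proof. by rewrite le_max lexx. Qed.

Lemma tent_le1 x : tent x <= 1.
Proof.
by rewrite ge_max ler01 /=; have := normr_ge0 (1 - 2 * x.1); have := normr_ge0 x.2; lra.
Qed.

Lemma tent_bnd x : bnd_ref x -> tent x = 0.
Proof.
move=> h; apply/eqP; rewrite eq_le tent_ge0 andbT leNgt; apply/negP => t0; apply: h.
move: t0; rewrite lt_max ltxx /= => t0.
have h1 := ler_norm (1 - 2 * x.1); have h2 := ler_norm (- (1 - 2 * x.1)); rewrite normrN in h2.
by split; have := normr_ge0 x.2; lra.
Qed.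

Variable k : nat.

(** This is also the reciprocal of the number of descendants of generation 2kj, so that the
    amplitudes of one level add up to 1. *)
Definition amp (j : nat) : R := 4^-1 ^+ (k * j).

Definition foldk (j : nat) x := iter (k * j).*2 fold_ref x.

Definition psum (n : nat) x : R := \sum_(0 <= j < n) amp j * tent (foldk j x).

Definition tower x : R := sup (range (psum ^~ x)).

Lemma amp_gt0 j : 0 < amp j.
Proof. by rewrite exprn_gt0 // invr_gt0. Qed.

Lemma ampD i j : amp (i + j) = amp i * amp j.
Proof. by rewrite /amp mulnDr exprD. Qed.

Lemma foldkD i j x : foldk (i + j) x = foldk j (foldk i x).
Proof. by rewrite /foldk addnC mulnDr doubleD iterD. Qed.

Lemma psumD i n x : psum (i + n) x = psum i x + amp i * psum n (foldk i x).
Proof.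
rewrite /psum (big_cat_nat (leq0n i) (leq_addr n i)) /=; congr (_ + _).
rewrite -{1}[i]add0n big_addn [(i + n)%N]addnC addnK mulr_sumr.
by apply: eq_big_nat => j _; rewrite addnC ampD foldkD mulrA.
Qed.

Hypothesis k0 : (0 < k)%N.

Lemma amp_le j : amp j <= 4^-1 ^+ j.
Proof. by rewrite /amp ler_wiXn2l ?leq_pmull // invf_le1 // ler1n. Qed.

Lemma geom_le (c : R) n : 0 <= c -> \sum_(0 <= j < n) c * 2^-1 ^+ j <= 2 * c.
Proof.
move=> c0; have -> : \sum_(0 <= j < n) c * 2^-1 ^+ j = 2 * c * (1 - 2^-1 ^+ n).
  elim: n => [|n IH]; first by rewrite big_nil expr0 subrr mulr0.
  by rewrite big_nat_recr //= IH exprS; field.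
have h : 0 <= 2^-1 ^+ n :> R by rewrite exprn_ge0.
by have := mulr_ge0 c0 h; lra.
Qed.

Lemma psum_nondecreasing x : nondecreasing_seq (psum ^~ x).
Proof.
apply/nondecreasing_seqP => n; rewrite /psum big_nat_recr //= lerDl.
by rewrite mulr_ge0 ?tent_ge0 // ltW ?amp_gt0.
Qed.

Lemma psum_le n x : psum n x <= 2.
Proof.
apply: (@le_trans _ _ (\sum_(0 <= j < n) 1 * 2^-1 ^+ j)); last first.
  by have := geom_le n ler01; lra.
apply: ler_sum => j _; rewrite mul1r -[leRHS]mulr1 ler_pM ?tent_ge0 ?tent_le1 //.
  exact/ltW/amp_gt0.
by apply: le_trans (amp_le j) _; rewrite lerXn2r ?nnegrE // lef_pV2 ?posrE // ler_nat.
Qed.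

Lemma psum_cvg x : psum n x @[n --> \oo] --> tower x.
Proof.
apply: nondecreasing_cvgn; first exact: psum_nondecreasing.
by exists 2 => _ [n _ <-]; exact: psum_le.
Qed.

(** Self-similarity: the tail is a scaled copy of the tower in the coordinates of a descendant. The
    Galerkin error and the reduction of each level to the first one both rest on it. *)
Lemma tower_split J x : tower x = psum J x + amp J * tower (foldk J x).
Proof.
have/cvg_lim <- // := @psum_cvg x; apply/cvg_lim => //.
rewrite -(cvg_shiftn J) /=.
under eq_fun do rewrite addnC psumD.
by apply: cvgD; [exact: cvg_cst|apply: cvgMr; exact: psum_cvg].
Qed.

(** The amplitude 4^(-kj) against the expansion 2^(kj) of the folds leaves a geometric series of
    Lipschitz constants. *)
Lemma psum_dist n x y : `|psum n x - psum n y| <= 4 * dist1 x y.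
Proof.
apply: (@le_trans _ _ (\sum_(0 <= j < n) (2 * dist1 x y) * 2^-1 ^+ j)); last first.
  by apply: le_trans (geom_le n _) _; rewrite ?mulr_ge0 ?dist1_ge0 //; lra.
rewrite /psum -sumrB; apply: le_trans (ler_norm_sum _ _ _) _.
apply: ler_sum => j _; rewrite -mulrBr normrM gtr0_norm ?amp_gt0 //.
have h := le_trans (tent_dist (foldk j x) (foldk j y)) (ler_wpM2l (ler0n _ 2) (iter_fold_dist (k * j) x y)).
apply: (@le_trans _ _ (amp j * (2 * (2 ^+ (k * j) * dist1 x y)))).
  by rewrite ler_wpM2l // ltW ?amp_gt0.
have -> : amp j * (2 * (2 ^+ (k * j) * dist1 x y)) = 2 * dist1 x y * (amp j * 2 ^+ (k * j)) by ring.
rewrite ler_wpM2l ?mulr_ge0 ?dist1_ge0 // /amp -exprMn.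
have -> : 4^-1 * 2 = 2^-1 :> R by field.
by rewrite ler_wiXn2l ?leq_pmull // invf_le1 // ler1n.
Qed.

Lemma tower_dist x y : `|tower x - tower y| <= 4 * dist1 x y.
Proof.
have c : psum n x - psum n y @[n --> \oo] --> tower x - tower y.
  by apply: cvgB; exact: psum_cvg.
have := @cvg_dist_le _ _ _ 0 _ c; rewrite subr0; apply.
by near=> n; rewrite subr0; exact: psum_dist.
Unshelve. all: end_near. Qed.

Lemma tail_dist J x y :
  `|tower x - psum J x - (tower y - psum J y)| <= 4 * 2^-1 ^+ (k * J) * dist1 x y.
Proof.
rewrite (tower_split J x) (tower_split J y) ![psum J _ + _]addrC !addrK -mulrBr normrM gtr0_norm ?amp_gt0 //.
have h : `|tower (foldk J x) - tower (foldk J y)| <= 4 * (2 ^+ (k * J) * dist1 x y).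
  by apply: le_trans (tower_dist _ _) _; rewrite ler_wpM2l // iter_fold_dist.
apply: le_trans (ler_wpM2l (ltW (amp_gt0 J)) h) _.
have -> : 2^-1 = 4^-1 * 2 :> R by field.
by rewrite /amp exprMn le_eqVlt; apply/orP; left; apply/eqP; ring.
Qed.

Lemma psum_bnd n x : bnd_ref x -> psum n x = 0.
Proof.
move=> h; rewrite /psum big1 // => j _.
by rewrite tent_bnd ?mulr0 //; exact: iter_fold_bnd.
Qed.

Lemma tower_bnd x : bnd_ref x -> tower x = 0.
Proof.
move=> h; have/cvg_lim <- // := @psum_cvg x; apply/cvg_lim => //.
by under eq_fun do rewrite psum_bnd //; exact: cvg_cst.
Qed.

End Tower.

(** * Affine pieces of the partial sums *)

Section Affine.
Context {R : realType}.
Implicit Types (K T : triangle R) (D : set (R * R)) (v : R * R -> R) (p : R * R).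

Definition affine_on D v :=
  exists a b c : R, forall p, D p -> v p = a * p.1 + b * p.2 + c.

Lemma affine_onD D v v' : affine_on D v -> affine_on D v' -> affine_on D (fun p => v p + v' p).
Proof.
move=> [a [b [c h]]] [a' [b' [c' h']]]; exists (a + a'), (b + b'), (c + c') => p Dp.
by rewrite h // h' //; ring.
Qed.

Lemma affine_onZ D (s : R) v : affine_on D v -> affine_on D (fun p => s * v p).
Proof.
move=> [a [b [c h]]]; exists (s * a), (s * b), (s * c) => p Dp.
by rewrite h //; ring.
Qed.

Lemma affine_on_cst D (s : R) : affine_on D (fun=> s).
Proof. by exists 0, 0, s => p _; ring. Qed.

Lemma affine_on_tr D K : affine_on D (tr K).
Proof. by exists (gr K).1, (gr K).2, (tr K 0) => p _; rewrite /tr /=; ring. Qed.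

Lemma affine_on_td D K : affine_on D (td K).
Proof. by exists (gd K).1, (gd K).2, (td K 0) => p _; rewrite /td /=; ring. Qed.

Lemma affine_onS D D' v : D `<=` D' -> affine_on D' v -> affine_on D v.
Proof. by move=> DD' [a [b [c h]]]; exists a, b, c => p /DD'; exact: h. Qed.

Lemma affine_on_eq D v v' : (forall p, D p -> v p = v' p) -> affine_on D v -> affine_on D v'.
Proof. by move=> e [a [b [c h]]]; exists a, b, c => p Dp; rewrite -e //; exact: h. Qed.

Lemma affine_on_comb D K (s t c : R) : affine_on D (fun p => s * tr K p + t * td K p + c).
Proof.
apply: affine_onD; last exact: affine_on_cst.
by apply: affine_onD; apply: affine_onZ; [exact: affine_on_tr|exact: affine_on_td].
Qed.

(** Three bisections resolve the kinks of the tent: the first splits at [td = 0], the second where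
    [tr] equals the modulus of [td], the third at [tr = 1/2]. *)
Lemma tent_affine3 K (b1 b2 b3 : bool) : tdet K != 0 ->
  affine_on (hull (node K [:: b1; b2; b3])) (fun p => tent (trd K p)).
Proof.
move=> D0.
pose s : R := if b1 then -1 else 1.
(* The coefficients of [tr], of [td] and the constant. The tent vanishes for [b2]; otherwise [b3]
   tells whether [tr] is above or below 1/2. *)
pose l : R * R * R := if b2 then (0, 0, 0) else if b3 then (- 2, - (2 * s), 2)
  else (2, - (2 * s), 0).
apply: affine_on_eq (affine_on_comb _ K l.1.1 l.1.2 l.2) => p.
have D1 := tdet_child_neq0 b1 D0; have D2 := tdet_child_neq0 b2 D1.
rewrite /node /= hull_child // => -[]; rewrite hull_child // => -[].
rewrite hull_child // => -[]; rewrite hullP // /in_ref => -[/= h1 h2] h3.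
have -> : td (child K b1) p = tr K p - s * td K p by have [_] := trd_child b1 p D0.
have -> : td (child (child K b1) b2) p = 1 - tr K p - s * td K p -
   (if b2 then -1 else 1) * (tr K p - s * td K p).
  have [_ ->] := trd_child b2 p D1; have [-> ->] := trd_child b1 p D0; by [].
have e : `|td K p| = s * td K p.
  rewrite /s; case: (b1) h3 => h3; first by rewrite mulN1r ler0_norm.
  by rewrite mul1r ger0_norm.
rewrite /tent /= e.
have n1 := ler_norm (1 - 2 * tr K p); have n2 := ler_norm (- (1 - 2 * tr K p)).
rewrite normrN in n2.
have hd : - (2 * s) * td K p = - 2 * (s * td K p) by ring.
move: h2; rewrite e => h2.
rewrite {}/l; case: b2 D2 => D2; case: b3 => /= h4 h5; rewrite ?hd {hd e h3};
  move: (s * td K p) (td K p) h2 h4 h5 => d d' h2 h4 h5.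
- by rewrite max_l; lra.
- by rewrite max_l; lra.
- by rewrite ler0_norm in n1 n2 *; [rewrite max_r; lra|lra].
- by rewrite ger0_norm in n1 n2 *; [rewrite max_r; lra|lra].
Qed.

Lemma tent_affine K g w : tdet K != 0 -> (g + 3 <= size w)%N ->
  affine_on (hull (node K w)) (fun p => tent (iter g fold_ref (trd K p))).
Proof.
move=> D0 hw; have sg : (g <= size w)%N by apply: leq_trans (leq_addr _ _) hw.
have D1 := tdet_node (take g w) D0.
have st : size (take g w) = g by rewrite size_takel.
apply: (@affine_on_eq _ (fun p => tent (trd (node K (take g w)) p))).
  move=> p hp; rewrite trd_node ?st //.
  by move: hp; rewrite -{1}(cat_take_drop g w) node_cat; exact: hull_node.
rewrite -{1}(cat_take_drop g w) node_cat.
have : (3 <= size (drop g w))%N by rewrite size_drop leq_subRL.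
case: (drop g w) => [|b1 [|b2 [|b3 w']]] //= _.
apply: affine_onS (tent_affine3 b1 b2 b3 D1).
by move=> p; apply: (hull_node (w := w')); exact: (tdet_node [:: b1; b2; b3]).
Qed.

(** The last tent lives at generation 2k(J-1) and is resolved three generations later. This fits
    below 2kJ because [k] is at least 2. *)
Lemma psum_affine k J T w : (1 < k)%N -> tdet T != 0 -> ((k * J).*2 <= size w)%N ->
  affine_on (hull (node T w)) (fun p => psum k J (trd T p)).
Proof.
move=> k1 D0; elim: J => [|J IH] hw.
  by apply: affine_on_eq (affine_on_cst _ 0) => p _; rewrite /psum big_nil.
apply: affine_on_eq (affine_onD (IH _) (affine_onZ (amp k J) (tent_affine D0 (g := (k * J).*2) _))).
- by move=> p _ /=; rewrite /psum big_nat_recr.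
- by apply: leq_trans hw; rewrite leq_double leq_mul.
apply: leq_trans hw; rewrite mulnS doubleD addnC leq_add2r.
by apply: leq_trans (_ : 4 <= _)%N => //; rewrite -(leq_double 2) in k1.
Qed.

End Affine.

(** * Strict derivatives almost everywhere and orthogonality *)

Section Regular.
Context {R : realType}.
Local Notation P := (measurableTypeR R * measurableTypeR R)%type.
Local Notation mu := (@plane_measure R).
Implicit Types (v w phi : R * R -> R) (p q : R * R) (G H : bool -> R) (K T : triangle R).

Definition approx v p G (e d : R) := forall x y : R * R,
  `|x.1 - p.1| < d -> `|x.2 - p.2| < d -> `|y.1 - p.1| < d -> `|y.2 - p.2| < d ->
  `|v x - v y - (G false * (x.1 - y.1) + G true * (x.2 - y.2))| <= e * dist1 x y.

Lemma approx_le v p G (e e' d d' : R) : e <= e' -> d' <= d -> approx v p G e d ->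
  approx v p G e' d'.
Proof.
move=> ee dd h x y h1 h2 h3 h4; apply: le_trans (h _ _ _ _ _ _) _;
  by rewrite ?(lt_le_trans _ dd) // ler_wpM2r // dist1_ge0.
Qed.

Lemma approx_unique v p G H (e e' d : R) i : 0 < d -> approx v p G e d ->
  approx v p H e' d -> `|G i - H i| <= e + e'.
Proof.
move=> d0 h1 h2; have [t t0 td] : exists2 t, 0 < t & t < d by exists (d / 2); lra.
pose x : R * R := p + t *: axis i.
have x1 : x.1 - p.1 = t * (axis i).1 by rewrite (shift_sub _ _ _).1.
have x2 : x.2 - p.2 = t * (axis i).2 by rewrite (shift_sub _ _ _).2.
have d1 : dist1 x p = t.
  by rewrite /dist1 x1 x2 !normrM (gtr0_norm t0) -mulrDr axis_norm mulr1.
have near1 (j : bool) : `|(if j then x.2 else x.1) - (if j then p.2 else p.1)| < d.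
  apply: le_lt_trans td; rewrite -d1 /dist1; case: j; rewrite ?lerDl ?lerDr //.
have := h1 x p (near1 false) (near1 true); have := h2 x p (near1 false) (near1 true).
rewrite !subrr !normr0 => /(_ d0 d0) k2 /(_ d0 d0) k1.
have gE (g : bool -> R) : g false * (x.1 - p.1) + g true * (x.2 - p.2) = t * g i.
  by rewrite x1 x2 -(axis_dot i g); ring.
rewrite !gE d1 in k1 k2.
rewrite -(ler_pM2l t0) -[t in X in X <= _]gtr0_norm // -normrM.
have -> : t * (G i - H i) = (v x - v p - t * H i) - (v x - v p - t * G i) by ring.
by apply: le_trans (ler_normB _ _) _; lra.
Qed.

(** Each accuracy comes with its own affine approximation, as the partial sums do for the tower. The
    gradient is recovered as the supremum of the lower bounds [G i - e], which [approx_unique] shows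
    to be consistent. *)
Lemma sdiff_approx v p :
  (forall e, 0 < e -> exists G, exists2 d, 0 < d & approx v p G e d) -> exists G, sdiff v p G.
Proof.
move=> h.
pose A i := [set x | exists e G d, [/\ 0 < e, 0 < d, approx v p G e d & x = G i - e]].
exists (fun i => sup (A i)).
have key i e G d : 0 < e -> 0 < d -> approx v p G e d -> `|sup (A i) - G i| <= e.
  move=> e0 d0 hG.
  have Ae : A i (G i - e) by exists e, G, d.
  have ub : ubound (A i) (G i + e).
    move=> _ [e' [H [d' [e'0 d'0 hH ->]]]].
    have m0 : 0 < Num.min d d' by rewrite lt_min d0.
    have h1 : approx v p G e (Num.min d d') by apply: approx_le hG; rewrite ?ge_min ?lexx.
    have h2 : approx v p H e' (Num.min d d').
      by apply: approx_le hH; rewrite // ge_min lexx orbT.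
    by have := approx_unique i m0 h1 h2; rewrite ler_norml; lra.
  have hs : has_sup (A i) by split; [exists (G i - e)|exists (G i + e)].
  have l1 : G i - e <= sup (A i) by apply: ub_le_sup => //; exists (G i + e).
  have l2 : sup (A i) <= G i + e by apply: ge_sup => //; exists (G i - e).
  by rewrite ler_norml; lra.
move=> e e0; have [G [d d0 hG]] := h (e / 2) (divr_gt0 e0 (ltr0n _ 2)).
exists d => // x y h1 h2 h3 h4; have := hG x y h1 h2 h3 h4.
have k1 := key false _ _ _ (divr_gt0 e0 (ltr0n _ 2)) d0 hG.
have k2 := key true _ _ _ (divr_gt0 e0 (ltr0n _ 2)) d0 hG.
set s1 := sup _ in k1 *; set s2 := sup _ in k2 *; rewrite -/(dist1 x y) => hh.
have -> : v x - v y - (s1 * (x.1 - y.1) + s2 * (x.2 - y.2)) =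
  (v x - v y - (G false * (x.1 - y.1) + G true * (x.2 - y.2))) -
  ((s1 - G false) * (x.1 - y.1) + (s2 - G true) * (x.2 - y.2)) by ring.
apply: le_trans (ler_normB _ _) _.
have := ler_normD ((s1 - G false) * (x.1 - y.1)) ((s2 - G true) * (x.2 - y.2)).
rewrite !normrM => h5.
have := ler_wpM2r (normr_ge0 (x.1 - y.1)) k1; have := ler_wpM2r (normr_ge0 (x.2 - y.2)) k2.
by move: hh h5; rewrite /dist1; lra.
Qed.

Lemma sdiff_unique v p G H i : sdiff v p G -> sdiff v p H -> G i = H i.
Proof.
move=> h h'; rewrite -(axis_dot i G) -(axis_dot i H).
exact: (cvg_unique _ (sdiff_dquot (a := axis i) h) (sdiff_dquot (a := axis i) h')).
Qed.

Lemma sdiff_lin (a : R) v w p G H : sdiff v p G -> sdiff w p H ->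
  sdiff (fun q => a * v q + w q) p (fun i => a * G i + H i).
Proof.
move=> hv hw e e0; set A := `|a| + 1; have A0 : 0 < A by rewrite /A ltr_pwDr.
have e1 : 0 < e / (2 * A) by rewrite divr_gt0 // mulr_gt0.
have [d d0 h] := hv _ e1; have [d' d'0 h'] := hw _ (divr_gt0 e0 (ltr0n _ 2)).
exists (Num.min d d'); first by rewrite lt_min d0.
move=> x y; rewrite !lt_min => /andP[x1 x1'] /andP[x2 x2'] /andP[y1 y1'] /andP[y2 y2'].
have := h x y x1 x2 y1 y2; have := h' x y x1' x2' y1' y2'.
rewrite -/(dist1 x y) => k1 k2.
have -> : a * v x + w x - (a * v y + w y) -
   ((a * G false + H false) * (x.1 - y.1) + (a * G true + H true) * (x.2 - y.2)) =
   a * (v x - v y - (G false * (x.1 - y.1) + G true * (x.2 - y.2))) +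
   (w x - w y - (H false * (x.1 - y.1) + H true * (x.2 - y.2))) by ring.
apply: le_trans (ler_normD _ _) _; rewrite normrM.
have := ler_wpM2l (normr_ge0 a) k2.
have : `|a| * (e / (2 * A) * dist1 x y) <= e / 2 * dist1 x y.
  have -> : e / (2 * A) = e / 2 * A^-1 by field; rewrite lt0r_neq0.
  rewrite mulrA ler_wpM2r ?dist1_ge0 // mulrCA -[leRHS]mulr1 ler_wpM2l //; first lra.
  by rewrite ler_pdivrMr // mul1r /A; lra.
by lra.
Qed.

Lemma sdiff_affine v p (a b c d : R) : 0 < d ->
  (forall x : R * R, `|x.1 - p.1| < d -> `|x.2 - p.2| < d -> v x = a * x.1 + b * x.2 + c) ->
  sdiff v p (fun i => if i then b else a).
Proof.
move=> d0 h e e0; exists d => // x y x1 x2 y1 y2; rewrite !h //.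
have -> : a * x.1 + b * x.2 + c - (a * y.1 + b * y.2 + c) -
   (a * (x.1 - y.1) + b * (x.2 - y.2)) = 0 by ring.
by rewrite normr0 mulr_ge0 ?dist1_ge0 // ltW.
Qed.

Definition regular v := exists b L N (F : R * R -> bool -> R), lipreg b L v N F.

Lemma lipreg_lin (a b b' L L' : R) v w N N' (G G' : R * R -> bool -> R) :
  lipreg b L v N G -> lipreg b' L' w N' G' ->
  lipreg (b + b') (`|a| * L + L') (fun p => a * v p + w p) (N `|` N')
    (fun p i => a * G p i + G' p i).
Proof.
move=> [b0 hv v0 N0 hG] [b'0 hw w0 N'0 hG']; split.
- exact: addr_ge0.
- move=> p q; have -> : a * v p + w p - (a * v q + w q) = a * (v p - v q) + (w p - w q) by ring.
  apply: le_trans (ler_normD _ _) _; rewrite normrM mulrDl -mulrA.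
  by apply: lerD; [rewrite ler_wpM2l|].
- move=> p hp; rewrite v0 ?w0 ?mulr0 ?addr0 // => -[h1 h2]; apply: hp; split; lra.
- exact: negligibleU.
- by move=> p hp; apply: sdiff_lin; [apply: hG|apply: hG'] => h; apply: hp; [left|right].
Qed.

Lemma regular_lin (a : R) v w : regular v -> regular w -> regular (fun p => a * v p + w p).
Proof.
by move=> [b [L [N [G h]]]] [b' [L' [N' [G' h']]]]; do 4 eexists; exact: lipreg_lin h h'.
Qed.

Lemma regular0 : regular (fun=> 0).
Proof.
exists 0, 0, set0, (fun _ _ => 0); split => //.
- by move=> p q; rewrite subrr normr0 mul0r.
- exact: negligible_set0.
move=> p _; have := @sdiff_affine (fun=> 0) p 0 0 0 1 ltr01; rewrite (_ : (fun i => if i then _ else _) = fun=> 0).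
  by apply => x _ _; ring.
by apply/funext; case.
Qed.

Lemma regularB v w : regular v -> regular w -> regular (fun p => v p - w p).
Proof.
move=> hv hw; have := regular_lin (-1) hw hv; congr regular.
by apply/funext => p; ring.
Qed.

Lemma regular_sum (I : Type) (s : seq I) (F : I -> R * R -> R) (a : I -> R) :
  (forall i, regular (F i)) -> regular (fun p => \sum_(i <- s) a i * F i p).
Proof.
move=> hF; elim: s => [|i s IH].
  by have := regular0; congr regular; apply/funext => p; rewrite big_nil.
have := regular_lin (a i) (hF i) IH; congr regular.
by apply/funext => p; rewrite big_cons.
Qed.

Lemma regular_wdiff v : regular v -> wdiff v.
Proof. by move=> [b [L [N [G h]]]]; exact: lipreg_wdiff h. Qed.

Lemma regular_Rint_wp v i : regular v -> \int[mu]_p (wp i v p) = 0.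
Proof.
move=> [b [L [N [G h]]]]; have [b0 hv v0 N0 hG] := h.
have M0 := lipreg_wp i h.
apply: (@Rint_derivative0 _ _ _ L v _ (axis i) (N `|` [set p : P | wp i v p != G p i]) b0 (lip_bdd b0 hv v0)).
- exact: L2_mfun (wdiff_L2 i (lipreg_wdiff h)).
- exact: negligibleU.
- by move=> n p; have := lip_dquot (axis i) n p hv; rewrite axis_norm mulr1.
move=> p /not_orP [hp /negP]; rewrite negbK => /eqP ->.
by rewrite -axis_dot; apply: sdiff_dquot; exact: hG.
Qed.

Lemma gip_sum (I : Type) (s : seq I) (F : I -> R * R -> R) (a : I -> R) z :
  (forall i, regular (F i)) -> regular z ->
  gip (fun p => \sum_(i <- s) a i * F i p) z = \sum_(i <- s) a i * gip (F i) z.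
Proof.
move=> hF hz; elim: s => [|i s IH].
  rewrite big_nil (_ : (fun p => _) = (fun p => -1 * z p + z p)); last first.
    by apply/funext => p; rewrite big_nil; ring.
  have wz := regular_wdiff hz; rewrite gip_linl //; ring.
rewrite big_cons -IH -gip_linl; try exact: regular_wdiff.
  by congr (gip _ _); apply/funext => p; rewrite big_cons.
exact/regular_wdiff/regular_sum.
Qed.

Lemma gip_lipreg_le b L v N (G : R * R -> bool -> R) : lipreg b L v N G ->
  gip v v <= 2 * (L ^+ 2 * (2 * (b + 1)) ^+ 2).
Proof.
move=> h; have [b0 hv v0 N0 hG] := h; have L0 := lip_ge0 hv.
have b1 : 0 <= b + 1 by lra.
have k i : ip (wp i v) (wp i v) <= L ^+ 2 * (2 * (b + 1)) ^+ 2.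
  have [w [hw ww _]] := lipreg_weak i h; have [hwp M0] := wpP ww.
  have mw := L2_mfun hwp.1; have [mw' wc _] := hw.
  rewrite ipE (@Rint_ae _ _ _ (fun p => w p * w p) M0); first last.
  - by move=> p /negP; rewrite negbK => /eqP ->.
  - exact: measurable_funM.
  - exact: measurable_funM.
  apply: le_trans (ler_norm _) _; have := normr_Rint_bdd b1 (bddM mw' wc hw).
  by rewrite -expr2.
by rewrite gipE mulr_natl mulr2n; apply: lerD.
Qed.

Definition tlip K : R := `|(gr K).1| + `|(gr K).2| + `|(gd K).1| + `|(gd K).2|.

Lemma tlip_ge0 K : 0 <= tlip K.
Proof. by rewrite !addr_ge0. Qed.

Lemma trd_dist K p q : dist1 (trd K p) (trd K q) <= tlip K * dist1 p q.
Proof.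
rewrite {1}/dist1 /= tr_diff td_diff /tlip /dist1.
set x := p.1 - q.1; set y := p.2 - q.2.
have h1 := ler_normD ((gr K).1 * x) ((gr K).2 * y).
have h2 := ler_normD ((gd K).1 * x) ((gd K).2 * y).
rewrite (normrM (gr K).1) (normrM (gr K).2) in h1.
rewrite (normrM (gd K).1) (normrM (gd K).2) in h2.
have m1 := mulr_ge0 (normr_ge0 (gr K).1) (normr_ge0 y).
have m2 := mulr_ge0 (normr_ge0 (gr K).2) (normr_ge0 x).
have m3 := mulr_ge0 (normr_ge0 (gd K).1) (normr_ge0 y).
have m4 := mulr_ge0 (normr_ge0 (gd K).2) (normr_ge0 x).
lra.
Qed.

Lemma tlip_nbhs K p (e : R) : 0 < e -> exists2 d : R, 0 < d & forall q,
  `|q.1 - p.1| < d -> `|q.2 - p.2| < d -> dist1 (trd K q) (trd K p) < e.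
Proof.
move=> e0; have t0 := tlip_ge0 K; have t1 : 0 < 2 * (tlip K + 1) by lra.
exists (e / (2 * (tlip K + 1))); first by rewrite divr_gt0.
move=> q q1 q2; apply: le_lt_trans (trd_dist K q p) _.
have : dist1 q p < e / (tlip K + 1).
  rewrite /dist1 (_ : e / (tlip K + 1) = e / (2 * (tlip K + 1)) + e / (2 * (tlip K + 1))).
    exact: ltrD.
  by field; apply: lt0r_neq0; lra.
rewrite ltr_pdivlMr; last lra.
by have := dist1_ge0 q p; lra.
Qed.

Lemma outside_nbhs K p : tdet K != 0 -> ~ hull K p -> exists2 d : R, 0 < d & forall q,
  `|q.1 - p.1| < d -> `|q.2 - p.2| < d -> ~ hull K q.
Proof.
move=> D0; rewrite hullP // /in_ref /= => h.
pose m : R := Num.max (- tr K p) (`|td K p| - (1 - tr K p)).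
have m0 : 0 < m.
  rewrite lt_max oppr_gt0 subr_gt0; apply/orP.
  have [h1|h1] := ltP (tr K p) 0; first by left.
  by right; rewrite ltNge; apply/negP => h2; apply: h.
have [d d0 hd] := tlip_nbhs K p m0.
exists d => // q q1 q2; rewrite hullP // => -[/= h1 h2].
have := hd q q1 q2; rewrite /dist1 /= lt_max.
have := ler_norm (tr K q - tr K p); have := ler_norm (- (tr K q - tr K p)).
have := normr_sub_le (td K p) (td K q); have := ler_norm (`|td K p| - `|td K q|).
rewrite normrN [`|td K p - td K q|]distrC => n1 n2 n3 n4 /orP[] n5.
  by have := normr_ge0 (td K q - td K p); lra.
by lra.
Qed.

Lemma tgrad_det K : tdet K != 0 ->
  (gr K).1 * (gd K).2 - (gr K).2 * (gd K).1 = 2 / tdet K.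
Proof.
case: K => [[[z1 z2] [a1 a2]] [b1 b2]].
by rewrite /gr /gd tdetE /newest /edge1 /edge2 /= => D0; field.
Qed.

Lemma negligible_ref_line K (s t c : R) : tdet K != 0 -> (s, t) != 0 ->
  mu.-negligible [set p : P | s * tr K p + t * td K p = c].
Proof.
move=> D0 st.
pose a := s * (gr K).1 + t * (gd K).1; pose b := s * (gr K).2 + t * (gd K).2.
have ab : (a, b) != 0.
  apply/eqP => -[a0 b0]; have := tgrad_det D0; set D := 2 / _ => hD.
  have DN : D != 0 by rewrite mulf_neq0 ?invr_eq0.
  have s0 : s * D = 0.
    have -> : s * D = a * (gd K).2 - b * (gd K).1 by rewrite -hD /a /b; ring.
    by rewrite a0 b0; ring.
  have t0 : t * D = 0.
    have -> : t * D = b * (gr K).1 - a * (gr K).2 by rewrite -hD /a /b; ring.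
    by rewrite a0 b0; ring.
  move/eqP: st; apply; congr pair; apply/eqP.
    by move/eqP: s0; rewrite mulf_eq0 (negbTE DN) orbF.
  by move/eqP: t0; rewrite mulf_eq0 (negbTE DN) orbF.
have := @negligible_line R a b (c - s * tr K 0 - t * td K 0) ab.
apply: negligibleS => p /= <-; rewrite /a /b /tr /td /=; ring.
Qed.

Lemma negligible_boundary K : tdet K != 0 ->
  mu.-negligible [set p : P | hull K p /\ ~ strict K p].
Proof.
move=> D0.
have n1 := @negligible_ref_line K 1 0 0 D0; have n2 := @negligible_ref_line K 1 1 1 D0.
have n3 := @negligible_ref_line K 1 (-1) 1 D0.
apply: negligibleS (negligibleU (n1 _) (negligibleU (n2 _) (n3 _))).
- move=> p /= [/(hullP _ D0) [/= h1 h2] h3]; apply: contrapT => /not_orP[k1 /not_orP[k2 k3]].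
  apply: h3; split => /=.
    by rewrite lt_neqAle h1 andbT; apply/eqP => e; apply: k1; rewrite -e; ring.
  rewrite lt_neqAle h2 andbT; apply/eqP => e; have [d0|d0] := leP 0 (td K p).
    by apply: k2; rewrite ger0_norm // in e; rewrite e; ring.
  by apply: k3; rewrite ltr0_norm // in e; rewrite mulN1r e; ring.
- by apply/eqP => -[/eqP]; rewrite oner_eq0.
- by apply/eqP => -[/eqP]; rewrite oner_eq0.
- by apply/eqP => -[/eqP]; rewrite oner_eq0.
Qed.

(** The boundaries of the descendants of all generations: one null set for the tower and for all its
    partial sums. *)
Definition skel T : set P :=
  [set p | exists w : seq bool, hull (node T w) p /\ ~ strict (node T w) p].

Lemma negligible_skel T : tdet T != 0 -> mu.-negligible (skel T).
Proof.
move=> D0; pose F n : set P := if unpickle n is Some w then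
  [set p | hull (node T w) p /\ ~ strict (node T w) p] else set0.
apply: (@negligibleS _ _ _ _ (\bigcup_n F n)).
  by move=> p [w hw]; exists (pickle w) => //; rewrite /F pickleK.
apply: negligible_bigcup => n; rewrite /F; case: unpickle => [w|]; last exact: negligible_set0.
exact/negligible_boundary/tdet_node.
Qed.

Definition tbox K : R := `|(newest K).1| + `|(newest K).2| + `|(edge1 K).1| + `|(edge1 K).2| +
  `|(edge2 K).1| + `|(edge2 K).2|.

Lemma hull_box K : hull K `<=` in_box (tbox K).
Proof.
move=> _ [r [s [t [[r0 s0 t0 rst] ->]]]].
have le1 (a x : R) : 0 <= a -> a <= 1 -> `|a *: (x : R^o)| <= `|x|.
  by move=> a0 a1; rewrite normrM ger0_norm // ler_piMl.
have key (x y z : R) : `|r * x + s * y + t * z| <= `|x| + `|y| + `|z|.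
  apply: le_trans (ler_normD _ _) _; apply: lerD; last by apply: le1 => //; lra.
  by apply: le_trans (ler_normD _ _) _; apply: lerD; apply: le1 => //; lra.
have n1 := normr_ge0 (newest K).1; have n2 := normr_ge0 (newest K).2.
have n3 := normr_ge0 (edge1 K).1; have n4 := normr_ge0 (edge1 K).2.
have n5 := normr_ge0 (edge2 K).1; have n6 := normr_ge0 (edge2 K).2.
split; [apply: le_trans (key (newest K).1 (edge1 K).1 (edge2 K).1) _|
        apply: le_trans (key (newest K).2 (edge1 K).2 (edge2 K).2) _]; rewrite /tbox; lra.
Qed.

(** Off the skeleton a point of [T] is interior to a descendant of any given generation, where [h]
    is affine up to a remainder with small Lipschitz constant. The remainder is the tail for the
    tower and zero for a partial sum. *)
Lemma lipreg_trd (h : R * R -> R) (L : R) T : tdet T != 0 ->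
  (forall x y, `|h x - h y| <= L * dist1 x y) -> (forall x, bnd_ref x -> h x = 0) ->
  (forall e, 0 < e -> exists g, forall w : seq bool, size w = g -> exists2 phi,
     affine_on (hull (node T w)) phi &
     forall p q, hull (node T w) p -> hull (node T w) q ->
      `|h (trd T p) - phi p - (h (trd T q) - phi q)| <= e * dist1 p q) ->
  exists G : R * R -> bool -> R, lipreg (tbox T) (L * tlip T) (fun p => h (trd T p)) (skel T) G.
Proof.
move=> D0 hL h0 happ.
have L0 : 0 <= L.
  have := hL (1, 0) 0; rewrite /dist1 /= subr0 normr1 subr0 normr0 addr0 mulr1.
  exact: le_trans.
have out p : ~ hull T p -> h (trd T p) = 0.
  by move=> hp; apply: h0 => hs; apply: hp; exact: strict_hull.
have /choice [G hG] : forall p, exists g, ~ skel T p -> sdiff (fun p => h (trd T p)) p g.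
  move=> p; have [hN|hN] := pselect (skel T p); first by exists (fun=> 0).
  have [hp|hp] := pselect (hull T p); last first.
    have [d d0 hd] := outside_nbhs D0 hp; exists (fun i : bool => if i then 0 else 0) => _.
    apply: (sdiff_affine d0 (c := 0)) => x x1 x2; rewrite out; [ring|exact: hd].
  have [G hG] : exists g, sdiff (fun p => h (trd T p)) p g; last by exists G.
  apply: sdiff_approx => e e0; have [g hg] := happ e e0.
  have [w [sw hw]] := node_cover g D0 hp.
  have [phi [a [b [c haff]]] hphi] := hg w sw.
  have sp : strict (node T w) p by apply: contrapT => hs; apply: hN; exists w.
  have [d d0 hd] := strict_nbhs sp.
  exists (fun i : bool => if i then b else a), d => // x y x1 x2 y1 y2.
  have hx := strict_hull (tdet_node w D0) (hd _ x1 x2).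
  have hy := strict_hull (tdet_node w D0) (hd _ y1 y2).
  have := hphi x y hx hy; rewrite !haff //; apply: le_trans.
  by rewrite le_eqVlt; apply/orP; left; apply/eqP; congr `|_|; ring.
exists G; split => //.
- by rewrite !addr_ge0.
- move=> p q; apply: le_trans (hL _ _) _; rewrite -mulrA ler_wpM2l //; exact: trd_dist.
- by move=> p hp; apply: out => /hull_box.
- exact: negligible_skel.
Qed.

Definition ufun k T p := tower k (trd T p).

Lemma lipreg_ufun k T : (1 < k)%N -> tdet T != 0 ->
  exists G : R * R -> bool -> R, lipreg (tbox T) (4 * tlip T) (ufun k T) (skel T) G.
Proof.
move=> k1 D0; have k0 : (0 < k)%N by apply: ltnW.
apply: lipreg_trd => //; [exact: tower_dist|exact: tower_bnd|].
move=> e e0; have t0 := tlip_ge0 T.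
have e1 : 0 < e / (4 * (tlip T + 1)) by rewrite divr_gt0 //; lra.
have [J hJ] : exists J, 2^-1 ^+ J < e / (4 * (tlip T + 1)).
  have : (fun n : nat => 2^-1 ^+ n : R) @ \oo --> (0 : R).
    by apply: cvg_expr; rewrite gtr0_norm ?invr_gt0 // invf_lt1 // ltr1n.
  move/cvgrPdist_lt => /(_ _ e1) [J _ /(_ J (leqnn J))].
  by rewrite /= sub0r normrN ger0_norm ?exprn_ge0 // => h; exists J.
(* The partial sum is affine on these descendants, and the tail has a Lipschitz constant of order
   2^(-kJ), which the choice of [J] makes small. *)
exists (k * J).*2 => w sw; exists (fun p => psum k J (trd T p)).
  by apply: psum_affine => //; rewrite sw.
move=> p q _ _; apply: le_trans (tail_dist k0 J _ _) _.
have h1 : 2^-1 ^+ (k * J) <= 2^-1 ^+ J :> R.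
  by rewrite ler_wiXn2l ?leq_pmull // invf_le1 // ler1n.
have h2 : 4 * 2^-1 ^+ (k * J) * (tlip T + 1) <= e.
  rewrite -ler_pdivlMr; last lra.
  have -> : e / (tlip T + 1) = 4 * (e / (4 * (tlip T + 1))).
    by field; rewrite lt0r_neq0 //; lra.
  by rewrite ler_wpM2l // (le_trans h1) // ltW.
have d0 := dist1_ge0 p q.
apply: le_trans (ler_wpM2r d0 h2); rewrite -[leRHS]mulrA ler_wpM2l ?mulr_ge0 ?exprn_ge0 //.
by apply: le_trans (trd_dist T p q) _; rewrite ler_wpM2r //; lra.
Qed.

Lemma regular_ufun k T : (1 < k)%N -> tdet T != 0 -> regular (ufun k T).
Proof. by move=> k1 /(lipreg_ufun k1) [G h]; do 4 eexists; exact: h. Qed.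

Lemma lipreg_psum k J T : (1 < k)%N -> tdet T != 0 ->
  exists G : R * R -> bool -> R, lipreg (tbox T) (4 * tlip T) (fun p => psum k J (trd T p)) (skel T) G.
Proof.
move=> k1 D0; have k0 : (0 < k)%N by apply: ltnW.
apply: lipreg_trd => //; [by move=> x y; exact: psum_dist|by move=> x; exact: psum_bnd|].
move=> e e0; exists (k * J).*2 => w sw; exists (fun p => psum k J (trd T p)).
  by apply: psum_affine => //; rewrite sw.
by move=> p q _ _; rewrite !subrr normr0 mulr_ge0 ?dist1_ge0 // ltW.
Qed.

Lemma regular_psum k J T : (1 < k)%N -> tdet T != 0 -> regular (fun p => psum k J (trd T p)).
Proof. by move=> k1 /(lipreg_psum J k1) [G h]; do 4 eexists; exact: h. Qed.

(** The gradient of [v] vanishes outside [T], so the gradient of [phi] may be replaced by its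
    constant value on [T]; the derivatives of [v] have integral zero. This yields Galerkin
    orthogonality and also removes the coarser levels from a local pairing. *)
Lemma gip_affine T phi v : tdet T != 0 -> regular phi -> affine_on (hull T) phi ->
  regular v -> (forall p, ~ hull T p -> v p = 0) -> gip phi v = 0.
Proof.
move=> D0 hphi [a [b [c aff]]] hv v0.
have wphi := regular_wdiff hphi; have wv := regular_wdiff hv.
have k i : ip (wp i phi) (wp i v) = 0.
  rewrite ipE; pose ci := if i then b else a.
  have [b1 [L1 [N1 [G1 h1]]]] := hphi; have [b2 [L2' [N2 [G2 h2]]]] := hv.
  have n1 := lipreg_wp i h1; have n2 := lipreg_wp i h2.
  have [_ _ _ N10 hG1] := h1; have [_ _ _ N20 hG2] := h2.
  have m1 := L2_mfun (wdiff_L2 i wphi); have m2 := L2_mfun (wdiff_L2 i wv).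
  have nn := negligibleU (negligibleU n1 n2) (negligibleU (negligibleU N10 N20) (negligible_boundary D0)).
  rewrite (@Rint_ae _ _ _ (fun p => ci * wp i v p) nn).
  - rewrite RintegralZl //=; first by rewrite regular_Rint_wp // mulr0.
    have [w [hw ww _]] := lipreg_weak i h2; have [_ M0] := wpP ww.
    apply: (itg_ae M0 (bdd_itg hw)) => // p /negP; rewrite negbK => /eqP -> //.
  - exact: measurable_funM.
  - by apply: measurable_funM => //; exact: measurable_cst.
  move=> p /not_orP[/not_orP[/negP e1 /negP e2] /not_orP[/not_orP[k1 k2] k3]].
  rewrite negbK in e1; rewrite negbK in e2; rewrite (eqP e1) (eqP e2).
  have [hp|hp] := pselect (hull T p).
    have sp : strict T p by apply: contrapT => hs; apply: k3.
    have [d d0 hd] := strict_nbhs sp; congr (_ * _).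
    have sd : sdiff phi p (fun i => if i then b else a).
      apply: (sdiff_affine d0 (c := c)) => x x1 x2.
      by apply: aff; apply: strict_hull => //; exact: hd.
    exact: (sdiff_unique i (hG1 _ k1) sd).
  have [d d0 hd] := outside_nbhs D0 hp.
  have sd : sdiff v p (fun i => if i then 0 else 0).
    by apply: (sdiff_affine d0 (c := 0)) => x x1 x2; rewrite v0; [ring|exact: hd].
  by rewrite (sdiff_unique i (hG2 _ k2) sd); case: (i); rewrite !mulr0.
by rewrite gipE !k addr0.
Qed.

End Regular.

(** * Piecewise affine profiles of one variable *)

Section PiecewiseAffine.
Context {R : realType}.
Local Notation P := (measurableTypeR R * measurableTypeR R)%type.
Local Notation mu := (@plane_measure R).
Implicit Types (v w h : R * R -> R) (p q x y : R * R) (s t : R) (f g : R -> R).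

(** Affine off the kinks -1, 0 and 1, which all profiles below share. *)
Definition piece (f f' : R -> R) := forall t, t != 0 -> `|t| != 1 ->
  exists2 d : R, 0 < d & forall s, `|s - t| < d -> f s = f t + f' t * (s - t).

Definition lip1 (f : R -> R) := (forall s t, `|f s - f t| <= `|s - t|) /\ forall t, `|f t| <= 1.

Definition hat t : R := Num.max 0 (1 - `|t|).
(** Here and in [clip], bounded substitutes for the positive part and for the identity. They agree
    with these on [-1, 1], the support of [hat], so that products with [hat] may use them as factors
    with bound and Lipschitz constant 1. *)
Definition ramp t : R := Num.max 0 (Num.min 1 t).
Definition clip t : R := Num.max (- 1) (Num.min 1 t).
Definition step t : R := (0 < t)%R%:R.
Definition dramp t : R := (0 < t < 1)%R%:R.
Definition dhat t : R := (- 1 < t < 0)%R%:R - dramp t.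
Definition dclip t : R := (- 1 < t < 1)%R%:R.

Lemma hat_ge0 t : 0 <= hat t. Proof. by rewrite le_max lexx. Qed.

Lemma hat_le1 t : hat t <= 1.
Proof. by rewrite ge_max ler01 /=; have := normr_ge0 t; lra. Qed.

Lemma hat_out t : 1 <= `|t| -> hat t = 0.
Proof. by move=> h; rewrite /hat max_l //; lra. Qed.

Lemma lip1_hat : lip1 hat.
Proof.
split=> [s t|t]; last by rewrite ger0_norm ?hat_ge0 ?hat_le1.
have := normr_sub_le s t; rewrite /hat; set a := `|s|; set b := `|t|; set c := `|s - t|.
rewrite ler_norml => /andP[h1 h2].
by case: (leP 0 (1 - a)); case: (leP 0 (1 - b)); rewrite ler_norml; lra.
Qed.

Lemma lip1_ramp : lip1 ramp.
Proof.
split=> [s t|t]; last first.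
  rewrite /ramp ler_norml; case: (leP 1 t) => h1; first by rewrite max_r //; lra.
  by case: (leP 0 t) => h2; lra.
rewrite /ramp; have := ler_norm (s - t); have := ler_norm (- (s - t)); rewrite normrN.
set c := `|_| => h1 h2.
case: (leP 1 s) => h3; case: (leP 1 t) => h4; rewrite ?(max_r ler01);
  rewrite ?subrr ?normr0 //; first lra; rewrite ler_norml.
- by case: (leP 0 t); lra.
- by case: (leP 0 s); lra.
- by case: (leP 0 t); case: (leP 0 s); lra.
Qed.

Lemma lip1_clip : lip1 clip.
Proof.
split=> [s t|t]; last first.
  by rewrite /clip; case: (leP 1 t) => h1; [case: (leP (-1) (1 : R))|case: (leP (-1) t)] => h2; rewrite ler_norml; lra.
rewrite /clip; have := ler_norm (s - t); have := ler_norm (- (s - t)); rewrite normrN.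
set c := `|_| => h1 h2; rewrite ler_norml.
case: (leP 1 s) => h3; case: (leP 1 t) => h4; case: (leP (-1) (1 : R)) => h5;
  case: (leP (-1) t) => h6; case: (leP (-1) s) => h7; lra.
Qed.

Variant off_kinks t : Prop :=
| Kink_ll of t < -1 | Kink_l of -1 < t & t < 0 | Kink_r of 0 < t & t < 1 | Kink_rr of 1 < t.

Lemma off_kinksP t : t != 0 -> `|t| != 1 -> off_kinks t.
Proof.
move=> t0 t1; have n1 : t != 1 by apply: contra_neq t1 => ->; rewrite normr1.
have n2 : t != - 1 by apply: contra_neq t1 => ->; rewrite normrN1.
by case: (ltgtP t 0) t0 => // h _; [case: (ltgtP t (-1)) n2|case: (ltgtP t 1) n1] => // h' _;
  [apply: Kink_ll|apply: Kink_l|apply: Kink_r|apply: Kink_rr].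
Qed.

Lemma piece_of (f f' : R -> R) :
  (forall s t, t < -1 -> s < -1 -> f s = f t + f' t * (s - t)) ->
  (forall s t, -1 < t < 0 -> -1 < s < 0 -> f s = f t + f' t * (s - t)) ->
  (forall s t, 0 < t < 1 -> 0 < s < 1 -> f s = f t + f' t * (s - t)) ->
  (forall s t, 1 < t -> 1 < s -> f s = f t + f' t * (s - t)) -> piece f f'.
Proof.
move=> h1 h2 h3 h4 t t0 t1; have [k|k k'|k k'|k] := off_kinksP t0 t1.
- exists (-1 - t) => [|s]; [lra|rewrite ltr_norml => /andP[a b]; apply: h1; lra].
- exists (Num.min (t + 1) (- t)) => [|s]; first by rewrite lt_min; lra.
  rewrite lt_min !ltr_norml => /andP[/andP[a b] /andP[c d]]; apply: h2; lra.
- exists (Num.min t (1 - t)) => [|s]; first by rewrite lt_min; lra.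
  rewrite lt_min !ltr_norml => /andP[/andP[a b] /andP[c d]]; apply: h3; lra.
- exists (t - 1) => [|s]; [lra|rewrite ltr_norml => /andP[a b]; apply: h4; lra].
Qed.

Lemma kink_ll t : t < -1 -> (hat t = 0) * (dhat t = 0) * (ramp t = 0) * (dramp t = 0) *
  (clip t = -1) * (dclip t = 0) * (step t = 0).
Proof.
move=> k; rewrite /dhat /dramp /dclip /step.
have -> : (-1 < t) = false by apply/negbTE; rewrite -leNgt; lra.
have -> : (0 < t) = false by apply/negbTE; rewrite -leNgt; lra.
rewrite hat_out ?ler0_norm; [|lra|lra].
rewrite (_ : ramp t = 0); last by rewrite /ramp min_r ?max_l; lra.
rewrite (_ : clip t = -1); last by rewrite /clip min_r ?max_l; lra.
by rewrite /= subr0.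
Qed.

Lemma kink_l t : -1 < t < 0 -> (hat t = 1 + t) * (dhat t = 1) * (ramp t = 0) * (dramp t = 0) *
  (clip t = t) * (dclip t = 1) * (step t = 0).
Proof.
move=> /andP[k k']; rewrite /dhat /dramp /dclip /step.
have -> : (t < 1) = true by lra.
have -> : (0 < t) = false by apply/negbTE; rewrite -leNgt; lra.
rewrite (_ : hat t = 1 + t); last by rewrite /hat ler0_norm ?max_r; lra.
rewrite (_ : ramp t = 0); last by rewrite /ramp min_r ?max_l; lra.
rewrite (_ : clip t = t); last by rewrite /clip min_r ?max_r; lra.
by rewrite k k' /= subr0.
Qed.

Lemma kink_r t : 0 < t < 1 -> (hat t = 1 - t) * (dhat t = -1) * (ramp t = t) * (dramp t = 1) *
  (clip t = t) * (dclip t = 1) * (step t = 1).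
Proof.
move=> /andP[k k']; rewrite /dhat /dramp /dclip /step.
have -> : (t < 0) = false by apply/negbTE; rewrite -leNgt; lra.
have -> : -1 < t by lra.
rewrite (_ : hat t = 1 - t); last by rewrite /hat ger0_norm ?max_r; lra.
rewrite (_ : ramp t = t); last by rewrite /ramp min_r ?max_r; lra.
rewrite (_ : clip t = t); last by rewrite /clip min_r ?max_r; lra.
by rewrite k k' /= sub0r.
Qed.

Lemma kink_rr t : 1 < t -> (hat t = 0) * (dhat t = 0) * (ramp t = 1) * (dramp t = 0) *
  (clip t = 1) * (dclip t = 0) * (step t = 1).
Proof.
move=> k; rewrite /dhat /dramp /dclip /step.
have -> : (t < 0) = false by apply/negbTE; rewrite -leNgt; lra.
have -> : (t < 1) = false by apply/negbTE; rewrite -leNgt; lra.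
have -> : 0 < t by lra.
rewrite hat_out ?ger0_norm; [|lra|lra].
rewrite (_ : ramp t = 1); last by rewrite /ramp min_l ?max_r; lra.
rewrite (_ : clip t = 1); last by rewrite /clip min_l ?max_r; lra.
by rewrite !andbF /= subr0.
Qed.

Lemma pieces : [/\ piece hat dhat, piece ramp dramp, piece clip dclip & piece step (fun=> 0)].
Proof.
split; apply: piece_of => s t ht hs.
all: first [rewrite !(kink_ll ht) !(kink_ll hs)|rewrite !(kink_l ht) !(kink_l hs)
  |rewrite !(kink_r ht) !(kink_r hs)|rewrite !(kink_rr ht) !(kink_rr hs)]; ring.
Qed.

(** Primitives: [quad] is the derivative of [clip * hat^2], [step * quad] that of [ramp * hat^2],
    and [step * dquad] is that of [-2 * ramp * hat] up to the remainder [-2 * dramp * hat], which is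
    the only one with nonzero mean. *)
Lemma kink_identities t : t != 0 -> `|t| != 1 ->
  [/\ dclip t * (hat t * hat t) + clip t * (hat t * dhat t + hat t * dhat t) =
        3 * (hat t * hat t) - 2 * hat t,
      dramp t * (hat t * hat t) + ramp t * (hat t * dhat t + hat t * dhat t) =
        step t * (3 * (hat t * hat t) - 2 * hat t)
    & step t * ((6 * hat t - 2) * dhat t) =
        - (2 * (dramp t * hat t + ramp t * dhat t) + 2 * (dramp t * hat t))].
Proof.
move=> t0 t1; case: (off_kinksP t0 t1) => [h|h h'|h h'|h].
- by rewrite !(kink_ll h); split; ring.
- by rewrite !(kink_l (t := t)) ?h //; split; ring.
- by rewrite !(kink_r (t := t)) ?h //; split; ring.
- by rewrite !(kink_rr h); split; ring.
Qed.

Lemma measurable_pieces :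
  [/\ measurable_fun setT hat, measurable_fun setT ramp, measurable_fun setT clip,
      measurable_fun setT step & measurable_fun setT dhat /\ measurable_fun setT dramp].
Proof.
have cont f : lip1 f -> measurable_fun setT f.
  move=> [hf _]; apply: continuous_measurable_fun => t; apply/cvgrPdist_lt => e e0.
  near=> s; apply: le_lt_trans (hf t s) _; near: s.
  by move: e e0; apply/cvgrPdist_lt.
have itv (i : interval R) : measurable_fun setT (fun t : R => (t \in i)%:R : R).
  rewrite (_ : (fun t => _) = \1_[set` i]); first exact: measurable_indic.
  by apply/funext => t; rewrite indicE mem_setE.
have mr : measurable_fun setT dramp.
  by rewrite (_ : dramp = fun t => (t \in `]0, 1[)%:R) //; apply/funext => t; rewrite in_itv.
split; [exact: cont lip1_hat|exact: cont lip1_ramp|exact: cont lip1_clip| |split=> //].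
  by rewrite (_ : step = fun t => (t \in `]0, +oo[)%:R) //; apply/funext => t; rewrite in_itv /= andbT.
apply: measurable_funB => //.
by rewrite (_ : (fun t => _) = fun t => (t \in `]-1, 0[)%:R) //; apply/funext => t; rewrite in_itv.
Unshelve. all: end_near. Qed.

Lemma sdiff_coord (f f' : R -> R) x (j : bool) : piece f f' ->
  let c (y : R * R) := if j then y.2 else y.1 in c x != 0 -> `|c x| != 1 ->
  sdiff (fun y => f (c y)) x (fun i => if i == j then f' (c x) else 0).
Proof.
move=> hf c t0 t1; have [d d0 hd] := hf _ t0 t1.
have := @sdiff_affine R (fun y => f (c y)) x (if j then 0 else f' (c x)) (if j then f' (c x) else 0)
  (f (c x) - f' (c x) * c x) d d0.
rewrite (_ : (fun i : bool => _) = (fun i => if i == j then f' (c x) else 0)); last first.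
  by apply/funext => -[]; case: (j).
apply => y y1 y2; rewrite hd; last by rewrite /c; case: (j).
by rewrite /c; case: (j); ring.
Qed.

Lemma sdiff_near_le v p (G : bool -> R) : sdiff v p G -> exists2 d : R, 0 < d & forall x y,
  `|x.1 - p.1| < d -> `|x.2 - p.2| < d -> `|y.1 - p.1| < d -> `|y.2 - p.2| < d ->
  `|v x - v y| <= (`|G false| + `|G true| + 1) * dist1 x y.
Proof.
move=> /(_ 1 ltr01) [d d0 h]; exists d => // x y h1 h2 h3 h4.
have := h x y h1 h2 h3 h4; rewrite -/(dist1 x y) mul1r => hh.
rewrite -(subrK (G false * (x.1 - y.1) + G true * (x.2 - y.2)) (v x - v y)).
apply: le_trans (ler_normD _ _) _; rewrite mulrDl mul1r [leRHS]addrC; apply: lerD => //.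
apply: le_trans (ler_normD _ _) _; rewrite !normrM /dist1 mulrDl.
have := mulr_ge0 (normr_ge0 (G false)) (normr_ge0 (x.2 - y.2)).
have := mulr_ge0 (normr_ge0 (G true)) (normr_ge0 (x.1 - y.1)); lra.
Qed.

Lemma sdiffM v w p (G H : bool -> R) : sdiff v p G -> sdiff w p H ->
  sdiff (fun q => v q * w q) p (fun i => v p * H i + w p * G i).
Proof.
move=> hv hw e e0.
have [d1 d10 k1] := sdiff_near_le hv; have [d2 d20 k2] := sdiff_near_le hw.
set A := `|G false| + _ + 1 in k1; set B := `|H false| + _ + 1 in k2.
have A0 : 0 < A by rewrite /A; have := normr_ge0 (G false); have := normr_ge0 (G true); lra.
have B0 : 0 < B by rewrite /B; have := normr_ge0 (H false); have := normr_ge0 (H true); lra.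
pose C := `|v p| + `|w p| + 1.
have C0 : 0 < C by rewrite /C; have := normr_ge0 (v p); have := normr_ge0 (w p); lra.
have e1 : 0 < e / (2 * C) by rewrite divr_gt0 // mulr_gt0.
have [d3 d30 k3] := hv _ e1; have [d4 d40 k4] := hw _ e1.
pose d5 := e / (8 * (A * B + 1)).
have AB : 0 < A * B by exact: mulr_gt0.
have d50 : 0 < d5 by rewrite divr_gt0 // mulr_gt0 //; lra.
exists (Num.min (Num.min d1 d2) (Num.min (Num.min d3 d4) d5)).
  by rewrite !lt_min d10 d20 d30 d40 d50.
move=> x y; rewrite !lt_min => /andP[/andP[x11 x12] /andP[/andP[x13 x14] x15]].
move=> /andP[/andP[x21 x22] /andP[/andP[x23 x24] x25]].
move=> /andP[/andP[y11 y12] /andP[/andP[y13 y14] y15]].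
move=> /andP[/andP[y21 y22] /andP[/andP[y23 y24] y25]].
have a1 := k1 x y x11 x21 y11 y21; have a2 := k2 x y x12 x22 y12 y22.
have z0 : `|p.1 - p.1| < d1 /\ `|p.2 - p.2| < d2 by rewrite !subrr !normr0.
have b1 : `|v x - v p| <= A * (2 * d5).
  have h := k1 x p x11 x21; rewrite !subrr !normr0 in h; apply: le_trans (h d10 d10) _.
  by apply: (ler_wpM2l (ltW A0)); rewrite mulr_natl mulr2n; apply: lerD; exact: ltW.
have b2 : `|w y - w p| <= B * (2 * d5).
  have h := k2 y p y12 y22; rewrite !subrr !normr0 in h; apply: le_trans (h d20 d20) _.
  by apply: (ler_wpM2l (ltW B0)); rewrite mulr_natl mulr2n; apply: lerD; exact: ltW.
have c1 := k3 x y x13 x23 y13 y23; have c2 := k4 x y x14 x24 y14 y24.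
rewrite -/(dist1 x y) in c1 c2 *; set D := dist1 x y in a1 a2 c1 c2 *.
have D0 : 0 <= D by exact: dist1_ge0.
set gv := G false * _ + _ in c1; set gw := H false * _ + _ in c2.
have -> : v x * w x - v y * w y - ((v p * H false + w p * G false) * (x.1 - y.1) +
   (v p * H true + w p * G true) * (x.2 - y.2)) =
   v p * (w x - w y - gw) + w p * (v x - v y - gv) + ((v x - v p) * (w x - w y) + (w y - w p) * (v x - v y)).
  by rewrite /gv /gw; ring.
apply: le_trans (ler_normD _ _) _.
have e2 : `|v p * (w x - w y - gw) + w p * (v x - v y - gv)| <= e / 2 * D.
  apply: le_trans (ler_normD _ _) _; rewrite !normrM.
  have m1 := ler_wpM2l (normr_ge0 (v p)) c2; have m2 := ler_wpM2l (normr_ge0 (w p)) c1.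
  apply: le_trans (lerD m1 m2) _; rewrite -mulrDl.
  have -> : e / 2 * D = C * (e / (2 * C) * D) by field; rewrite lt0r_neq0.
  by apply: ler_wpM2r; [rewrite mulr_ge0 // ltW|rewrite /C lerDl].
have e3 : `|(v x - v p) * (w x - w y) + (w y - w p) * (v x - v y)| <= e / 2 * D.
  apply: le_trans (ler_normD _ _) _; rewrite !normrM.
  have m1 := ler_pM (normr_ge0 _) (normr_ge0 _) b1 a2.
  have m2 := ler_pM (normr_ge0 _) (normr_ge0 _) b2 a1.
  apply: le_trans (lerD m1 m2) _.
  have -> : A * (2 * d5) * (B * D) + B * (2 * d5) * (A * D) = 4 * (A * B * d5) * D by ring.
  apply: ler_wpM2r => //.
  have AB1 : A * B + 1 != 0 by rewrite lt0r_neq0 // addr_gt0.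
  have h : (A * B + 1) * d5 = e / 8 by rewrite /d5; field.
  have -> : e / 2 = 4 * ((A * B + 1) * d5) by rewrite h; field.
  by rewrite ler_pM2l //; apply: ler_wpM2r; [exact: ltW|rewrite lerDl].
by apply: le_trans (lerD e2 e3) _; rewrite -mulrDl -splitr.
Qed.

End PiecewiseAffine.

(** * Test waves *)

Section AffineCoordinates.
Context {R : realType}.
Local Notation P := (measurableTypeR R * measurableTypeR R)%type.
Local Notation mu := (@plane_measure R).
Implicit Types (v w h : R * R -> R) (p q x y : R * R) (s t : R) (f g : R -> R).

Definition off_cross x := [/\ x.1 != 0, `|x.1| != 1, x.2 != 0 & `|x.2| != 1].

Definition der2 f f' := forall x, x.2 != 0 -> `|x.2| != 1 ->
  sdiff (fun y => f y.2) x (fun i => if i then f' x.2 else 0).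

Lemma sdiff_ext v w p (G H : bool -> R) : sdiff v p G -> v =1 w -> G =1 H -> sdiff w p H.
Proof. by move=> h /funext <- /funext <-. Qed.

Lemma der2_piece f f' : piece f f' -> der2 f f'.
Proof. by move=> hf x x0 x1; apply: sdiff_ext (sdiff_coord (j := true) hf x0 x1) _ _ => // -[]. Qed.

Lemma der2M f f' g g' : der2 f f' -> der2 g g' ->
  der2 (fun t => f t * g t) (fun t => f t * g' t + g t * f' t).
Proof.
move=> hf hg x x0 x1; apply: sdiff_ext (sdiffM (hf x x0 x1) (hg x x0 x1)) _ _ => // -[] //.
by rewrite !mulr0 addr0.
Qed.

Lemma der2_lin (a : R) f f' g g' : der2 f f' -> der2 g g' ->
  der2 (fun t => a * f t + g t) (fun t => a * f' t + g' t).
Proof.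
move=> hf hg x x0 x1; apply: sdiff_ext (sdiff_lin a (hf x x0 x1) (hg x x0 x1)) _ _ => // -[] //.
by rewrite mulr0 addr0.
Qed.

Lemma sdiff_tensor f f' x : der2 f f' -> off_cross x ->
  sdiff (fun y => hat y.1 * f y.2) x
    (fun i => if i then hat x.1 * f' x.2 else dhat x.1 * f x.2).
Proof.
move=> hf [x1 x2 x3 x4]; have [ph _ _ _] := @pieces R.
apply: sdiff_ext (sdiffM (sdiff_coord (j := false) ph x1 x2) (hf x x3 x4)) _ _ => // -[] /=.
  by rewrite mulr0 addr0.
by rewrite mulr0 add0r mulrC.
Qed.

(* Even with value 1 at the origin, but of mean zero on either half-line. *)
Definition quad t : R := 3 * (hat t * hat t) + - 2 * hat t.
Definition dquad t : R := (6 * hat t - 2) * dhat t.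

Lemma der2_ext f f' g g' : der2 f f' -> f =1 g -> (forall t, f' t = g' t) -> der2 g g'.
Proof. by move=> h /funext <- /funext <-. Qed.

Lemma der2_quad : der2 quad dquad.
Proof.
have [ph _ _ _] := @pieces R; have dh := der2_piece ph.
have := der2_lin 3 (der2M dh dh) (der2_lin (-2) dh (der2_piece (f := fun=> 0) (f' := fun=> 0) _)).
move=> h; apply: (der2_ext (h _)) => [|t|t]; rewrite /quad /dquad; [|by ring..].
by move=> t _ _; exists 1 => // s _; ring.
Qed.

Lemma quad_le1 t : `|quad t| <= 1.
Proof.
have h0 := hat_ge0 t; have h1 := hat_le1 t; rewrite /quad ler_norml.
by apply/andP; split; nra.
Qed.

Lemma quad_lip s t : `|quad s - quad t| <= 4 * `|s - t|.
Proof.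
have -> : quad s - quad t = (3 * (hat s + hat t) - 2) * (hat s - hat t) by rewrite /quad; ring.
have [hl _] := @lip1_hat R.
rewrite normrM ler_pM //; have := hat_ge0 s; have := hat_le1 s; have := hat_ge0 t; have := hat_le1 t.
by move=> *; rewrite ler_norml; lra.
Qed.

Lemma quad_out t : 1 <= `|t| -> quad t = 0.
Proof. by move=> h; rewrite /quad hat_out //; ring. Qed.

Variables (al be c : R * R).

Definition amap p : R * R := (al.1 * p.1 + al.2 * p.2 + c.1, be.1 * p.1 + be.2 * p.2 + c.2).

Local Notation Y := amap.
Local Notation Q := (in_box (1 : R)).

Definition adet : R := al.1 * be.2 - al.2 * be.1.
Definition anorm : R := `|al.1| + `|al.2| + `|be.1| + `|be.2|.

Lemma amap_dist p q : dist1 (Y p) (Y q) <= anorm * dist1 p q.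
Proof.
rewrite {1}/dist1 /=.
have -> : al.1 * p.1 + al.2 * p.2 + c.1 - (al.1 * q.1 + al.2 * q.2 + c.1) =
  al.1 * (p.1 - q.1) + al.2 * (p.2 - q.2) by ring.
have -> : be.1 * p.1 + be.2 * p.2 + c.2 - (be.1 * q.1 + be.2 * q.2 + c.2) =
  be.1 * (p.1 - q.1) + be.2 * (p.2 - q.2) by ring.
rewrite /anorm /dist1; set x := p.1 - q.1; set y := p.2 - q.2.
have h1 := ler_normD (al.1 * x) (al.2 * y); have h2 := ler_normD (be.1 * x) (be.2 * y).
rewrite !normrM in h1 h2.
have m1 := mulr_ge0 (normr_ge0 al.1) (normr_ge0 y).
have m2 := mulr_ge0 (normr_ge0 al.2) (normr_ge0 x).
have m3 := mulr_ge0 (normr_ge0 be.1) (normr_ge0 y).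
have m4 := mulr_ge0 (normr_ge0 be.2) (normr_ge0 x).
lra.
Qed.

Lemma anorm_ge0 : 0 <= anorm.
Proof. by rewrite !addr_ge0. Qed.

Lemma amap_near p (e : R) : 0 < e -> exists2 d : R, 0 < d & forall q,
  `|q.1 - p.1| < d -> `|q.2 - p.2| < d ->
  `|(Y q).1 - (Y p).1| < e /\ `|(Y q).2 - (Y p).2| < e.
Proof.
move=> e0; have a0 := anorm_ge0; pose d := e / (2 * (anorm + 1)).
have d0 : 0 < d by rewrite divr_gt0 //; lra.
have ed : (anorm + 1) * (2 * d) = e by rewrite /d; field; rewrite lt0r_neq0 //; lra.
exists d => // q q1 q2.
have h : dist1 (Y q) (Y p) < e.
  apply: le_lt_trans (amap_dist q p) _; rewrite -ed.
  apply: (@le_lt_trans _ _ (anorm * (2 * d))).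
    by rewrite ler_wpM2l // /dist1; lra.
  by rewrite ltr_pM2r; lra.
by split; apply: le_lt_trans h; rewrite /dist1 ?lerDl ?lerDr.
Qed.

Lemma sdiff_comp h p (H : bool -> R) : sdiff h (Y p) H ->
  sdiff (fun q => h (Y q)) p
    (fun i => H false * (if i then al.2 else al.1) + H true * (if i then be.2 else be.1)).
Proof.
move=> hh e e0; have a0 := anorm_ge0.
have e1 : 0 < e / (anorm + 1) by rewrite divr_gt0 //; lra.
have [d d0 hd] := hh _ e1; have [d' d'0 near'] := amap_near p d0.
exists d' => // x y x1 x2 y1 y2.
have [k1 k2] := near' _ x1 x2; have [k3 k4] := near' _ y1 y2.
have := hd _ _ k1 k2 k3 k4; rewrite -/(dist1 (Y x) (Y y)) -/(dist1 x y) => k.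
apply: (@le_trans _ _ (e / (anorm + 1) * dist1 (Y x) (Y y))).
  by apply: le_trans k; rewrite le_eqVlt; apply/orP; left; apply/eqP; congr `|_|; rewrite /=; ring.
apply: le_trans (ler_wpM2l (ltW e1) (amap_dist x y)) _.
rewrite mulrA ler_wpM2r ?dist1_ge0 // mulrAC ler_pdivrMr; last lra.
by rewrite ler_wpM2l ?(ltW e0) //; lra.
Qed.

Hypothesis D0 : adet != 0.

(** The basis dual to [al] and [be]: motion along [adir j] moves [amap] along the axis [j].
    Integrals of derivatives in the new coordinates thus become integrals of directional derivatives
    in the plane. *)
Definition adir (j : bool) : R * R :=
  if j then (- al.2 / adet, al.1 / adet) else (be.2 / adet, - be.1 / adet).

Lemma amap_shift p s j : Y (p + s *: adir j) = Y p + s *: axis j.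
Proof.
have D1 := D0; case: j; congr pair; rewrite /= /GRing.scale /= /amap /= ?mulr0 ?mulr1 ?addr0;
  by move: D1; rewrite /adet => D1; field.
Qed.

Lemma adir_dot (H : bool -> R) j :
  let G i := H false * (if i then al.2 else al.1) + H true * (if i then be.2 else be.1) in
  G false * (adir j).1 + G true * (adir j).2 = H j.
Proof.
have D1 := D0; case: j; rewrite /= /adir /=; move: D1; rewrite /adet => D1; by field.
Qed.

Lemma negligible_cross : mu.-negligible [set p : P | ~ off_cross (Y p)].
Proof.
have line (s t r : R) : (s, t) != 0 -> mu.-negligible [set p : P | s * (Y p).1 + t * (Y p).2 = r].
  move=> st; have ab : (s * al.1 + t * be.1, s * al.2 + t * be.2) != 0.
    apply/eqP => -[a0 b0]; move/eqP: st; apply; congr pair; apply: (mulIf D0); rewrite mul0r /adet.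
      have -> : s * (al.1 * be.2 - al.2 * be.1) = (s * al.1 + t * be.1) * be.2 - (s * al.2 + t * be.2) * be.1 by ring.
      by rewrite a0 b0; ring.
    have -> : t * (al.1 * be.2 - al.2 * be.1) = (s * al.2 + t * be.2) * al.1 - (s * al.1 + t * be.1) * al.2 by ring.
    by rewrite a0 b0; ring.
  apply: negligibleS (@negligible_line R _ _ (r - s * c.1 - t * c.2) ab) => p /= <-; ring.
have n1 : (1 : R, 0 : R) != 0 by apply/eqP => -[/eqP]; rewrite oner_eq0.
have n2 : (0 : R, 1 : R) != 0 by apply/eqP => -[/eqP]; rewrite oner_eq0.
apply: negligibleS (negligibleU (negligibleU (line 1 0 0 n1) (negligibleU (line 1 0 1 n1) (line 1 0 (-1) n1)))
  (negligibleU (line 0 1 0 n2) (negligibleU (line 0 1 1 n2) (line 0 1 (-1) n2)))).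
move=> p /= hp; apply: contrapT => /not_orP[/not_orP[h1 /not_orP[h2 h3]] /not_orP[h4 /not_orP[h5 h6]]].
move: h1 h2 h3 h4 h5 h6; rewrite !mul1r !mul0r !addr0 !add0r => h1 h2 h3 h4 h5 h6.
have nn (t : R) : t <> 1 -> t <> -1 -> `|t| != 1.
  move=> t1 t2; apply/eqP => e; have [t0|t0] := leP 0 t.
    by rewrite ger0_norm // in e.
  by apply: t2; rewrite ltr0_norm // in e; rewrite -e opprK.
by apply: hp; split; first [exact/eqP|exact: nn].
Qed.

Definition acenter : R * R := ((al.2 * c.2 - be.2 * c.1) / adet, (be.1 * c.1 - al.1 * c.2) / adet).

Lemma amap_inv p :
  (p.1 - acenter.1 = (be.2 * (Y p).1 - al.2 * (Y p).2) / adet) *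
  (p.2 - acenter.2 = (al.1 * (Y p).2 - be.1 * (Y p).1) / adet).
Proof.
by have D1 := D0; move: D1; rewrite /acenter /amap /adet /= => D1; split; field.
Qed.

Definition arad : R := anorm / `|adet|.

Lemma amap_box p : Q (Y p) -> `|p.1 - acenter.1| <= arad /\ `|p.2 - acenter.2| <= arad.
Proof.
move=> [q1 q2]; have D1 : 0 < `|adet| by rewrite normr_gt0.
have key (a b : R) : `|a| + `|b| <= anorm ->
    `|(a * (Y p).1 - b * (Y p).2) / adet| <= arad.
  move=> ab; rewrite normrM normfV /arad ler_pM2r ?invr_gt0 //.
  apply: le_trans (ler_normB _ _) _; rewrite !normrM; apply: le_trans ab.
  by apply: lerD; rewrite ler_piMr.
have n1 := normr_ge0 al.1; have n2 := normr_ge0 al.2; have n3 := normr_ge0 be.1; have n4 := normr_ge0 be.2.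
split.
  by rewrite (amap_inv p).1; apply: key; rewrite /anorm; lra.
rewrite (amap_inv p).2 -opprB mulNr normrN.
by apply: key; rewrite /anorm; lra.
Qed.

Definition abound : R := `|acenter.1| + `|acenter.2| + arad.

Lemma arad_ge0 : 0 <= arad.
Proof. by rewrite divr_ge0 ?anorm_ge0. Qed.

Lemma abound_ge0 : 0 <= abound.
Proof. by rewrite !addr_ge0 ?arad_ge0. Qed.

Lemma amap_out p : ~ in_box abound p -> ~ Q (Y p).
Proof.
move=> hp /amap_box [h1 h2]; apply: hp; rewrite /abound.
have := ler_normD acenter.1 (p.1 - acenter.1); have := ler_normD acenter.2 (p.2 - acenter.2).
have n1 := normr_ge0 acenter.1; have n2 := normr_ge0 acenter.2.
rewrite !(addrC _ (_ - _)) !subrK => k1 k2; split; lra.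
Qed.

Lemma measurable_amap f (j : bool) : measurable_fun setT f ->
  mfun2 (fun p => f (if j then (Y p).2 else (Y p).1)).
Proof.
move=> mf; apply: (measurableT_comp (f := f)) => //.
apply: continuous_measurable2; apply: (@lip_continuous _ _ anorm) => p q.
rewrite -/(dist1 p q); apply: le_trans (amap_dist p q).
by case: j; rewrite /dist1 ?lerDl ?lerDr.
Qed.

Lemma tensor_bdd f g (k : R) : measurable_fun setT f -> measurable_fun setT g ->
  (forall t, `|g t| <= 1) -> (forall t, `|f t| <= k) ->
  (forall t, 1 < `|t| -> g t = 0) -> (forall t, 1 < `|t| -> f t = 0) ->
  bdd abound k (fun p => g (Y p).1 * f (Y p).2).
Proof.
move=> mf mg hg hf g0 f0; split.
- exact: measurable_funM (measurable_amap false mg) (measurable_amap true mf).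
- by move=> p; rewrite normrM -[leRHS]mul1r ler_pM.
move=> p /amap_out hp; have [h1|h1] := leP `|(Y p).1| 1; last by rewrite g0 ?mul0r.
have [h2|h2] := leP `|(Y p).2| 1; last by rewrite f0 ?mulr0.
by case: hp.
Qed.

Lemma Rint_amap_derivative0 j h w b k (L : R) : 0 <= b -> bdd b k (fun p => h (Y p)) ->
  mfun2 (fun p => w (Y p)) ->
  (forall x s, 0 < s -> `|h (x + s *: axis j) - h x| <= L * s) ->
  (forall x, off_cross x -> exists2 H : bool -> R, sdiff h x H & H j = w x) ->
  \int[mu]_p w (Y p) = 0.
Proof.
move=> b0 hb mw hL hd.
apply: (@Rint_derivative0 _ _ _ L (fun p => h (Y p)) _ (adir j) _ b0 hb mw negligible_cross).
  move=> n p; have n0 := @invS_gt0 R n.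
  rewrite dquotE normrM normfV (gtr0_norm n0) ler_pdivrMl // amap_shift mulrC.
  exact: hL.
move=> p /contrapT hp; have [H hH <-] := hd _ hp.
rewrite -(adir_dot H j); exact: (sdiff_dquot (a := adir j) (sdiff_comp hH)).
Qed.

Lemma Rint_dhat f f' (k : R) : der2 f f' -> measurable_fun setT f -> (forall t, `|f t| <= k) ->
  (forall t, 1 < `|t| -> f t = 0) -> \int[mu]_p (dhat (Y p).1 * f (Y p).2) = 0.
Proof.
move=> df mf fk f0; have [mh _ _ _ [mdh _]] := @measurable_pieces R.
have [hl hl1] := @lip1_hat R.
have := @Rint_amap_derivative0 false (fun x => hat x.1 * f x.2) (fun x => dhat x.1 * f x.2) abound k k.
apply=> //.
- exact: abound_ge0.
- by apply: tensor_bdd => // t h; apply: hat_out; exact: ltW.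
- exact: measurable_funM (measurable_amap false mdh) (measurable_amap true mf).
- move=> x s s0 /=; rewrite scaler0 addr0 -mulrBl normrM mulrC.
  apply: ler_pM => //; apply: le_trans (hl _ _) _.
  by rewrite addrAC subrr add0r /GRing.scale /= mulr1 gtr0_norm.
by move=> x hx; exists (fun i => if i then hat x.1 * f' x.2 else dhat x.1 * f x.2) => //; exact: sdiff_tensor.
Qed.

Lemma Rint_der f f' (k L : R) : der2 f f' -> measurable_fun setT f -> measurable_fun setT f' ->
  (forall t, `|f t| <= k) -> (forall s t, `|f s - f t| <= L * `|s - t|) ->
  (forall t, 1 < `|t| -> f t = 0) -> \int[mu]_p (hat (Y p).1 * f' (Y p).2) = 0.
Proof.
move=> df mf mf' fk fL f0; have [mh _ _ _ _] := @measurable_pieces R.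
have [hl hl1] := @lip1_hat R.
have := @Rint_amap_derivative0 true (fun x => hat x.1 * f x.2) (fun x => hat x.1 * f' x.2) abound k L.
apply=> //.
- exact: abound_ge0.
- by apply: tensor_bdd => // t h; apply: hat_out; exact: ltW.
- exact: measurable_funM (measurable_amap false mh) (measurable_amap true mf').
- move=> x s s0 /=; rewrite scaler0 addr0 -mulrBr normrM -[leRHS]mul1r.
  apply: ler_pM => //; apply: le_trans (fL _ _) _.
  by rewrite addrAC subrr add0r /GRing.scale /= mulr1 gtr0_norm.
by move=> x hx; exists (fun i => if i then hat x.1 * f' x.2 else dhat x.1 * f x.2) => //; exact: sdiff_tensor.
Qed.

Definition wave p : R := hat (Y p).1 * quad (Y p).2.

Lemma measurable_quad : measurable_fun setT (quad : R -> R) /\ measurable_fun setT (dquad : R -> R).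
Proof.
have [mh _ _ _ [mdh _]] := @measurable_pieces R; split.
  apply: measurable_funD; apply: measurable_funM => //; exact: measurable_funM.
apply: measurable_funM => //; apply: measurable_funB => //; exact: measurable_funM.
Qed.

(** By the primitives of [kink_identities], the wave has mean zero on both sides of its line.
    Functions that are constant on either side therefore do not see it. *)
Lemma Rint_wave : \int[mu]_p wave p = 0 /\ \int[mu]_p (step (Y p).2 * wave p) = 0.
Proof.
have [mh mr mc ms [mdh mdr]] := @measurable_pieces R; have [mq mdq] := measurable_quad.
have [ph pr pc ps] := @pieces R; have dh := der2_piece ph.
have [hl hl1] := @lip1_hat R; have [rl rl1] := @lip1_ramp R; have [cl cl1] := @lip1_clip R.
have lipM (f g : R -> R) (k L : R) : (forall t, `|f t| <= 1) -> (forall t, `|g t| <= 1) ->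
    (forall s t, `|f s - f t| <= k * `|s - t|) -> (forall s t, `|g s - g t| <= L * `|s - t|) ->
    forall s t, `|f s * g s - f t * g t| <= (k + L) * `|s - t|.
  move=> f1 g1 fl gl s t.
  have -> : f s * g s - f t * g t = (f s - f t) * g s + f t * (g s - g t) by ring.
  apply: le_trans (ler_normD _ _) _; rewrite !normrM mulrDl; apply: lerD.
    by apply: le_trans (fl s t); rewrite ler_piMr.
  by apply: le_trans (gl s t); rewrite ler_piMl.
have b1M (f g : R -> R) : (forall t, `|f t| <= 1) -> (forall t, `|g t| <= 1) ->
    forall t, `|f t * g t| <= 1.
  by move=> f1 g1 t; rewrite normrM mulr_ile1.
have l1 (f : R -> R) : (forall s t, `|f s - f t| <= `|s - t|) -> forall s t, `|f s - f t| <= 1 * `|s - t|.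
  by move=> h s t; rewrite mul1r.
have negl f g : (forall t, t != 0 -> `|t| != 1 -> f t = g t) -> measurable_fun setT f -> measurable_fun setT g ->
  \int[mu]_p (hat (Y p).1 * f (Y p).2) = \int[mu]_p (hat (Y p).1 * g (Y p).2).
  move=> fg mf mg; apply: (Rint_ae negligible_cross).
  - exact: measurable_funM (measurable_amap false mh) (measurable_amap true mf).
  - exact: measurable_funM (measurable_amap false mh) (measurable_amap true mg).
  by move=> p /contrapT [_ _ h1 h2]; rewrite fg.
have mdc : measurable_fun setT (dclip : R -> R).
  rewrite (_ : dclip = fun t => \1_`]-1, 1[%classic t); first exact: measurable_indic.
  by apply/funext => t; rewrite indicE mem_setE in_itv.
have mhh := measurable_funM mh mh.
split.
  rewrite /wave; have := @Rint_der (fun t => clip t * (hat t * hat t)) _ 1 (1 + (1 + 1)) (der2M (der2_piece pc) (der2M dh dh)).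
  move=> h; rewrite (negl _ (fun t => clip t * (hat t * dhat t + hat t * dhat t) + hat t * hat t * dclip t)).
  - apply: h.
    + exact: measurable_funM.
    + apply: measurable_funD; last exact: measurable_funM.
      by apply: measurable_funM => //; apply: measurable_funD; exact: measurable_funM.
    + by apply: (b1M) => //; apply: (b1M).
    + apply: (lipM) => //; [exact: (b1M)|exact: l1|by apply: (lipM) => //; exact: l1].
    + by move=> t h; rewrite hat_out ?mulr0 // ltW.
  - by move=> t t0 t1; have [h1 _ _] := kink_identities t0 t1; rewrite /quad mulNr -h1; ring.
  - by [].
  - apply: measurable_funD; last exact: measurable_funM.
    by apply: measurable_funM => //; apply: measurable_funD; exact: measurable_funM.
have := @Rint_der (fun t => ramp t * (hat t * hat t)) _ 1 (1 + (1 + 1)) (der2M (der2_piece pr) (der2M dh dh)).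
move=> h; rewrite (eq_Rint (g := fun p => hat (Y p).1 * (step (Y p).2 * quad (Y p).2))); last first.
  by move=> p; rewrite /wave mulrCA.
rewrite (negl (fun t => step t * quad t) (fun t => ramp t * (hat t * dhat t + hat t * dhat t) + hat t * hat t * dramp t)).
- apply: h.
  + exact: measurable_funM.
  + apply: measurable_funD; last exact: measurable_funM.
    by apply: measurable_funM => //; apply: measurable_funD; exact: measurable_funM.
  + by apply: (b1M) => //; apply: (b1M).
  + apply: (lipM) => //; [exact: (b1M)|exact: l1|by apply: (lipM) => //; exact: l1].
  + by move=> t h; rewrite hat_out ?mulr0 // ltW.
- by move=> t t0 t1; have [_ h1 _] := kink_identities t0 t1; rewrite /quad mulNr -h1; ring.
- exact: measurable_funM.
- apply: measurable_funD; last exact: measurable_funM.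
  by apply: measurable_funM => //; apply: measurable_funD; exact: measurable_funM.
Qed.

End AffineCoordinates.

(** * Pairing of a wave with a kinked function *)

Section Wave.
Context {R : realType}.
Local Notation P := (measurableTypeR R * measurableTypeR R)%type.
Local Notation mu := (@plane_measure R).
Implicit Types (v w phi : R * R -> R) (p q x y : R * R) (s t : R).
Variables (al be c : R * R).
Hypothesis D0 : adet al be != 0.
Local Notation Y := (amap al be c).
Local Notation W := (wave al be c).
Local Notation A := (anorm al be).
Local Notation B := (abound al be c).
Local Notation rho := (arad al be).

Definition wave1 p : R := dhat (Y p).1 * quad (Y p).2.
Definition wave2 p : R := hat (Y p).1 * dquad (Y p).2.
(** What remains of the half-plane integral of [wave2] after integration by parts. Its integral is
    bounded from below in [pulse_ge]. *)
Definition pulse p : R := hat (Y p).1 * (dramp (Y p).2 * hat (Y p).2).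

Definition gwave p (i : bool) : R :=
  wave1 p * (if i then al.2 else al.1) + wave2 p * (if i then be.2 else be.1).

Lemma dramp_le1 t : `|dramp t| <= 1 :> R.
Proof. by rewrite /dramp; case: (_ < _ < _); rewrite ?normr1 ?normr0. Qed.

Lemma dhat_le1 t : `|dhat t| <= 1 :> R.
Proof.
rewrite /dhat /dramp; have [h|h] := ltP 0 t.
  by rewrite [t < 0]lt_gtF // andbF sub0r normrN; case: (_ && _); rewrite ?normr1 ?normr0.
by rewrite /= subr0; case: (_ && _); rewrite ?normr1 ?normr0.
Qed.

Lemma dramp_out t : 1 < `|t| -> dramp t = 0 :> R.
Proof.
rewrite /dramp => h; case: (boolP (0 < t < 1)) => // /andP[t0 t1].
by rewrite gtr0_norm // in h; lra.
Qed.

Lemma dhat_out t : 1 < `|t| -> dhat t = 0 :> R.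
Proof.
move=> h; rewrite /dhat dramp_out // subr0; case: (boolP (-1 < t < 0)) => // /andP[t0 t1].
by rewrite ltr0_norm // in h; lra.
Qed.

Lemma dquad_le t : `|dquad t| <= 4 :> R.
Proof.
rewrite /dquad normrM -[leRHS]mulr1; apply: ler_pM => //; last exact: dhat_le1.
by have := hat_ge0 t; have := hat_le1 t; rewrite ler_norml; lra.
Qed.

Lemma dquad_out t : 1 < `|t| -> dquad t = 0 :> R.
Proof. by move=> h; rewrite /dquad dhat_out // mulr0. Qed.

Lemma step_le1 t : `|step t| <= 1 :> R.
Proof. by rewrite /step; case: (_ < _); rewrite ?normr1 ?normr0. Qed.

Lemma wave1_bdd : bdd B 1 wave1.
Proof.
have [mh _ _ ms [mdh _]] := @measurable_pieces R; have [mq mdq] := @measurable_quad R.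
apply: tensor_bdd => //; [exact: dhat_le1|exact: quad_le1|exact: dhat_out|].
by move=> t h; apply: quad_out; exact: ltW.
Qed.

Lemma wave2_bdd : bdd B 4 wave2.
Proof.
have [mh _ _ ms [mdh _]] := @measurable_pieces R; have [mq mdq] := @measurable_quad R.
have [_ hl1] := @lip1_hat R.
apply: tensor_bdd => //; [exact: dquad_le| |exact: dquad_out].
by move=> t h; apply: hat_out; exact: ltW.
Qed.

Lemma pulse_bdd : bdd B 1 pulse.
Proof.
have [mh _ _ ms [_ mdr]] := @measurable_pieces R; have [_ hl1] := @lip1_hat R.
apply: (tensor_bdd c D0 (f := fun t => dramp t * hat t)) => //.
- exact: measurable_funM.
- by move=> t; rewrite normrM mulr_ile1 // dramp_le1.
- by move=> t h; apply: hat_out; exact: ltW.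
- by move=> t h; rewrite dramp_out // mul0r.
Qed.

Lemma step_bdd k v : bdd B k v -> bdd B k (fun p => step (Y p).2 * v p).
Proof.
move=> h; have [_ _ _ ms _] := @measurable_pieces R.
have := bddM (measurable_amap al be c true ms) (fun p => step_le1 (Y p).2) h.
rewrite mulr1 => h'; rewrite (_ : (fun p => _) = fun p => v p * step (Y p).2) //.
by apply/funext => p; rewrite mulrC.
Qed.

Lemma Rint_wave1 : \int[mu]_p wave1 p = 0 /\ \int[mu]_p (step (Y p).2 * wave1 p) = 0.
Proof.
have [mh _ _ ms [mdh _]] := @measurable_pieces R; have [mq mdq] := @measurable_quad R.
have [_ _ _ ps] := @pieces R.
split.
  apply: (Rint_dhat c D0 (@der2_quad R) mq (@quad_le1 R)).
  by move=> t h; apply: quad_out; exact: ltW.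
rewrite (eq_Rint (g := fun p => dhat (Y p).1 * (step (Y p).2 * quad (Y p).2))); last first.
  by move=> p; rewrite /wave1 mulrCA.
apply: (Rint_dhat c D0 (f := fun t => step t * quad t) (k := 1) (der2M (der2_piece ps) (@der2_quad R))).
- exact: measurable_funM.
- by move=> t; rewrite normrM mulr_ile1 ?step_le1 ?quad_le1.
- by move=> t h; rewrite quad_out ?mulr0 // ltW.
Qed.

(** On the half-plane, [step * dquad] is -2 times the derivative [f] of [ramp * hat] minus
    [2 * dramp * hat], and only the latter has nonzero integral. *)
Lemma Rint_wave2 : \int[mu]_p wave2 p = 0 /\
  \int[mu]_p (step (Y p).2 * wave2 p) = - 2 * \int[mu]_p pulse p.
Proof.
have [mh mr _ ms [mdh mdr]] := @measurable_pieces R; have [mq mdq] := @measurable_quad R.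
have [ph pr _ ps] := @pieces R; have [hl hl1] := @lip1_hat R; have [rl rl1] := @lip1_ramp R.
split.
  apply: (Rint_der c D0 (@der2_quad R) mq mdq (@quad_le1 R) (@quad_lip R)).
  by move=> t h; apply: quad_out; exact: ltW.
pose f t := ramp t * dhat t + hat t * dramp t : R.
have mf : measurable_fun setT f by apply: measurable_funD; exact: measurable_funM.
have i0 : \int[mu]_p (hat (Y p).1 * f (Y p).2) = 0.
  apply: (Rint_der c D0 (k := 1) (L := 2) (der2M (der2_piece pr) (der2_piece ph))) => //.
  - exact: measurable_funM.
  - by move=> t; rewrite normrM mulr_ile1.
  - move=> s t.
    have -> : ramp s * hat s - ramp t * hat t = (ramp s - ramp t) * hat s + ramp t * (hat s - hat t) by ring.
    apply: le_trans (ler_normD _ _) _; rewrite !normrM mulr_natl mulr2n; apply: lerD.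
      by apply: le_trans (rl s t); rewrite ler_piMr.
    by apply: le_trans (hl s t); rewrite ler_piMl.
  - by move=> t h; rewrite hat_out ?mulr0 // ltW.
have bf : bdd B 2 (fun p => hat (Y p).1 * f (Y p).2).
  apply: tensor_bdd => //.
  - move=> t; apply: le_trans (ler_normD _ _) _; rewrite !normrM.
    have h1 : `|ramp t| * `|dhat t| <= 1 by rewrite mulr_ile1 ?dhat_le1.
    have h2 : `|hat t| * `|dramp t| <= 1 by rewrite mulr_ile1 ?dramp_le1.
    lra.
  - by move=> t h; apply: hat_out; exact: ltW.
  - by move=> t h; rewrite /f dhat_out // dramp_out // !mulr0 addr0.
transitivity (\int[mu]_p (- 2 * (hat (Y p).1 * f (Y p).2) + - 2 * pulse p)).
  have [mw2 _ _] := step_bdd wave2_bdd.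
  apply: (Rint_ae (negligible_cross c D0)) => //.
    apply: measurable_funD; apply: measurable_funM => //; first by have [] := bf.
    by have [] := pulse_bdd.
  move=> p /contrapT [_ _ h1 h2]; have [_ _ h3] := kink_identities h1 h2.
  by rewrite /wave2 mulrCA h3 /pulse /f; ring.
rewrite RintD; [|exact: itgZ (bdd_itg bf)|exact: itgZ (bdd_itg pulse_bdd)].
rewrite RintZ ?i0 ?mulr0 ?add0r; last exact: bdd_itg bf.
by rewrite RintZ //; exact: bdd_itg pulse_bdd.
Qed.

Lemma sdiff_wave p : off_cross (Y p) -> sdiff W p (gwave p).
Proof.
move=> hp; exact: (sdiff_comp (sdiff_tensor (@der2_quad R) hp)).
Qed.

Lemma lipreg_wave : lipreg B (4 * A) W [set p : P | ~ off_cross (Y p)] gwave.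
Proof.
have [hl hl1] := @lip1_hat R.
split; [exact: abound_ge0| | |exact: negligible_cross|].
- move=> p q; rewrite -mulrA.
  apply: (@le_trans _ _ (4 * dist1 (Y p) (Y q))); last by rewrite ler_wpM2l //; exact: amap_dist.
  rewrite /wave /dist1; set a := (Y p).1; set b := (Y p).2; set a' := (Y q).1; set b' := (Y q).2.
  have -> : hat a * quad b - hat a' * quad b' = (hat a - hat a') * quad b + hat a' * (quad b - quad b') by ring.
  apply: le_trans (ler_normD _ _) _; rewrite !normrM.
  have h1 : `|hat a - hat a'| * `|quad b| <= `|a - a'|.
    by apply: le_trans (hl a a'); rewrite ler_piMr // quad_le1.
  have h2 : `|hat a'| * `|quad b - quad b'| <= 4 * `|b - b'|.
    by apply: le_trans (quad_lip b b'); rewrite ler_piMl.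
  have := normr_ge0 (a - a'); lra.
- move=> p /(amap_out D0) hp; rewrite /wave; have [h1|h1] := leP `|(Y p).1| 1.
    have [h2|h2] := leP `|(Y p).2| 1; first by case: hp.
    by rewrite quad_out ?mulr0 // ltW.
  by rewrite hat_out ?mul0r // ltW.
- by move=> p /contrapT; exact: sdiff_wave.
Qed.

Lemma regular_wave : regular W.
Proof. by do 4 eexists; exact: lipreg_wave. Qed.

(** The affine part of [phi] drops out because [wave1] and [wave2] have mean zero. Across the line
    the gradient jumps by [- s] times [be], and of the two half-plane integrals only the one with
    [wave2] survives. *)
Lemma gip_wave phi (a b d s : R) : regular phi ->
  (forall p, in_box 1 (Y p) -> phi p = a * p.1 + b * p.2 + d - s * ramp (Y p).2) ->
  gip phi W = 2 * s * (be.1 ^+ 2 + be.2 ^+ 2) * \int[mu]_p pulse p.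
Proof.
move=> hphi form; have [b1 [L1 [N1 [G1 h1]]]] := hphi; have h2 := lipreg_wave.
have wphi := regular_wdiff hphi; have wW := lipreg_wdiff h2.
have iL i := L2M (wdiff_L2 i wphi) (wdiff_L2 i wW).
have [j1 j2] := Rint_wave1; have [j3 j4] := Rint_wave2.
have bs1 := step_bdd wave1_bdd; have bs2 := step_bdd wave2_bdd.
pose c1 := a * al.1 + b * al.2; pose c2 := a * be.1 + b * be.2.
pose c3 := - s * (al.1 * be.1 + al.2 * be.2); pose c4 := - s * (be.1 ^+ 2 + be.2 ^+ 2).
have i1 := itgZ c1 (bdd_itg wave1_bdd); have i2 := itgZ c2 (bdd_itg wave2_bdd).
have i3 := itgZ c3 (bdd_itg bs1); have i4 := itgZ c4 (bdd_itg bs2).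
pose E p := (c1 * wave1 p + c2 * wave2 p) + (c3 * (step (Y p).2 * wave1 p) + c4 * (step (Y p).2 * wave2 p)).
have i5 := itgD (itgD i1 i2) (itgD i3 i4).
transitivity (\int[mu]_p E p); last first.
  rewrite RintD; [|exact: itgD|exact: itgD].
  rewrite RintD // RintD // RintZ ?RintZ ?RintZ ?RintZ; try exact: bdd_itg bs1; try exact: bdd_itg bs2;
    try exact: bdd_itg wave1_bdd; try exact: bdd_itg wave2_bdd.
  by rewrite j1 j2 j3 j4 /c4; ring.
rewrite gipE !ipE -RintD //.
have [_ _ _ N10 hG1] := h1; have [_ _ _ N20 hG2] := h2.
have n00 := negligibleU (negligibleU (lipreg_wp false h1) (lipreg_wp true h1))
  (negligibleU (lipreg_wp false h2) (lipreg_wp true h2)).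
apply: (Rint_ae (negligibleU (negligibleU N10 N20) n00)).
- exact: itg_measurable (itgD (iL false) (iL true)).
- exact: itg_measurable i5.
move=> p /not_orP[/not_orP[k1 /contrapT k2] /not_orP[/not_orP[/negP e1 /negP e2] /not_orP[/negP e3 /negP e4]]].
rewrite !negbK in e1 e2 e3 e4; rewrite (eqP e1) (eqP e2) (eqP e3) (eqP e4).
have [x1 x2 x3 x4] := k2.
(* The form of [phi] is only known in the window; outside it the gradient of the wave vanishes. *)
have [out|] := boolP ((1 <= `|(Y p).1|) || (1 <= `|(Y p).2|)).
  have [z1 z2] : wave1 p = 0 /\ wave2 p = 0.
    move: out; rewrite /wave1 /wave2 => /orP[l1|l1].
      by rewrite dhat_out ?hat_out ?mul0r // lt_neqAle eq_sym x2.
    by rewrite dquad_out ?quad_out ?mulr0 // lt_neqAle eq_sym x4.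
  by rewrite /E /gwave z1 z2; ring.
rewrite negb_or -!ltNge => /andP[l1 l2].
have sd : sdiff phi p (fun i => (if i then b else a) - s * (step (Y p).2 * (if i then be.2 else be.1))).
  have [_ pr _ _] := @pieces R.
  have e0 : 0 < Num.min (1 - `|(Y p).1|) (1 - `|(Y p).2|) by rewrite lt_min !subr_gt0 l1.
  have [dd dd0 near'] := amap_near al be c p e0.
  have sr := sdiff_comp (der2_piece pr x3 x4).
  have sa := @sdiff_affine R (fun q => a * q.1 + b * q.2 + d) p a b d 1 ltr01 (fun _ _ _ => erefl).
  have := sdiff_lin (- s) sr sa => hh e e'0; have [d' d'0 hd'] := hh e e'0.
  exists (Num.min d' dd) => [|x y]; first by rewrite lt_min d'0.
  rewrite !lt_min => /andP[x1' x1''] /andP[x2' x2''] /andP[y1' y1''] /andP[y2' y2''].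
  have inb q : `|q.1 - p.1| < dd -> `|q.2 - p.2| < dd -> in_box 1 (Y q).
    move=> q1 q2; have := near' _ q1 q2; rewrite !lt_min => -[/andP[m1 _] /andP[_ m2]].
    have := ler_normD (Y p).1 ((Y q).1 - (Y p).1); have := ler_normD (Y p).2 ((Y q).2 - (Y p).2).
    rewrite !(addrC _ (_ - _)) !subrK => m3 m4.
    by split; [apply: le_trans m4 _|apply: le_trans m3 _]; rewrite -lerBrDl; exact: ltW.
  have stE : step (Y p).2 = dramp (Y p).2.
    rewrite /step /dramp; have [t0|] := ltP 0 (Y p).2 => //=; first by rewrite (le_lt_trans (ler_norm _) l2).
  rewrite !form; [|exact: inb|exact: inb].
  apply: le_trans (hd' _ _ x1' x2' y1' y2'); rewrite le_eqVlt; apply/orP; left; apply/eqP.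
  by congr `|_|; rewrite stE /=; ring.
rewrite (sdiff_unique false (hG1 _ k1) sd) (sdiff_unique true (hG1 _ k1) sd) /E /gwave /c1 /c2 /c3 /c4.
have st2 : step (Y p).2 * step (Y p).2 = step (Y p).2.
  by rewrite /step; case: (_ < _); rewrite ?mulr1 ?mulr0.
ring.
Qed.

(** The box is centred at [p0], since the bound from [bdd] would grow with the distance of the
    support from the origin. *)
Lemma Rint_box_le (p0 : R * R) (r k : R) v : 0 <= r -> itg v -> (forall p, `|v p| <= k) ->
  (forall p, v p != 0 -> `|p.1 - p0.1| <= r /\ `|p.2 - p0.2| <= r) ->
  `|\int[mu]_p v p| <= k * (2 * r) ^+ 2.
Proof.
move=> r0 iv vk v0; have [iv' <-] := Rint_shift p0 iv.
apply: normr_Rint_bdd => //; split => //; first exact: itg_measurable iv'.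
move=> p hp; apply/eqP; rewrite -[_ == _]negbK; apply/negP => /v0.
by rewrite /= !addrK => h; apply: hp.
Qed.

Lemma gip_wave_le b L v N (G : R * R -> bool -> R) : lipreg b L v N G ->
  `|gip v W| <= 32 * L * A * rho ^+ 2.
Proof.
move=> h1; have h2 := lipreg_wave; have [b0 hv v0 N0 hG] := h1; have L0 := lip_ge0 hv.
have a0 := anorm_ge0 al be.
have k i : `|ip (wp i v) (wp i W)| <= L * (4 * A) * (2 * rho) ^+ 2.
  have [w [hw ww _]] := lipreg_weak i h1; have [hwp M0] := wpP ww.
  have M1 := lipreg_wp i h2; have [mw wk _] := hw.
  have [m1 k1 _] := wave1_bdd; have [m2 k2 _] := wave2_bdd.
  have gb : bdd B (4 * A) (gwave^~ i).
    split.
    - by apply: measurable_funD; exact: measurable_funM.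
    - move=> p; rewrite /gwave; apply: le_trans (ler_normD _ _) _; rewrite (normrM (wave1 p)) (normrM (wave2 p)).
      have n1 := normr_ge0 al.1; have n2 := normr_ge0 al.2; have n3 := normr_ge0 be.1; have n4 := normr_ge0 be.2.
      rewrite /anorm; case: i {ww hwp M0 M1}.
        have h3 := ler_wpM2r n2 (k1 p); have h4 := ler_wpM2r n4 (k2 p); lra.
      have h3 := ler_wpM2r n1 (k1 p); have h4 := ler_wpM2r n3 (k2 p); lra.
    - have [_ _ z1] := wave1_bdd; have [_ _ z2] := wave2_bdd.
      by move=> p hp; rewrite /gwave z1 // z2 // !mul0r addr0.
  have [mg gk _] := gb.
  rewrite ipE (@Rint_ae _ _ _ (fun p => gwave p i * w p) (negligibleU M0 M1)); first last.
  - move=> p /not_orP[/negP e1 /negP e2]; rewrite !negbK in e1 e2.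
    by rewrite (eqP e1) (eqP e2) mulrC.
  - exact: measurable_funM.
  - by apply: measurable_funM; [exact: L2_mfun hwp.1|exact: L2_mfun (wdiff_L2 i (lipreg_wdiff h2))].
  apply: (@Rint_box_le (acenter al be c) rho (L * (4 * A)) _ (arad_ge0 al be)).
  - exact: bdd_itg (bddM mw wk gb).
  - by move=> p; rewrite normrM mulrC; apply: ler_pM.
  move=> p gp; apply: amap_box => //; apply: contrapT => hp.
  have [z1 z2] : wave1 p = 0 /\ wave2 p = 0.
    rewrite /wave1 /wave2; have [l1|l1] := leP `|(Y p).1| 1.
      have [l2|l2] := leP `|(Y p).2| 1; first by case: hp.
      by rewrite quad_out ?dquad_out ?mulr0 // ltW.
    by rewrite dhat_out ?hat_out ?mul0r // ltW.
  by move/eqP: gp; apply; rewrite /gwave z1 z2 !mul0r addr0 mul0r.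
rewrite gipE; apply: le_trans (ler_normD _ _) _; apply: le_trans (lerD (k false) (k true)) _.
by rewrite le_eqVlt; apply/orP; left; apply/eqP; ring.
Qed.

Lemma anorm_gt0 : 0 < A.
Proof.
have := anorm_ge0 al be; rewrite le_eqVlt => /orP[/eqP a0|//].
have [n1 n2 n3 n4] : [/\ `|al.1| <= 0, `|al.2| <= 0, `|be.1| <= 0 & `|be.2| <= 0].
  move: a0; rewrite /anorm; have := normr_ge0 al.1; have := normr_ge0 al.2.
  by have := normr_ge0 be.1; have := normr_ge0 be.2; split; lra.
move: D0; rewrite /adet; move: n1 n2; rewrite !normr_le0 => /eqP -> /eqP ->.
by rewrite !mul0r subrr eqxx.
Qed.

Lemma pulse_ge : (256 * A ^+ 2)^-1 <= \int[mu]_p pulse p.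
Proof.
have A0 := anorm_gt0; pose p1 := acenter al be c + (3 / 8) *: adir al be true.
have Yp1 : Y p1 = (0, 3 / 8).
  rewrite amap_shift //; have [e1 e2] : (Y (acenter al be c)).1 = 0 /\ (Y (acenter al be c)).2 = 0.
    by move: D0; rewrite /amap /acenter /adet /= => D1; split; field.
  rewrite [Y (acenter al be c)]surjective_pairing e1 e2.
  by congr pair; rewrite /= /GRing.scale /= ?mulr0 ?mulr1 ?add0r.
have [iv' <-] := Rint_shift p1 (bdd_itg pulse_bdd).
pose r := (16 * A)^-1; have r0 : 0 < r by rewrite invr_gt0 mulr_gt0.
have -> : (256 * A ^+ 2)^-1 = \int[mu]_p (4^-1 * \1_(in_box r) p).
  rewrite RintZ; last exact: itg_box.
  rewrite Rint_itv_box ?(ltW r0) // /r; field; exact: lt0r_neq0.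
have p0 p : 0 <= pulse p.
  rewrite /pulse mulr_ge0 ?mulr_ge0 ?hat_ge0 // /dramp; by case: (_ < _ < _).
apply: le_Rint => // [|p]; first by apply: itgZ; exact: itg_box.
have [[h1 h2]|hp] := pselect (in_box r p); last by rewrite indicE memNset // mulr0.
rewrite indicE mem_set // mulr1 /pulse.
have := amap_dist al be c (p + p1) p1; rewrite Yp1.
have d1 : dist1 (p + p1) p1 <= 2 * r by rewrite /dist1 /= !addrK; lra.
have Ar : A * (2 * r) = 8^-1 by rewrite /r; field; exact: lt0r_neq0.
move=> /le_trans /(_ (ler_wpM2l (ltW A0) d1)); rewrite Ar /dist1 /= subr0.
set a := (Y (p + p1)).1; set b := (Y (p + p1)).2.
move=> h3; have n1 := normr_ge0 a; have n2 := normr_ge0 (b - 3 / 8).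
have : `|a| <= 8^-1 by lra.
have : `|b - 3 / 8| <= 8^-1 by lra.
rewrite ler_norml => /andP[b1 b2] a1.
have -> : dramp b = 1 by rewrite /dramp (_ : _ < _ < _ = true) //; apply/andP; split; lra.
have ha : 2^-1 <= hat a by rewrite /hat le_max; apply/orP; right; lra.
have hb : 2^-1 <= hat b by rewrite /hat le_max gtr0_norm; [apply/orP; right; lra|lra].
rewrite mul1r (_ : 4^-1 = 2^-1 * 2^-1); last by field.
by apply: ler_pM.
Qed.

Lemma H10_wave omega (s : R) : (forall p, in_box 2 (Y p) -> omega p) ->
  H10 omega (fun p => s * W p).
Proof.
move=> sub; have A0 := anorm_gt0.
have d0 : 0 < (2 * A)^-1 by rewrite invr_gt0 mulr_gt0.
have [b [L [N [G h0]]]] := @regular0 R.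
rewrite (_ : (fun p => _) = (fun p => s * W p + 0)); last by apply/funext => p; rewrite addr0.
apply: (lipreg_H10 (lipreg_lin s lipreg_wave h0) d0) => p q; rewrite addr0 mulf_eq0 negb_or => /andP[_ Wp] q1 q2; apply: sub.
have [l1 l2] : `|(Y p).1| <= 1 /\ `|(Y p).2| <= 1.
  move: Wp; rewrite /wave => Wp; split; rewrite leNgt; apply/negP => l; move/eqP: Wp; apply.
    by rewrite hat_out ?mul0r // ltW.
  by rewrite quad_out ?mulr0 // ltW.
have := amap_dist al be c q p; rewrite /dist1 => h.
have : A * (`|q.1 - p.1| + `|q.2 - p.2|) <= 1.
  apply: le_trans (ler_wpM2l (ltW A0) (lerD q1 q2)) _.
  by rewrite le_eqVlt; apply/orP; left; apply/eqP; field; exact: lt0r_neq0.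
move=> /(le_trans h) h'.
have := ler_normD (Y p).1 ((Y q).1 - (Y p).1); have := ler_normD (Y p).2 ((Y q).2 - (Y p).2).
have := normr_ge0 ((Y q).1 - (Y p).1); have := normr_ge0 ((Y q).2 - (Y p).2).
by rewrite ![_ + (_ - _)]addrC !subrK => m1 m2 m3 m4; split; lra.
Qed.

End Wave.

Section LocalBound.
Context {R : realType}.
Local Notation P := (measurableTypeR R * measurableTypeR R)%type.
Local Notation mu := (@plane_measure R).
Implicit Types (v phi : R * R -> R) (p q : R * R) (s t : R) (K T : triangle R) (w : seq bool).

(* Similarity invariant: newest vertex bisection leaves it unchanged. *)
Definition shape K : R :=
  ((gr K).1 ^+ 2 + (gr K).2 ^+ 2 + (gd K).1 ^+ 2 + (gd K).2 ^+ 2) * `|tdet K|.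

Lemma shape_child K b : tdet K != 0 -> shape (child K b) = shape K.
Proof.
move=> D0; rewrite /shape; have [-> ->] := grd_child b D0; rewrite tdet_child.
have -> : `|(if b then - tdet K else tdet K) / 2| = `|tdet K| / 2.
  by rewrite normrM [X in _ * X]ger0_norm ?invr_ge0 //; case: b; rewrite ?normrN.
by move: (gr K) (gd K) => [a1 a2] [b1 b2]; case: b; rewrite /= /GRing.scale /=; field.
Qed.

Lemma shape_node K w : tdet K != 0 -> shape (node K w) = shape K.
Proof.
elim: w K => //= b w IH K D0; rewrite IH ?shape_child //; exact: tdet_child_neq0.
Qed.

Lemma tlip_shape K : tdet K != 0 -> tlip K ^+ 2 <= 2 * shape K * `|2 / tdet K|.
Proof.
move=> D0; have n0 : `|tdet K| != 0 by rewrite normr_eq0.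
have -> : 2 * shape K * `|2 / tdet K| =
  4 * ((gr K).1 ^+ 2 + (gr K).2 ^+ 2 + (gd K).1 ^+ 2 + (gd K).2 ^+ 2).
  by rewrite /shape normrM normfV ger0_norm //; field.
rewrite -(real_normK (num_real (gr K).1)) -(real_normK (num_real (gr K).2)).
rewrite -(real_normK (num_real (gd K).1)) -(real_normK (num_real (gd K).2)) /tlip.
set a := `|_|; set b := `|(gr K).2|; set c := `|(gd K).1|; set d := `|(gd K).2|.
have := sqr_ge0 (a - b); have := sqr_ge0 (a - c); have := sqr_ge0 (a - d).
have := sqr_ge0 (b - c); have := sqr_ge0 (b - d); have := sqr_ge0 (c - d).
by rewrite !expr2; lra.
Qed.

Lemma sum_sqr_le (a b c d : R) : 0 <= a -> 0 <= b -> 0 <= c -> 0 <= d ->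
  a ^+ 2 + b ^+ 2 <= (a + b + c + d) ^+ 2.
Proof.
move=> a0 b0 c0 d0; apply: (@le_trans _ _ ((a + b) ^+ 2)).
  by have := mulr_ge0 a0 b0; rewrite sqrrD; lra.
by rewrite lerXn2r ?nnegrE ?addr_ge0 //; lra.
Qed.

Lemma lipreg_tail k J T : (1 < k)%N -> tdet T != 0 ->
  exists (b : R) N (G : R * R -> bool -> R), lipreg b (4 * 2^-1 ^+ (k * J) * tlip T)
    (fun p => ufun k T p - psum k J (trd T p)) N G.
Proof.
move=> k1 D0; have k0 := ltnW k1.
have [G hG] := lipreg_ufun k1 D0; have [H hH] := lipreg_psum J k1 D0.
have [b0 _ v0 N0 hd] := lipreg_lin (-1) hH hG.
exists (tbox T + tbox T), (skel T `|` skel T), (fun p i => -1 * H p i + G p i).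
split; [exact: b0| | |exact: N0|].
- move=> p q; apply: le_trans (tail_dist k0 J (trd T p) (trd T q)) _.
  rewrite -[leRHS]mulrA ler_wpM2l ?mulr_ge0 ?exprn_ge0 //; exact: trd_dist.
- by move=> p /v0; rewrite mulN1r addrC.
by move=> p /hd hp; apply: (sdiff_ext hp) => // q; rewrite mulN1r addrC.
Qed.

Section Edge.
Variables (T : triangle R) (r0 eta : R).
Hypotheses (D0 : tdet T != 0) (eta0 : 0 < eta) (lo : 2^-1 <= r0 - eta) (hi : r0 + 2 * eta <= 1).

Let al : R * R := ((gr T).1 / eta, (gr T).2 / eta).
Let be : R * R := ((gd T).1 / eta, (gd T).2 / eta).
Let c : R * R := ((tr T 0 - r0) / eta, td T 0 / eta).

Definition edge_wave : R * R -> R := wave al be c.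

Lemma edge_amap p : amap al be c p = ((tr T p - r0) / eta, td T p / eta).
Proof.
have e0 := lt0r_neq0 eta0.
rewrite /amap /al /be /c /tr /td; move: (gr T) (gd T) (newest T) => [a1 a2] [b1 b2] [z1 z2] /=.
by congr pair; field.
Qed.

Lemma edge_adet : adet al be = (2 / tdet T) / eta ^+ 2.
Proof.
by have e0 := lt0r_neq0 eta0; rewrite -(tgrad_det D0) /adet /al /be; move: (gr T) (gd T) => [a1 a2] [b1 b2] /=; field.
Qed.

Lemma edge_adet0 : adet al be != 0.
Proof.
by have e0 := lt0r_neq0 eta0; rewrite edge_adet !mulf_neq0 // ?invr_eq0 // expf_neq0.
Qed.

Lemma edge_anorm : anorm al be = tlip T / eta.
Proof.
by rewrite /anorm /al /be /= !(normrM _ eta^-1) (gtr0_norm (_ : 0 < eta^-1)) ?invr_gt0 // -!mulrDl.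
Qed.

Lemma in_box_edge (m : R) p : in_box m (amap al be c p) <->
  `|tr T p - r0| <= m * eta /\ `|td T p| <= m * eta.
Proof.
rewrite edge_amap /in_box /= !normrM normfV (gtr0_norm eta0).
by rewrite !ler_pdivrMr.
Qed.

Local Notation det := (`|2 / tdet T|).

Lemma edge_scale (kap : R) : 2 * shape T <= kap ->
  [/\ 0 < kap, 0 < tlip T, 0 < det, tlip T ^+ 4 / det ^+ 2 <= kap ^+ 2
    & tlip T ^+ 2 / kap ^+ 2 <= (gd T).1 ^+ 2 + (gd T).2 ^+ 2].
Proof.
move=> hk; have A0 := anorm_gt0 edge_adet0.
have t0 : 0 < tlip T by have := A0; rewrite edge_anorm pmulr_lgt0 ?invr_gt0.
have det0 : 0 < det by rewrite normr_gt0 mulf_neq0 ?invr_eq0.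
have tk : tlip T ^+ 2 <= kap * det.
  by apply: le_trans (tlip_shape D0) _; rewrite ler_wpM2r // ltW.
have lag : det ^+ 2 <= ((gr T).1 ^+ 2 + (gr T).2 ^+ 2) * ((gd T).1 ^+ 2 + (gd T).2 ^+ 2).
  rewrite real_normK ?num_real // -(tgrad_det D0).
  have := sqr_ge0 ((gr T).1 * (gd T).1 + (gr T).2 * (gd T).2); rewrite !expr2; lra.
have grt : (gr T).1 ^+ 2 + (gr T).2 ^+ 2 <= tlip T ^+ 2.
  rewrite -(real_normK (num_real (gr T).1)) -(real_normK (num_real (gr T).2)) /tlip.
  apply: sum_sqr_le; exact: normr_ge0.
have gd0 : 0 <= (gd T).1 ^+ 2 + (gd T).2 ^+ 2 by rewrite addr_ge0 ?sqr_ge0.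
move: (_ + (gd T).2 ^+ 2) lag gd0 => g2 /le_trans /(_ (ler_wpM2r _ grt)) lag g0.
have {lag} := lag g0; move: (tlip T) t0 tk {grt A0} => t t0 tk lag.
move: det det0 tk lag => d d0 tk lag.
have kap0 : 0 < kap by rewrite -(pmulr_lgt0 _ d0); apply: lt_le_trans tk; rewrite exprn_gt0.
have t4 : t ^+ 4 / d ^+ 2 <= kap ^+ 2.
  rewrite ler_pdivrMr ?exprn_gt0 // -exprMn (exprM _ 2 2).
  by apply: lerXn2r => //; rewrite nnegrE ?exprn_ge0 ?mulr_ge0 // ltW.
split=> //; rewrite ler_pdivrMr ?exprn_gt0 // -(ler_pM2l (exprn_gt0 2 t0)).
have dn0 := lt0r_neq0 d0.
have -> : t ^+ 2 * t ^+ 2 = t ^+ 4 / d ^+ 2 * d ^+ 2 by field.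
apply: le_trans (ler_wpM2r (exprn_ge0 2 (ltW d0)) t4) _.
rewrite (_ : t ^+ 2 * (g2 * kap ^+ 2) = kap ^+ 2 * (t ^+ 2 * g2)); last ring.
by apply: ler_wpM2l => //; rewrite exprn_ge0 // ltW.
Qed.

Lemma gip_edge_le b L v N (G : R * R -> bool -> R) : lipreg b L v N G ->
  `|gip v edge_wave| <= 32 * L * (tlip T / eta) * (tlip T * eta / det) ^+ 2.
Proof.
move=> /(gip_wave_le c edge_adet0); rewrite edge_anorm.
rewrite (_ : arad al be = tlip T * eta / det) //.
rewrite /arad edge_anorm edge_adet normrM normfV (gtr0_norm (exprn_gt0 _ eta0)).
have e0 := lt0r_neq0 eta0; have dn0 : det != 0 by rewrite normr_eq0 mulf_neq0 ?invr_eq0.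
by move: det dn0 => d dn0; field; rewrite e0 dn0.
Qed.

Lemma gip_edge_tent k : (1 < k)%N -> gip (fun p => psum k 1 (trd T p)) edge_wave =
  8 * ((gd T).1 ^+ 2 + (gd T).2 ^+ 2) / eta * \int[mu]_p pulse al be c p.
Proof.
move=> k1; have [a [b' [d aff]]] := affine_on_comb setT T (-2) 2 2.
have e0 := lt0r_neq0 eta0.
rewrite (@gip_wave _ al be c edge_adet0 _ a b' d (4 * eta) (regular_psum 1 k1 D0)).
  rewrite (_ : be.1 ^+ 2 + be.2 ^+ 2 = ((gd T).1 ^+ 2 + (gd T).2 ^+ 2) / eta ^+ 2).
    by congr (_ * _); move: (_ + _) => g2; field.
  by rewrite /be; move: (gd T) => [g1 g2] /=; field.
move=> p /in_box_edge; rewrite !mul1r => -[h1 h2].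
rewrite -(aff p I) edge_amap /psum big_nat1 /amp muln0 expr0 mul1r /foldk muln0 /=.
have lo' := lo; have hi' := hi; move: h1; rewrite ler_norml => /andP[h3 h4].
rewrite /tent /= ler0_norm; last by lra.
have [d0|d0] := leP 0 (td T p).
  rewrite ger0_norm // in h2 *; rewrite /ramp (_ : Num.min 1 _ = td T p / eta); last first.
    by rewrite min_r // ler_pdivrMr // mul1r.
  rewrite !max_r ?divr_ge0 ?(ltW eta0) //; last lra.
  by move: (tr T p) (td T p) => t1 t2; field.
rewrite ltr0_norm // in h2 *; rewrite /ramp max_r; last lra.
rewrite max_l; first by ring.
by rewrite ge_min orbC ler_pdivrMr // mul0r ltW.
Qed.

Lemma gip_edge_wave k (kap : R) : (1 < k)%N -> 2 * shape T <= kap ->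
  2^-1 ^+ k * (8192 * kap ^+ 4) <= 1 ->
  eta / (64 * kap ^+ 2) <= gip (ufun k T) edge_wave /\ gip edge_wave edge_wave <= 128 * kap ^+ 2.
Proof.
move=> k1 hk hkk; have [kap0 t0 det0 t4 gd2] := edge_scale hk.
have e0 := lt0r_neq0 eta0; have dn0 := lt0r_neq0 det0; have kn0 := lt0r_neq0 kap0; have tn0 := lt0r_neq0 t0.
split; last first.
  have := gip_edge_le (lipreg_wave c edge_adet0); rewrite edge_anorm => /(le_trans (ler_norm _)) h.
  apply: le_trans h _.
  apply: (@le_trans _ _ (128 * (tlip T ^+ 4 / det ^+ 2))); last by rewrite ler_wpM2l.
  rewrite le_eqVlt; apply/orP; left; apply/eqP.
  by move: (tlip T) det dn0 => t d dn0; field; rewrite e0 dn0.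
have [b [N [G htail]]] := lipreg_tail 1 k1 D0.
have rt : regular (fun p => ufun k T p - psum k 1 (trd T p)) by do 4 eexists; exact: htail.
have rw : regular edge_wave := regular_wave c edge_adet0.
have -> : gip (ufun k T) edge_wave = gip (fun p => psum k 1 (trd T p)) edge_wave +
    gip (fun p => ufun k T p - psum k 1 (trd T p)) edge_wave.
  have rp := regular_psum 1 k1 D0.
  rewrite -[X in X + _]mul1r -gip_linl; try exact: regular_wdiff.
  by congr (gip _ _); apply/funext => p; ring.
have := gip_edge_le htail; set g2 := gip (fun p => ufun k T p - _) _; rewrite muln1 => tail.
have tail' : `|g2| <= eta / (64 * kap ^+ 2).
  apply: le_trans tail _.
  apply: (@le_trans _ _ (128 * 2^-1 ^+ k * eta * (tlip T ^+ 4 / det ^+ 2))).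
    rewrite le_eqVlt; apply/orP; left; apply/eqP.
    by move: (tlip T) det dn0 (2^-1 ^+ k) => t d dn0 x; field; rewrite e0 dn0.
  apply: (@le_trans _ _ (128 * 2^-1 ^+ k * eta * kap ^+ 2)).
    by rewrite ler_wpM2l // !mulr_ge0 ?exprn_ge0 // ltW.
  rewrite ler_pdivlMr ?mulr_gt0 ?exprn_gt0 //.
  have -> : 128 * 2^-1 ^+ k * eta * kap ^+ 2 * (64 * kap ^+ 2) = eta * (2^-1 ^+ k * (8192 * kap ^+ 4)) by ring.
  by rewrite ler_piMr // ltW.
have pg := pulse_ge c edge_adet0; rewrite edge_anorm in pg.
have main : eta / (32 * kap ^+ 2) <= 8 * ((gd T).1 ^+ 2 + (gd T).2 ^+ 2) / eta * \int[mu]_p pulse al be c p.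
  move: (_ + (gd T).2 ^+ 2) gd2 => g gd2.
  have g0 : 0 <= g by apply: le_trans gd2; rewrite divr_ge0 ?exprn_ge0 // ltW.
  apply: (@le_trans _ _ (8 * g / eta * (256 * (tlip T / eta) ^+ 2)^-1)); last first.
    by rewrite ler_wpM2l // divr_ge0 ?mulr_ge0 // ltW.
  move: (tlip T) t0 tn0 gd2 => t t0 tn0 gd2.
  have -> : eta / (32 * kap ^+ 2) = t ^+ 2 / kap ^+ 2 * (eta / (32 * t ^+ 2)).
    by field; rewrite kn0 tn0.
  have -> : 8 * g / eta * (256 * (t / eta) ^+ 2)^-1 = g * (eta / (32 * t ^+ 2)).
    by field; rewrite e0 tn0.
  by rewrite ler_wpM2r // divr_ge0 ?mulr_ge0 ?exprn_ge0 // ltW.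
have e2 : eta / (32 * kap ^+ 2) = 2 * (eta / (64 * kap ^+ 2)) by field.
rewrite -/g2 gip_edge_tent //; have := ler_norm (- g2); rewrite normrN.
move: main tail'; rewrite e2; move: (_ * \int[_]_p _) (eta / _) => x y h1 h2 h3.
by clear -h1 h2 h3; lra.
Qed.

Lemma edge_wave_hull p : ~ hull T p -> edge_wave p = 0.
Proof.
move=> hp; have [hb|hb] := pselect (in_box 1 (amap al be c p)).
  have lo' := lo; have hi' := hi; case: hp; rewrite hullP //; move/in_box_edge: hb; rewrite !mul1r !ler_norml => -[/andP[h1 h2] /andP[h3 h4]].
  split; [change (0 <= tr T p)|change (`|td T p| <= 1 - tr T p); rewrite ler_norml; apply/andP; split]; lra.
rewrite /edge_wave /wave; have [h1|h1] := leP `|(amap al be c p).1| 1.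
  have [h2|h2] := leP `|(amap al be c p).2| 1; first by case: hb.
  by rewrite quad_out ?mulr0 // ltW.
by rewrite hat_out ?mul0r // ltW.
Qed.

Lemma regular_edge_wave : regular edge_wave.
Proof. exact: regular_wave edge_adet0. Qed.

Lemma H10_edge_wave omega a : (forall p, `|tr T p - r0| <= 2 * eta -> `|td T p| <= 2 * eta -> omega p) ->
  H10 omega (fun p => a * edge_wave p).
Proof.
move=> sub; apply: (H10_wave edge_adet0 (c := c)) => p /in_box_edge [h1 h2]; exact: sub.
Qed.

Lemma Rint_edge_wave : \int[mu]_p edge_wave p = 0 /\
  \int[mu]_p (step (td T p) * edge_wave p) = 0.
Proof.
have [h1 h2] := Rint_wave c edge_adet0; split => //.
rewrite -[RHS]h2; apply: eq_Rint => p; congr (_ * _); rewrite edge_amap /=.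
by rewrite /step pmulr_lgt0 ?invr_gt0.
Qed.

End Edge.

Lemma gip_node k T0 (w : seq bool) j T (r0 eta : R) : (1 < k)%N -> tdet T0 != 0 -> size w = (k * j).*2 ->
  T = node T0 w -> 0 < eta -> 2^-1 <= r0 - eta -> r0 + 2 * eta <= 1 ->
  gip (ufun k T0) (edge_wave T r0 eta) = amp k j * gip (ufun k T) (edge_wave T r0 eta).
Proof.
move=> k1 D0 sw TE eta0 lo hi; have k0 := ltnW k1.
have DT : tdet T != 0 by rewrite TE tdet_node.
have rw := regular_edge_wave r0 DT eta0.
have r1 := regular_ufun k1 D0; have r2 := regular_ufun k1 DT.
have r3 := regular_lin (- amp k j) r2 r1.
have z : gip (fun p => - amp k j * ufun k T p + ufun k T0 p) (edge_wave T r0 eta) = 0.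
  apply: (gip_affine DT r3 _ rw); last by move=> p; exact: edge_wave_hull.
  rewrite TE; have := psum_affine k1 D0 (J := j) (w := w); rewrite sw => /(_ (leqnn _)).
  apply: affine_on_eq => p hp; rewrite /ufun (tower_split k0 j (trd T0 p)) trd_node // sw /foldk; ring.
move: z; rewrite gip_linl; try exact: regular_wdiff.
by move/eqP; rewrite mulNr addrC subr_eq0 => /eqP.
Qed.

End LocalBound.

Section PiecewiseAffineFunctions.
Context {R : realType}.
Local Notation P := (measurableTypeR R * measurableTypeR R)%type.
Local Notation mu := (@plane_measure R).
Implicit Types (v : R * R -> R) (p q : R * R) (s t : R) (K T : triangle R) (M : seq (triangle R)).

Lemma local_lip1 (g : R -> R) (C : R) : 0 <= C ->
  (forall t, 0 <= t <= 1 -> exists2 d, 0 < d & forall s, 0 <= s <= 1 -> `|s - t| < d ->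
    `|g s - g t| <= C * `|s - t|) -> `|g 1 - g 0| <= C.
Proof.
move=> C0 loc.
pose A := [set t : R | 0 <= t <= 1 /\ forall s, 0 <= s <= t -> `|g s - g 0| <= C * s].
have A0 : A 0.
  split=> [|s /andP[s0 s1]]; first by rewrite lexx ler01.
  have -> : s = 0 by apply/eqP; rewrite eq_le s0 s1.
  by rewrite subrr normr0 mulr0.
have ub : ubound A 1 by move=> t [/andP[]].
have hs : has_sup A by split; [exists 0|exists 1].
set c := sup A; have c0 : 0 <= c by apply: ub_le_sup => //; exists 1.
have c1 : c <= 1 by apply: ge_sup => //; exists 0.
have below s : 0 <= s -> s < c -> `|g s - g 0| <= C * s.
  move=> s0 sc; have e0 : 0 < c - s by rewrite subr_gt0.
  have [a [_ ha] ca] := sup_adherent e0 hs; apply: ha; rewrite s0 /=.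
  by rewrite ltW //; move: ca; rewrite -/c; lra.
have [|d d0 hd] := loc c; first by rewrite c0.
have add a b : 0 <= a <= b -> b <= 1 -> `|g a - g 0| <= C * a -> `|g b - g a| <= C * (b - a) ->
    `|g b - g 0| <= C * b.
  move=> ab b1 h1 h2; have -> : g b - g 0 = (g b - g a) + (g a - g 0) by ring.
  by apply: le_trans (ler_normD _ _) _; lra.
have hc : `|g c - g 0| <= C * c.
  have [->|cn] := eqVneq c 0; first by rewrite subrr normr0 mulr0.
  have cp : 0 < c by rewrite lt_neqAle eq_sym cn.
  pose a := Num.max 0 (c - d / 2).
  have a0 : 0 <= a by rewrite le_max lexx.
  have ac : a < c by rewrite gt_max cp /=; lra.
  have acd : c - d / 2 <= a by rewrite le_max lexx orbT.
  have := hd a; rewrite a0 (le_trans (ltW ac) c1) ltr0_norm ?subr_lt0 // => /(_ isT) h.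
  apply: (add a c _ c1 (below a a0 ac)); first by rewrite a0 ltW.
  by rewrite distrC -(opprB a c) h //; lra.
have [c1'|c1'] := ltP c 1; last first.
  have -> : 1 = c by apply/eqP; rewrite eq_le c1' c1.
  by apply: le_trans hc _; rewrite ler_piMr.
exfalso; pose b := Num.min 1 (c + d / 2).
have cb : c < b by rewrite lt_min c1' /=; lra.
have b1 : b <= 1 by rewrite ge_min lexx.
have bd : b <= c + d / 2 by rewrite ge_min lexx orbT.
suff : A b by move=> /(ub_le_sup (ex_intro _ 1 ub)); rewrite -/c leNgt cb.
split=> [|s /andP[s0 sb]]; first by rewrite b1 (le_trans c0) // ltW.
have [sc|sc] := ltP s c; first exact: below.
apply: (add c s) => //; [by rewrite c0|exact: le_trans b1|].
have := hd s; rewrite s0 (le_trans sb b1) ger0_norm ?subr_ge0 // => /(_ isT); apply; lra.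
Qed.

Lemma local_lip v (L : R) : 0 <= L ->
  (forall p, exists2 d, 0 < d & forall q, `|q.1 - p.1| < d -> `|q.2 - p.2| < d ->
    `|v q - v p| <= L * dist1 q p) -> lip L v.
Proof.
move=> L0 loc p q; rewrite -/(dist1 p q).
pose x t : R * R := (q.1 + t * (p.1 - q.1), q.2 + t * (p.2 - q.2)).
have x1 : x 1 = p by rewrite [RHS]surjective_pairing /x; congr pair; ring.
have x0 : x 0 = q by rewrite [RHS]surjective_pairing /x; congr pair; ring.
have D0 := dist1_ge0 p q.
have xd s t : ((x s).1 - (x t).1 = (s - t) * (p.1 - q.1)) * ((x s).2 - (x t).2 = (s - t) * (p.2 - q.2)).
  by split; rewrite /x /=; ring.
rewrite -{1}x1 -{1}x0; apply: (@local_lip1 (fun t => v (x t))); first exact: mulr_ge0.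
move=> t _; have [d d0 hd] := loc (x t).
have d1 : 0 < d / (dist1 p q + 1) by rewrite divr_gt0 //; lra.
exists (d / (dist1 p q + 1)) => // s _ st.
have st' : `|s - t| * (dist1 p q + 1) < d by rewrite -ltr_pdivlMr //; lra.
have n1 := normr_ge0 (s - t); have n2 := normr_ge0 (p.1 - q.1); have n3 := normr_ge0 (p.2 - q.2).
have m1 := mulr_ge0 n1 n2; have m2 := mulr_ge0 n1 n3.
apply: le_trans (hd _ _ _) _.
- by rewrite (xd s t).1 normrM; move: st'; rewrite /dist1; lra.
- by rewrite (xd s t).2 normrM; move: st'; rewrite /dist1; lra.
by rewrite {1}/dist1 (xd s t).1 (xd s t).2 !normrM -mulrDr mulrAC mulrA -/(dist1 p q).
Qed.

Lemma near_hulls M p : (forall K, K \in M -> tdet K != 0) -> exists2 d, 0 < d &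
  forall q, `|q.1 - p.1| < d -> `|q.2 - p.2| < d -> forall K, K \in M -> hull K q -> hull K p.
Proof.
elim: M => [|K M IH] hM; first by exists 1.
have [|d d0 hd] := IH; first by move=> T TM; apply: hM; rewrite in_cons TM orbT.
have DK : tdet K != 0 by apply: hM; rewrite mem_head.
have [hp|hp] := pselect (hull K p).
  exists d => // q q1 q2 T; rewrite in_cons => /orP[/eqP -> //|]; exact: hd.
have [d' d'0 hd'] := outside_nbhs DK hp.
exists (Num.min d d') => [|q]; first by rewrite lt_min d0.
rewrite !lt_min => /andP[q1 q1'] /andP[q2 q2'] T; rewrite in_cons => /orP[/eqP ->|]; last exact: hd.
by move=> /(hd' _ q1' q2').
Qed.

Lemma negligible_boundaries M : (forall K, K \in M -> tdet K != 0) ->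
  mu.-negligible [set p : P | exists2 K, K \in M & hull K p /\ ~ strict K p].
Proof.
elim: M => [|K M IH] hM.
  by apply: negligibleS (negligible_set0 _) => p [K].
have DK : tdet K != 0 by apply: hM; rewrite mem_head.
have h : mu.-negligible [set p : P | exists2 K, K \in M & hull K p /\ ~ strict K p].
  by apply: IH => T TM; apply: hM; rewrite in_cons TM orbT.
apply: negligibleS (negligibleU (negligible_boundary DK) h) => p [T].
by rewrite in_cons => /orP[/eqP ->|TM] hT; [left|right; exists T].
Qed.

Lemma affine_lip M v : (forall K, K \in M -> affine_on (hull K) v) ->
  exists2 L : R, 0 <= L & forall K p q, K \in M -> hull K p -> hull K q ->
    `|v p - v q| <= L * dist1 p q.
Proof.
elim: M => [|K M IH] hM; first by exists 0.
have [|L L0 hL] := IH; first by move=> T TM; apply: hM; rewrite in_cons TM orbT.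
have [|a [b [c aff]]] := hM K; first by rewrite mem_head.
have n1 := normr_ge0 a; have n2 := normr_ge0 b.
exists (L + `|a| + `|b|); first by lra.
move=> T p q; have D0 := dist1_ge0 p q; rewrite in_cons => /orP[/eqP ->|TM] hp hq; last first.
  apply: le_trans (hL _ _ _ TM hp hq) _; rewrite ler_wpM2r //; lra.
rewrite !aff // (_ : _ - _ = a * (p.1 - q.1) + b * (p.2 - q.2)); last by ring.
apply: le_trans (ler_normD _ _) _; rewrite !normrM /dist1.
have n3 := normr_ge0 (p.1 - q.1); have n4 := normr_ge0 (p.2 - q.2).
have := mulr_ge0 n1 n4; have := mulr_ge0 n2 n3; have := mulr_ge0 L0 n3; have := mulr_ge0 L0 n4; lra.
Qed.

Lemma regular_affine M (Omega : set (R * R)) v b : 0 <= b -> open Omega -> Omega `<=` in_box b ->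
  (forall K, K \in M -> tdet K != 0) -> (forall p, Omega p -> exists2 K, K \in M & hull K p) ->
  (forall p, ~ Omega p -> v p = 0) -> (forall K, K \in M -> affine_on (hull K) v) -> regular v.
Proof.
move=> b0 oO Ob hM cover v0 aff.
have [L L0 hL] := affine_lip aff.
pose N : set P := [set p | exists2 K, K \in M & hull K p /\ ~ strict K p].
have /choice [G hG] : forall p, exists g, ~ N p -> sdiff v p g.
  move=> p; have [[K KM hp]|hn] := pselect (exists2 K, K \in M & hull K p).
    have [sp|sp] := pselect (strict K p).
      have [d d0 hd] := strict_nbhs sp; have [a [b' [c hK]]] := aff K KM.
      exists (fun i : bool => if i then b' else a) => _; apply: (sdiff_affine d0 (c := c)) => x x1 x2.
      by apply: hK; apply: strict_hull; [exact: hM|exact: hd].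
    by exists (fun=> 0); case; exists K.
  have [d d0 hd] := near_hulls p hM.
  exists (fun i : bool => if i then 0 else 0) => _; apply: (sdiff_affine d0 (c := 0)) => x x1 x2.
  rewrite v0; first by ring.
  by move=> /cover [K KM hK]; apply: hn; exists K => //; exact: hd hK.
exists b, L, N, G; split => //.
- apply: local_lip => // p; have [d d0 hd] := near_hulls p hM.
  have key q : `|q.1 - p.1| < d -> `|q.2 - p.2| < d -> Omega q -> `|v q - v p| <= L * dist1 q p.
    by move=> q1 q2 /cover [K KM hK]; apply: (hL K) => //; exact: hd hK.
  have [Op|Op] := pselect (Omega p).
    have [e e0 he] := nbhs_box (open_nbhs_nbhs (conj oO Op)).
    exists (Num.min d e) => [|q]; first by rewrite lt_min d0.
    by rewrite !lt_min => /andP[q1 q1'] /andP[q2 q2']; apply: key => //; exact: he.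
  exists d => // q q1 q2; have [Oq|Oq] := pselect (Omega q); first exact: key.
  by rewrite !v0 // subrr normr0 mulr_ge0 // dist1_ge0.
- by move=> p hp; apply: v0 => /Ob.
- exact: negligible_boundaries.
Qed.

Lemma unit_square_open : open (@unit_square R).
Proof.
rewrite openE => p [/=]; rewrite !in_itv /= => /andP[a b] /andP[c d].
pose e := Num.min (Num.min p.1 (1 - p.1)) (Num.min p.2 (1 - p.2)).
have e0 : 0 < e by rewrite !lt_min !subr_gt0 a b c.
apply: (box_nbhs e0) => q; rewrite !lt_min !ltr_norml.
move=> /andP[/andP[/andP[h1 h2] /andP[h3 h4]] _] /andP[_ /andP[/andP[h5 h6] /andP[h7 h8]]].
by split; rewrite /= in_itv /=; apply/andP; split; lra.
Qed.

Lemma unit_square_closure : closure (@unit_square R) = `[0, 1]%classic `*` `[0, 1]%classic.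
Proof.
apply/seteqP; split.
  move=> p hp.
  have app e : 0 < e -> [/\ - e <= p.1, p.1 <= 1 + e, - e <= p.2 & p.2 <= 1 + e].
    move=> e0; have /hp [q [[/= h1 h2] [/= h3 h4]]] : nbhs p [set q : R * R | `|q.1 - p.1| < e /\ `|q.2 - p.2| < e].
      by apply: (box_nbhs e0) => q.
    move: h1 h2 h3 h4; rewrite !in_itv /= !ltr_norml => /andP[a b] /andP[c d] /andP[e1 e2] /andP[e3 e4].
    by split; lra.
  by split; rewrite /= in_itv /=; apply/andP; split; apply/ler_addgt0Pr => e /app []; lra.
move=> p [/=]; rewrite !in_itv /= => /andP[p1 p1'] /andP[p2 p2'] B /nbhs_box [e e0 he].
pose t := Num.min 2^-1 (e / 4); have t0 : 0 < t by rewrite lt_min invr_gt0 ltr0n divr_gt0.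
have t1 : t <= 2^-1 by rewrite ge_min lexx.
have te : t <= e / 4 by rewrite ge_min lexx orbT.
exists (p.1 + t * (2^-1 - p.1), p.2 + t * (2^-1 - p.2)); split.
  by rewrite /unit_square /=; split; rewrite /= in_itv /=; apply/andP; split; nra.
by apply: he => /=; rewrite addrAC subrr add0r normrM gtr0_norm //;
  (have : `|2^-1 - p.1| <= 1 by rewrite ler_norml; apply/andP; split; lra);
  (have : `|2^-1 - p.2| <= 1 by rewrite ler_norml; apply/andP; split; lra);
  move=> h1 h2; nra.
Qed.

Lemma interior_closure_unit_square : interior (closure (@unit_square R)) `<=` unit_square.
Proof.
rewrite unit_square_closure => p /nbhs_box [e e0 he].
have h1 := he (p.1 - e / 2, p.2 - e / 2); have h2 := he (p.1 + e / 2, p.2 + e / 2).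
have ne : `|- (e / 2)| < e by rewrite normrN gtr0_norm; lra.
have pe : `|e / 2| < e by rewrite gtr0_norm; lra.
have sE (x y : R) : x + y - x = y by ring.
rewrite /= !sE in h1 h2; have [/=] := h1 ne ne; have [/=] := h2 pe pe.
rewrite !in_itv /= => /andP[a1 a2] /andP[a3 a4] /andP[a5 a6] /andP[a7 a8].
by rewrite /unit_square; split; rewrite /= in_itv /=; apply/andP; split; lra.
Qed.

Lemma unit_square_box : @unit_square R `<=` in_box 1.
Proof.
move=> p [/=]; rewrite !in_itv /= => /andP[a b] /andP[c d].
by split; rewrite gtr0_norm // ltW.
Qed.

End PiecewiseAffineFunctions.

(** * Local dual norms *)

Section DualNorms.
Context {R : realType}.
Local Notation P := (measurableTypeR R * measurableTypeR R)%type.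
Local Notation mu := (@plane_measure R).
Local Notation Omega := (@unit_square R).
Implicit Types (v w g : R * R -> R) (p q z : R * R) (s t : R) (K T : triangle R) (M : seq (triangle R)).
Implicit Types (omega : set (R * R)) (l : (R * R -> R) -> R).

Lemma cvg_sumr (I : Type) (r : seq I) (T : Type) (F : set_system T) (FF : Filter F)
  (h : I -> T -> R) (a : I -> R) : (forall i, h i t @[t --> F] --> a i) ->
  (\sum_(i <- r) h i t) @[t --> F] --> \sum_(i <- r) a i.
Proof.
move=> hh; elim: r => [|i r IH].
  by under eq_fun do rewrite big_nil; rewrite big_nil; exact: cvg_cst.
by under eq_fun do rewrite big_cons; rewrite big_cons; exact: cvgD.
Qed.

Lemma cvg_sum_sqr (I : Type) (r : seq I) (T : Type) (F : set_system T) (FF : Filter F)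
  (h : I -> T -> R) (a : I -> R) : (forall i, h i t @[t --> F] --> a i) ->
  (\sum_(i <- r) h i t ^+ 2) @[t --> F] --> \sum_(i <- r) a i ^+ 2.
Proof. by move=> hh; apply: cvg_sumr => i; rewrite expr2; under eq_fun do rewrite expr2; exact: cvgM. Qed.

Lemma squeeze_dist (I : finType) (T : Type) (F : set_system T) (FF : Filter F)
  (g : I -> T -> R) (a : I -> R) (h : T -> R) (b k : R) : (forall i, g i t @[t --> F] --> a i) ->
  (forall t : T, `|b - h t| <= k * \sum_i `|a i - g i t|) -> h t @[t --> F] --> b.
Proof.
move=> hg hh; apply/cvgrPdist_le => e e0.
have h0 i : `|a i - g i t| @[t --> F] --> `|a i - a i|.
  by apply: cvg_norm; apply: cvgB; [exact: cvg_cst|exact: hg].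
have h1 : k * \sum_i `|a i - g i t| @[t --> F] --> k * \sum_i `|a i - a i|.
  by apply: cvgMr; exact: cvg_sumr.
rewrite big1 ?mulr0 in h1; last by move=> i _; rewrite subrr normr0.
move/cvgr0Pnorm_le : h1 => /(_ e e0) h1; near=> t.
apply: le_trans (hh t) _; apply: le_trans (ler_norm _) _; near: t; exact: h1.
Unshelve. all: end_near. Qed.

Definition gnorm v : R := Num.sqrt (gip v v).

Lemma gnorm_ge0 v : 0 <= gnorm v. Proof. exact: sqrtr_ge0. Qed.

Lemma grad_dot_H10 omega v w : open omega -> wdiff w -> H10 omega v -> grad_dot omega w v = gip w v.
Proof.
move=> oom hw hv; apply: grad_dotE => //; first exact: open_measurable2.
  exact: H10_wdiff hv.
by move=> i; have := H10_outside i oom hv; rewrite wpE.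
Qed.

Lemma grad_norm_H10 omega v : open omega -> H10 omega v -> grad_norm omega v = gnorm v.
Proof. by move=> oom hv; rewrite /grad_norm grad_dot_H10 //; exact: H10_wdiff hv. Qed.

Lemma H10_zero omega : H10 omega (fun=> 0 : R).
Proof.
have [b [L [N [G h]]]] := @regular0 R.
by apply: (lipreg_H10 h ltr01) => p q; rewrite eqxx.
Qed.

Lemma gnorm0 : gnorm (fun=> 0) = 0.
Proof.
have h := regular_wdiff (@regular0 R); rewrite /gnorm.
have := gip_linl 1 h h h; rewrite (_ : (fun p : R * R => 1 * 0 + 0) = fun=> 0).
  by rewrite mul1r => e; rewrite (_ : gip _ _ = 0) ?sqrtr0 //; apply: (addrI (gip (fun=> 0) (fun=> 0))); rewrite -e addr0.
by apply/funext => p; rewrite mulr0 addr0.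
Qed.

Lemma H10_sub omega omega' v : omega `<=` omega' -> H10 omega v -> H10 omega' v.
Proof.
move=> sub [hv ex [phi [tphi c1 c2]]]; split => //; exists phi; split => // k.
have [sp [K [cK Ko K0]]] := tphi k; split => //; exists K; split => //; exact: subset_trans sub.
Qed.

Lemma n2_gnorm omega v : omega `<=` Omega -> H10 omega v -> n2 v <= 2 * gnorm v.
Proof.
move=> sub hv; apply: le_trans (friedrichs sub hv) _; rewrite -wpE ler_wpM2l //.
rewrite n2E ler_wsqrtr // gipE lerDl; exact: ip_ge0.
Qed.

Definition dual_bounded omega l (B : R) := forall v, H10 omega v -> gnorm v <= 1 -> `|l v| <= B.

Lemma Hm1norm_le omega l B : open omega -> dual_bounded omega l B -> Hm1norm omega l <= B.
Proof.
move=> oom hB; apply: ge_sup.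
  exists `|l (fun=> 0)|; exists (fun=> 0) => //; split; first exact: H10_zero.
  by rewrite grad_norm_H10 ?gnorm0 //; exact: H10_zero.
move=> _ [v [hv +] <-]; rewrite grad_norm_H10 //; exact: hB.
Qed.

Lemma Hm1norm_ge omega l B v : open omega -> dual_bounded omega l B -> H10 omega v ->
  gnorm v <= 1 -> `|l v| <= Hm1norm omega l.
Proof.
move=> oom hB hv gv; apply: ub_le_sup; last by exists v => //; rewrite /= grad_norm_H10.
by exists B => _ [w [hw +] <-]; rewrite grad_norm_H10 //; exact: hB.
Qed.

Lemma Hm1norm_ge0 omega l B : open omega -> dual_bounded omega l B -> 0 <= Hm1norm omega l.
Proof.
move=> oom hB; apply: le_trans (Hm1norm_ge oom hB (H10_zero omega) _) => //.
by rewrite gnorm0.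
Qed.

Lemma Hm1norm_dist omega l l' (B B' C : R) : open omega -> dual_bounded omega l B ->
  dual_bounded omega l' B' -> dual_bounded omega (fun v => l v - l' v) C ->
  `|Hm1norm omega l - Hm1norm omega l'| <= C.
Proof.
move=> oom hB hB' hC; rewrite ler_norml; apply/andP; split.
  suff : Hm1norm omega l' <= Hm1norm omega l + C by lra.
  apply: Hm1norm_le => // v hv gv; have h1 := Hm1norm_ge oom hB hv gv; have h2 := hC v hv gv.
  have := ler_normB (l v) (l v - l' v); rewrite opprB addrC subrK; lra.
suff : Hm1norm omega l <= Hm1norm omega l' + C by lra.
apply: Hm1norm_le => // v hv gv; have h1 := Hm1norm_ge oom hB' hv gv; have h2 := hC v hv gv.
have := ler_normD (l' v) (l v - l' v); rewrite addrC subrK; lra.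
Qed.

Lemma gnormZ s v : wdiff v -> gnorm (fun p => s * v p) = `|s| * gnorm v.
Proof.
move=> wv; have w0 := regular_wdiff (@regular0 R).
have z w : wdiff w -> gip (fun=> 0) w = 0.
  move=> ww; have := gip_linl 1 w0 w0 ww; rewrite (_ : (fun p : R * R => 1 * 0 + 0) = fun=> 0).
    by rewrite mul1r => e; apply: (addrI (gip (fun=> 0) w)); rewrite -e addr0.
  by apply/funext => p; rewrite mulr0 addr0.
have lin w : wdiff w -> gip (fun p => s * v p) w = s * gip v w.
  move=> ww; rewrite (_ : (fun p => s * v p) = (fun p => s * v p + (fun=> 0) p)).
    by rewrite gip_linl // z // addr0.
  by apply/funext => p; rewrite addr0.
have wsv : wdiff (fun p => s * v p).
  have [h _] := wdiff_lin s wv w0; move: h; congr wdiff; apply/funext => p; by rewrite addr0.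
by rewrite /gnorm lin // gipC lin // mulrA -expr2 sqrtrM ?sqr_ge0 // sqrtr_sqr.
Qed.

Lemma Hm1norm_ge_scaled omega l B v (C : R) : open omega -> dual_bounded omega l B ->
  (forall s, H10 omega (fun p => s * v p) /\ l (fun p => s * v p) = s * l v) -> wdiff v ->
  0 < C -> gnorm v <= C -> `|l v| <= C * Hm1norm omega l.
Proof.
move=> oom hB hv wv C0 gC; have [h1 h2] := hv C^-1.
have := Hm1norm_ge oom hB h1; rewrite gnormZ // h2 normrM gtr0_norm ?invr_gt0 //.
rewrite !ler_pdivrMl // mulr1; exact.
Qed.

Lemma eq_Hm1norm omega l l' : open omega -> (forall v, H10 omega v -> l v = l' v) ->
  Hm1norm omega l = Hm1norm omega l'.
Proof.
move=> oom ll; congr sup; apply/seteqP; split => _ [v [hv gv] <-]; exists v => //; by rewrite ll.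
Qed.

Definition good M := [/\ uniq M, forall K, K \in M -> tdet K != 0,
  closure Omega = [set p | exists2 K, K \in M & hull K p] &
  forall K K' p, K \in M -> K' \in M -> K != K' -> strict K p -> ~ hull K' p].

Lemma good_hull M K p : good M -> K \in M -> hull K p -> closure Omega p.
Proof. by move=> [_ _ -> _] KM hp; exists K. Qed.

Lemma patch_open M z : open (vertex_patch M z).
Proof. exact: open_interior. Qed.

Lemma patch_sub M z : good M -> vertex_patch M z `<=` Omega.
Proof.
move=> gM; apply: subset_trans (@interior_closure_unit_square R).
by apply: interiorS => p [K KM [_ hp]]; exact: (good_hull gM KM hp).
Qed.

Lemma open_strict K : open (strict K : set (R * R)).
Proof.
rewrite openE => p /strict_nbhs [e e0 he]; exact: (box_nbhs e0).
Qed.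

Lemma strict_Omega M K p : good M -> K \in M -> strict K p -> Omega p.
Proof.
move=> gM KM sp; apply: interior_closure_unit_square.
have [_ hM _ _] := gM; have := strict_interior (hM _ KM) sp.
by apply: interiorS => q hq; exact: (good_hull gM KM hq).
Qed.

Definition er K : R * R := newest K - midpoint (edge1 K) (edge2 K).

Lemma trd_er K p s : tdet K != 0 -> (tr K (p + s *: er K) = tr K p + s) * (td K (p + s *: er K) = td K p).
Proof.
move=> D0; rewrite /tr /td /gr /gd /er /midpoint; move: D0.
case: K => [[[z1 z2] [a1 a2]] [b1 b2]]; rewrite tdetE /newest /edge1 /edge2 /= /GRing.scale /= => D0.
by split; field.
Qed.

Lemma interior_strict K p : tdet K != 0 -> interior (hull K) p -> strict K p.
Proof.
move=> D0 /nbhs_box [e e0 he]; pose A := `|(er K).1| + `|(er K).2| + 1.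
have n1 := normr_ge0 (er K).1; have n2 := normr_ge0 (er K).2.
pose s := e / (2 * A); have A0 : 0 < 2 * A by rewrite /A; lra.
have s0 : 0 < s by rewrite divr_gt0.
have sA : s * (2 * A) = e by rewrite /s divfK // lt0r_neq0.
have m1 := mulr_ge0 (ltW s0) n1; have m2 := mulr_ge0 (ltW s0) n2.
have inn t : `|t| = s -> hull K (p + t *: er K).
  move=> ts; apply: he; rewrite ?(shift_sub p (er K) t).1 ?(shift_sub p (er K) t).2 normrM ts;
  by move: sA; rewrite /A; lra.
have := inn s (gtr0_norm s0); have := inn (- s); rewrite normrN (gtr0_norm s0) => /(_ erefl).
rewrite !hullP // => -[/= + _] [_ /=]; rewrite !(trd_er p _ D0).1 !(trd_er p _ D0).2 => h1 h2.
by split => /=; lra.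
Qed.

Section PiecewiseConstant.
Variable M : seq (triangle R).
Hypothesis gM : good M.
Local Notation tri i := (tnth (in_tuple M) i).
Local Notation vec := 'rV[R]_(size M).
Implicit Types (c : vec).

Definition pconst c p : R := \sum_i c 0 i * \1_(strict (tri i)) p.

Lemma tri_mem i : tri i \in M. Proof. exact: mem_tnth. Qed.

Lemma tri_det i : tdet (tri i) != 0.
Proof. by have [_ + _ _] := gM; apply; exact: tri_mem. Qed.

Lemma tri_inj i j : tri i = tri j -> i = j.
Proof.
have [uM _ _ _] := gM; move=> e; apply/val_inj/eqP.
have := nth_uniq (tri i) (ltn_ord i) (ltn_ord j) uM.
by rewrite -!(tnth_nth _ (in_tuple M)) e eqxx => <-.
Qed.

Lemma measurable_strict i : mfun2 (\1_(strict (tri i)) : R * R -> R).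
Proof. by apply: measurable_indic; apply: open_measurable2; exact: open_strict. Qed.

Lemma pconstE c i p : strict (tri i) p -> pconst c p = c 0 i.
Proof.
move=> sp; rewrite /pconst (bigD1 i) //= indicE mem_set // mulr1 big1 ?addr0 // => j ji.
have [_ hM _ dM] := gM; rewrite indicE memNset ?mulr0 // => sj.
apply: (dM (tri i) (tri j) p) => //; try exact: tri_mem.
  by apply: contraNneq ji => e; apply/eqP/esym/tri_inj.
exact: strict_hull (tri_det j) sj.
Qed.

Lemma pconst_outside c p : ~ Omega p -> pconst c p = 0.
Proof.
move=> hp; rewrite /pconst big1 // => i _; rewrite indicE memNset ?mulr0 // => sp.
exact: hp (strict_Omega gM (tri_mem i) sp).
Qed.

Lemma pconst_bdd c : bdd 1 (\sum_i `|c 0 i|) (pconst c).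
Proof.
split.
- rewrite /mfun2 /pconst; apply: measurable_sum => i; apply: measurable_funM => //.
  exact: measurable_strict.
- move=> p; apply: le_trans (ler_norm_sum _ _ _) _; apply: ler_sum => i _.
  by rewrite normrM ler_piMr // indicE; case: (_ \in _); rewrite ?normr1 ?normr0.
by move=> p hp; apply: pconst_outside => /unit_square_box.
Qed.

Lemma P0_pconst c : P0 Omega M (pconst c).
Proof.
split; first by apply: measurable_funTS; have [] := pconst_bdd c.
move=> K /seq_tnthP [i ->]; exists (c 0 i) => p ip; apply: pconstE.
exact: interior_strict (tri_det i) ip.
Qed.

Lemma Omega_strict p : Omega p -> ~ (exists2 K, K \in M & hull K p /\ ~ strict K p) ->
  exists i, strict (tri i) p.
Proof.
move=> Op hn; have [_ _ cl _] := gM; have : closure Omega p by exact: subset_closure.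
rewrite cl => -[K KM hp]; have /seq_tnthP [i Ki] := KM; exists i; rewrite -Ki.
by apply: contrapT => hs; apply: hn; exists K.
Qed.

Lemma P0_normal g : P0 Omega M g -> exists c, forall v, mfun2 v ->
  \int[mu]_(p in Omega) (g p * v p) = \int[mu]_p (pconst c p * v p).
Proof.
move=> [mg hg].
have /choice [k hk] : forall i, exists k, forall p, strict (tri i) p -> g p = k.
  move=> i; have [k hk] := hg _ (tri_mem i); exists k => p sp; apply: hk.
  exact: strict_interior (tri_det i) sp.
exists (\row_i k i) => v mv; rewrite Rint_setE.
have mO : measurable (Omega : set P) by apply: open_measurable2; exact: unit_square_open.
have [_ hM _ _] := gM.
apply: (Rint_ae (negligible_boundaries hM)).
- have -> : (fun p => g p * v p * \1_Omega p) = (fun p => (g \_ Omega) p * v p).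
    by apply/funext => p; rewrite patch_indic /= mulrAC.
  by apply: measurable_funM => //; apply/(measurable_restrictT _ mO).
- by apply: measurable_funM => //; have [] := pconst_bdd (\row_i k i).
move=> p hn; have [Op|Op] := pselect (Omega p); last first.
  by rewrite indicE memNset // mulr0 pconst_outside // mul0r.
have [i sp] := Omega_strict Op hn.
by rewrite indicE mem_set // mulr1 (pconstE _ sp) mxE (hk i).
Qed.

Variable u : R * R -> R.
Hypothesis wu : wdiff u.
Local Notation f := (grad_dot Omega u).
Local Notation patch := (vertex_patch M).

Definition resid c v : R := f v - \int[mu]_p (pconst c p * v p).

Lemma patch_H10 z v : H10 (patch z) v -> H10 Omega v.
Proof. by apply: H10_sub; exact: patch_sub. Qed.

Lemma int_L2_le h z v : L2 h -> H10 (patch z) v -> gnorm v <= 1 ->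
  `|\int[mu]_p (h p * v p)| <= 2 * n2 h.
Proof.
move=> Lh hv gv; have [Lv _] := H10_wdiff hv; have := cauchy_schwarz Lh Lv; rewrite ipE => h1.
apply: le_trans h1 _; rewrite mulrC ler_wpM2r ?n2_ge0 //.
by apply: le_trans (n2_gnorm (patch_sub gM) hv) _; lra.
Qed.

Lemma resid_bounded c z : dual_bounded (patch z) (resid c) (gnorm u + 2 * n2 (pconst c)).
Proof.
move=> v hv gv; have hvO := patch_H10 hv; have wv := H10_wdiff hv.
apply: le_trans (ler_normB _ _) _; apply: lerD; last first.
  by apply: int_L2_le hv gv; exact: bdd_L2 (pconst_bdd c).
rewrite (grad_dot_H10 unit_square_open) //; apply: le_trans (gip_cs wu wv) _.
by rewrite ler_piMr // gnorm_ge0.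
Qed.

Lemma residZ c s v : wdiff v -> H10 Omega v -> H10 Omega (fun p => s * v p) ->
  resid c (fun p => s * v p) = s * resid c v.
Proof.
move=> wv hv hsv; have w0 := regular_wdiff (@regular0 R).
rewrite /resid !(grad_dot_H10 unit_square_open) // mulrBr; congr (_ - _).
  rewrite ![gip u _]gipC (_ : (fun p => s * v p) = (fun p => s * v p + (fun=> 0) p)); last first.
    by apply/funext => p; rewrite addr0.
  rewrite gip_linl // (_ : gip (fun=> 0) u = 0) ?addr0 //.
  have := gip_linl 1 w0 w0 wu; rewrite (_ : (fun p : R * R => 1 * 0 + 0) = fun=> 0).
    by rewrite mul1r => e; apply: (addrI (gip (fun=> 0) u)); rewrite -e addr0.
  by apply/funext => p; rewrite mulr0 addr0.
rewrite -RintZ; first by apply: eq_Rint => p; rewrite mulrCA.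
by apply: L2M; [exact: bdd_L2 (pconst_bdd c)|have [] := wv].
Qed.

Definition vec_osc c : R :=
  Num.sqrt (\sum_(z <- mesh_vertices M) Hm1norm (patch z) (resid c) ^+ 2).

Lemma oscillationE g c : (forall v, mfun2 v ->
    \int[mu]_(p in Omega) (g p * v p) = \int[mu]_p (pconst c p * v p)) ->
  oscillation Omega f M g = vec_osc c.
Proof.
move=> h; congr Num.sqrt; apply: eq_bigr => z _; congr (_ ^+ 2).
apply: eq_Hm1norm; first exact: patch_open.
by move=> v hv; rewrite /resid h //; have [/L2_mfun] := H10_wdiff hv.
Qed.

Lemma Hm1_le_osc z c : z \in mesh_vertices M -> Hm1norm (patch z) (resid c) <= vec_osc c.
Proof.
move=> zM; have N0 := Hm1norm_ge0 (@patch_open M z) (@resid_bounded c z).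
rewrite -[leLHS]ger0_norm // -sqrtr_sqr ler_wsqrtr // (big_rem z) //= lerDl.
by rewrite sumr_ge0 // => y _; exact: sqr_ge0.
Qed.

Lemma n2_bdd_le (b k : R) h : 0 <= b -> 0 <= k -> bdd b k h -> n2 h <= k * (2 * b).
Proof.
move=> b0 k0 hb; have [mh hk _] := hb; rewrite n2E.
rewrite -[leRHS]ger0_norm ?mulr_ge0 // -sqrtr_sqr ler_wsqrtr // ipE exprMn.
apply: le_trans (ler_norm _) _; have := normr_Rint_bdd b0 (bddM mh hk hb).
by rewrite -expr2.
Qed.

Lemma resid_dist c c' z : `|Hm1norm (patch z) (resid c) - Hm1norm (patch z) (resid c')| <=
  4 * \sum_i `|c 0 i - c' 0 i|.
Proof.
apply: (Hm1norm_dist (@patch_open M z) (@resid_bounded c z) (@resid_bounded c' z)) => v hv gv.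
have Lv : L2 v by have [] := H10_wdiff hv.
have i1 := L2M (bdd_L2 (pconst_bdd c)) Lv; have i2 := L2M (bdd_L2 (pconst_bdd c')) Lv.
rewrite (_ : _ - _ = - \int[mu]_p (pconst (c - c') p * v p)); last first.
  rewrite (eq_Rint (g := fun p => pconst c p * v p - pconst c' p * v p)).
    by rewrite RintB //; rewrite /resid; ring.
  move=> p; rewrite -mulrBl /pconst -sumrB; congr (_ * _); apply: eq_bigr => i _.
  by rewrite !mxE mulrBl.
rewrite normrN; apply: le_trans (int_L2_le (bdd_L2 (pconst_bdd (c - c'))) hv gv) _.
have s0 : 0 <= \sum_i `|(c - c') 0 i| by exact: sumr_ge0.
have := n2_bdd_le (@ler01 R) s0 (pconst_bdd (c - c')).
rewrite (eq_bigr (fun i => `|c 0 i - c' 0 i|)); last by move=> i _; rewrite !mxE.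
by lra.
Qed.

Lemma vec_osc_continuous : continuous vec_osc.
Proof.
move=> c; have cc i : (fun c' : vec => c' 0 i) @ nbhs c --> c 0 i := @coord_continuous R 1 (size M) 0 i c.
have cN z : (fun c' => Hm1norm (patch z) (resid c')) @ nbhs c --> Hm1norm (patch z) (resid c).
  apply: (squeeze_dist (nbhs_filter c) cc) => c'; exact: resid_dist.
have cs := @cvg_sum_sqr _ (mesh_vertices M) _ _ (nbhs_filter c) _ _ cN.
exact: (@continuous_cvg _ _ _ _ (nbhs_filter c) _ Num.sqrt _ (@sqrt_continuous R _) cs).
Qed.

End PiecewiseConstant.

Lemma box_hat p0 (e : R) omega : 0 < e ->
  (forall q, `|q.1 - p0.1| < e -> `|q.2 - p0.2| < e -> omega q) ->
  exists v, [/\ regular v, forall s, H10 omega (fun p => s * v p), forall p, v p != 0 -> `|p.1 - p0.1| < e /\ `|p.2 - p0.2| < e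
    & 0 < \int[mu]_p v p].
Proof.
move=> e0 sub; have en0 := lt0r_neq0 e0.
pose al : R * R := (2 / e, 0); pose be : R * R := (0, 2 / e).
pose c : R * R := (- (2 / e * p0.1), - (2 / e * p0.2)).
have YE p : amap al be c p = (2 / e * (p.1 - p0.1), 2 / e * (p.2 - p0.2)).
  by rewrite /amap /al /be /c /=; congr pair; ring.
have D0 : adet al be != 0 by rewrite /adet /al /be /= mulr0 subr0 !mulf_neq0 ?invr_eq0.
have [hl hl1] := @lip1_hat R; have [mh _ _ _ _] := @measurable_pieces R.
have [ph _ _ _] := @pieces R.
pose v p := hat (amap al be c p).1 * hat (amap al be c p).2.
have ho t : 1 < `|t| -> hat t = 0 by move=> /ltW; exact: hat_out.
have hb : bdd (abound al be c) 1 v by apply: tensor_bdd.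
have supp p : v p != 0 -> `|p.1 - p0.1| <= e / 2 /\ `|p.2 - p0.2| <= e / 2.
  have e2 : 0 < 2 / e by rewrite divr_gt0.
  rewrite /v YE mulf_eq0 negb_or /= => /andP[h1 h2]; split; rewrite leNgt; apply/negP => h.
    by move/eqP: h1; apply; rewrite hat_out // normrM gtr0_norm // -ler_pdivrMl // mulr1 invf_div ltW.
  by move/eqP: h2; apply; rewrite hat_out // normrM gtr0_norm // -ler_pdivrMl // mulr1 invf_div ltW.
have lr : lipreg (abound al be c) (2 * anorm al be) v [set p : P | ~ off_cross (amap al be c p)]
   (fun p i => dhat (amap al be c p).1 * hat (amap al be c p).2 * (if i then al.2 else al.1) +
               hat (amap al be c p).1 * dhat (amap al be c p).2 * (if i then be.2 else be.1)).
  split; [exact: abound_ge0| |by have [] := hb|exact: negligible_cross|].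
    move=> p q; rewrite -mulrA.
    apply: (@le_trans _ _ (2 * dist1 (amap al be c p) (amap al be c q))).
      rewrite /v /dist1; set a := (amap al be c p).1; set b := (amap al be c p).2.
      set a' := (amap al be c q).1; set b' := (amap al be c q).2.
      have -> : hat a * hat b - hat a' * hat b' = (hat a - hat a') * hat b + hat a' * (hat b - hat b') by ring.
      apply: le_trans (ler_normD _ _) _; rewrite !normrM.
      have h1 : `|hat a - hat a'| * `|hat b| <= `|a - a'|.
        by apply: le_trans (hl a a'); rewrite ler_piMr.
      have h2 : `|hat a'| * `|hat b - hat b'| <= `|b - b'|.
        by apply: le_trans (hl b b'); rewrite ler_piMl.
      by have := normr_ge0 (a - a'); have := normr_ge0 (b - b'); lra.
    by rewrite ler_wpM2l //; exact: amap_dist.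
  by move=> p /contrapT hp; exact: (sdiff_comp (sdiff_tensor (der2_piece ph) hp)).
exists v; split.
- by do 4 eexists; exact: lr.
- move=> s; have [b' [L' [N' [G' h0]]]] := @regular0 R.
  rewrite (_ : (fun p => _) = (fun p => s * v p + 0)); last by apply/funext => p; rewrite addr0.
  apply: (lipreg_H10 (lipreg_lin s lr h0) (d := e / 4)); first by rewrite divr_gt0.
  move=> p q; rewrite addr0 mulf_eq0 negb_or => /andP[_ /supp [h1 h2]] q1 q2; apply: sub.
    by rewrite -(subrK p.1 q.1) -addrA; apply: le_lt_trans (ler_normD _ _) _; lra.
  by rewrite -(subrK p.2 q.2) -addrA; apply: le_lt_trans (ler_normD _ _) _; lra.
- by move=> p /supp [h1 h2]; split; lra.
have [iv <-] := Rint_shift p0 (bdd_itg hb).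
apply: (@lt_le_trans _ _ (\int[mu]_p (4^-1 * \1_(in_box (e / 4)) p))).
  rewrite RintZ; last exact: itg_box.
  by rewrite Rint_itv_box; [rewrite mulr_gt0 ?invr_gt0 // exprn_gt0 // mulr_gt0 // divr_gt0|rewrite divr_ge0 // ltW].
apply: le_Rint => // [|p]; first by apply: itgZ; exact: itg_box.
have [[h1 h2]|hp] := pselect (in_box (e / 4) p); last first.
  by rewrite indicE memNset // mulr0 /v mulr_ge0 ?hat_ge0.
rewrite indicE mem_set // mulr1 /v YE /= !addrK.
have hh t : `|t| <= e / 4 -> 2^-1 <= hat (2 / e * t).
  move=> ht; rewrite /hat le_max; apply/orP; right; rewrite normrM gtr0_norm ?divr_gt0 //.
  have : 2 / e * `|t| <= 2 / e * (e / 4) by rewrite ler_wpM2l // divr_ge0 // ltW.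
  have -> : 2 / e * (e / 4) = 2^-1 by field.
  by lra.
rewrite (_ : 4^-1 = 2^-1 * 2^-1); last by field.
by apply: ler_pM; rewrite ?hh.
Qed.

Section OscillationMin.
Variable M : seq (triangle R).
Hypothesis gM : good M.
Variable u : R * R -> R.
Hypothesis wu : wdiff u.
Local Notation f := (grad_dot Omega u).
Local Notation patch := (vertex_patch M).
Local Notation tri i := (tnth (in_tuple M) i).
Local Notation vec := 'rV[R]_(size M).

Lemma strict_patch K z : K \in M -> hull K z -> strict K `<=` patch z.
Proof.
move=> KM hz p sp; have [_ hM _ _] := gM; have [e e0 he] := strict_nbhs sp.
apply: (box_nbhs e0) => q q1 q2; exists K => //; split => //.
by apply: strict_hull; [exact: hM|exact: he].
Qed.

Lemma hull_vertex K z : z \in vertices K -> hull K z.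
Proof.
rewrite /vertices !inE => /or3P[] /eqP ->.
- by exists 1, 0, 0; rewrite scale1r !scale0r !addr0 lexx ler01.
- by exists 0, 1, 0; rewrite scale1r !scale0r addr0 add0r addr0 add0r lexx ler01.
- by exists 0, 0, 1; rewrite scale1r !scale0r !add0r lexx ler01.
Qed.

Lemma vertex_mem K z : K \in M -> z \in vertices K -> z \in mesh_vertices M.
Proof.
move=> KM zK; rewrite mem_undup; apply/flattenP; exists (vertices K) => //.
exact: map_f.
Qed.

Lemma strict_point K : tdet K != 0 -> exists p, strict K p.
Proof.
move=> D0; exists (3^-1 *: newest K + 3^-1 *: edge1 K + 3^-1 *: edge2 K).
rewrite /strict trd_comb //; last by field.
by split; rewrite /= ?subrr ?normr0; lra.
Qed.

Lemma osc_coercive (B : R) : exists B', forall c : vec, vec_osc u c <= B -> forall i, `|c 0 i| <= B'.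
Proof.
have key i : exists b, forall c : vec, vec_osc u c <= B -> `|c 0 i| <= b.
  have D0 := tri_det gM i; have [p sp] := strict_point D0.
  pose z := newest (tri i); have zT : z \in vertices (tri i) by rewrite mem_head.
  have [e e0 he] := strict_nbhs sp.
  have [q q1 q2|v [rv hv supp v0]] := @box_hat p e (patch z) e0.
    by apply: (strict_patch (tri_mem i)); [exact: hull_vertex|exact: he].
  have wv := regular_wdiff rv; have g0 := gnorm_ge0 v.
  have g1 : 0 < gnorm v + 1 by lra.
  exists ((`|f v| + B * (gnorm v + 1)) / \int[mu]_p v p) => c hc.
  have zM := vertex_mem (tri_mem i) zT.
  have bd := le_trans (Hm1_le_osc gM wu c zM) hc.
  have iv : itg v.
    have [b [L [N [G h]]]] := rv; have [b0 hl hout _ _] := h.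
    exact: bdd_itg (lip_bdd b0 hl hout).
  have int : \int[mu]_p (pconst c p * v p) = c 0 i * \int[mu]_p v p.
    rewrite -RintZ //; apply: eq_Rint => q; have [->|vq] := eqVneq (v q) 0; first by rewrite !mulr0.
    by have [q1 q2] := supp _ vq; rewrite (pconstE gM c (he _ q1 q2)).
  have Rv : `|resid u c v| <= B * (gnorm v + 1).
    apply: (@le_trans _ _ ((gnorm v + 1) * Hm1norm (patch z) (resid u c))); last first.
      by rewrite mulrC ler_wpM2r // ltW.
    have hvO s : H10 Omega (fun p => s * v p) := patch_H10 gM (hv s).
    have hvO1 : H10 Omega v by have := hvO 1; congr (H10 _ _); apply/funext => q; rewrite mul1r.
    have hs s : H10 (patch z) (fun p => s * v p) /\ resid u c (fun p => s * v p) = s * resid u c v.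
      exact: (conj (hv s) (residZ gM wu c wv hvO1 (hvO s))).
    have gle : gnorm v <= gnorm v + 1 by rewrite lerDl.
    exact: (Hm1norm_ge_scaled (@patch_open M z) (@resid_bounded M gM u wu c z) hs wv g1 gle).
  rewrite ler_pdivlMr // -[X in _ * X]gtr0_norm // -normrM -int.
  rewrite (_ : \int[mu]_p _ = f v - resid u c v); last by rewrite /resid; ring.
  by apply: le_trans (ler_normB _ _) _; rewrite lerD2l.
have /choice [b hb] := key.
exists (\sum_i `|b i|) => c hc i; apply: le_trans (hb i c hc) _.
rewrite (bigD1 i) //=; apply: le_trans (ler_norm _) _; rewrite lerDl; exact: sumr_ge0.
Qed.

Lemma osc_min : exists2 g, P0 Omega M g & forall g', P0 Omega M g' ->
  oscillation Omega f M g <= oscillation Omega f M g'.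
Proof.
have [B' hB] := osc_coercive (vec_osc u (0 : vec)).
pose A : set vec := [set c | forall i, `|c 0 i| <= B'].
have A0 : A 0 by exact: hB.
have cA : compact A.
  have -> : A = [set c : vec | forall i, `[- B', B']%classic (c ord0 i)].
    by apply/seteqP; split => c h i; have := h i; rewrite /= in_itv /= -ler_norml.
  exact: (@rV_compact R (size M) (fun=> `[- B', B']%classic) (fun=> @segment_compact R _ _)).
have [|c cAc hc] := @EVT_min_rV R (size M) (vec_osc u) A (ex_intro _ 0 A0) cA.
  exact: continuous_subspaceT (vec_osc_continuous gM wu).
exists (pconst c); first exact: P0_pconst.
move=> g' /(P0_normal gM) [c' /oscillationE ->].
rewrite (@oscillationE _ u (pconst c) c); last first.
  move=> v mv; rewrite Rint_setE; apply: eq_Rint => p; have [Op|Op] := pselect (Omega p).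
    by rewrite indicE mem_set // mulr1.
  by rewrite pconst_outside // !mul0r.
have /orP[le0|gt0] := le_total (vec_osc u c') (vec_osc u (0 : vec)).
  by apply: hc; rewrite inE => i; exact: (hB c' le0).
by apply: le_trans gt0; apply: hc; rewrite inE; exact: A0.
Qed.

End OscillationMin.

End DualNorms.

(** * Newest vertex bisection *)

Section Meshes.
Context {R : realType}.
Local Notation Omega := (@unit_square R).
Implicit Types (p q z x y : R * R) (s t : R) (K T C : triangle R) (M S : seq (triangle R)).

Lemma child_mem K T : T \in children K -> exists b, T = child K b.
Proof. by rewrite childrenE !inE => /orP[/eqP ->|/eqP ->]; [exists false|exists true]. Qed.

Lemma mem_child K b : child K b \in children K.
Proof. by rewrite childrenE !inE; case: b; rewrite eqxx ?orbT. Qed.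

Lemma bisectP S M T : reflect (exists2 K, K \in M &
  if K \in S then is_true (T \in children K) else T = K) (T \in bisect S M).
Proof.
apply: (iffP flatten_mapP) => -[K KM h]; exists K => //; move: h; case: (K \in S) => //.
  by rewrite inE => /eqP.
by move=> ->; rewrite inE.
Qed.

Lemma bisect_node S M T : T \in bisect S M -> exists2 K, K \in M & exists w, T = node K w.
Proof.
move=> /bisectP [K KM h]; exists K => //; move: h; case: (K \in S).
  by move=> /child_mem [b ->]; exists [:: b].
by move=> ->; exists [::].
Qed.

Lemma bisect_cons S K M : bisect S (K :: M) =
  (if K \in S then children K else [:: K]) ++ bisect S M.
Proof. by []. Qed.

Lemma bisect_cat S M M' : bisect S (M ++ M') = bisect S M ++ bisect S M'.
Proof. by rewrite /bisect map_cat flatten_cat. Qed.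

Lemma hull_children K p : tdet K != 0 -> hull K p -> exists b, hull (child K b) p.
Proof.
move=> D0 /(node_cover 1 D0) [w [sw h]]; case: w sw h => [|b [|]] //= _ h; by exists b.
Qed.

Lemma good_bisect S M : good M -> good (bisect S M).
Proof.
move=> [uM hM cM dM].
have hB T : T \in bisect S M -> tdet T != 0.
  by move=> /bisect_node [K KM [w ->]]; apply: tdet_node; exact: hM.
split => //.
- have dis K K' T : K \in M -> K' \in M -> K != K' ->
      T \in (if K \in S then children K else [:: K]) ->
      T \in (if K' \in S then children K' else [:: K']) -> False.
    have nd K0 : T \in (if K0 \in S then children K0 else [:: K0]) -> exists w, T = node K0 w.
      case: (K0 \in S); first by move=> /child_mem [b ->]; exists [:: b].
      by rewrite inE => /eqP ->; exists [::].
    move=> KM K'M KK /nd [w e] /nd [w' e'].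
    have D1 : tdet T != 0 by rewrite e; apply: tdet_node; exact: hM.
    have [p sp] := strict_point D1; have hp := strict_hull D1 sp.
    rewrite e in sp; rewrite e' in hp.
    exact: (dM _ _ _ KM K'M KK (strict_node (hM _ KM) sp) (hull_node (hM _ K'M) hp)).
  suff gen M1 : uniq M1 -> {subset M1 <= M} -> uniq (bisect S M1) by exact: gen.
  elim: M1 => [//|K M1 IH] /= /andP[KM1 u1] sub.
  have KM : K \in M by apply: sub; rewrite mem_head.
  rewrite bisect_cons cat_uniq IH ?andbT //; last by move=> T T1; apply: sub; rewrite in_cons T1 orbT.
  apply/andP; split.
    case: (K \in S) => //; rewrite childrenE /= inE andbT; apply/eqP => e.
    have D1 := tdet_child_neq0 false (hM _ KM); have [p sp] := strict_point D1.
    apply: (@node_disjoint _ K [:: false] [:: true] p (hM _ KM)) => //=.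
    by rewrite -e; exact: strict_hull.
  apply/hasPn => T /flatten_mapP [K' K'1 T']; apply/negP => /= T1.
  apply: (dis K K' T) => //; first by apply: sub; rewrite in_cons K'1 orbT.
  by apply: contraNneq KM1 => ->.
- rewrite cM; apply/seteqP; split => p [K KM hp].
    have [KS|KS] := boolP (K \in S); last by exists K => //; apply/bisectP; exists K => //; rewrite (negbTE KS).
    have [b hb] := hull_children (hM _ KM) hp; exists (child K b) => //.
    by apply/bisectP; exists K => //; rewrite KS mem_child.
  have [K' K'M [w e]] := bisect_node KM; exists K' => //; rewrite e in hp.
  exact: hull_node (hM _ K'M) hp.
- move=> T T' p /bisectP [K KM hT] /bisectP [K' K'M hT'] TT sT hT''.
  have nd K0 T0 : K0 \in M -> (if K0 \in S then is_true (T0 \in children K0) else T0 = K0) ->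
     exists w, T0 = node K0 w /\ size w = (K0 \in S).
    move=> _; case: (K0 \in S); first by move=> /child_mem [b ->]; exists [:: b].
    by move=> ->; exists [::].
  have [w [e sw]] := nd _ _ KM hT; have [w' [e' sw']] := nd _ _ K'M hT'.
  have [KK|KK] := eqVneq K K'.
    subst K' T T'; apply: (@node_disjoint _ K w w' p (hM _ KM)) => //; first by rewrite sw sw'.
    by apply: contra_neq TT => ->.
  rewrite e in sT; rewrite e' in hT''.
  exact: (dM _ _ _ KM K'M KK (strict_node (hM _ KM) sT) (hull_node (hM _ K'M) hT'')).
Qed.

Inductive reach M0 : seq (triangle R) -> Prop :=
| Reach0 : reach M0 M0
| ReachS M S : reach M0 M -> reach M0 (bisect S M).

Lemma reach_trans M0 M1 M2 : reach M0 M1 -> reach M1 M2 -> reach M0 M2.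
Proof. by move=> h; elim=> // M S _ IH; exact: ReachS. Qed.

Lemma completion_reach M M' : completion M M' -> reach M M'.
Proof.
elim=> [M1 _|M1 M2 _ _ IH]; first exact: Reach0.
by apply: reach_trans IH; apply: ReachS; exact: Reach0.
Qed.

Lemma recursive_reach M K M' : recursive_refinement M K M' -> reach M M'.
Proof.
elim=> {M K M'} [M K _ _|M K K' _ _ _|M K K' M1 M2 _ _ _ _ h1 _ h2].
- exact/ReachS/Reach0.
- exact/ReachS/Reach0.
- exact: reach_trans h1 h2.
Qed.

Lemma nvb_reach M0 M : nvb M0 M -> reach M0 M.
Proof.
elim=> [|M1 S M2 _ h _ /completion_reach h'|M1 K M2 _ h /recursive_reach h'].
- exact: Reach0.
- by apply: reach_trans h'; exact: ReachS.
- exact: reach_trans h h'.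
Qed.

Lemma reach_good M0 M : good M0 -> reach M0 M -> good M.
Proof. by move=> g0; elim=> // M1 S _; exact: good_bisect. Qed.

Lemma size_bisect S M : size (bisect S M) = (size M + count (mem S) M)%N.
Proof.
elim: M => //= K M IH; rewrite bisect_cons size_cat IH.
by case: (K \in S); rewrite /= ?add1n ?addSn ?addnS ?add0n.
Qed.

Lemma bisect_none S M : count (mem S) M = 0%N -> bisect S M = M.
Proof.
elim: M => //= K M IH; rewrite bisect_cons; case: (K \in S) => //=.
by rewrite add0n => /IH ->.
Qed.

(* A bisection step only depends on which entries of the list are marked. *)
Definition submasks M : seq (seq (triangle R)) :=
  [seq mask (val m) M | m <- enum {: (size M).-tuple bool}].

Lemma submasksP S M : exists2 S', S' \in submasks M & bisect S M = bisect S' M.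
Proof.
pose m : seq bool := [seq K \in S | K <- M].
have sm : size m == size M by rewrite size_map.
exists (mask m M); first by apply/mapP; exists (Tuple sm) => //; rewrite mem_enum.
have -> : mask m M = [seq K <- M | K \in S] by rewrite filter_mask.
by congr flatten; apply/eq_in_map => K KM; rewrite mem_filter KM andbT.
Qed.

Fixpoint levels M0 n : seq (seq (triangle R)) :=
  if n is n'.+1 then
    levels M0 n' ++ flatten [seq [seq bisect Z M | Z <- submasks M] | M <- levels M0 n']
  else [:: M0].

Lemma reach_levels M0 M : reach M0 M -> exists n, (n + size M0 <= size M)%N /\ M \in levels M0 n.
Proof.
elim=> [|M1 S _ [n [hn Mn]]]; first by exists 0%N; rewrite add0n mem_head.
have [c0|c0] := posnP (count (mem S) M1); first by rewrite bisect_none //; exists n.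
have [S' S'm e] := submasksP S M1; exists n.+1; split.
  rewrite size_bisect addSn -addnS; apply: leq_trans (_ : size M1 + 1 <= _)%N; last by rewrite leq_add2l.
  by rewrite addn1 addnS ltnS.
rewrite e.
rewrite /= mem_cat; apply/orP; right; apply/flatten_mapP; exists M1 => //; exact: map_f.
Qed.

Definition forest M T := (exists K w, [/\ K \in M, w != [::] & T = node K w]) \/
  forall p, hull T p -> exists w, node T w \in M /\ hull (node T w) p.

Lemma reach_forest M0 M K w : good M0 -> K \in M0 -> reach M0 M -> forest M (node K w).
Proof.
move=> g0 KM0; elim=> [|M1 S h1 IH].
  case: w => [|b w]; first by right => p hp; exists [::].
  by left; exists K, (b :: w).
have [_ hM1 _ _] := reach_good g0 h1.
case: IH => [[T [v [TM vn e]]]|h]; last first.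
  right=> p hp; have [v [vM hv]] := h p hp.
  have [vS|vS] := boolP (node (node K w) v \in S); last first.
    by exists v; split => //; apply/bisectP; exists (node (node K w) v) => //; rewrite (negbTE vS).
  have [b hb] := hull_children (hM1 _ vM) hv; exists (v ++ [:: b]).
  rewrite node_cat /=; split => //; apply/bisectP.
  by exists (node (node K w) v) => //; rewrite vS mem_child.
rewrite e; have [TS|TS] := boolP (T \in S); last first.
  by left; exists T, v; split => //; apply/bisectP; exists T => //; rewrite (negbTE TS).
case: v vn e => // b v _ e.
have cM : child T b \in bisect S M1 by apply/bisectP; exists T => //; rewrite TS mem_child.
case: v e => [|b' v] e; first by right => p hp; exists [::].
by left; exists (child T b), (b' :: v).
Qed.

Definition wt K p x : R := tr K p * (x == newest K)%:R + (1 - tr K p + td K p) / 2 * (x == edge1 K)%:R +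
  (1 - tr K p - td K p) / 2 * (x == edge2 K)%:R.

Definition conf M := forall K K' p x, K \in M -> K' \in M -> hull K p -> hull K' p ->
  wt K p x = wt K' p x.

Lemma wt_vertex K z x : tdet K != 0 -> z \in vertices K -> wt K z x = (x == z)%:R.
Proof.
move=> D0; rewrite /vertices !inE /wt => /or3P[] /eqP ->.
- by have [-> ->] := trd_newest D0; ring.
- by have [-> ->] := trd_edge1 D0; field.
- by have [-> ->] := trd_edge2 D0; field.
Qed.

Lemma wt_affine K p q x (s t : R) : s + t = 1 -> wt K (s *: p + t *: q) x = s * wt K p x + t * wt K q x.
Proof.
move=> st; have [e1 e2] := trd_affine K p q st; rewrite /wt e1 e2 /= /GRing.scale /=.
have -> : s = 1 - t; [by lra|by field].
Qed.

Lemma wt_pos K p x : wt K p x != 0 -> x \in vertices K.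
Proof.
rewrite /vertices !inE /wt; case: (x == newest K) => //; case: (x == edge1 K) => //.
by case: (x == edge2 K) => //; rewrite !mulr0 !addr0 eqxx.
Qed.

Lemma segm_bnd K y z p : tdet K != 0 -> y \in vertices K -> z \in vertices K -> segm y z p -> ~ strict K p.
Proof.
move=> D0 yK zK [t /andP[t0 t1] ->]; rewrite /strict /strict_ref /trd /= => -[].
have [-> ->] : (tr K ((1 - t) *: y + t *: z) = (1 - t) * tr K y + t * tr K z) /\
   (td K ((1 - t) *: y + t *: z) = (1 - t) * td K y + t * td K z).
  by have [-> ->] := trd_affine K y z (subrK t 1).
have vals v : v \in vertices K -> [\/ tr K v = 1 /\ td K v = 0, tr K v = 0 /\ td K v = 1 | tr K v = 0 /\ td K v = -1].
  rewrite /vertices !inE => /or3P[] /eqP ->.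
  - by have [-> ->] := trd_newest D0; constructor 1.
  - by have [-> ->] := trd_edge1 D0; constructor 2.
  - by have [-> ->] := trd_edge2 D0; constructor 3.
move=> h1; rewrite ltr_norml => /andP[h2 h3].
by case: (vals y yK) => -[e1 e2]; case: (vals z zK) => -[e3 e4]; move: h1 h2 h3; rewrite e1 e2 e3 e4; lra.
Qed.

Lemma triangulation_good M : triangulation Omega M -> good M /\ conf M.
Proof.
move=> [uM nM cM fM]; have hM K : K \in M -> tdet K != 0 by move=> /nM /nondegenerateE.
have sgm y z p : segm y z p -> exists s t : R, s + t = 1 /\ p = s *: y + t *: z.
  by move=> [t _ ->]; exists (1 - t), t; split => //; ring.
split.
  split => // K K' p KM K'M KK sp hp'; have hp := strict_hull (hM _ KM) sp.
  have both : (hull K `&` hull K') p by split.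
  case: (fM K K' KM K'M KK) => [e|[z [zK _] e]|[y [z [[yK _] [zK _] _ e]]]].
  - by rewrite e in both.
  - rewrite e in both; apply: (@segm_bnd K z z p) => //; first exact: hM.
    by exists 0; rewrite ?lexx ?ler01 // both subr0 scale1r scale0r addr0.
  - by rewrite e in both; apply: (segm_bnd (hM _ KM) yK zK both).
move=> K K' p x KM K'M hp hp'; have [->//|KK] := eqVneq K K'.
have both : (hull K `&` hull K') p by split.
case: (fM K K' KM K'M KK) => [e|[z [zK zK'] e]|[y [z [[yK yK'] [zK zK'] _ e]]]].
- by rewrite e in both.
- by rewrite e in both; rewrite both !wt_vertex //; exact: hM.
- rewrite e in both; have [s [t [st ->]]] := sgm _ _ _ both.
  by rewrite !wt_affine // !wt_vertex //; exact: hM.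
Qed.

Lemma conf_regular M : good M -> conf M -> irregular M = [::].
Proof.
move=> [_ hM _ _] cM; apply/eqP; rewrite -[_ == _]negbK -has_filter; apply/hasPn => K KM.
apply/hasPn => z /=; rewrite mem_undup => /flatten_mapP [K' K'M zK'].
apply/negP => /andP[/asboolP hz /negP]; apply.
apply: (@wt_pos K z z); rewrite (cM K K' z z KM K'M hz (hull_vertex zK')).
by rewrite wt_vertex ?eqxx ?oner_eq0 //; exact: hM.
Qed.

(* The weights of [p] at the vertices of the grandchild of [K] that contains it. *)
Definition gwt K p x : R :=
  let e := if 0 <= td K p then edge1 K else edge2 K in let a := `|td K p| in
  (1 - tr K p - a) * (x == midpoint (edge1 K) (edge2 K))%:R +
  (tr K p + a - `|tr K p - a|) * (x == midpoint (newest K) e)%:R +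
  Num.max 0 (tr K p - a) * (x == newest K)%:R + Num.max 0 (a - tr K p) * (x == e)%:R.

Lemma midpointC y z : midpoint y z = midpoint z y :> R * R.
Proof. by rewrite /midpoint addrC. Qed.

Lemma wt_grandchild K b1 b2 p x : tdet K != 0 -> hull (node K [:: b1; b2]) p ->
  wt (node K [:: b1; b2]) p x = gwt K p x.
Proof.
move=> D0 hp; have D1 := tdet_child_neq0 b1 D0.
have := hp; rewrite /node /= hull_child // => -[hc hd'].
have := hc; rewrite hull_child // => -[hK hd].
have := trd_node D0 hp; rewrite /= => -[e1 e2].
have := trd_child_fold D0 hd; case=> e3 e4; rewrite e4 in hd'.
rewrite /wt e1 e2 /gwt.
have -> : newest (child (child K b1) b2) = midpoint (newest K) (if b1 then edge2 K else edge1 K) by [].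
have -> : edge1 (child (child K b1) b2) = midpoint (edge1 K) (edge2 K) by [].
have -> : edge2 (child (child K b1) b2) = if b2 then (if b1 then edge2 K else edge1 K) else newest K by [].
have := (hullP _ D0).1 hK; case=> /= r0; rewrite ler_norml => /andP[d1 d2].
set r := tr K p in r0 d1 d2 hd' *; set d := td K p in d1 d2 hd hd' *.
have [d0|d0] := eqVneq d 0.
  rewrite d0 normr0 !subr0 lexx in hd' *; rewrite !addr0.
  case: b2 hd' {hp e1 e2 D1 hc e3 e4} => hd'; last first.
    by rewrite (ger0_norm hd') (max_r hd') max_l; [case: (b1); rewrite /=; field|lra].
  have -> : r = 0 by lra.
  by rewrite normr0 !subr0 !maxxx; case: (b1); rewrite /=; field.
have -> : (0 <= d) = ~~ b1.
  by case: (b1) hd => h; rewrite ?h //; apply/negbTE; rewrite -ltNge lt_neqAle d0.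
case: b1 hd {hp e1 e2 D1 hc e3 e4} => hd /=.
  rewrite (ler0_norm hd) in hd' *; case: b2 hd' => hd'.
    by rewrite (ler0_norm hd') max_l ?max_r; [field|lra|lra].
  by rewrite (ger0_norm hd') max_r ?max_l; [field|lra|lra].
rewrite (ger0_norm hd) in hd' *; case: b2 hd' => hd'.
  by rewrite (ler0_norm hd') max_l ?max_r; [field|lra|lra].
by rewrite (ger0_norm hd') max_r ?max_l; [field|lra|lra].
Qed.

Definition emix (y z : R * R) (t : R) x : R :=
  (1 - `|2 * t - 1|) * (x == midpoint y z)%:R +
  Num.max 0 (2 * t - 1) * (x == y)%:R + Num.max 0 (1 - 2 * t) * (x == z)%:R.

Lemma gwt_boundary K p : tdet K != 0 -> hull K p -> ~ strict K p ->
  exists y z t, [/\ y != z, forall x, wt K p x = t * (x == y)%:R + (1 - t) * (x == z)%:R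
    & forall x, gwt K p x = emix y z t x].
Proof.
move=> D0 hp sp; have ne : [/\ newest K != edge1 K, newest K != edge2 K & edge1 K != edge2 K].
  split; apply/eqP => e.
  - by have := trd_newest D0; rewrite e trd_edge1 // => -[/eqP]; rewrite eq_sym oner_eq0.
  - by have := trd_newest D0; rewrite e trd_edge2 // => -[/eqP]; rewrite eq_sym oner_eq0.
  - by have := trd_edge1 D0; rewrite e trd_edge2 // => -[h]; clear e; lra.
have [n1 n2 n3] := ne.
have := (hullP _ D0).1 hp; rewrite /in_ref /trd /= => -[r0 dr].
have : tr K p = 0 \/ `|td K p| = 1 - tr K p.
  have [->|rn] := eqVneq (tr K p) 0; [by left|right].
  apply/eqP; rewrite eq_le dr leNgt; apply/negP => h; apply: sp; split => //=.
  by rewrite lt_neqAle eq_sym rn.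
rewrite /wt /gwt; move: (tr K p) (td K p) r0 dr => r d r0 dr [e|e].
  rewrite e; exists (edge1 K), (edge2 K), ((1 + d) / 2); split => // x; first by field.
  rewrite /emix !subr0 !sub0r !add0r normrN normr_id subrr mul0r addr0.
  have -> : 2 * ((1 + d) / 2) - 1 = d by field.
  have -> : 1 - 2 * ((1 + d) / 2) = - d by field.
  have [d0|d0] := leP 0 d; first by rewrite ger0_norm // (max_l (x := 0) (y := - d)) ?(max_r d0) ?max_l; [ring|lra..].
  by rewrite ltr0_norm // opprK ?(max_l (ltW d0)) !max_r ?oppr_ge0 ?(ltW d0) //; ring.
have [d0|d0] := leP 0 d.
  rewrite ger0_norm // in e *; exists (newest K), (edge1 K), r; split => // x; first by rewrite e; field.
  rewrite /emix e; have -> : r - (1 - r) = 2 * r - 1 by ring.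
  have -> : 1 - r - r = 1 - 2 * r by ring.
  by ring.
rewrite ltr0_norm // in e *; exists (newest K), (edge2 K), r; split => // x.
  have -> : d = r - 1; [by lra|by field].
rewrite /emix e; have -> : r - (1 - r) = 2 * r - 1 by ring.
have -> : 1 - r - r = 1 - 2 * r by ring.
by ring.
Qed.

Lemma emix_unique y z y' z' s t x : y != z -> y' != z' ->
  (forall x, s * (x == y)%:R + (1 - s) * (x == z)%:R = t * (x == y')%:R + (1 - t) * (x == z')%:R :> R) ->
  emix y z s x = emix y' z' t x.
Proof.
move=> yz yz' h.
have e0 a b : emix a b 1 x = (x == a)%:R.
  rewrite /emix; have -> : 2 * 1 - 1 = 1 :> R by ring.
  by rewrite normr1 (max_r ler01) max_l; [ring|lra].
have swap a b r : emix a b r x = emix b a (1 - r) x.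
  rewrite /emix (midpointC a b) -(normrN (2 * (1 - r) - 1)).
  have -> : - (2 * (1 - r) - 1) = 2 * r - 1 by ring.
  have -> : 2 * (1 - r) - 1 = 1 - 2 * r by ring.
  have -> : 1 - 2 * (1 - r) = 2 * r - 1 by ring.
  by ring.
have e1 a b : emix a b 0 x = (x == b)%:R by rewrite swap subr0 e0.
have hy := h y; have hz := h z; rewrite eqxx (negbTE yz) /= in hy; rewrite eqxx eq_sym (negbTE yz) /= in hz.
have [yy|yy] := eqVneq y y'.
  subst y'; rewrite eqxx (negbTE yz') /= in hy; have st : s = t by lra.
  subst t; have [zz|zz] := eqVneq z z'; first by subst z'.
  rewrite (eq_sym z y) (negbTE yz) (negbTE zz) /= in hz.
  have -> : s = 1 by lra.
  by rewrite !e0.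
rewrite (negbTE yy) /= in hy; have [yz1|yz1] := eqVneq y z'.
  subst z'; rewrite eqxx /= in hy; have st : s = 1 - t by lra.
  have [zy|zy] := eqVneq z y'; first by subst y' s; rewrite swap; congr emix; ring.
  rewrite (negbTE zy) (eq_sym z y) (negbTE yz) /= in hz.
  have s1 : s = 1 by lra.
  have t0 : t = 0 by lra.
  by rewrite s1 t0 e0 e1.
rewrite (negbTE yz1) /= in hy; have s0 : s = 0 by lra.
rewrite s0 e1; have [zy|zy] := eqVneq z y'.
  subst y'; rewrite eqxx (negbTE yz') s0 /= in hz.
  have -> : t = 1 by lra.
  by rewrite e0.
rewrite (negbTE zy) /= in hz; have [zz|zz] := eqVneq z z'.
  subst z'; rewrite eqxx s0 /= in hz.
  have -> : t = 0 by lra.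
  by rewrite e1.
by rewrite (negbTE zz) s0 /= in hz; lra.
Qed.

Definition refine M := bisect (bisect M M) (bisect M M).

Lemma bisect_self S M : {subset M <= S} -> bisect S M = flatten [seq children K | K <- M].
Proof. by move=> h; congr flatten; apply/eq_in_map => K /h ->. Qed.

Lemma refineP M T : reflect (exists2 K, K \in M & exists b1 b2, T = node K [:: b1; b2]) (T \in refine M).
Proof.
rewrite /refine bisect_self //; apply: (iffP flatten_mapP) => -[K].
  rewrite bisect_self // => /flatten_mapP [K' K'M /child_mem [b1 ->]] /child_mem [b2 ->].
  by exists K' => //; exists b1, b2.
move=> KM [b1 [b2 ->]]; exists (child K b1); last exact: mem_child.
by rewrite bisect_self //; apply/flatten_mapP; exists K => //; exact: mem_child.
Qed.

Lemma refine_conf M : good M -> conf M -> conf (refine M).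
Proof.
move=> [uM hM cM dM] cfM T T' p x /refineP [K KM [b1 [b2 ->]]] /refineP [K' K'M [b3 [b4 ->]]] hp hp'.
have D0 := hM _ KM; have D0' := hM _ K'M.
rewrite !wt_grandchild //; have hK := hull_node D0 hp; have hK' := hull_node D0' hp'.
have [->//|KK] := eqVneq K K'.
have sK : ~ strict K p by move=> /(dM _ _ _ KM K'M KK).
have sK' : ~ strict K' p by move=> h; apply: (dM _ _ _ K'M KM _ h) => //; rewrite eq_sym.
have [y [z [t [yz h1 ->]]]] := gwt_boundary D0 hK sK.
have [y' [z' [t' [yz' h1' ->]]]] := gwt_boundary D0' hK' sK'.
by apply: emix_unique => // v; rewrite -h1 -h1'; exact: cfM.
Qed.

Lemma refine_good M : good M -> good (refine M).
Proof. by move=> h; do 2 apply: good_bisect. Qed.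

Lemma vertices_child C b x : x \in vertices (child C b) ->
  x \in vertices C \/ x = midpoint (edge1 C) (edge2 C).
Proof.
rewrite /vertices /child !inE => /or3P[] /eqP ->; [by right|by left; rewrite eqxx|left].
by rewrite /edge2 /=; case: b; rewrite eqxx ?orbT.
Qed.

Lemma vertex_children C x : x \in vertices C -> exists b, x \in vertices (child C b).
Proof.
rewrite /vertices !inE => /or3P[] /eqP ->; [exists false|exists false|exists true];
by rewrite /vertices !inE /child /newest /edge1 /edge2 /= eqxx ?orbT.
Qed.

Lemma irregularP M K : reflect (K \in M /\ exists2 z, z \in mesh_vertices M & hull K z /\ z \notin vertices K)
  (K \in irregular M).
Proof.
rewrite mem_filter; apply: (iffP andP) => [[/hasP [z zM /andP[/asboolP h1 h2]] KM]|[KM [z zM [h1 h2]]]].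
  by split=> //; exists z.
by split=> //; apply/hasP; exists z => //; rewrite h2 andbT; exact/asboolP.
Qed.

Lemma mesh_verticesP M z : reflect (exists2 K, K \in M & z \in vertices K) (z \in mesh_vertices M).
Proof. by rewrite mem_undup; exact: flatten_mapP. Qed.

Section Refinement.
Variable M : seq (triangle R).
Hypotheses (gM : good M) (cfM : conf M).
Let M1 := bisect M M.
Let M2 := bisect (irregular M1) M1.

Lemma refine_vertex C z : C \in M1 -> hull C z -> z \in mesh_vertices (refine M) ->
  z \in vertices C \/ z = midpoint (edge1 C) (edge2 C).
Proof.
move=> CM hz /mesh_verticesP [T TR zT].
have g1 : good M1 := good_bisect M gM; have [_ h1 _ _] := g1.
have [b hb] := hull_children (h1 _ CM) hz.
have CR : child C b \in refine M by rewrite /refine bisect_self //; apply/flatten_mapP; exists C => //; exact: mem_child.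
apply: (vertices_child (b := b)); apply: (@wt_pos _ z).
have [_ hR _ _] := refine_good gM.
rewrite (refine_conf gM cfM z CR TR hb (hull_vertex zT)) wt_vertex ?eqxx ?oner_eq0 //.
exact: hR.
Qed.

Lemma vertices1 z : z \in mesh_vertices M1 -> z \in mesh_vertices (refine M).
Proof.
move=> /mesh_verticesP [C CM zC]; have [b zb] := vertex_children zC.
apply/mesh_verticesP; exists (child C b) => //.
by rewrite /refine bisect_self //; apply/flatten_mapP; exists C => //; exact: mem_child.
Qed.

(* The midpoint of the refinement edge of an irregular child is its hanging node. *)
Lemma irregular_midpoint C : C \in irregular M1 -> midpoint (edge1 C) (edge2 C) \in mesh_vertices M1.
Proof.
move=> /irregularP [CM [z zM [hz zC]]].
have [zC'|<-//] := refine_vertex CM hz (vertices1 zM).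
by rewrite zC' in zC.
Qed.

Lemma vertices2 z : z \in mesh_vertices M2 -> z \in mesh_vertices M1.
Proof.
move=> /mesh_verticesP [T /bisectP [C CM]].
have [CI /child_mem [b ->]|_ -> zC] := boolP (C \in irregular M1); last by apply/mesh_verticesP; exists C.
move=> /vertices_child [zC|->]; first by apply/mesh_verticesP; exists C.
exact: irregular_midpoint.
Qed.

Lemma regular2 : irregular M2 = [::].
Proof.
apply/eqP; rewrite -size_eq0 -leqn0 leqNgt; apply/negP => h.
have /irregularP [/bisectP [C CM h'] [z /vertices2 zM [hz zT]]] : nth (0, 0, (0, 0), (0, 0)) (irregular M2) 0 \in irregular M2.
  exact: mem_nth.
move: h' hz zT; set T := nth _ _ _.
have [CI /child_mem [b ->] hz zT|CI -> hz zC] := boolP (C \in irregular M1).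
  have CR : child C b \in refine M by rewrite /refine bisect_self //; apply/flatten_mapP; exists C => //; exact: mem_child.
  have /mesh_verticesP [T' T'R zT'] := vertices1 zM.
  move/negP: zT; apply; apply: (@wt_pos _ z).
  have [_ hR _ _] := refine_good gM.
  by rewrite (refine_conf gM cfM z CR T'R hz (hull_vertex zT')) wt_vertex ?eqxx ?oner_eq0 //; exact: hR.
by move/negP: CI; apply; apply/irregularP; split => //; exists z.
Qed.

Lemma completion1 : completion M1 M2.
Proof.
have [e|e] := eqVneq (irregular M1) [::].
  have -> : M2 = M1 by rewrite /M2 e bisect_none //; elim: M1.
  exact: Completion_done.
by apply: Completion_step; [exact/eqP|apply: Completion_done; exact: regular2].
Qed.

Lemma completion2 : exists S, {subset S <= M2} /\ bisect S M2 = refine M.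
Proof.
pose S := [seq C <- M1 | C \notin irregular M1]; exists S; split.
  move=> C; rewrite mem_filter => /andP[CI CM]; apply/bisectP; exists C => //.
  by rewrite (negbTE CI).
have g1 : good M1 := good_bisect M gM; have [_ h1 _ d1] := g1.
have grand C b : C \in M1 -> C \in irregular M1 -> child C b \notin S.
  move=> CM CI; apply/negP; rewrite mem_filter => /andP[bI bM].
  have nb : child C b != C by apply: contraNneq bI => ->.
  have [p sp] := strict_point (h1 _ bM).
  have hb := strict_hull (h1 _ bM) sp; move: hb; rewrite hull_child ?h1 // => -[hC _].
  exact: (d1 _ _ _ bM CM nb sp hC).
rewrite /refine (bisect_self (S := bisect M M)) // /M2.
suff gen N : {subset N <= M1} -> bisect S (bisect (irregular M1) N) = flatten [seq children K | K <- N].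
  exact: gen.
elim: N => [//|C N IH sub].
have -> : flatten [seq children K | K <- C :: N] = children C ++ flatten [seq children K | K <- N] by [].
rewrite bisect_cons bisect_cat IH; last by move=> T TN; apply: sub; rewrite in_cons TN orbT.
have CM : C \in M1 by apply: sub; rewrite mem_head.
congr (_ ++ _); have [CI|CI] := boolP (C \in irregular M1).
  by rewrite childrenE /bisect /= (negbTE (grand C false CM CI)) (negbTE (grand C true CM CI)).
by rewrite /bisect /= mem_filter CI CM.
Qed.

Lemma nvb_refine M0 : nvb M0 M -> nvb M0 (refine M).
Proof.
move=> h; have h2 : nvb M0 M2 by apply: (Nvb_iterative (S := M) h) => //; exact: completion1.
have [S [sub e]] := completion2; apply: (Nvb_iterative h2 sub); rewrite e.
by apply: Completion_done; apply: conf_regular; [exact: refine_good|exact: refine_conf].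
Qed.

End Refinement.

Lemma size_refine M : size (refine M) = (4 * size M)%N.
Proof.
have c (N : seq (triangle R)) : size (bisect N N) = (2 * size N)%N.
  by rewrite size_bisect mul2n -addnn; congr (_ + _)%N; apply/eqP; rewrite -all_count; apply/allP.
by rewrite /refine !c mulnA.
Qed.

Lemma iter_refine M0 l : triangulation Omega M0 ->
  [/\ nvb M0 (iter l refine M0), good (iter l refine M0), size (iter l refine M0) = (4 ^ l * size M0)%N &
   forall T, T \in iter l refine M0 <-> exists2 K, K \in M0 & exists w, size w = l.*2 /\ T = node K w].
Proof.
move=> /triangulation_good [g0 c0].
suff : [/\ nvb M0 (iter l refine M0), good (iter l refine M0), size (iter l refine M0) = (4 ^ l * size M0)%N,
   conf (iter l refine M0) &
   forall T, T \in iter l refine M0 <-> exists2 K, K \in M0 & exists w, size w = l.*2 /\ T = node K w].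
  by case.
elim: l => [|l [h1 h2 h3 h4 h5]].
  split => //=; [exact: Nvb_initial|by rewrite expn0 mul1n|].
  move=> T; split=> [TM|[K KM [w [/size0nil -> ->]]]] //; by exists T => //; exists [::].
rewrite iterS; split.
- exact: nvb_refine.
- exact: refine_good.
- by rewrite size_refine h3 expnS mulnA.
- exact: refine_conf.
move=> T; split.
  move=> /refineP [T' /h5 [K KM [w [sw ->]]] [b1 [b2 ->]]]; exists K => //.
  by exists (w ++ [:: b1; b2]); rewrite node_cat size_cat sw addn2 doubleS.
move=> [K KM [w [sw ->]]]; apply/refineP; exists (node K (take l.*2 w)).
  by apply/h5; exists K => //; exists (take l.*2 w); by rewrite size_takel // sw doubleS !leqW.
have : size (drop l.*2 w) = 2%N by rewrite size_drop sw doubleS -addn2 addKn.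
case e : (drop l.*2 w) => [|b1 [|b2 [|]]] // _; exists b1, b2.
by rewrite -node_cat -e cat_take_drop.
Qed.

End Meshes.

(** * Lower bound for the oscillation *)

Section LeafGeometry.
Context {R : realType}.
Implicit Types (p q z a : R * R) (s t : R) (K T : triangle R) (w : seq bool).

Definition img T K : triangle R := (trd T (newest K), trd T (edge1 K), trd T (edge2 K)).

Lemma trd_affine3 T (x y z : R * R) (r s t : R) : r + s + t = 1 ->
  trd T (r *: x + s *: y + t *: z) = r *: trd T x + s *: trd T y + t *: trd T z.
Proof.
move=> rst; have -> : r = 1 - s - t by lra.
by rewrite /trd /tr /td; congr pair; rewrite /= /GRing.scale /=; ring.
Qed.

Lemma hull_img T K p : tdet T != 0 -> hull K p <-> hull (img T K) (trd T p).
Proof.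
move=> D0; split=> -[r [s [t [[r0 s0 t0 rst] e]]]]; exists r, s, t; split => //.
  by rewrite e trd_affine3.
by apply: (trd_inj D0); rewrite e trd_affine3.
Qed.

Lemma img_child T K b : img T (child K b) = child (img T K) b.
Proof.
rewrite /img /child /= -/(newest _).
have -> : trd T (midpoint (edge1 K) (edge2 K)) = midpoint (trd T (edge1 K)) (trd T (edge2 K)).
  have := @trd_affine3 T (edge1 K) (edge2 K) (edge2 K) 2^-1 2^-1 0.
  by rewrite !scale0r !addr0 -!scalerDr => -> //; field.
by case: b.
Qed.

Lemma img_node T K w : img T (node K w) = node (img T K) w.
Proof. by elim: w K => //= b w IH K; rewrite IH img_child. Qed.

Lemma img_self T : tdet T != 0 -> img T T = ((1, 0), (0, 1), (0, -1)).
Proof. by move=> D0; rewrite /img trd_newest // trd_edge1 // trd_edge2. Qed.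

(* The two third-generation descendants of [T] that share the segment from the
   midpoint [c] of the median to the newest vertex; [s = 1] or [-1] is their side. *)
Definition side (b : bool) : seq bool := [:: b; false; true].
Definition sgb (b : bool) : R := if b then -1 else 1.

Lemma img_side T b : tdet T != 0 ->
  img T (node T (side b)) = ((2^-1, 0), (2^-1, sgb b / 2), (1, 0)).
Proof.
move=> D0; rewrite img_node img_self // /side /node /= /child /midpoint /newest /edge1 /edge2 /=.
by case: b; rewrite /sgb; congr (_, _, _); congr pair; rewrite /= /GRing.scale /=; field.
Qed.

Definition iso K : Prop :=
  let d1 := edge1 K - newest K in let d2 := edge2 K - newest K in
  d1.1 * d2.1 + d1.2 * d2.2 = 0 /\ d1.1 ^+ 2 + d1.2 ^+ 2 = d2.1 ^+ 2 + d2.2 ^+ 2.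

Lemma iso_child K b : iso K -> iso (child K b).
Proof.
case: K => [[[z1 z2] [a1 a2]] [b1 b2]]; rewrite /iso /child /midpoint /newest /edge1 /edge2 /=.
rewrite /GRing.scale /= => -[h1 h2]; case: b => /=.
  have e : ((z1 - 2^-1 * (a1 + b1)) * (b1 - 2^-1 * (a1 + b1)) + (z2 - 2^-1 * (a2 + b2)) * (b2 - 2^-1 * (a2 + b2))) =
    ((a1 - z1) ^+ 2 + (a2 - z2) ^+ 2 - ((b1 - z1) ^+ 2 + (b2 - z2) ^+ 2)) / 4 by field.
  split; first by rewrite e h2 subrr mul0r.
  apply/eqP; rewrite -subr_eq0; apply/eqP.
  transitivity ((a1 - z1) * (b1 - z1) + (a2 - z2) * (b2 - z2)); last by [].
  by field.
have e : ((z1 - 2^-1 * (a1 + b1)) * (a1 - 2^-1 * (a1 + b1)) + (z2 - 2^-1 * (a2 + b2)) * (a2 - 2^-1 * (a2 + b2))) =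
  - ((a1 - z1) ^+ 2 + (a2 - z2) ^+ 2 - ((b1 - z1) ^+ 2 + (b2 - z2) ^+ 2)) / 4 by field.
split; first by rewrite e h2 subrr oppr0 mul0r.
apply/eqP; rewrite -subr_eq0; apply/eqP.
transitivity ((a1 - z1) * (b1 - z1) + (a2 - z2) * (b2 - z2)); last by [].
by field.
Qed.

Lemma iso_node K w : iso K -> iso (node K w).
Proof. by elim: w K => //= b w IH K /(iso_child b); exact: IH. Qed.

Lemma iso_side b : iso ((2^-1, 0), (2^-1, sgb b / 2), (1, 0)).
Proof.
by rewrite /iso /newest /edge1 /edge2 /= /sgb; case: b; split; field.
Qed.

Lemma hull_swap z a (b : R * R) p : hull (z, a, b) p -> hull (z, b, a) p.
Proof.
move=> [r [s [t [[r0 s0 t0 rst] ->]]]]; exists r, t, s; split; first by split => //; lra.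
by rewrite /newest /edge1 /edge2 /= addrAC.
Qed.

Lemma iso_swap z a (b : R * R) : iso (z, a, b) -> iso (z, b, a).
Proof. by rewrite /iso /newest /edge1 /edge2 /= => -[h1 h2]; split; [rewrite -h1; ring|rewrite h2]. Qed.

Lemma sqr_signed (s e f : R) : s * s = 1 -> 0 <= s * e -> 0 <= f -> e ^+ 2 = f ^+ 2 -> e = s * f.
Proof.
move=> ss se f0 ef.
have h : (s * e) ^+ 2 = f ^+ 2 by rewrite exprMn ef expr2 ss mul1r.
have {}h : s * e = f by apply/eqP; rewrite -(eqrXn2 (n := 2)) ?h.
by rewrite -h mulrA ss mul1r.
Qed.

Lemma iso_leg (s z1 a1 : R) (b : R * R) p : s * s = 1 -> z1 != a1 -> 0 <= s * b.2 ->
  iso ((z1, 0), (a1, 0), b) ->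
  0 <= s * p.2 -> s * p.2 <= p.1 - Num.min z1 a1 -> s * p.2 <= Num.max z1 a1 - p.1 ->
  hull ((z1, 0), (a1, 0), b) p.
Proof.
move=> ss za sb; rewrite /iso /newest /edge1 /edge2 /= !subr0 => -[h1 h2] p0 pl pu.
have d0 : a1 - z1 != 0 by rewrite subr_eq0 eq_sym.
have b1 : b.1 = z1.
  by move/eqP: h1; rewrite mul0r addr0 mulf_eq0 (negbTE d0) /= subr_eq0 => /eqP.
rewrite b1 !subrr !expr0n /= addr0 add0r in h2.
have [le|lt] := lerP z1 a1.
  have b2 : b.2 = s * (a1 - z1) by apply: sqr_signed => //; rewrite subr_ge0.
  have r0 : 0 < a1 - z1 by rewrite lt_neqAle eq_sym d0 subr_ge0.
  rewrite min_l // in pl; rewrite max_r // in pu.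
  exists (1 - s * p.2 / (a1 - z1) - (p.1 - z1) / (a1 - z1)), ((p.1 - z1) / (a1 - z1)), (s * p.2 / (a1 - z1)).
  split.
    split; [|apply: divr_ge0; lra|apply: divr_ge0; lra|ring].
    have -> : 1 - s * p.2 / (a1 - z1) - (p.1 - z1) / (a1 - z1) = (a1 - p.1 - s * p.2) / (a1 - z1) by field.
    by apply: divr_ge0; lra.
  rewrite [LHS]surjective_pairing [b]surjective_pairing b1 b2 /newest /edge1 /edge2.
  congr pair; rewrite /= /GRing.scale /=; first by field.
  have -> : s * p.2 / (a1 - z1) * (s * (a1 - z1)) = s * s * p.2 by field.
  by rewrite ss; ring.
have b2 : b.2 = s * (z1 - a1).
  by apply: sqr_signed => //; [rewrite subr_ge0 ltW|rewrite -h2; ring].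
have r0 : 0 < z1 - a1 by rewrite subr_gt0.
have n0 := lt0r_neq0 r0.
rewrite (min_r (ltW lt)) in pl; rewrite (max_l (ltW lt)) in pu.
exists (1 - s * p.2 / (z1 - a1) - (z1 - p.1) / (z1 - a1)), ((z1 - p.1) / (z1 - a1)), (s * p.2 / (z1 - a1)).
split.
  split; [|apply: divr_ge0; lra|apply: divr_ge0; lra|ring].
  have -> : 1 - s * p.2 / (z1 - a1) - (z1 - p.1) / (z1 - a1) = (p.1 - a1 - s * p.2) / (z1 - a1) by field.
  by apply: divr_ge0; lra.
rewrite [LHS]surjective_pairing [b]surjective_pairing b1 b2 /newest /edge1 /edge2.
congr pair; rewrite /= /GRing.scale /=; first by field.
have -> : s * p.2 / (z1 - a1) * (s * (z1 - a1)) = s * s * p.2 by field.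
  by rewrite ss; ring.
Qed.

Lemma iso_hypotenuse (s a1 b1 : R) z p : s * s = 1 -> a1 < b1 -> 0 <= s * z.2 ->
  iso (z, (a1, 0), (b1, 0)) ->
  0 <= s * p.2 -> s * p.2 <= p.1 - a1 -> s * p.2 <= b1 - p.1 ->
  hull (z, (a1, 0), (b1, 0)) p.
Proof.
move=> ss ab sz; rewrite /iso /newest /edge1 /edge2 /= !sub0r => -[h1 h2] p0 pl pu.
have r0 : 0 < b1 - a1 by rewrite subr_gt0.
have n0 := lt0r_neq0 r0.
have z1 : z.1 = (a1 + b1) / 2.
  have e : (a1 - b1) * (a1 + b1 - 2 * z.1) = 0.
    have := h2 => /eqP; rewrite -subr_eq0 => /eqP <-; ring.
  move/eqP: e; rewrite mulf_eq0 subr_eq0 (lt_eqF ab) /= => /eqP e; lra.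
have z2 : z.2 = s * ((b1 - a1) / 2).
  apply: sqr_signed => //; first lra.
  have := h1; rewrite z1 => e; have : z.2 * z.2 = (b1 - a1) ^+ 2 / 4.
    have -> : z.2 * z.2 = ((a1 - (a1 + b1) / 2) * (b1 - (a1 + b1) / 2) + - z.2 * - z.2) + (b1 - a1) ^+ 2 / 4 by field.
    by rewrite e add0r.
  by rewrite -expr2 => ->; field.
pose d := s * p.2; exists (2 * d / (b1 - a1)), ((b1 - p.1 - d) / (b1 - a1)), ((p.1 - a1 - d) / (b1 - a1)).
have d0 : 0 <= d by [].
split.
  split.
  - by apply: divr_ge0; [exact: mulr_ge0|exact: ltW].
  - by apply: divr_ge0; [rewrite /d; lra|exact: ltW].
  - by apply: divr_ge0; [rewrite /d; lra|exact: ltW].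
  by field.
rewrite [LHS]surjective_pairing [z]surjective_pairing z1 z2 /newest /edge1 /edge2 /d.
congr pair; rewrite /= /GRing.scale /=; first by field.
have -> : 2 * (s * p.2) / (b1 - a1) * (s * ((b1 - a1) / 2)) = s * s * p.2 by field.
  by rewrite ss; ring.
Qed.

Lemma two_sides (w0 w1 v0 v1 x y m : R) : 0 <= w0 -> 0 <= w1 -> w0 + w1 = 1 ->
  w0 * v0 + w1 * v1 = m -> x < m -> m < y -> v0 <= x \/ y <= v0 -> v1 <= x \/ y <= v1 ->
  [/\ v0 != v1, Num.min v0 v1 <= x & y <= Num.max v0 v1].
Proof.
move=> h0 h1 h2 h3 xm my a b.
have side : (v0 <= x /\ y <= v1) \/ (v1 <= x /\ y <= v0).
  case: a b => [a|a] [b|b]; [exfalso|by left|by right|exfalso].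
    have := ler_wpM2l h0 a; have := ler_wpM2l h1 b.
    have : w0 * x + w1 * x = x by rewrite -mulrDl h2 mul1r.
    lra.
  have := ler_wpM2l h0 a; have := ler_wpM2l h1 b.
  have : w0 * y + w1 * y = y by rewrite -mulrDl h2 mul1r.
  lra.
split; first by apply/eqP => e; rewrite e in side; lra.
  by rewrite ge_min; case: side => -[-> _]; rewrite ?orbT.
by rewrite le_max; case: side => -[_ ->]; rewrite ?orbT.
Qed.

Lemma iso_region (s : R) K (x y m : R) : s * s = 1 -> iso K -> tdet K != 0 ->
  (forall v, v \in vertices K -> 0 <= s * v.2) ->
  (forall v, v \in vertices K -> v.2 = 0 -> v.1 <= x \/ y <= v.1) ->
  x < m -> m < y -> hull K (m, 0) ->
  forall p, 0 <= s * p.2 -> s * p.2 <= p.1 - x -> s * p.2 <= y - p.1 -> hull K p.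
Proof.
case: K => [[[z1 z2] [a1 a2]] [b1 b2]] ss hi D0 pos gap xm my [w0 [w1 [w2 [[w0p w1p w2p ws] e]]]] p p0 px py.
set K := (_, _, _) in hi D0 pos gap *.
have vz : (z1, z2) \in vertices K by rewrite /vertices !inE eqxx.
have va : (a1, a2) \in vertices K by rewrite /vertices !inE eqxx !orbT.
have vb : (b1, b2) \in vertices K by rewrite /vertices !inE eqxx !orbT.
have pz := pos _ vz; have pa := pos _ va; have pb := pos _ vb.
have gz := gap _ vz; have ga := gap _ va; have gb := gap _ vb.
move: e; rewrite /newest /edge1 /edge2 /= /GRing.scale /= => -[e1 e2].
rewrite /GRing.scale /= in e1 e2.
rewrite /= in pz pa pb gz ga gb.
have sn : s != 0 by apply: contra_eq_neq ss => ->; rewrite mul0r eq_sym oner_neq0.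
have [kz ka kb] : [/\ w0 * (s * z2) = 0, w1 * (s * a2) = 0 & w2 * (s * b2) = 0].
  have := mulr_ge0 w0p pz; have := mulr_ge0 w1p pa; have := mulr_ge0 w2p pb.
  have : w0 * (s * z2) + w1 * (s * a2) + w2 * (s * b2) = 0.
    have -> : w0 * (s * z2) + w1 * (s * a2) + w2 * (s * b2) = s * (w0 * z2 + w1 * a2 + w2 * b2) by ring.
    by rewrite -e2 mulr0.
  move: (w0 * _) (w1 * _) (w2 * _) => A B C *; split; lra.
have zero (w v : R) : w * (s * v) = 0 -> v != 0 -> w = 0.
  by move=> /eqP; rewrite !mulf_eq0 (negbTE sn) => /orP[/eqP //|/= /eqP ->]; rewrite eqxx.
have one (v : R) : m = v -> (v <= x \/ y <= v) -> False by move=> <- [|]; lra.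
clear pos gap vz va vb; rewrite {}/K in hi D0 *.
have [z0|z0] := eqVneq z2 0; have [a0|a0] := eqVneq a2 0; have [b0|b0] := eqVneq b2 0.
- by move: D0; rewrite tdetE /newest /edge1 /edge2 /= z0 a0 b0 !subrr !mulr0 !mul0r subrr eqxx.
- have w20 := zero _ _ kb b0; rewrite w20 mul0r !addr0 in e1 ws; subst z2 a2.
  have [n1 n2 n3] := two_sides w0p w1p ws (esym e1) xm my (gz erefl) (ga erefl).
  by apply: (iso_leg ss) => //; lra.
- have w10 := zero _ _ ka a0; rewrite w10 mul0r !addr0 in e1 ws; subst z2 b2.
  have [n1 n2 n3] := two_sides w0p w2p ws (esym e1) xm my (gz erefl) (gb erefl).
  by apply: hull_swap; apply: (iso_leg ss) => //; [exact: iso_swap|lra|lra].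
- have w10 := zero _ _ ka a0; have w20 := zero _ _ kb b0; rewrite w10 w20 !mul0r !addr0 in e1 ws.
  by rewrite ws mul1r in e1; case: (one _ e1 (gz z0)).
- have w00 := zero _ _ kz z0; rewrite w00 mul0r !add0r in e1 ws; subst a2 b2.
  have [n1 n2 n3] := two_sides w1p w2p ws (esym e1) xm my (ga erefl) (gb erefl).
  have [ab|ab] := ltP a1 b1.
    rewrite min_l ?max_r ?(ltW ab) // in n2 n3; apply: (iso_hypotenuse ss) => //; lra.
  have {}ab : b1 < a1 by rewrite lt_neqAle eq_sym n1.
  rewrite min_r ?max_l ?(ltW ab) // in n2 n3; apply: hull_swap.
  by apply: (iso_hypotenuse ss) => //; [exact: iso_swap|lra|lra].
- have w00 := zero _ _ kz z0; have w20 := zero _ _ kb b0; rewrite w00 w20 !mul0r !addr0 !add0r in e1 ws.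
  by rewrite ws mul1r in e1; case: (one _ e1 (ga a0)).
- have w00 := zero _ _ kz z0; have w10 := zero _ _ ka a0; rewrite w00 w10 !mul0r !add0r in e1 ws.
  by rewrite ws mul1r in e1; case: (one _ e1 (gb b0)).
- have w00 := zero _ _ kz z0; have w10 := zero _ _ ka a0; have w20 := zero _ _ kb b0.
  by move: ws; rewrite w00 w10 w20 !addr0 => /eqP; rewrite eq_sym oner_eq0.
Qed.

Lemma vertex_descendant K w z : tdet K != 0 -> z \in vertices K -> hull (node K w) z ->
  z \in vertices (node K w).
Proof.
elim: w K => //= b w IH K D0 zK hz; have D1 := tdet_child_neq0 b D0; apply: IH => //.
have := hull_node D1 hz; rewrite hull_child // => -[_]; move: zK.
rewrite /vertices /child !inE /newest /edge1 /edge2 /= -/(newest K) -/(edge1 K) -/(edge2 K).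
move=> /or3P[] /eqP ->; rewrite ?eqxx ?orbT //.
  have [_ ->] := trd_edge1 D0; case: b {hz D1}; rewrite ?eqxx ?orbT //; lra.
have [_ ->] := trd_edge2 D0; case: b {hz D1}; rewrite ?eqxx ?orbT //; lra.
Qed.

End LeafGeometry.

Section SkeletonBounds.
Context {R : realType}.
Local Notation P := (measurableTypeR R * measurableTypeR R)%type.
Local Notation mu := (@plane_measure R).
Local Notation Omega := (@unit_square R).
Implicit Types (p q z : R * R) (s t : R) (K T : triangle R) (M : seq (triangle R)) (w v : seq bool).

Lemma edge_wave_support T (r0 eta : R) p : 0 < eta -> edge_wave T r0 eta p != 0 ->
  `|tr T p - r0| <= eta /\ `|td T p| <= eta.
Proof.
move=> e0; rewrite /edge_wave /wave edge_amap // mulf_eq0 negb_or /= => /andP[h1 h2]; split; rewrite leNgt; apply/negP => h.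
  by move/eqP: h1; apply; rewrite hat_out // normrM normfV (gtr0_norm e0) ler_pdivlMr // mul1r ltW.
by move/eqP: h2; apply; rewrite quad_out // normrM normfV (gtr0_norm e0) ler_pdivlMr // mul1r ltW.
Qed.

Definition axis_point T x : R * R := x *: newest T + ((1 - x) / 2) *: edge1 T + ((1 - x) / 2) *: edge2 T.

Lemma trd_axis_point T x : tdet T != 0 -> trd T (axis_point T x) = (x, 0).
Proof. by move=> D0; rewrite trd_comb ?subrr //; field. Qed.

Lemma hull_side T b p : tdet T != 0 -> td T p = 0 -> 2^-1 <= tr T p -> tr T p <= 1 ->
  hull (node T (side b)) p.
Proof.
move=> D0 h0 h1 h2; apply/(hull_img _ _ D0); rewrite img_side //.
exists (2 * (1 - tr T p)), 0, (2 * tr T p - 1); split; first by split; lra.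
by rewrite /trd h0 /newest /edge1 /edge2; congr pair; rewrite /= /GRing.scale /=; field.
Qed.

Lemma leaf_region M T b v (x y m : R) q : tdet T != 0 -> node (node T (side b)) v \in M ->
  hull (node (node T (side b)) v) q -> td T q = 0 -> tr T q = m -> x < m -> m < y ->
  (forall z, z \in mesh_vertices M -> td T z = 0 -> tr T z <= x \/ y <= tr T z) ->
  forall p, 0 <= sgb b * td T p -> sgb b * td T p <= tr T p - x -> sgb b * td T p <= y - tr T p ->
  hull (node (node T (side b)) v) p.
Proof.
move=> D0; set tau := node _ v => tM hq q0 qm xm my gap p p0 px py; apply/(hull_img _ _ D0).
have ss : sgb b * sgb b = 1 :> R by rewrite /sgb; case: b {tau tM hq p0 px py} => /=; ring.
have DA := tdet_node (side b) D0; have Dt := tdet_node v DA.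
have vP x' : x' \in vertices (img T tau) -> exists2 z, z \in vertices tau & x' = trd T z.
  rewrite /vertices !inE => /or3P[] /eqP ->.
  - by exists (newest tau); rewrite // !inE eqxx.
  - by exists (edge1 tau); rewrite // !inE eqxx orbT.
  - by exists (edge2 tau); rewrite // !inE eqxx !orbT.
apply: (@iso_region _ (sgb b) _ x y m) => //.
- by rewrite /tau img_node img_side //; apply: iso_node; exact: iso_side.
- rewrite /tau img_node img_side //; apply: tdet_node; rewrite tdetE /newest /edge1 /edge2 /= /sgb.
  by case: (b); apply/eqP; lra.
- move=> x' /vP [z zt ->] /=; have hz := hull_node DA (hull_vertex zt).
  have := @hull_node _ (child T b) [:: false; true] z (tdet_child_neq0 b D0) hz; rewrite hull_child // => -[_].
  by rewrite /sgb; case: (b); lra.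
- by move=> x' /vP [z zt ->]; apply: gap; exact: vertex_mem zt.
by move/(hull_img _ _ D0): hq; rewrite /trd q0 qm.
Qed.

Lemma max_image (I : eqType) (s : seq I) (f : I -> R) : s != [::] ->
  exists2 i, i \in s & forall j, j \in s -> f j <= f i.
Proof.
elim: s => // i s IH _; have [->|/IH [j js hj]] := eqVneq s [::].
  by exists i; rewrite ?mem_head // => j; rewrite inE => /eqP ->.
have [h|h] := leP (f i) (f j).
  by exists j; rewrite ?inE ?js ?orbT // => l; rewrite inE => /orP[/eqP ->|/hj].
exists i; rewrite ?mem_head // => l; rewrite inE => /orP[/eqP -> //|/hj hl].
exact: le_trans hl (ltW h).
Qed.

Lemma gaps_sum (I : eqType) (s : seq I) (f F : I -> R) (c a y : R) : uniq s -> {in s &, injective f} ->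
  (exists2 i, i \in s & f i = a) -> (forall i, i \in s -> a <= f i /\ f i < y) ->
  (forall i, i \in s -> 0 <= F i) ->
  (forall i (b : R), i \in s -> (b = y \/ exists2 j, j \in s & f j = b) -> f i < b ->
    (forall j, j \in s -> f j <= f i \/ b <= f j) -> c * (b - f i) <= F i) ->
  c * (y - a) <= \sum_(i <- s) F i.
Proof.
move: {2}(size s) (erefl (size s)) => n; elim: n s y => [|n IH] s y sn us inj [i0 i0s fa] rg F0 gap.
  by move/size0nil: sn i0s => ->.
have s0 : s != [::] by rewrite -size_eq0 sn.
have [i si mi] := max_image f s0; rewrite (big_rem i) //=.
have hi : c * (y - f i) <= F i.
  apply: gap => //; first by left.
    by have [] := rg _ si.
  by move=> j /mi; left.
have rs j : j \in rem i s -> j \in s by exact: mem_rem.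
have [e|ne] := eqVneq (f i) a.
  by rewrite -e; apply: le_trans hi _; rewrite lerDl big_seq sumr_ge0 // => j /rs /F0.
have -> : c * (y - a) = c * (y - f i) + c * (f i - a) by ring.
have lt_i j : j \in rem i s -> f j < f i.
  move=> jr; rewrite lt_neqAle mi ?rs // andbT; apply/eqP => /(inj _ _ (rs _ jr) si) e.
  by move: jr; rewrite e mem_rem_uniq // inE eqxx.
apply: lerD => //; apply: IH.
- by rewrite size_rem // sn.
- exact: rem_uniq.
- by move=> j l /rs js /rs ls; exact: inj.
- exists i0 => //; rewrite mem_rem_uniq // inE i0s andbT; apply: contraNneq ne => <-.
  by rewrite fa.
- by move=> j jr; split; [have [] := rg _ (rs _ jr)|exact: lt_i].
- by move=> j /rs /F0.
move=> j b jr bh jb hb; apply: gap => //; first exact: rs.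
  by right; case: bh => [->|[l lr <-]]; [exists i|exists l => //; exact: rs].
move=> l ls; have [->|li] := eqVneq l i.
  by right; case: bh => [->|[l' lr <-]] //; exact/ltW/lt_i.
by apply: hb; rewrite mem_rem_uniq // inE li.
Qed.

Lemma gap_window (x y t s : R) : `|t - (x + y) / 2| <= 3 * ((y - x) / 12) ->
  `|s| <= 3 * ((y - x) / 12) -> `|s| <= t - x /\ `|s| <= y - t.
Proof. by rewrite ler_norml => /andP[h1 h2] h3; split; lra. Qed.

Lemma gap_center (x y : R) : 2^-1 <= x -> x < y -> y <= 1 -> let r0 := (x + y) / 2 in
  let eta := (y - x) / 12 in [/\ 0 < eta, x < r0, r0 < y, 2^-1 <= r0 - eta & r0 + 2 * eta <= 1].
Proof. by move=> h1 h2 h3 /=; split; lra. Qed.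

Section Mesh.
Variable M : seq (triangle R).
Hypothesis gM : good M.
Local Notation patch := (vertex_patch M).
Variables (k : nat) (kap : R) (T0 : triangle R).
Hypotheses (k1 : (1 < k)%N) (D0 : tdet T0 != 0) (hkap : 2 * shape T0 <= kap)
  (kap0 : 0 < kap) (hk : 2^-1 ^+ k * (8192 * kap ^+ 4) <= 1).
Local Notation u := (ufun k T0).
Variable c : 'rV[R]_(size M).
Local Notation N z := (Hm1norm (patch z) (resid u c)).
Local Notation C1 := (768 * kap ^+ 3).

Lemma wdiff_ufun : wdiff u.
Proof. exact/regular_wdiff/regular_ufun. Qed.

Lemma dual_ge0 z : 0 <= N z.
Proof. exact: Hm1norm_ge0 (@patch_open _ M z) (@resid_bounded _ M gM u wdiff_ufun c z). Qed.

Lemma scaled_ge0 z : 0 <= C1 * N z.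
Proof.
by apply: mulr_ge0 (dual_ge0 z); apply: mulr_ge0 (ler0n _ _) _; apply: exprn_ge0; exact: ltW.
Qed.

Lemma dual_lower w j z tau tau' (r0 eta : R) : size w = (k * j).*2 -> let T := node T0 w in
  0 < eta -> 2^-1 <= r0 - eta -> r0 + 2 * eta <= 1 ->
  tau \in M -> tau' \in M -> hull tau z -> hull tau' z ->
  (forall p, `|tr T p - r0| <= 3 * eta -> `|td T p| <= 3 * eta ->
     (0 <= td T p -> hull tau p) /\ (td T p <= 0 -> hull tau' p)) ->
  amp k j * eta <= C1 * N z.
Proof.
move=> sw T eta0 lo hi tM tM' tz tz' reg; have DT : tdet T != 0 by exact: tdet_node.
have en := lt0r_neq0 eta0; have kn := lt0r_neq0 kap0.
set v := edge_wave T r0 eta; have wv := regular_wdiff (regular_edge_wave r0 DT eta0).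
have sub p : `|tr T p - r0| <= 2 * eta -> `|td T p| <= 2 * eta -> patch z p.
  move=> h1 h2; have [d d0 hd] := tlip_nbhs T p eta0; apply: (box_nbhs d0) => q q1 q2.
  have h := hd q q1 q2.
  have h3 : `|tr T q - tr T p| + `|td T q - td T p| < eta by exact: h.
  have n1 := normr_ge0 (tr T q - tr T p); have n2 := normr_ge0 (td T q - td T p).
  have [||g1 g2] := reg q.
  - by rewrite -(subrK (tr T p) (tr T q)) -addrA; apply: le_trans (ler_normD _ _) _; lra.
  - by rewrite -(subrK (td T p) (td T q)); apply: le_trans (ler_normD _ _) _; lra.
  by have [/ltW h4|h4] := ltP 0 (td T q); [exists tau => //; split => //; exact: g1|exists tau' => //; split => //; exact: g2].
have hv a : H10 (patch z) (fun p => a * v p) by exact: H10_edge_wave.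
have hvO a : H10 Omega (fun p => a * v p) := patch_H10 gM (hv a).
have hv1 : H10 Omega v by have := hvO 1; congr (H10 _ _); apply/funext => q; rewrite mul1r.
have wu := wdiff_ufun.
have [] := gip_edge_wave DT eta0 lo hi k1 (kap := kap) _ hk; first by rewrite shape_node.
rewrite -/v => g1 g2.
have gv : gnorm v <= 12 * kap.
  rewrite -[leRHS]ger0_norm ?mulr_ge0 // ?(ltW kap0) // -sqrtr_sqr ler_wsqrtr // (le_trans g2) //.
  by rewrite exprMn ler_wpM2r ?sqr_ge0 //; lra.
have int0 : \int[mu]_p (pconst c p * v p) = 0.
  have /seq_tnthP [i ei] := tM; have /seq_tnthP [i' ei'] := tM'.
  have [_ hM _ _] := gM.
  have iv : itg v.
    have [b [L [X [G h]]]] := regular_edge_wave r0 DT eta0; have [b0 hl hout _ _] := h.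
    exact: bdd_itg (lip_bdd b0 hl hout).
  have [_ _ _ ms _] := @measurable_pieces R.
  have mv : mfun2 (fun p : R * R => step (td T p)).
    apply: (@measurableT_comp _ _ _ _ _ _ step) => //.
    apply: continuous_measurable2; apply: (@lip_continuous _ _ (tlip T)) => p q.
    by have := trd_dist T p q; have := normr_ge0 (tr T p - tr T q); rewrite /dist1 /=; lra.
  have isv : itg (fun p => step (td T p) * v p).
    apply: (itg_le _ iv) => [|p]; first by apply: measurable_funM => //; exact: itg_measurable iv.
    by rewrite normrM ler_piMl // /step; case: (0 < _)%R; rewrite ?normr1 ?normr0.
  have [z1 z2] := Rint_edge_wave r0 DT eta0.
  transitivity (\int[mu]_p ((c 0 i - c 0 i') * (step (td T p) * v p) + c 0 i' * v p)); last first.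
    by rewrite RintD ?RintZ //; [rewrite z1 z2 !mulr0 addr0|exact: itgZ|exact: itgZ].
  apply: (Rint_ae (negligible_boundaries hM)).
  - by apply: measurable_funM; [have [] := pconst_bdd gM c|exact: itg_measurable iv].
  - by apply: itg_measurable; apply: itgD; exact: itgZ.
  move=> p hn; have [->|vp] := eqVneq (v p) 0; first by rewrite !mulr0 addr0.
  have [s1 s2] := edge_wave_support eta0 vp.
  have e3 : eta <= 3 * eta by apply: ler_peMl; [exact: ltW|rewrite ler1n].
  have [g3 g4] := reg p (le_trans s1 e3) (le_trans s2 e3).
  have st K : K \in M -> hull K p -> strict K p.
    by move=> KM hp; apply: contrapT => hs; apply: hn; exists K.
  rewrite /step; case: ltP => h /=.
    by have h5 := st _ tM (g3 (ltW h)); rewrite ei in h5; rewrite (pconstE gM c h5); ring.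
  by have h5 := st _ tM' (g4 h); rewrite ei' in h5; rewrite (pconstE gM c h5); ring.
have rv : resid u c v = amp k j * gip (ufun k T) v.
  rewrite /resid int0 subr0 (grad_dot_H10 unit_square_open) //.
  exact: (gip_node k1 D0 sw).
have hs a : H10 (patch z) (fun p => a * v p) /\ resid u c (fun p => a * v p) = a * resid u c v.
  by split; [exact: hv|exact: (residZ gM wu c wv hv1 (hvO a))].
have C0 : 0 < 12 * kap by rewrite mulr_gt0.
have := Hm1norm_ge_scaled (@patch_open _ M z) (@resid_bounded _ M gM u wu c z) hs wv C0 gv.
have a0 := @amp_gt0 R k j.
rewrite rv normrM (gtr0_norm a0) => h.
have h1 : amp k j * (eta / (64 * kap ^+ 2)) <= 12 * kap * N z.
  by apply: le_trans h; rewrite ler_pM2l //; apply: le_trans g1 (ler_norm _).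
have k2 : 0 < 64 * kap ^+ 2 by rewrite mulr_gt0 // exprn_gt0.
rewrite mulrA ler_pdivrMr // in h1; apply: le_trans h1 _.
by rewrite (_ : 12 * kap * N z * (64 * kap ^+ 2) = C1 * N z) //; ring.
Qed.

Definition axis_vertices T := [seq z <- mesh_vertices M | (td T z == 0) && (2^-1 <= tr T z < 1)].

Lemma axis_sum w j : size w = (k * j).*2 -> let T := node T0 w in
  (forall b p, hull (node T (side b)) p ->
     exists v, node (node T (side b)) v \in M /\ hull (node (node T (side b)) v) p) ->
  amp k j / 24 <= C1 * \sum_(z <- axis_vertices T) N z.
Proof.
move=> sw T cov; have DT : tdet T != 0 by exact: tdet_node.
have vm z : z \in vertices (node T (side false)) -> hull (node T (side false)) z -> z \in mesh_vertices M.
  move=> zv hz; have [v [vM hv]] := cov _ _ hz; apply: vertex_mem vM _.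
  by apply: vertex_descendant => //; exact: tdet_node.
have imgE := img_side false DT.
have mem z : z \in axis_vertices T -> [/\ z \in mesh_vertices M, td T z = 0, 2^-1 <= tr T z & tr T z < 1].
  by rewrite mem_filter => /andP[/andP[/eqP h1 /andP[h2 h3]] h4].
have sc := scaled_ge0; have dl := @dual_lower w j _ _ _ _ _ sw.
pose NN z : R := N z; rewrite -/T (eq_bigr NN) // in dl *.
have {}sc z : 0 <= C1 * NN z by exact: sc.
have {}dl z tau tau' (r0 eta : R) := dl z tau tau' r0 eta : _ -> _ -> _ -> _ -> _ -> _ -> _ -> _ -> _ <= C1 * NN z.
move: (C1) NN sc dl => CC NN sc dl.
rewrite mulr_sumr (_ : amp k j / 24 = amp k j / 12 * (1 - 2^-1)); last by field.
apply: (gaps_sum (f := tr T)).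
- exact/filter_uniq/undup_uniq.
- move=> z z' /mem [_ h1 _ _] /mem [_ h2 _ _] e; apply: (trd_inj DT).
  by rewrite /trd e h1 h2.
- have e : trd T (newest (node T (side false))) = (2^-1, 0) by have := congr1 (fun K : triangle R => newest K) imgE.
  have hz : newest (node T (side false)) \in vertices (node T (side false)) by rewrite mem_head.
  exists (newest (node T (side false))); last by case: e.
  rewrite mem_filter vm //; last exact: hull_vertex.
  by case: e => -> ->; rewrite eqxx lexx /= andbT; lra.
- by move=> z /mem [].
- by move=> z _; exact: sc.
move=> z y zA yh zy gap; have [zM z0 zlo zhi] := mem _ zA.
have y1 : y <= 1 by case: yh => [->|[z' /mem [_ _ _ /ltW h] <-]].
pose r0 := (tr T z + y) / 2; pose eta := (y - tr T z) / 12.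
have [eta0 xm my lo hi] := gap_center zlo zy y1; rewrite -/r0 -/eta in eta0 xm my lo hi.
have gapM z' : z' \in mesh_vertices M -> td T z' = 0 -> tr T z' <= tr T z \/ y <= tr T z'.
  move=> z'M h0; have [h1|h1] := ltP (tr T z') 2^-1; first by left; lra.
  have [h2|h2] := ltP (tr T z') 1; last by right; lra.
  by apply: gap; rewrite mem_filter z'M h0 eqxx h1 h2.
have q0 := trd_axis_point r0 DT; set q := axis_point T r0 in q0; case: q0 => q1 q2.
have tri b : exists2 tau, tau \in M & forall p, 0 <= sgb b * td T p ->
    sgb b * td T p <= tr T p - tr T z -> sgb b * td T p <= y - tr T p -> hull tau p.
  have hq : hull (node T (side b)) q.
    apply: hull_side => //; rewrite q1; first exact: le_trans zlo (ltW xm).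
    exact: le_trans (ltW my) y1.
  have [v [vM hv]] := cov _ _ hq; exists (node (node T (side b)) v) => //.
  exact: (leaf_region DT vM hv q2 q1 xm my gapM).
have [tau tM ht] := tri false; have [tau' tM' ht'] := tri true.
rewrite /sgb in ht ht'.
rewrite (_ : amp k j / 12 * (y - tr T z) = amp k j * eta); last by rewrite /eta; field.
apply: (dl z tau tau' r0 eta) => //.
- by apply: ht; rewrite z0 mulr0 ?subrr ?subr_ge0 // ltW.
- by apply: ht'; rewrite z0 mulr0 ?subrr ?subr_ge0 // ltW.
move=> p h1 h2; have [g1 g2] := gap_window h1 h2.
have n1 := ler_norm (td T p); have n2 := ler_norm (- td T p); rewrite normrN in n2.
split=> h.
  by apply: ht; rewrite mul1r //; [exact: le_trans n1 g1|exact: le_trans n1 g2].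
by apply: ht'; rewrite mulN1r ?oppr_ge0 //; [exact: le_trans n2 g1|exact: le_trans n2 g2].
Qed.

Lemma deep_lower w j : size w = (k * j).*2 ->
  (exists2 K, K \in M & forall p, hull (node T0 w) p -> hull K p) ->
  exists2 z, z \in mesh_vertices M & amp k j / 24 <= C1 * N z.
Proof.
move=> sw [K KM sub]; have zK : newest K \in vertices K by rewrite mem_head.
exists (newest K); first exact: vertex_mem zK.
have hz : hull K (newest K) by exact: hull_vertex.
pose r0 : R := 3 / 4; pose eta : R := 24^-1.
have e0 : 0 < eta by rewrite invr_gt0.
have lo : 2^-1 <= r0 - eta by rewrite /r0 /eta; lra.
have hi : r0 + 2 * eta <= 1 by rewrite /r0 /eta; lra.
apply: (@dual_lower w j (newest K) K K r0 eta sw e0 lo hi) => //; rewrite /r0 /eta.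
move=> p; rewrite !ler_norml => /andP[h1 h2] /andP[h3 h4].
have hp : hull K p.
  apply: sub; rewrite hullP ?tdet_node //; split; first by rewrite /=; lra.
  by rewrite /= ler_norml; apply/andP; split; lra.
by split.
Qed.

Lemma axis_vertices_disjoint w j w' j' z : size w = (k * j).*2 -> size w' = (k * j').*2 -> (j <= j')%N ->
  z \in axis_vertices (node T0 w) -> z \in axis_vertices (node T0 w') -> w = w'.
Proof.
move=> sw sw' jj.
have st T : z \in axis_vertices T -> [/\ strict T z, td T z = 0, 0 < tr T z & tr T z < 1].
  rewrite mem_filter => /andP[/andP[/eqP h1 /andP[h2 h3]] _].
  by rewrite /strict /strict_ref /= h1 normr0; split => //; [split|]; lra.
move=> /st [s1 d1 r1 r1'] /st [s2 _ _ _].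
have le_w : (size w <= size w')%N by rewrite sw sw' leq_double leq_mul2l jj orbT.
move: s2; rewrite -(cat_take_drop (size w) w') node_cat.
set x := take _ _; set y := drop _ _ => s2.
have sx : size w = size x by rewrite size_takel.
have [wx|nwx] := eqVneq w x; last first.
  case: (node_disjoint D0 sx nwx s1); apply: strict_hull; first exact: tdet_node.
  by apply: strict_node s2; exact: tdet_node.
move: s2; rewrite wx; case: y => [|b y]; first by rewrite cats0.
rewrite wx in d1 r1 r1'; have Dx := tdet_node x D0.
move=> /(strict_node (tdet_child_neq0 b Dx)) => -[]; rewrite trd_child // d1 mulr0 !subr0 /=.
by move=> _ h; exfalso; have := ler_norm (tr (node T0 x) z); lra.
Qed.

End Mesh.

End SkeletonBounds.

Section CountingBound.
Context {R : realType}.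
Local Notation Omega := (@unit_square R).
Implicit Types (p q z : R * R) (K T : triangle R) (M : seq (triangle R)) (w v : seq bool).

Lemma sum_at_most_one (I : finType) (Q : pred I) (a : R) : 0 <= a ->
  (forall i j, Q i -> Q j -> i = j) -> \sum_(i | Q i) a <= a.
Proof.
move=> a0 h; case: (pickP Q) => [i Qi|Q0]; last by rewrite big_pred0.
rewrite (bigD1 i) //= big1 ?addr0 // => j /andP[Qj]; by rewrite (h j i Qj Qi) eqxx.
Qed.

Lemma sum_sqr_seq (I : Type) (s : seq I) (F : I -> R) :
  (\sum_(i <- s) F i) ^+ 2 <= (size s)%:R * \sum_(i <- s) F i ^+ 2.
Proof.
have [|s0] := eqVneq (size s) 0%N.
  by move=> /size0nil s0; rewrite s0 /= !big_nil expr0n mulr0.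
set n : R := (size s)%:R; have n0 : 0 < n by rewrite ltr0n lt0n.
have nn := lt0r_neq0 n0; set S1 := \sum_(i <- s) F i.
have h : 0 <= \sum_(i <- s) (F i - S1 / n) ^+ 2 by apply: sumr_ge0 => i _; exact: sqr_ge0.
have e : \sum_(i <- s) (F i - S1 / n) ^+ 2 = \sum_(i <- s) F i ^+ 2 - S1 ^+ 2 / n.
  rewrite (eq_bigr (fun i => F i ^+ 2 + ((- (2 * S1 / n)) * F i + (S1 / n) ^+ 2))); last by move=> i _; ring.
  rewrite !big_split /= -mulr_sumr -/S1 big_const_seq count_predT iter_addr_0 -mulr_natr -/n.
  by field.
by rewrite e subr_ge0 ler_pdivrMr // mulrC in h.
Qed.

Lemma size_mesh_vertices M : (size (mesh_vertices M) <= 3 * size M)%N.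
Proof.
apply: leq_trans (size_undup _) _; elim: M => //= K M IH.
by rewrite mulnS; do 3 rewrite addSn ltnS; rewrite add0n.
Qed.

Section Mesh.
Variable M : seq (triangle R).
Hypothesis gM : good M.
Local Notation patch := (vertex_patch M).
Variables (k : nat) (kap : R) (T0 : triangle R).
Hypotheses (k1 : (1 < k)%N) (D0 : tdet T0 != 0) (hkap : 2 * shape T0 <= kap)
  (kap0 : 0 < kap) (hk : 2^-1 ^+ k * (8192 * kap ^+ 4) <= 1).
Local Notation u := (ufun k T0).
Variable c : 'rV[R]_(size M).
Local Notation N z := (Hm1norm (patch z) (resid u c)).

Lemma total_lower (C : R) J : 0 <= C ->
  (forall j w, (j < J)%N -> size w = (k * j).*2 ->
     amp k j / 24 <= C * \sum_(z <- axis_vertices M (node T0 w)) N z) ->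
  J%:R / 24 <= C * \sum_(z <- mesh_vertices M) N z.
Proof.
move=> C0 h.
pose V w := axis_vertices M (node T0 w).
have -> : J%:R / 24 = \sum_(j < J) \sum_(w : (k * j).*2.-tuple bool) amp k j / 24 :> R.
  rewrite (eq_bigr (fun=> 24^-1)) => [|j _].
    by rewrite big_const_ord iter_addr_0 mulr_natl.
  rewrite sumr_const card_tuple card_bool -[LHS]mulr_natl.
  rewrite (_ : (2 ^ (k * j).*2)%:R * (amp k j / 24) = (2 ^ (k * j).*2)%:R * amp k j / 24 :> R); last by rewrite mulrA.
  rewrite (_ : _ * amp k j = 1) ?mul1r //.
  have -> : ((k * j).*2 = 2 * (k * j))%N by rewrite mul2n.
  by rewrite /amp expnM natrX -exprMn mulfV ?expr1n // pnatr_eq0.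
apply: (@le_trans _ _ (\sum_(j < J) \sum_(w : (k * j).*2.-tuple bool) C * \sum_(z <- V w) N z)).
  by apply: ler_sum => j _; apply: ler_sum => w _; apply: h => //; rewrite size_tuple.
rewrite (eq_bigr (fun j : 'I_J => \sum_(w : (k * j).*2.-tuple bool)
    \sum_(z <- mesh_vertices M) if z \in V w then C * N z else 0)); last first.
  move=> j _; apply: eq_bigr => w _; rewrite -big_mkcond mulr_sumr /V /axis_vertices big_filter.
  by rewrite big_seq_cond [RHS]big_seq_cond; apply: eq_bigl => z; rewrite mem_filter; case: (z \in mesh_vertices M); rewrite ?andbT.
rewrite (@sig_big_dep _ _ _ _ (fun j : 'I_J => (k * j).*2.-tuple bool) predT (fun j => predT) (fun (j : 'I_J) (w : (k * j).*2.-tuple bool) =>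
    \sum_(z <- mesh_vertices M) if z \in V w then C * N z else 0)) /=.
rewrite exchange_big mulr_sumr; apply: ler_sum => z _ /=.
rewrite -big_mkcondr /=; apply: sum_at_most_one.
  by apply: mulr_ge0 => //; exact: dual_ge0.
suff key (i i' : {j : 'I_J & (k * j).*2.-tuple bool}) : (tag i <= tag i')%N ->
    z \in V (tagged i) -> z \in V (tagged i') -> i = i'.
  move=> i i' zi zi'; have [h1|h1] := leqP (tag i) (tag i'); first exact: key.
  by apply/esym/key => //; exact: ltnW.
move: i i' => [j w] [j' w'] /= jj zw zw'.
have e : val w = val w'.
  exact: (axis_vertices_disjoint D0 (size_tuple w) (size_tuple w') jj zw zw').
have ej : j = j'.
  apply/val_inj/eqP; have := size_tuple w'; rewrite -e size_tuple => /eqP.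
  by rewrite -!muln2 eqn_pmul2r // eqn_pmul2l // ltnW.
by move: w' e zw'; rewrite -ej => w' /val_inj <-.
Qed.

Lemma osc_lower M0 K0 w0 J : good M0 -> K0 \in M0 -> reach M0 M -> T0 = node K0 w0 ->
  let C1 := 768 * kap ^+ 3 in
  J%:R <= 48 * C1 * (Num.sqrt (size M)%:R * vec_osc u c) \/ amp k J <= 24 * C1 * vec_osc u c.
Proof.
move=> g0 K0M hr T0E C1.
have C0 : 0 <= C1 by apply: mulr_ge0 (ler0n _ _) _; apply: exprn_ge0; exact: ltW.
have wu := wdiff_ufun k1 D0.
have Nle z : z \in mesh_vertices M -> N z <= vec_osc u c by exact: Hm1_le_osc.
have [hall|/existsNP [j /existsNP [w /existsNP [b /not_implyP [jJ /not_implyP [sw hn]]]]]] :=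
  pselect (forall j w b, (j < J)%N -> size w = (k * j).*2 -> forall p, hull (node (node T0 w) (side b)) p ->
     exists v, node (node (node T0 w) (side b)) v \in M /\ hull (node (node (node T0 w) (side b)) v) p).
  left; pose S1 := \sum_(z <- mesh_vertices M) N z.
  have h : J%:R / 24 <= C1 * S1.
    apply: total_lower C0 _ => j w jJ sw.
    by apply: (axis_sum gM k1 D0 hkap kap0 hk c sw) => b p; exact: hall jJ sw p.
  have S1le : S1 <= 2 * (Num.sqrt (size M)%:R * vec_osc u c).
    have S10 : 0 <= S1 by apply: sumr_ge0 => z _; exact: (dual_ge0 gM k1 D0).
    rewrite -(ger0_norm S10) -sqrtr_sqr.
    have -> : 2 = Num.sqrt 4 :> R by rewrite (_ : 4 = 2 ^+ 2) ?sqrtr_sqr ?ger0_norm //; ring.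
    rewrite /vec_osc -!sqrtrM ?ler0n //; apply: ler_wsqrtr; apply: le_trans (sum_sqr_seq _ _) _.
    rewrite mulrA -natrM; apply: ler_wpM2r; first by apply: sumr_ge0 => z _; exact: sqr_ge0.
    by rewrite ler_nat; apply: leq_trans (size_mesh_vertices M) _; rewrite leq_mul2r orbT.
  have h2 := ler_wpM2l C0 S1le.
  move: (C1 * S1) (Num.sqrt _ * _) h h2 => X Y h h2.
  have -> : 48 * C1 * Y = 24 * (C1 * (2 * Y)) by ring.
  by clear wu hall Nle; lra.
right.
have T0w v : node (node T0 w) v = node K0 (w0 ++ (w ++ v)) by rewrite !node_cat T0E.
have [[K [v [KM v0 e]]]|h] := reach_forest (w0 ++ (w ++ side b)) g0 K0M hr; last first.
  by case: hn; rewrite T0w.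
pose w' := w ++ side b ++ nseq ((k.*2) - 3) true.
have sw' : size w' = (k * j.+1).*2.
  rewrite /w' !size_cat sw size_nseq mulnS doubleD /= addnC; congr addn.
  by rewrite subnKC // ltnW // -[4%N]/(2.*2) leq_double.
have [|z zM hz] := deep_lower gM k1 D0 hkap kap0 hk c sw'.
  exists K; [exact: KM|move=> p; rewrite /w' catA node_cat => /hull_node hp].
  have DK : tdet K != 0 by have [_ hM _ _] := gM; exact: hM.
  by apply: (@hull_node _ K v _ DK); rewrite -e node_cat -T0E; apply: hp; exact: tdet_node.
have h1 : amp k J <= amp k j.+1 :> R.
  rewrite /amp; apply: ler_wiXn2l; rewrite ?invr_ge0 // ?leq_mul2l ?jJ ?orbT //.
  by rewrite invf_le1 // ler1n.
have h2 := ler_wpM2l C0 (Nle z zM).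
by move: (C1 * N z) (amp k j.+1) hz h1 h2 => X Y; rewrite -mulrA; lra.
Qed.

End Mesh.

End CountingBound.

(** * Galerkin error *)

Section GalerkinError.
Context {R : realType}.
Local Notation P := (measurableTypeR R * measurableTypeR R)%type.
Local Notation mu := (@plane_measure R).
Local Notation Omega := (@unit_square R).
Implicit Types (v x : R * R -> R) (p q z : R * R) (K T : triangle R) (M : seq (triangle R)) (w : seq bool).

Lemma grad_dotC D v x : grad_dot D v x = grad_dot D x v.
Proof.
by apply: eq_Rintegral => p _; apply: eq_bigr => i _; exact: mulrC.
Qed.

Lemma regular_outside i v : regular v -> (forall p, ~ Omega p -> v p = 0) ->
  mu.-negligible [set p : P | ~ Omega p /\ wp i v p != 0].
Proof.
move=> [b [L [N [G h]]]] v0; have nw := lipreg_wp i h; have [_ _ _ N0 hG] := h.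
have l1 (a b' c : R) : (a, b') != 0 -> mu.-negligible [set p : P | a * p.1 + b' * p.2 = c].
  exact: negligible_line.
have x0 : (1, 0) != 0 :> R * R by apply/eqP => -[/eqP]; rewrite oner_eq0.
have y0 : (0, 1) != 0 :> R * R by apply/eqP => -[/eqP]; rewrite oner_eq0.
have nn := negligibleU (negligibleU nw N0) (negligibleU (negligibleU (l1 _ _ 0 x0) (l1 _ _ 1 x0))
  (negligibleU (l1 _ _ 0 y0) (l1 _ _ 1 y0))).
apply: negligibleS nn => p /= [hp wn]; apply: contrapT => /not_orP[/not_orP[/negP e1 k1] /not_orP[/not_orP[a1 a2] /not_orP[a3 a4]]].
rewrite negbK in e1; move/eqP: wn; apply; rewrite (eqP e1).
rewrite /= !mul1r !mul0r ?addr0 ?add0r in a1 a2 a3 a4.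
have [d d0 hd] : exists2 d : R, 0 < d & forall q, `|q.1 - p.1| < d -> `|q.2 - p.2| < d -> ~ Omega q.
  have far (a : R) : a <> 0 -> a <> 1 -> ~ (0 < a < 1) -> exists2 d : R, 0 < d & forall s, `|s - a| < d -> ~ (0 < s < 1).
    move=> /eqP n0 /eqP n1 hn; have [al|al] := ltP a 0.
      exists (- a); first by rewrite oppr_gt0.
      by move=> s; rewrite ltr_norml => /andP[h1 h2] /andP[h3 h4]; lra.
    have a0 : 0 < a by rewrite lt_neqAle eq_sym n0.
    have a1' : 1 < a.
      by rewrite lt_neqAle eq_sym n1 leNgt; apply/negP => h1; apply: hn; rewrite a0.
    exists (a - 1); first by rewrite subr_gt0.
    by move=> s; rewrite ltr_norml => /andP[h1 h2] /andP[h3 h4]; lra.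
  have [h1|h1] := pselect (0 < p.1 < 1).
    have h2 : ~ (0 < p.2 < 1) by move=> h2; apply: hp; split; rewrite /= in_itv.
    have [d d0 hd] := far _ a3 a4 h2; exists d => // q _ q2 [_ /=]; rewrite in_itv /=; exact: hd.
  have [d d0 hd] := far _ a1 a2 h1; exists d => // q q1 _ [/= + _]; rewrite in_itv /=; exact: hd.
have sd : sdiff v p (fun i => if i then 0 else 0).
  by apply: (sdiff_affine d0 (c := 0)) => x x1 x2; rewrite v0; [ring|exact: hd].
by rewrite (sdiff_unique i (hG _ k1) sd); case: (i).
Qed.

Lemma grad_dot_regular v x : regular v -> (forall p, ~ Omega p -> v p = 0) -> wdiff x ->
  grad_dot Omega x v = gip x v.
Proof.
move=> hv v0 hx; apply: grad_dotE => //; first exact: open_measurable2 unit_square_open.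
  exact: regular_wdiff.
by move=> i; exact: regular_outside.
Qed.

Lemma V0_regular M v : good M -> V0 Omega M v -> regular v.
Proof.
move=> [_ hM cl _] [_ v0 aff].
apply: (@regular_affine _ M Omega v 1) => //; [exact: unit_square_open|exact: unit_square_box|].
move=> p Op; have : closure Omega p by exact: subset_closure.
by rewrite cl.
Qed.

Lemma V0B M v x : V0 Omega M v -> V0 Omega M x -> V0 Omega M (fun p => v p - x p).
Proof.
move=> [cv v0 av] [cx x0 ax]; split.
- by move=> p; apply: cvgB; [exact: cv|exact: cx].
- by move=> p hp; rewrite v0 // x0 // subrr.
move=> K KM; have [a [b [c h]]] := av K KM; have [a' [b' [c' h']]] := ax K KM.
by exists (a - a'), (b - b'), (c - c') => p hp; rewrite h // h' //; ring.
Qed.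

Lemma gipB v x y : wdiff v -> wdiff x -> wdiff y -> gip (fun p => v p - x p) y = gip v y - gip x y.
Proof.
move=> hv hx hy; have := gip_linl (-1) hx hv hy.
rewrite (_ : (fun p => -1 * x p + v p) = fun p => v p - x p); last by apply/funext => p; ring.
by move=> ->; ring.
Qed.

Lemma defect_eq (a b c e : R) : a = b -> e = c - b -> (a = c <-> e = 0).
Proof.
by move=> -> ->; split=> [->|/eqP]; [rewrite subrr|rewrite subr_eq0 => /eqP].
Qed.

Section Solution.
Variables (k : nat) (T0 : triangle R) (d : R).
Hypotheses (k1 : (1 < k)%N) (D0 : tdet T0 != 0) (d0 : 0 < d)
  (margin : forall p q, hull T0 p -> `|q.1 - p.1| <= d -> `|q.2 - p.2| <= d -> Omega q).
Local Notation u := (ufun k T0).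
Local Notation f := (grad_dot Omega u).
Local Notation U J := (fun p => psum k J (trd T0 p)).

Lemma psum_out J p : ~ strict T0 p -> U J p = 0.
Proof. by move=> hp; apply: psum_bnd. Qed.

Lemma ufun_out T p : ~ strict T p -> ufun k T p = 0.
Proof. by move=> hp; apply: tower_bnd => //; exact: ltnW. Qed.

Lemma strict_inside p : strict T0 p -> Omega p.
Proof.
by move=> /(strict_hull D0) hp; apply: (margin hp); rewrite subrr normr0 ltW.
Qed.

Lemma H10_ufun : H10 Omega u.
Proof.
have [G h] := lipreg_ufun k1 D0; apply: (lipreg_H10 h d0) => p q up; apply: margin.
apply: contrapT => hp; move/eqP: up; apply; apply: ufun_out => sp; apply: hp; exact: strict_hull.
Qed.

Lemma wdiff_u : wdiff u. Proof. exact/regular_wdiff/regular_ufun. Qed.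

Lemma functionalE v : wdiff v -> f v = gip u v.
Proof.
move=> hv; rewrite grad_dotC gipC grad_dot_regular //; first exact: regular_ufun.
by move=> p hp; apply: ufun_out => /strict_inside.
Qed.

Lemma Hm1_functional : Hm1 Omega f.
Proof.
have wu := wdiff_u; split.
  move=> a v x hv hx; have wv := H10_wdiff hv; have wx := H10_wdiff hx.
  have [wl _] := wdiff_lin a wv wx.
  by rewrite !functionalE // ![gip u _]gipC gip_linl.
exists (gnorm u) => v hv; have wv := H10_wdiff hv.
by rewrite (grad_norm_H10 unit_square_open hv) functionalE //; exact: gip_cs.
Qed.

Lemma poisson_ufun : poisson_solution Omega f u.
Proof. by split; [exact: H10_ufun|]. Qed.

Section Discrete.
Variable M : seq (triangle R).
Hypothesis gM : good M.

Lemma galerkinP v : V0 Omega M v -> galerkin_solution Omega f M v <->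
  forall x, V0 Omega M x -> gip (fun p => u p - v p) x = 0.
Proof.
move=> hv; have wv := regular_wdiff (V0_regular gM hv); have wu := wdiff_u.
have e x : V0 Omega M x -> grad_dot Omega v x = gip v x /\ gip (fun p => u p - v p) x = f x - gip v x.
  move=> hx; have rx := V0_regular gM hx; have wx := regular_wdiff rx; have [_ x0 _] := hx.
  by rewrite grad_dot_regular // functionalE // gipB.
have key x (hx : V0 Omega M x) := defect_eq (e x hx).1 (e x hx).2.
split=> [[_ h] x hx|h]; first exact: (key x hx).1 (h x hx).
exact: (conj hv (fun x hx => (key x hx).2 (h x hx))).
Qed.

Lemma error_norm v : V0 Omega M v -> grad_norm Omega (u \- v) = gnorm (fun p => u p - v p).
Proof.
move=> hv; have [_ v0 _] := hv; rewrite /grad_norm /gnorm; congr Num.sqrt.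
have r := regularB (regular_ufun k1 D0) (V0_regular gM hv).
apply: grad_dot_regular => //; last exact: regular_wdiff.
by move=> p hp /=; rewrite ufun_out ?v0 ?subrr // => /strict_inside.
Qed.

Lemma galerkin_unique v x : galerkin_solution Omega f M v -> galerkin_solution Omega f M x ->
  grad_norm Omega (u \- v) = grad_norm Omega (u \- x).
Proof.
move=> gv gx; have [hv _] := gv; have [hx _] := gx.
have wv := regular_wdiff (V0_regular gM hv); have wx := regular_wdiff (V0_regular gM hx).
have wu := wdiff_u; rewrite !error_norm //; congr Num.sqrt.
have hd := V0B hv hx; have wd := regular_wdiff (V0_regular gM hd).
have e1 := (galerkinP hv).1 gv; have e2 := (galerkinP hx).1 gx.
set a := fun p => u p - v p; set b := fun p => u p - x p; set dd := fun p => v p - x p in hd wd.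
have wa : wdiff a by exact: regular_wdiff (regularB (regular_ufun k1 D0) (V0_regular gM hv)).
have wb : wdiff b by exact: regular_wdiff (regularB (regular_ufun k1 D0) (V0_regular gM hx)).
have k3 : gip a dd = 0 by exact: e1.
have k4 : gip b dd = 0 by exact: e2.
have bE : b = fun p => 1 * dd p + a p by apply/funext => p; rewrite /b /dd /a; ring.
have g1 : gip b a = 1 * gip dd a + gip a a by rewrite {1}bE gip_linl.
have g2 : gip b b = 1 * gip dd b + gip a b by rewrite {1}bE gip_linl.
by rewrite g2 [gip dd b]gipC k4 mulr0 add0r [gip a b]gipC g1 [gip dd a]gipC k3 mulr0 add0r.
Qed.

Lemma galerkin_error J : V0 Omega M (U J) -> (forall x, V0 Omega M x -> gip (fun p => u p - U J p) x = 0) ->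
  galerkin_solution Omega f M (U J) /\ grad_norm Omega (u \- U J) <= 24 * tlip T0 * 2^-1 ^+ (k * J).
Proof.
move=> hU orth; split; first exact/galerkinP.
rewrite error_norm //; have [b [N [G h]]] := lipreg_tail J k1 D0; have [_ hl _ N0 hG] := h.
have h1 : lipreg 1 (4 * 2^-1 ^+ (k * J) * tlip T0) (fun p => u p - U J p) N G.
  split => // p hp; have sp : ~ strict T0 p by move=> /strict_inside/unit_square_box.
  by rewrite ufun_out // psum_out // subrr.
have g := gip_lipreg_le h1; have t0 := tlip_ge0 T0.
have q0 : 0 <= 2^-1 ^+ (k * J) :> R by rewrite exprn_ge0 // invr_ge0.
rewrite /gnorm -[leRHS]ger0_norm; last by apply: mulr_ge0 => //; exact: mulr_ge0.
rewrite -sqrtr_sqr; apply: ler_wsqrtr; apply: le_trans g _.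
move: (2^-1 ^+ _) q0 => s s0; have m0 : 0 <= s * tlip T0 by exact: mulr_ge0.
have -> : 2 * ((4 * s * tlip T0) ^+ 2 * (2 * (1 + 1)) ^+ 2) = 512 * (s * tlip T0) ^+ 2 by ring.
have -> : (24 * tlip T0 * s) ^+ 2 = 576 * (s * tlip T0) ^+ 2 by ring.
by apply: ler_wpM2r; [exact: sqr_ge0|lra].
Qed.

End Discrete.

Lemma tail_sum J p : u p - U J p =
  \sum_(w <- enum {: (k * J).*2.-tuple bool}) amp k J * ufun k (node T0 w) p.
Proof.
have k0 := ltnW k1; rewrite big_enum /= {1}/ufun (tower_split k0 J) addrAC subrr add0r.
have [sp|sp] := pselect (strict T0 p); last first.
  rewrite tower_bnd ?mulr0 //; last exact: iter_fold_bnd.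
  by rewrite big1 // => w _; rewrite ufun_out ?mulr0 // => /(strict_node D0).
have [w [sw hw]] := node_cover (k * J).*2 D0 (strict_hull D0 sp).
have sw' : size w == (k * J).*2 by rewrite sw.
rewrite (bigD1 (Tuple sw')) //= big1 ?addr0; first by rewrite /ufun trd_node // sw.
move=> w' ww; rewrite ufun_out ?mulr0 // => sw2.
apply: (node_disjoint D0 _ _ sw2 hw); first by rewrite size_tuple sw.
by apply: contraNneq ww => e; apply/eqP/val_inj.
Qed.

Variables (M0 : seq (triangle R)) (K0 : triangle R) (w0 : seq bool) (l0 : nat).
Hypotheses (tM0 : triangulation Omega M0) (K0M : K0 \in M0) (T0E : T0 = node K0 w0) (sw0 : size w0 = l0.*2).

Lemma psum_V0 M J : (forall K, K \in M -> affine_on (hull K) (U J)) -> V0 Omega M (U J).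
Proof.
move=> aff; split => //.
  have [G [_ hl _ _ _]] := lipreg_psum J k1 D0; exact: lip_continuous hl.
by move=> p hp; apply: psum_out => /strict_inside.
Qed.

Lemma galerkin_initial : exists2 v, galerkin_solution Omega f M0 v &
  grad_norm Omega (u \- v) <= 24 * tlip T0 * 2^-1 ^+ (k * 0).
Proof.
have [gM _] := triangulation_good tM0.
have hV : V0 Omega M0 (U 0).
  by apply: psum_V0 => K _; apply: affine_on_eq (affine_on_cst _ 0) => p _; rewrite /psum big_nil.
suff orth x : V0 Omega M0 x -> gip (fun p => u p - U 0 p) x = 0.
  by exists (U 0); have [] := galerkin_error gM hV orth.
move=> hx; rewrite gipC (_ : (fun p => u p - U 0 p) = u); last first.
  by apply/funext => p; rewrite /psum big_nil subr0.
have [_ _ aff] := hx; apply: (gip_affine D0) => //; [exact: V0_regular hx| |exact: regular_ufun|].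
  have [a [b [c h]]] := aff _ K0M; exists a, b, c => p hp; apply: h.
  have [_ hM _ _] := gM; move: hp; rewrite T0E; apply: hull_node; exact: hM.
by move=> p hp; apply: ufun_out => /(strict_hull D0).
Qed.

Lemma galerkin_level J : exists2 v, galerkin_solution Omega f (iter (l0 + k * J) refine M0) v &
  grad_norm Omega (u \- v) <= 24 * tlip T0 * 2^-1 ^+ (k * J).
Proof.
have [gM0 _] := triangulation_good tM0; have [_ gM _ memM] := iter_refine (l0 + k * J) tM0.
have [_ hM0 _ dM0] := gM0.
suff [hV orth] : V0 Omega (iter (l0 + k * J) refine M0) (U J) /\
    (forall x, V0 Omega (iter (l0 + k * J) refine M0) x -> gip (fun p => u p - U J p) x = 0).
  by exists (U J); have [] := galerkin_error gM hV orth.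
split.
  apply: psum_V0 => K /memM [K' K'M [w [sw ->]]].
  rewrite -(cat_take_drop (size w0) w) node_cat.
  have lw : (size w0 <= size w)%N by rewrite sw0 sw leq_double leq_addr.
  have [e|ne] := pselect (node K' (take (size w0) w) = T0).
    by rewrite e; apply: psum_affine => //; rewrite size_drop sw sw0 -doubleB addKn.
  have off p : hull (node (node K' (take (size w0) w)) (drop (size w0) w)) p -> ~ strict T0 p.
    move=> hp; have DK' := hM0 _ K'M; have hp' := hull_node (tdet_node _ DK') hp.
    have [KK|KK] := eqVneq K' K0; last first.
      rewrite T0E => /(strict_node (hM0 _ K0M)) sp; apply: (dM0 K0 K' p) => //; first by rewrite eq_sym.
      exact: hull_node DK' hp'.
    rewrite T0E => sp; rewrite KK in hp' ne; apply: (node_disjoint (hM0 _ K0M) _ _ sp hp').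
      by rewrite size_takel.
    by apply/eqP => e; apply: ne; rewrite T0E {2}e.
  by apply: affine_on_eq (affine_on_cst _ 0) => p hp; rewrite psum_out //; exact: off.
move=> x hx; have rx := V0_regular gM hx; have [_ _ aff] := hx.
have rT w : regular (ufun k (node T0 w)) by apply: regular_ufun => //; exact: tdet_node.
rewrite (_ : (fun p => _) = fun p => \sum_(w <- enum {: (k * J).*2.-tuple bool}) amp k J * ufun k (node T0 w) p); last first.
  by apply/funext => p; exact: tail_sum.
rewrite gip_sum // big1_seq // => w _; rewrite gipC (gip_affine (tdet_node w D0)) ?mulr0 //.
  apply: aff; apply/memM; exists K0 => //; exists (w0 ++ w); split; last by rewrite node_cat -T0E.
  by rewrite size_cat sw0 size_tuple doubleD.
by move=> p hp; apply: ufun_out => /(strict_hull (tdet_node w D0)).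
Qed.

End Solution.

End GalerkinError.

Section Assembly.
Context {R : realType}.
Local Notation Omega := (@unit_square R).
Implicit Types (p q z : R * R) (K T : triangle R) (M : seq (triangle R)) (w : seq bool).

Lemma trd_child2 K p : tdet K != 0 ->
  trd (child (child K false) false) p = (2 * td K p, 1 - 2 * tr K p).
Proof.
move=> D0; rewrite (trd_child false p (tdet_child_neq0 false D0)).
by have [-> ->] := trd_child false p D0; congr pair; ring.
Qed.

Lemma hull_false6 K p : tdet K != 0 -> hull (node K (nseq 6 false)) p ->
  [/\ 4^-1 <= tr K p, 8^-1 <= td K p, td K p <= 4^-1 & tr K p + td K p <= 3 / 4].
Proof.
move=> D0; have tdc b := @tdet_child_neq0 _ K b D0.
pose K2 := child (child K false) false; pose K4 := child (child K2 false) false.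
have D2 : tdet K2 != 0 by exact/tdet_child_neq0/tdet_child_neq0.
have D4 : tdet K4 != 0 by exact/tdet_child_neq0/tdet_child_neq0.
rewrite (hullP _ (tdet_node (nseq 6 false) D0)).
have -> : trd (node K (nseq 6 false)) p = (2 - 8 * td K p, 8 * tr K p - 3).
  have -> : trd (node K (nseq 6 false)) p = trd (child (child K4 false) false) p by [].
  rewrite trd_child2 //; have [-> ->] := @trd_child2 K2 p D2.
  by have [-> ->] := trd_child2 p D0; congr pair; ring.
rewrite /in_ref /= ler_norml; move: (tr K p) (td K p) => r s [h1 /andP[h2 h3]].
by split; lra.
Qed.

Lemma strict_margin (r s r' s' : R) : [/\ 4^-1 <= r, 8^-1 <= s, s <= 4^-1 & r + s <= 3 / 4] ->
  `|r' - r| + `|s' - s| <= 8^-1 -> 0 < r' /\ `|s'| < 1 - r'.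
Proof.
move=> [h1 h2 h3 h4] h; have n1 := normr_ge0 (s' - s); have n2 := normr_ge0 (r' - r).
have := ler_norm (s' - s); have := ler_norm (r' - r); have := ler_norm (- (s' - s)).
have := ler_norm (- (r' - r)); rewrite !normrN ltr_norml => a1 a2 a3 a4.
by split; [|apply/andP; split]; lra.
Qed.

Lemma inner_margin K : tdet K != 0 -> exists2 d : R, 0 < d & forall p q,
  hull (node K (nseq 6 false)) p -> `|q.1 - p.1| <= d -> `|q.2 - p.2| <= d -> strict K q.
Proof.
move=> D0; have t0 := tlip_ge0 K; have t1 : 0 < 16 * (tlip K + 1) by lra.
exists (16 * (tlip K + 1))^-1; first by rewrite invr_gt0.
move=> p q /(hull_false6 D0) hp q1 q2; have h := trd_dist K q p.
apply: strict_margin hp _; apply: le_trans h _.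
apply: (@le_trans _ _ (tlip K * (2 * (16 * (tlip K + 1))^-1))).
  by apply: ler_wpM2l => //; rewrite mulr_natl mulr2n; exact: lerD.
by rewrite mulrA ler_pdivrMr //; lra.
Qed.

Lemma tower_parameters (s : R) : exists k, [/\ (1 < k)%N & 2^-1 ^+ k * s <= 1].
Proof.
pose m := (Num.truncn `|s|).+1; have hm : `|s| < m%:R by exact: truncnS_gt.
exists m.+2; split => //; rewrite exprVn mulrC ler_pdivrMr ?exprn_gt0 // mul1r.
apply: le_trans (ler_norm s) _; apply: ltW; apply: lt_le_trans hm _.
by rewrite -natrX ler_nat; apply: leq_trans (ltnW (ltn_expl m (ltnSn 1))) _; rewrite leq_exp2l // -addn2 leq_addr.
Qed.

Lemma min_over_list (I : eqType) (s : seq I) (Q : I -> set R) :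
  (forall i, i \in s -> Q i !=set0 -> exists m, is_min (Q i) m) ->
  (exists2 i, i \in s & Q i !=set0) -> exists m, is_min [set x | exists2 i, i \in s & Q i x] m.
Proof.
elim: s => [_ [] //|i s IH] hQ ne.
have [[j js Qj]|no] := pselect (exists2 j, j \in s & Q j !=set0); last first.
  have Qi : Q i !=set0.
    by case: ne => j; rewrite inE => /orP[/eqP -> //|js Qj]; case: no; exists j.
  have [m [Qm lm]] := hQ i (mem_head _ _) Qi; exists m; split.
    by exists i; rewrite ?mem_head.
  move=> x [j]; rewrite inE => /orP[/eqP ->|js Qj]; first exact: lm.
  by case: no; exists j => //; exists x.
have [||m [[l ls Ql] lm]] := IH.
- by move=> l ls; apply: hQ; rewrite inE ls orbT.
- by exists j.
have ls' : l \in i :: s by rewrite inE ls orbT.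
have [Qi|nQ] := pselect (Q i !=set0); last first.
  exists m; split; first by exists l.
  move=> x [l']; rewrite inE => /orP[/eqP ->|l's Q']; first by move=> Qx; case: nQ; exists x.
  by apply: lm; exists l'.
have [m' [Qm' lm']] := hQ i (mem_head _ _) Qi.
have [le|lt] := leP m m'.
  exists m; split; first by exists l.
  move=> x [l']; rewrite inE => /orP[/eqP ->|l's Q']; first by move=> /lm'; exact: le_trans.
  by apply: lm; exists l'.
exists m'; split; first by exists i => //; exact: mem_head.
move=> x [l']; rewrite inE => /orP[/eqP ->|l's Q']; first exact: lm'.
by apply: le_trans (ltW lt) _; apply: lm; exists l'.
Qed.

Definition mesh_list M0 n := flatten [seq levels M0 i | i <- iota 0 n.+1].

Lemma nvb_size M0 M : nvb M0 M -> (size M0 <= size M)%N.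
Proof. by move=> /nvb_reach/reach_levels [n [h _]]; apply: leq_trans h; exact: leq_addl. Qed.

Lemma mem_mesh_list M0 n M : nvb_meshes M0 n M -> M \in mesh_list M0 n.
Proof.
move=> [/nvb_reach/reach_levels [i [h hM]] sn]; apply/flatten_mapP; exists i => //.
rewrite mem_iota /= add0n ltnS; apply: leq_trans sn; apply: leq_trans h; exact: leq_addr.
Qed.

Lemma powR_inv_sqrt n : n%:R `^ (- 2^-1) = (Num.sqrt n%:R)^-1 :> R.
Proof. by rewrite powRN powR12_sqrt // ler0n. Qed.

Lemma leq_expn4 J : (J <= 4 ^ J)%N.
Proof. exact/ltnW/ltn_expl. Qed.

Lemma sqrt_pow16 m : Num.sqrt (16 ^ m)%:R = 4 ^+ m :> R.
Proof.
rewrite natrX (_ : 16 = 4 ^+ 2 :> R); last by ring.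
by rewrite -exprM mulnC exprM sqrtr_sqr ger0_norm // exprn_ge0.
Qed.

Lemma sqrt_pow4 m : Num.sqrt (4 ^ m)%:R = 2 ^+ m :> R.
Proof.
rewrite natrX (_ : 4 = 2 ^+ 2 :> R); last by ring.
by rewrite -exprM mulnC exprM sqrtr_sqr ger0_norm // exprn_ge0.
Qed.

Lemma log_rate (B : nat) (c : R) : (1 < B)%N -> 0 < c ->
  (forall n, (0 < n)%N -> (trunc_log B n)%:R * c <= c / ln B%:R * ln n%:R) /\
  (trunc_log B n)%:R * c @[n --> \oo] --> +oo.
Proof.
move=> B1 c0; have lB : 0 < ln B%:R :> R by apply: ln_gt0; rewrite ltr1n.
split=> [n n0|].
  rewrite mulrC -mulrA ler_pM2l // ler_pdivlMl // mulrC mulr_natl -lnXn ?ltr0n ?(ltnW B1) //.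
  by rewrite ler_ln ?posrE ?exprn_gt0 ?ltr0n ?(ltnW B1) // -natrX ler_nat trunc_logP.
apply/cvgryPge => A; pose N := (Num.truncn `|A / c|).+1.
have hN : A <= N%:R * c.
  rewrite -ler_pdivrMr //; apply: le_trans (ler_norm _) _; exact/ltW/truncnS_gt.
near=> n; apply: le_trans hN _; rewrite ler_pM2r // ler_nat; apply: trunc_log_max => //.
by near: n; exact: nbhs_infty_ge.
Unshelve. all: end_near. Qed.

End Assembly.

Section Estimates.
Context {R : realType}.
Local Notation Omega := (@unit_square R).
Variables (M0 : seq (triangle R)) (K0 : triangle R) (w0 : seq bool) (l0 k : nat) (d kap : R).
Local Notation T0 := (node K0 w0).
Hypotheses (tM0 : triangulation Omega M0) (K0M : K0 \in M0) (sw0 : size w0 = l0.*2) (d0 : 0 < d)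
  (margin : forall p q : R * R, hull T0 p -> `|q.1 - p.1| <= d -> `|q.2 - p.2| <= d -> Omega q)
  (k1 : (1 < k)%N) (hkap : 2 * shape T0 <= kap) (kap0 : 0 < kap) (hk : 2^-1 ^+ k * (8192 * kap ^+ 4) <= 1).
Local Notation u := (ufun k T0).
Local Notation f := (grad_dot Omega u).

Lemma initial_good : good M0. Proof. by have [] := triangulation_good tM0. Qed.

Lemma tower_det : tdet T0 != 0.
Proof. by apply: tdet_node; have [_ hM _ _] := initial_good; exact: hM. Qed.

Lemma initial_size : (0 < size M0)%N.
Proof. by move: K0M; case: (M0). Qed.

Let A := (4 ^ l0 * size M0)%N.
Let E := 24 * tlip T0 * 2 ^+ k * Num.sqrt A%:R.

Lemma galerkin_exists n : nvb_meshes M0 n !=set0 -> exists M v,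
  [/\ nvb_meshes M0 n M, galerkin_solution Omega f M v & grad_norm Omega (u \- v) <= E * n%:R `^ (- 2^-1)].
Proof.
move=> [M1 [/nvb_size s1 s2]]; have sn := leq_trans s1 s2.
have n0 := leq_trans initial_size sn.
have A0 : (0 < A)%N by rewrite muln_gt0 expn_gt0 initial_size.
have t0 : 0 <= 24 * tlip T0 by apply: mulr_ge0; [exact: ler0n|exact: tlip_ge0].
have rate J : (n <= (4 ^ k) ^ J.+1 * A)%N -> 24 * tlip T0 * 2^-1 ^+ (k * J) <= E * n%:R `^ (- 2^-1).
  move=> hn; rewrite powR_inv_sqrt ler_pdivlMr ?sqrtr_gt0 ?ltr0n // /E -!mulrA.
  rewrite mulrA [leRHS]mulrA; apply: ler_wpM2l => //.
  rewrite exprVn ler_pdivrMl ?exprn_gt0 //.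
  apply: (@le_trans _ _ (Num.sqrt ((4 ^ k) ^ J.+1 * A)%:R)).
    by apply: ler_wsqrtr; rewrite ler_nat.
  by rewrite -expnM natrM sqrtrM ?ler0n // sqrt_pow4 mulnS addnC exprD -mulrA.
have [nA|An] := ltnP n A.
  have [v gv hv] := galerkin_initial k1 tower_det d0 margin tM0 K0M (erefl T0).
  exists M0, v; split => //; first by split => //; exact: Nvb_initial.
  apply: le_trans hv _; apply: rate; apply: leq_trans (ltnW nA) _.
  by rewrite leq_pmull // expn_gt0 expn_gt0.
have B1 : (1 < 4 ^ k)%N by rewrite -[1%N](expn0 4) ltn_exp2l // ltnW.
have q0 : (0 < n %/ A)%N by rewrite divn_gt0.
set J := trunc_log (4 ^ k) (n %/ A).
have [v gv hv] := galerkin_level k1 tower_det d0 margin tM0 K0M (erefl T0) sw0 J.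
have [hM _ sM _] := iter_refine (l0 + k * J) tM0.
exists (iter (l0 + k * J) refine M0), v; split => //.
  split => //; rewrite sM expnD mulnAC mulnC expnM.
  by apply: leq_trans (leq_divM n A); rewrite mulnC -/A [leqRHS]mulnC; apply: leq_mul => //; exact: trunc_logP.
apply: le_trans hv _; apply: rate; apply: ltnW; rewrite -ltn_divLR //; exact: trunc_log_ltn.
Qed.

Lemma galerkin_min n : nvb_meshes M0 n !=set0 -> exists2 e : R,
  is_min [set x | exists M v, [/\ nvb_meshes M0 n M, galerkin_solution Omega f M v &
     x = grad_norm Omega (u \- v)]] e & e <= E * n%:R `^ (- 2^-1).
Proof.
move=> hn; have [M [v [hM gv le]]] := galerkin_exists hn.
pose Q M' : set R := [set x | nvb_meshes M0 n M' /\
  exists2 v', galerkin_solution Omega f M' v' & x = grad_norm Omega (u \- v')].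
have [||e [[M' _ [hM' [v' gv' ev']]] le_e]] := @min_over_list R _ (mesh_list M0 n) Q.
- move=> M' _ [_ [hM' [v' gv' _]]]; exists (grad_norm Omega (u \- v')); split.
    exact: (conj hM' (ex_intro2 _ _ v' gv' erefl)).
  move=> y [_ [v'' gv'' ->]].
  have gM' : good M' by apply: reach_good initial_good _; apply: nvb_reach; have [] := hM'.
  by rewrite (galerkin_unique k1 tower_det d0 margin gM' gv' gv'').
- by exists M; [exact: mem_mesh_list|exists (grad_norm Omega (u \- v)); exact: (conj hM (ex_intro2 _ _ v gv erefl))].
exists e; first split.
- by exists M', v'; exact: And3 hM' gv' ev'.
- move=> y [M'' [v'' [hM'' gv'' ->]]]; apply: le_e; exists M''; first exact: mem_mesh_list.
  exact: (conj hM'' (ex_intro2 _ _ v'' gv'' erefl)).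
apply: le_trans le; apply: le_e; exists M; first exact: mem_mesh_list.
exact: (conj hM (ex_intro2 _ _ v gv erefl)).
Qed.

Let C1 := 768 * kap ^+ 3.
Let B := (16 ^ k.+1)%N.

Lemma osc_rate n M g : nvb_meshes M0 n M -> P0 Omega M g ->
  (trunc_log B n)%:R * (48 * C1)^-1 * n%:R `^ (- 2^-1) <= oscillation Omega f M g.
Proof.
move=> [hM sn] hg; have hr := nvb_reach hM; have gM := reach_good initial_good hr.
have n0 : (0 < n)%N by apply: leq_trans (leq_trans (nvb_size hM) sn); exact: initial_size.
have [c /oscillationE ->] := P0_normal gM hg; set J := trunc_log B n.
have C0 : 0 < C1 by apply: mulr_gt0; [rewrite ltr0n|exact: exprn_gt0].
have o0 : 0 <= vec_osc u c by exact: sqrtr_ge0.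
have s0 : 0 < Num.sqrt n%:R :> R by rewrite sqrtr_gt0 ltr0n.
rewrite powR_inv_sqrt ler_pdivrMr // mulrC ler_pdivrMl; last by rewrite mulr_gt0.
have := osc_lower gM k1 tower_det hkap kap0 hk c J initial_good K0M hr (erefl T0).
rewrite /= -/C1 => -[h|h].
  apply: le_trans h _; apply: ler_wpM2l; first by rewrite mulr_ge0 // ltW.
  by rewrite [leRHS]mulrC; apply: ler_wpM2r => //; apply: ler_wsqrtr; rewrite ler_nat.
have hs : 4 ^+ (k * J) * 4 ^+ J <= Num.sqrt n%:R :> R.
  rewrite -exprD (_ : (k * J + J = k.+1 * J)%N); last by rewrite mulSn addnC.
  rewrite -sqrt_pow16; apply: ler_wsqrtr; rewrite ler_nat expnM trunc_logP //.
  by rewrite -[1%N](expn0 16) ltn_exp2l.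
have h1 : 4 ^+ J <= Num.sqrt n%:R * amp k J :> R.
  by rewrite /amp exprVn ler_pdivlMr ?exprn_gt0 // mulrC.
have h2 : J%:R <= 4 ^+ J :> R by rewrite -natrX ler_nat leq_expn4.
have h3 : Num.sqrt n%:R * amp k J <= Num.sqrt n%:R * (24 * C1 * vec_osc u c) by rewrite ler_pM2l.
apply: le_trans h2 _; apply: le_trans h1 _; apply: le_trans h3 _.
have x0 : 0 <= Num.sqrt n%:R * (C1 * vec_osc u c).
  by apply: mulr_ge0; [exact: ltW|apply: mulr_ge0 => //; exact: ltW].
move: (Num.sqrt _) (vec_osc u c) x0 => s o; lra.
Qed.

Lemma oscillation_min n : nvb_meshes M0 n !=set0 -> exists2 e : R,
  is_min [set x | exists M g, [/\ nvb_meshes M0 n M, P0 Omega M g & x = oscillation Omega f M g]] e &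
  (trunc_log B n)%:R * (48 * C1)^-1 * n%:R `^ (- 2^-1) <= e.
Proof.
have wu := wdiff_ufun k1 tower_det.
have best M' : nvb_meshes M0 n M' -> exists2 g, P0 Omega M' g & forall g', P0 Omega M' g' ->
    oscillation Omega f M' g <= oscillation Omega f M' g'.
  move=> [/nvb_reach hr _]; have gM' := reach_good initial_good hr.
  exact: (@osc_min _ M' gM' _ wu).
move=> [M hM].
pose Q M' : set R := [set x | nvb_meshes M0 n M' /\ exists2 g, P0 Omega M' g & x = oscillation Omega f M' g].
have [||e [[M' _ [hM' [g hg eg]]] le_e]] := @min_over_list R _ (mesh_list M0 n) Q.
- move=> M' _ [_ [hM' _]]; have [g hg hmin] := best M' hM'.
  exists (oscillation Omega f M' g); split; first exact: (conj hM' (ex_intro2 _ _ g hg erefl)).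
  by move=> y [_ [g' hg' ->]]; exact: hmin.
- exists M; first exact: mem_mesh_list.
  by have [g hg _] := best M hM; exists (oscillation Omega f M g); exact: (conj hM (ex_intro2 _ _ g hg erefl)).
exists e; last by rewrite eg; exact: osc_rate.
split; first by exists M', g; exact: And3 hM' hg eg.
move=> y [M'' [g' [hM'' hg' ->]]]; apply: le_e; exists M''; first exact: mem_mesh_list.
exact: (conj hM'' (ex_intro2 _ _ g' hg' erefl)).
Qed.

End Estimates.
Theorem lemma21 (R : realType) (M0 : seq (triangle R))
    (hM0 : triangulation unit_square M0) :
  exists (f : (R * R -> R) -> R) (u : R * R -> R) (L : nat -> R) (C : R),
    Hm1 unit_square f /\
    poisson_solution unit_square f u /\
    (forall n : nat, (0 < n)%N -> L n <= C * ln n%:R) /\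
    L n @[n --> \oo] --> +oo /\
    forall n : nat, nvb_meshes M0 n !=set0 ->
      (exists2 e : R,
         is_min [set x | exists M U,
                   [/\ nvb_meshes M0 n M,
                       galerkin_solution unit_square f M U &
                       x = grad_norm unit_square (u \- U)]] e &
         e <= C * n%:R `^ (- 2^-1)) /\
      (exists2 e : R,
         is_min [set x | exists M g,
                   [/\ nvb_meshes M0 n M, P0 unit_square M g &
                       x = oscillation unit_square f M g]] e &
         L n * n%:R `^ (- 2^-1) <= e).
Proof.
have [gM0 _] := triangulation_good hM0; have [_ hM cl _] := gM0.
have [K0 K0M _] : exists2 K, K \in M0 & hull K (0, 0).
  have : closure (@unit_square R) (0, 0).
    by rewrite unit_square_closure; split; rewrite /= in_itv /= lexx ler01.
  by rewrite cl.
have D0 := hM _ K0M; have [d d0 inner] := inner_margin D0.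
pose T0 := node K0 (nseq 6 false); pose kap := 2 * `|shape T0| + 1.
have margin (p q : R * R) : hull T0 p -> `|q.1 - p.1| <= d -> `|q.2 - p.2| <= d -> unit_square q.
  by move=> hp q1 q2; apply: strict_Omega gM0 K0M _; exact: inner hp q1 q2.
have hkap : 2 * shape T0 <= kap by have := ler_norm (shape T0); rewrite /kap; lra.
have kap0 : 0 < kap by have := normr_ge0 (shape T0); rewrite /kap; lra.
have [k [k1 hk]] := tower_parameters (8192 * kap ^+ 4).
have DT : tdet T0 != 0 by exact: tdet_node.
pose c0 := (48 * (768 * kap ^+ 3))^-1; pose B := (16 ^ k.+1)%N.
have c00 : 0 < c0.
  by rewrite invr_gt0; apply: mulr_gt0; [rewrite ltr0n|apply: mulr_gt0; [rewrite ltr0n|exact: exprn_gt0]].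
have B1 : (1 < B)%N by rewrite -[1%N](expn0 16) ltn_exp2l.
have [Lle Linf] := log_rate B1 c00.
set E := 24 * tlip T0 * 2 ^+ k * Num.sqrt (4 ^ 3 * size M0)%:R.
have E0 : 0 <= E.
  apply: mulr_ge0; last exact: sqrtr_ge0.
  apply: mulr_ge0; [apply: mulr_ge0; [exact: ler0n|exact: tlip_ge0]|exact: exprn_ge0].
have l0 : 0 <= c0 / ln B%:R by apply: divr_ge0; [exact: ltW|apply: ln_ge0; rewrite ler1n ltnW].
exists (grad_dot unit_square (ufun k T0)), (ufun k T0), (fun n => (trunc_log B n)%:R * c0), (c0 / ln B%:R + E).
split; first exact: Hm1_functional k1 DT d0 margin.
split; first exact: poisson_ufun k1 DT d0 margin.
split.
  move=> n n0; apply: le_trans (Lle n n0) _; apply: ler_wpM2r; last by rewrite lerDl.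
  by apply: ln_ge0; rewrite ler1n.
split; first exact: Linf.
move=> n hn; split.
  have [e emin ele] := galerkin_min (w0 := nseq 6 false) (l0 := 3) hM0 K0M (erefl _) d0 margin k1 hn.
  exists e => //; apply: le_trans ele _; apply: ler_wpM2r; first exact: powR_ge0.
  by rewrite lerDr.
have [e emin ele] := oscillation_min (w0 := nseq 6 false) hM0 K0M k1 hkap kap0 hk hn.
by exists e.
Qed.
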